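(* Let $K$ be a primitive quartic CM field whose real quadratic subfield $K_0$ has class number one. Let $\ell$ be a prime with $\ell\mathcal{O}_{K_0}=\mathfrak{l}_1\mathfrak{l}_2$, where $\mathfrak{l}_1\neq\mathfrak{l}_2$ are prime ideals of norm $\ell$ generated by totally positive elements, and let $\mathfrak{l}\in\{\mathfrak{l}_1,\mathfrak{l}_2\}$. Let $A$ be a principally polarized ordinary abelian surface defined over a finite field $\mathbb{F}_q$ of characteristic different from $\ell$, with complex multiplication by an order of $K$ having locally maximal real multiplication at $\mathfrak{l}$. Let $P$ be a nonzero $\mathfrak{l}$-torsion point, let $r$ be the smallest integer such that $A[\mathfrak{l}]\subset A(\mathbb{F}_{q^r})$, and let $n$ be the largest integer such that $A[\mathfrak{l}^n]\subset A(\mathbb{F}_{q^r})$. Assume that $k_{\mathfrak{l},A}>0$. Let $G$ be a cyclic subgroup of $A[\mathfrak{l}^n]$ such that $\ell^{n-1}G$ is the subgroup generated by $P$. Then the isogeny with kernel $\langle P\rangle$ is descending if and only if the Tate pairing is non-degenerate on $G\times G$. It is horizontal or ascending otherwise.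
   Context: A quartic CM field is primitive if it contains no imaginary quadratic subfield. An order $\mathcal{O}$ of $K$ has locally maximal real multiplication at $\mathfrak{l}$ if, with $\mathcal{O}_0=\mathcal{O}\cap K_0$, the index $[\mathcal{O}_{K_0}:\mathcal{O}_0]$ is prime to $\ell$; then $\mathcal{O}_{\mathfrak{l}}:=\mathcal{O}\otimes_{\mathcal{O}_0}\mathcal{O}_{K_0,\mathfrak{l}}$, where $\mathcal{O}_{K_0,\mathfrak{l}}$ is the completion of $\mathcal{O}_{K_0}$ at $\mathfrak{l}$. ''Complex multiplication by $\mathcal{O}$'' means an embedding $K\hookrightarrow\mathrm{End}(A)\otimes\mathbb{Q}$ identifying $\mathcal{O}$ with $\mathrm{End}(A)$. For $m\ge 1$, $A[\mathfrak{l}^m]=\{x\in A(\overline{\mathbb{F}}_q):\beta x=0\ \forall\beta\in\mathfrak{l}^m\cap\mathcal{O}_0\}\cong(\mathbb{Z}/\ell^m\mathbb{Z})^2$. An isogeny $I:A\to A'$ with kernel of order $\ell$ in $A[\mathfrak{l}]$ is called an $\mathfrak{l}$-isogeny. With $\mathrm{End}(A)$, $\mathrm{End}(A')$ viewed as orders of $K$ compatibly with $I$, it is horizontal if $\mathrm{End}(A)\simeq\mathrm{End}(A')$, descending if $\mathrm{End}(A')_{\mathfrak{l}}\subsetneq\mathrm{End}(A)_{\mathfrak{l}}$, and ascending if $\mathrm{End}(A)_{\mathfrak{l}}\subsetneq\mathrm{End}(A')_{\mathfrak{l}}$. Tate pairing: let $\pi$ be the $q$-Frobenius endomorphism and $\lambda$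 the principal polarization of $A$. For $P,Q\in A[\mathfrak{l}^n]\subset A(\mathbb{F}_{q^r})$ put $T_{\ell^n}(P,Q)=W_{\ell^n}(\pi^r(\bar P)-\bar P,\lambda(Q))\in\mu_{\ell^n}$, where $W_{\ell^n}:A[\ell^n]\times\hat A[\ell^n]\to\mu_{\ell^n}$ is the Weil pairing and $\bar P$ is any point with $\ell^n\bar P=P$. Define $$k_{\mathfrak{l},A}=\max_{P\in A[\mathfrak{l}^n]}\{k : T_{\ell^n}(P,P)\in\mu_{\ell^k}\setminus\mu_{\ell^{k-1}}\},$$ i.e. $\ell^{k_{\mathfrak{l},A}}$ is the maximal order of a self-pairing $T_{\ell^n}(P,P)$. For a cyclic subgroup $G\subset A[\mathfrak{l}^n]$, the Tate pairing is called non-degenerate on $G\times G$ if its restriction $T_{\ell^n}:G\times G\to\mu_{\ell^{k_{\mathfrak{l},A}}}$ is surjective, and degenerate otherwise. *)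

(* Defs.v *)
From HB Require Import structures.
From mathcomp Require Import all_boot all_order all_algebra all_field.
From mathcomp Require Import boolp classical_sets.
From mathcomp Require Import mpoly.

Set Implicit Arguments.
Unset Strict Implicit.
Unset Printing Implicit Defensive.

Import Order.TTheory GRing.Theory Num.Theory.
Local Open Scope classical_set_scope.
Local Open Scope ring_scope.

(* MathComp world, with classical sets.

   Varieties over an algebraically closed field [k] are spaces with functions:
   a set of points, its Zariski-open subsets, and the regular functions on each
   of them.  A variety over F_q is a variety over k = \bar F_q together with
   its q-Frobenius map. *)

(** * Spaces with functions *)

(* [reg U f] is meaningful for [U] open only, and then says that the
   restriction of [f] to [U] is regular. *)
Record space (k : fieldType) (T : Type) := Space {
  opn : set (set T);
  reg : set T -> set (T -> k) }.

Definition clsd k T (X : space k T) (Z : set T) := opn X (~` Z).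

Definition morphism k S T (X : space k S) (Y : space k T) (f : S -> T) :=
  forall V, opn Y V -> opn X (f @^-1` V) /\
    forall g, reg Y V g -> reg X (f @^-1` V) (g \o f).

Definition isomorphism k S T (X : space k S) (Y : space k T) (f : S -> T) :=
  morphism X Y f /\
  exists g, [/\ morphism Y X g, cancel f g & cancel g f].

(* The functions sum_i f_i (x) g_i on U x V with f_i, g_i regular. *)
Definition tensor_reg k S T (X : space k S) (Y : space k T)
    (U : set S) (V : set T) (h : S * T -> k) :=
  exists (m : nat) (f : 'I_m -> S -> k) (g : 'I_m -> T -> k),
    (forall i, reg X U (f i) /\ reg Y V (g i)) /\
    forall x y, U x -> V y -> h (x, y) = \sum_(i < m) f i x * g i y.

(* The product in the category of varieties: its topology has for basis the
   nonvanishing loci of the functions in [tensor_reg], and its regular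
   functions are locally fractions of those. *)
Definition prod_space k S T (X : space k S) (Y : space k T) :
    space k (S * T) :=
  {| opn := fun W => forall w, W w ->
       exists U V h, [/\ opn X U /\ U w.1, opn Y V /\ V w.2,
         tensor_reg X Y U V h, h w != 0 &
         forall w', U w'.1 -> V w'.2 -> h w' != 0 -> W w'];
     reg := fun W f => forall w, W w ->
       exists U V h d, [/\ opn X U /\ U w.1, opn Y V /\ V w.2,
         tensor_reg X Y U V h /\ tensor_reg X Y U V d, d w != 0 &
         forall w', W w' -> U w'.1 -> V w'.2 -> d w' != 0 ->
           f w' = h w' / d w'] |}.

(* [phi] identifies the open subset [U], with the induced structure, with a
   Zariski-closed subset of affine n-space. *)
Definition affine_chart k T (X : space k T) (U : set T) n
    (phi : T -> 'I_n -> k) :=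
  opn X U /\
  [/\ exists S : set {mpoly k[n]},
        phi @` U = [set v | forall p, S p -> p.@[v] = 0],
      forall x y, U x -> U y -> phi x = phi y -> x = y,
      forall W, W `<=` U ->
        (opn X W <-> exists S : set {mpoly k[n]},
           W = [set x | U x /\ exists2 p, S p & p.@[phi x] != 0]) &
      forall W f, W `<=` U -> opn X W ->
        (reg X W f <-> forall x, W x -> exists a d : {mpoly k[n]},
           d.@[phi x] != 0 /\
           forall y, W y -> d.@[phi y] != 0 ->
             f y = a.@[phi y] / d.@[phi y])].

Definition affine_open k T (X : space k T) (U : set T) :=
  exists n (phi : T -> 'I_n -> k), affine_chart X U phi.

Definition irreducible_set k T (X : space k T) (Z : set T) :=
  Z !=set0 /\ forall U V, opn X U -> opn X V ->
    (Z `&` U) !=set0 -> (Z `&` V) !=set0 -> (Z `&` U `&` V) !=set0.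

Record variety (k : fieldType) T (X : space k T) : Prop := Variety {
  opn_setT : opn X setT;
  opn_setI : forall U V, opn X U -> opn X V -> opn X (U `&` V);
  opn_union : forall F : set (set T), F `<=` opn X ->
    opn X [set x | exists2 U, F U & U x];
  reg_restrict : forall U V f, opn X U -> opn X V -> V `<=` U ->
    reg X U f -> reg X V f;
  reg_local : forall U f, opn X U -> (reg X U f <->
    forall x, U x -> exists V, [/\ opn X V, V x, V `<=` U & reg X V f]);
  variety_irreducible : irreducible_set X setT;
  variety_charts : exists m (U : 'I_m -> set T),
    (forall i, affine_open X (U i)) /\ forall x, exists i, U i x;
  variety_separated : clsd (prod_space X X) [set w | w.1 = w.2] }.

Definition complete k T (X : space k T) :=
  forall (S : Type) (Y : space k S), variety Y ->
    forall Z, clsd (prod_space X Y) Z -> clsd Y (snd @` Z).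

Definition irr_chain k T (X : space k T) (d : nat) :=
  exists Z : nat -> set T,
    (forall i, (i <= d)%N -> clsd X (Z i) /\ irreducible_set X (Z i)) /\
    (forall i, (i < d)%N -> Z i `<` Z i.+1).

Definition dimension_is k T (X : space k T) (d : nat) :=
  irr_chain X d /\ ~ irr_chain X d.+1.

(** * Abelian varieties *)

Record abvar (k : fieldType) := AbVar {
  ab_pt :> zmodType;
  ab_sp : space k ab_pt;
  ab_variety : variety ab_sp;
  ab_complete : complete ab_sp;
  ab_add : morphism (prod_space ab_sp ab_sp) ab_sp (fun w => w.1 + w.2);
  ab_opp : morphism ab_sp ab_sp (fun x => - x) }.

Definition is_hom k (A B : abvar k) (f : A -> B) :=
  (forall x y, f (x + y) = f x + f y) /\ morphism (ab_sp A) (ab_sp B) f.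

Definition is_end k (A : abvar k) (f : A -> A) := is_hom f.

(* The quotient map A -> A/G, that is, the separable isogeny with kernel [G]:
   [A'] carries the quotient topology and the G-invariant functions. *)
Definition isogeny_with_kernel k (A A' : abvar k) (f : A -> A') (G : set A) :=
  [/\ is_hom f,
      forall y, exists x, f x = y,
      forall x, f x = 0 <-> G x,
      forall V, opn (ab_sp A') V <-> opn (ab_sp A) (f @^-1` V) &
      forall V g, opn (ab_sp A') V ->
        (reg (ab_sp A') V g <-> reg (ab_sp A) (f @^-1` V) (g \o f))].

Definition cyclic_gen (V : zmodType) (P : V) : set V :=
  [set x | exists m : int, x = P *~ m].

(* Over a field of characteristic [p]: A[p](k) has order p^dim A. *)
Definition ordinary_surface k (A : abvar k) (p : nat) :=
  exists s : seq A, [/\ uniq s, size s = (p ^ 2)%N &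
    forall x, (x \in s) = (x *+ p == 0)].

(** * Line bundles, by cocycles *)

Record cocycle (k : fieldType) (T : Type) := Cocycle {
  idx : Type;
  dom : idx -> set T;
  tr : idx -> idx -> T -> k }.
Arguments dom {k T} L i : rename.
Arguments tr {k T} L i j x : rename.

Definition line_bundle k T (X : space k T) (L : cocycle k T) :=
  [/\ forall i, opn X (dom L i),
      forall x, exists i, dom L i x,
      forall i j, reg X (dom L i `&` dom L j) (tr L i j),
      forall i x, dom L i x -> tr L i i x = 1 &
      forall i j l x, dom L i x -> dom L j x -> dom L l x ->
        tr L i j x * tr L j l x = tr L i l x].

Definition lb_mul k T (L M : cocycle k T) : cocycle k T :=
  @Cocycle k T (idx L * idx M)
    (fun i => dom L i.1 `&` dom M i.2)
    (fun i j x => tr L i.1 j.1 x * tr M i.2 j.2 x).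

Definition lb_inv k T (L : cocycle k T) : cocycle k T :=
  @Cocycle k T (idx L) (dom L) (fun i j x => (tr L i j x)^-1).

Definition lb_exp k T (L : cocycle k T) (m : nat) : cocycle k T :=
  @Cocycle k T (idx L) (dom L) (fun i j x => tr L i j x ^+ m).

Definition pullback k S T (f : S -> T) (L : cocycle k T) : cocycle k S :=
  @Cocycle k S (idx L) (fun i => f @^-1` dom L i)
    (fun i j x => tr L i j (f x)).

Definition gsection k T (X : space k T) (L : cocycle k T)
    (s : idx L -> T -> k) :=
  (forall i, reg X (dom L i) (s i)) /\
  forall i j x, dom L i x -> dom L j x ->
    s i x = tr L i j x * s j x.
Arguments gsection {k T} X L s.

Definition trivialization k T (X : space k T) (L : cocycle k T)
    (s : idx L -> T -> k) :=
  gsection X L s /\ forall i x, dom L i x -> s i x != 0.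
Arguments trivialization {k T} X L s.

Definition lb_iso k T (X : space k T) (L M : cocycle k T) :=
  exists s, trivialization X (lb_mul L (lb_inv M)) s.

Definition lb_trivial k T (X : space k T) (L : cocycle k T) :=
  exists s, trivialization X L s.

(* Every point has an affine neighbourhood of the form X_s, with [s] a section
   of a positive power of [L]. *)
Definition ample k T (X : space k T) (L : cocycle k T) :=
  forall x, exists m (s : idx (lb_exp L m) -> T -> k),
    let Xs := [set y | exists i, dom L i y /\ s i y != 0] in
    [/\ (0 < m)%N, gsection X (lb_exp L m) s, Xs x & affine_open X Xs].

(** * Duality, polarizations and pairings *)

Definition translate (V : zmodType) (a : V) : V -> V := fun x => x + a.

Definition Pic0 k (A : abvar k) (L : cocycle k A) :=
  line_bundle (ab_sp A) L /\
  forall a, lb_iso (ab_sp A) (pullback (translate a) L) L.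
Arguments Pic0 {k} A L.

(* [M] is a family of line bundles in Pic^0(A) parametrized by [T] and
   rigidified along the origin of [A]. *)
Definition Pic0_family k (A : abvar k) T (Y : space k T)
    (M : cocycle k (A * T)) :=
  [/\ line_bundle (prod_space (ab_sp A) Y) M,
      forall t, Pic0 A (pullback (fun x => (x, t)) M) &
      lb_trivial Y (pullback (fun t => (0 : A, t)) M)].

(* [B] is the dual abelian variety of [A], with Poincare bundle [Pc]. *)
Definition is_dual k (A B : abvar k) (Pc : cocycle k (A * B)) :=
  Pic0_family (ab_sp B) Pc /\
  forall (T : Type) (Y : space k T) (M : cocycle k (A * T)),
    variety Y -> Pic0_family Y M ->
    exists! f : T -> B, morphism Y (ab_sp B) f /\
      lb_iso (prod_space (ab_sp A) Y)
        (pullback (fun w => (w.1, f w.2)) Pc) M.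

(* The element of Pic^0(A) corresponding to a point [b] of the dual. *)
Definition fibre k (A B : abvar k) (Pc : cocycle k (A * B)) (b : B) :=
  pullback (fun x : A => (x, b)) Pc.

Definition principal_polarization k (A B : abvar k) (Pc : cocycle k (A * B))
    (lam : A -> B) :=
  [/\ is_hom lam,
      isomorphism (ab_sp A) (ab_sp B) lam &
      exists L : cocycle k A,
        [/\ line_bundle (ab_sp A) L, ample (ab_sp A) L &
            forall a, lb_iso (ab_sp A) (fibre Pc (lam a))
              (lb_mul (pullback (translate a) L) (lb_inv L))]].

(* [w] is the value at (a, b) of the Weil pairing on A[N] x \hat A[N].  If
   [D] is a divisor with local equations f_i, O(D) has the transition functions
   f_i / f_j; for D in the class [b] and [N]^* D = div g, a trivialization of
   [N]^* O(D) is s_i = [N]^* f_i / g, so that w = g(x + a) / g(x). *)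
Definition weil k (A B : abvar k) (Pc : cocycle k (A * B)) (N : nat)
    (a : A) (b : B) (w : k) :=
  [/\ a *+ N = 0, b *+ N = 0 &
      exists s, trivialization (ab_sp A)
          (pullback (fun x : A => x *+ N) (fibre Pc b)) s /\
        forall i x, dom (fibre Pc b) i (x *+ N) ->
          s i x = w * s i (x + a)].

(** * Fields of definition *)

(* [F] is the q-Frobenius map of an F_q-structure on [X]: [X] is covered by
   finitely many F-stable affine charts in which [F] raises the coordinates to
   the q-th power.  The F_(q^r)-rational points are the fixed points of the
   r-th iterate of [F]. *)
Definition frobenius_map k T (X : space k T) (q : nat) (F : T -> T) :=
  exists m (U : 'I_m -> set T),
    (forall x, exists i, U i x) /\
    forall i, exists n (phi : T -> 'I_n -> k),
      [/\ affine_chart X (U i) phi,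
          forall x, U i (F x) <-> U i x &
          forall x j, U i x -> phi (F x) j = phi x j ^+ q].

Definition abvar_frobenius k (A : abvar k) (q : nat) (F : A -> A) :=
  frobenius_map (ab_sp A) q F /\ is_end F.

Definition rational_pts (T : Type) (F : T -> T) (r : nat) : set T :=
  [set x | iter r F x = x].

(* [M] is isomorphic to the conjugate of [L] under the q-power automorphism of
   [k], whose transition functions are x |-> tr (F^-1 x) ^+ q; as [F] is
   bijective the equations below determine them. *)
Definition frob_conjugate k T (X : space k T) (q : nat) (F : T -> T)
    (L M : cocycle k T) :=
  exists (d : idx L -> set T) (t : idx L -> idx L -> T -> k),
    [/\ forall i x, d i (F x) <-> dom L i x,
        forall i j x, t i j (F x) = tr L i j x ^+ q &
        lb_iso X (Cocycle d t) M].

(* [lam] commutes with the Galois action. *)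
Definition polarization_over k (A B : abvar k) (Pc : cocycle k (A * B))
    (q : nat) (F : A -> A) (lam : A -> B) :=
  forall a, frob_conjugate (ab_sp A) q F
    (fibre Pc (lam a)) (fibre Pc (lam (F a))).

(* [z] is the value at (P, Q) of the N-th Tate pairing over F_(q^r); the choice
   of [R] is the choice of the N-th part of [P]. *)
Definition tate k (A B : abvar k) (Pc : cocycle k (A * B)) (F : A -> A)
    (lam : A -> B) (r N : nat) (P Q : A) (z : k) :=
  exists R : A, R *+ N = P /\ weil Pc N (iter r F R - R) (lam Q) z.

(* Order exactly ell^m; mu_(ell^(m-1)) is read as empty for m = 0. *)
Definition exact_order (k : fieldType) (ell m : nat) (z : k) :=
  z ^+ (ell ^ m) = 1 /\ ((0 < m)%N -> z ^+ (ell ^ m.-1) <> 1).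

(* [kk] is the largest m such that some self-pairing of a point of [S] has
   order ell^m. *)
Definition max_selfpairing k (A : abvar k) (ell : nat)
    (T : A -> A -> k -> Prop) (S : set A) (kk : nat) :=
  (exists P z, [/\ S P, T P P z & exact_order ell kk z]) /\
  forall m P z, S P -> T P P z -> exact_order ell m z -> (m <= kk)%N.

Definition tate_nondegenerate k (A : abvar k) (ell : nat)
    (T : A -> A -> k -> Prop) (G : set A) (kk : nat) :=
  forall z : k, z ^+ (ell ^ kk) = 1 -> exists a b, [/\ G a, G b & T a b z].

(** * CM fields, ideals and orders *)

Definition totally_real (K : fieldExtType rat) (F : {subfield K}) :=
  forall (s : {rmorphism K -> algC}) x, x \in F -> s x \is Num.real.

Definition totally_imaginary (K : fieldExtType rat) (F : {subfield K}) :=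
  forall s : {rmorphism K -> algC}, exists2 x, x \in F & s x \isn't Num.real.

Definition quartic_cm (K : fieldExtType rat) (K0 : {subfield K}) :=
  [/\ \dim {:K} = 4%N, \dim K0 = 2%N,
      totally_real K0 & totally_imaginary {:K}%AS].

Definition primitive_cm (K : fieldExtType rat) :=
  ~ exists F : {subfield K}, \dim F = 2%N /\ totally_imaginary F.

Definition int_ring (K : fieldExtType rat) (F : {subfield K}) : set K :=
  [set x | x \in F /\ integralOver (intr : int -> K) x].

Definition totally_positive (K : fieldExtType rat) (x : K) :=
  forall s : {rmorphism K -> algC}, 0 < s x.

Definition is_ideal (K : fieldType) (O I : set K) :=
  [/\ I `<=` O, I 0, forall x y, I x -> I y -> I (x + y) &
      forall a x, O a -> I x -> I (a * x)].

Definition is_prime_ideal (K : fieldType) (O I : set K) :=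
  [/\ is_ideal O I, ~ I 1 &
      forall x y, O x -> O y -> I (x * y) -> I x \/ I y].

Definition scale_set (K : fieldType) (a : K) (I : set K) : set K :=
  [set a * x | x in I].

Definition ideal_mul (K : fieldType) (I J : set K) : set K :=
  [set x | exists s : seq (K * K),
     (forall u, u \in s -> I u.1 /\ J u.2) /\ x = \sum_(u <- s) u.1 * u.2].

Definition ideal_exp (K : fieldType) (O I : set K) (m : nat) : set K :=
  iter m (ideal_mul I) O.

Definition ideal_equiv (K : fieldType) (O I J : set K) :=
  exists a b, [/\ O a /\ a != 0, O b /\ b != 0 &
                  scale_set a I = scale_set b J].

Definition nonzero_ideal (K : fieldType) (O I : set K) :=
  is_ideal O I /\ exists2 x, I x & x != 0.

Definition class_number_is (K : fieldType) (O : set K) (h : nat) :=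
  exists I : 'I_h -> set K,
    [/\ forall i, nonzero_ideal O (I i),
        forall i j, ideal_equiv O (I i) (I j) -> i = j &
        forall J, nonzero_ideal O J -> exists i, ideal_equiv O J (I i)].

Definition index_is (K : fieldType) (M N : set K) (d : nat) :=
  exists s : seq K,
    [/\ uniq s /\ size s = d, forall x, x \in s -> M x,
        forall x, M x -> exists2 y, y \in s & N (x - y) &
        forall x y, x \in s -> y \in s -> N (x - y) -> x = y].

Definition is_order (K : fieldExtType rat) (O : set K) :=
  [/\ O 1, forall x y, O x -> O y -> O (x * y) &
      exists b : (\dim {:K}).-tuple K, basis_of fullv b /\
        O = [set x | exists c : 'I_(\dim {:K}) -> int,
               x = \sum_i tnth b i *~ c i]].

Definition loc_max_RM (K : fieldExtType rat) (K0 : {subfield K}) (ell : nat)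
    (O : set K) :=
  exists d, index_is (int_ring K0) (O `&` [set` K0]) d /\ coprime d ell.

(* Ring isomorphism between the subrings [O] and [O'] of [K]. *)
Definition order_iso (K : fieldType) (O O' : set K) :=
  exists f : K -> K,
    [/\ f @` O = O',
        forall x y, O x -> O y -> f x = f y -> x = y,
        f 1 = 1,
        forall x y, O x -> O y -> f (x + y) = f x + f y &
        forall x y, O x -> O y -> f (x * y) = f x * f y].

(* The completion of [R] at its ideal [I]: Cauchy sequences, up to
   [null_diff]. *)
Definition completion (K : fieldType) (R I : set K) : set (nat -> K) :=
  [set z | (forall i, R (z i)) /\
     forall m, exists n, forall i j, (n <= i)%N -> (n <= j)%N ->
       ideal_exp R I m (z i - z j)].

Definition null_diff (K : fieldType) (R I : set K) (z z' : nat -> K) :=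
  forall m, exists n, forall i, (n <= i)%N -> ideal_exp R I m (z i - z' i).

(* R-balanced maps on K x R^, where R^ is the completion of [R] at [I]. *)
Definition balanced (K : fieldType) (R I : set K) (V : zmodType)
    (b : K -> (nat -> K) -> V) :=
  let C := completion R I in
  [/\ forall x z z', C z -> C z' -> null_diff R I z z' -> b x z = b x z',
      forall x y z, C z -> b (x + y) z = b x z + b y z,
      forall x z z', C z -> C z' ->
        b x (fun i => z i + z' i) = b x z + b x z' &
      forall c x z, R c -> C z -> b (c * x) z = b x (fun i => c * z i)].

(* Formal sums of elementary tensors, representing elements of K (x)_R R^ with
   first factors in [O]. *)
Definition tensors (K : fieldType) (R I O : set K) :
    set (seq (K * (nat -> K))) :=
  [set t | forall i, (i < size t)%N ->
     O (nth (0, fun=> 0) t i).1 /\ completion R I (nth (0, fun=> 0) t i).2].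

(* Equality in K (x)_R R^, by the universal property of tensor products. *)
Definition tensor_eq (K : fieldType) (R I : set K)
    (t t' : seq (K * (nat -> K))) :=
  forall (V : zmodType) (b : K -> (nat -> K) -> V), balanced R I b ->
    \sum_(u <- t) b u.1 u.2 = \sum_(u <- t') b u.1 u.2.

(* O_I is contained in O'_I.  With R the ring of integers of K_0 and
   O_0 = O \cap K_0 of index prime to I in R, the completion R^ is flat over
   O_0, so O_I = O (x)_(O_0) R^ embeds into K (x)_(O_0) R^ = K (x)_R R^, the
   completion of K at I; inclusions are taken there. *)
Definition local_sub (K : fieldType) (R I O O' : set K) :=
  forall t, tensors R I O t ->
    exists2 t', tensors R I O' t' & tensor_eq R I t t'.

Definition local_proper (K : fieldType) (R I O O' : set K) :=
  local_sub R I O O' /\ ~ local_sub R I O' O.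

(** * Complex multiplication *)

(* [(f, m)] stands for the element f / m of End(A) (x) Q; End(A) being
   torsion-free, equality is cross-multiplication. *)
Definition qend k (A : abvar k) : Type := ((A -> A) * nat)%type.

Definition qend_eq k (A : abvar k) (f g : qend A) :=
  forall x, f.1 x *+ g.2 = g.1 x *+ f.2.

Definition qend_add k (A : abvar k) (f g : qend A) : qend A :=
  (fun x => f.1 x *+ g.2 + g.1 x *+ f.2, (f.2 * g.2)%N).

Definition qend_mul k (A : abvar k) (f g : qend A) : qend A :=
  (fun x => f.1 (g.1 x), (f.2 * g.2)%N).

Definition qend_embedding (K : fieldType) k (A : abvar k)
    (io : K -> qend A) :=
  [/\ forall x, is_end (io x).1 /\ (0 < (io x).2)%N,
      qend_eq (io 1) (id, 1%N),
      forall x y, qend_eq (io (x + y)) (qend_add (io x) (io y)),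
      forall x y, qend_eq (io (x * y)) (qend_mul (io x) (io y)) &
      forall x y, qend_eq (io x) (io y) -> x = y].

Definition has_CM_by (K : fieldType) k (A : abvar k) (O : set K)
    (io : K -> qend A) :=
  [/\ qend_embedding io,
      forall x, O x <-> exists2 f, is_end f & qend_eq (io x) (f, 1%N) &
      forall f, is_end f -> exists2 x, O x & qend_eq (io x) (f, 1%N)].

(* The points killed by J \cap O, for J contained in K_0. *)
Definition torsion (K : fieldType) k (A : abvar k) (O : set K)
    (io : K -> qend A) (J : set K) : set A :=
  [set x | forall beta f, J beta -> O beta -> is_end f ->
     qend_eq (io beta) (f, 1%N) -> f x = 0].

(* End(A') as a subring of K, through [io] and the isogeny [I]: [x] belongs to
   it if I io(x) I^-1 is an endomorphism [g] of [A']. *)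
Definition end_order (K : fieldType) k (A A' : abvar k)
    (io : K -> qend A) (I : A -> A') : set K :=
  [set x | exists2 g : A' -> A', is_end g &
     forall a, g (I a) *+ (io x).2 = I ((io x).1 a)].

(* Main.v *)
(** Line bundles are handled through divisors, and the seesaw principle is replaced by the
    uniqueness part of the definition of the dual.  This gives the adjoints of endomorphisms
    and the Weil pairing, which is nondegenerate on A[N] because an endomorphism or a
    trivialization that is invariant under A[N] descends up to a power of Frobenius.

    An endomorphism x in O is expanded in base F^M.  As complex conjugation is the adjoint
    on K, its norm form is divided by q^M at each step, so that multiplication by ell^t is
    given by fractions of degree about ell^(2t) and its kernel has about ell^(4t) elements
    at most.  With the faithfulness of O / ell on A[ell] and the alternation of the Weil
    pairing, A[l] is a plane over F_ell.

    On A[l^n] the Tate pairing is e(nu x, y) with pi^r - 1 = ell^n nu.  Subtracting an integer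
    from nu and dividing by the largest possible power of ell leaves an element mu of O
    acting on A[l] as a non-scalar map.  The self-pairings of G have maximal order if and
    only if mu does not preserve the line of P.  In that case End(A') is contained in O
    but does not contain mu locally at l; otherwise O preserves the kernel of the isogeny,
    so that O is contained in End(A'). *)

Require Import Defs.
From HB Require Import structures.
From mathcomp Require Import all_boot all_order all_algebra all_field.
From mathcomp Require Import boolp classical_sets.
From mathcomp Require Import perm cyclic mpoly ring lra zify.

Set Implicit Arguments.
Unset Strict Implicit.
Unset Printing Implicit Defensive.

Import Order.TTheory GRing.Theory Num.Theory.
Local Open Scope classical_set_scope.
Local Open Scope ring_scope.

(** * Spaces with functions *)

(** That A[l] is a plane is usually read off from the degree of multiplication by ell. Here the two
    bounds have different sources. The summands of A[ell] at l and at the other prime are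
    orthogonal, and a cyclic summand would be orthogonal to itself by alternation, so both have at
    least two dimensions. A third independent vector at l would then make five in A[ell], hence
    ell^(5t) points in A[ell^t]; against a growth of ell^(4t), any bound up to constants is enough.
    Frobenius makes the rest elementary. As k is algebraic over F_p, every point is periodic, and a
    finite kernel gives surjectivity by counting in finite groups. The differential of F vanishes,
    which isolates kernels. What a descent loses to inseparability is a power of F, a divisor of a
    power of q, and q is invertible modulo ell. Primitivity enters through the Rosati involution: it
    has to fix K0, so that elements of O in K0 are self-adjoint and the projector onto A[l] is
    orthogonal. *)

Definition nbh k T (X : Defs.space k T) (x : T) (W : set T) :=
  exists V, [/\ opn X V, V x & V `<=` W].

Definition regat k T (X : Defs.space k T) (x : T) (f : T -> k) :=
  exists V, [/\ opn X V, V x & reg X V f].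

Record rspace (k : fieldType) T (X : Defs.space k T) : Prop := RSpace {
  rs_openT : opn X setT;
  rs_openI : forall U V, opn X U -> opn X V -> opn X (U `&` V);
  rs_openU : forall U, (forall x, U x -> nbh X x U) -> opn X U;
  rs_reg : forall U f, opn X U -> (reg X U f <-> forall x, U x -> regat X x f);
  rs_ext : forall x f g, nbh X x [set y | f y = g y] -> regat X x f -> regat X x g;
  rs_cst : forall x c, regat X x (fun=> c);
  rs_add : forall x f g, regat X x f -> regat X x g -> regat X x (fun y => f y + g y);
  rs_mul : forall x f g, regat X x f -> regat X x g -> regat X x (fun y => f y * g y);
  rs_nz : forall x f, regat X x f -> f x != 0 -> nbh X x [set y | f y != 0];
  rs_inv : forall x f, regat X x f -> f x != 0 -> regat X x (fun y => (f y)^-1) }.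

Lemma nbhS k T (X : Defs.space k T) x (V W : set T) :
  V `<=` W -> nbh X x V -> nbh X x W.
Proof. by move=> VW [U [? ? UV]]; exists U; split=> // y /UV /VW. Qed.

Lemma nbh_pt k T (X : Defs.space k T) x (V : set T) : nbh X x V -> V x.
Proof. by case=> U [_ Ux UV]; apply: UV. Qed.

Lemma nbh_open k T (X : Defs.space k T) x (V : set T) : opn X V -> V x -> nbh X x V.
Proof. by exists V; split. Qed.

Section RSpace.
Variables (k : fieldType) (T : Type) (X : Defs.space k T).
Hypothesis rX : rspace X.
Implicit Types (x : T) (V W : set T) (f g : T -> k).

Lemma nbhT x : nbh X x setT.
Proof. by exists setT; split=> //; apply: rs_openT. Qed.

Lemma nbhI x V W : nbh X x V -> nbh X x W -> nbh X x (V `&` W).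
Proof.
case=> V' [oV Vx VV] [W' [oW Wx WW]]; exists (V' `&` W'); split=> //.
  exact: rs_openI.
by move=> y [/VV ? /WW].
Qed.

Lemma opnP V : opn X V <-> forall x, V x -> nbh X x V.
Proof. by split; [move=> oV x Vx; exact: nbh_open | exact: rs_openU]. Qed.

Lemma nbh_forall m (V : 'I_m -> set T) x :
  (forall i, nbh X x (V i)) -> nbh X x [set y | forall i, V i y].
Proof.
elim: m V => [|m IH] V hV; first by apply: nbhS (nbhT x) => y _ [].
have := nbhI (hV ord0) (IH (fun i => V (lift ord0 i)) (fun i => hV _)).
by apply: nbhS => y [h0 h1] i; case: (unliftP ord0 i) => [j|] ->.
Qed.

Lemma ra_ext x f g : (forall y, f y = g y) -> regat X x f -> regat X x g.
Proof. by move=> h; apply: rs_ext => //; apply: nbhS (nbhT x) => y _; exact: h. Qed.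

Lemma ra_opp x f : regat X x f -> regat X x (fun y => - f y).
Proof.
move=> rf; apply: ra_ext (rs_mul rX (rs_cst rX x (-1)) rf) => y.
by rewrite mulN1r.
Qed.

Lemma ra_sub x f g : regat X x f -> regat X x g -> regat X x (fun y => f y - g y).
Proof. by move=> rf rg; apply: (rs_add rX) => //; exact: ra_opp. Qed.

Lemma ra_div x f g : regat X x f -> regat X x g -> g x != 0 ->
  regat X x (fun y => f y / g y).
Proof. by move=> rf rg g0; apply: (rs_mul rX) => //; exact: rs_inv. Qed.

Lemma ra_exp x f m : regat X x f -> regat X x (fun y => f y ^+ m).
Proof.
move=> rf; elim: m => [|m IH]; first exact: rs_cst.
by apply: ra_ext (rs_mul rX rf IH) => y; rewrite exprS.
Qed.

Lemma ra_sum x I (r : seq I) (P : pred I) (F : I -> T -> k) :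
  (forall i, P i -> regat X x (F i)) ->
  regat X x (fun y => \sum_(i <- r | P i) F i y).
Proof.
move=> h; elim: r => [|i r IH].
  by apply: ra_ext (rs_cst rX x 0) => y; rewrite big_nil.
case Pi: (P i); last by apply: ra_ext IH => y; rewrite big_cons Pi.
by apply: ra_ext (rs_add rX (h i Pi) IH) => y; rewrite big_cons Pi.
Qed.

Lemma ra_prod x I (r : seq I) (P : pred I) (F : I -> T -> k) :
  (forall i, P i -> regat X x (F i)) ->
  regat X x (fun y => \prod_(i <- r | P i) F i y).
Proof.
move=> h; elim: r => [|i r IH].
  by apply: ra_ext (rs_cst rX x 1) => y; rewrite big_nil.
case Pi: (P i); last by apply: ra_ext IH => y; rewrite big_cons Pi.
by apply: ra_ext (rs_mul rX (h i Pi) IH) => y; rewrite big_cons Pi.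
Qed.

Lemma ra_meval x n (p : {mpoly k[n]}) (F : T -> 'I_n -> k) :
  (forall i, regat X x (fun y => F y i)) -> regat X x (fun y => p.@[F y]).
Proof.
move=> h; apply: (@ra_ext _ (fun y => \sum_(m <- msupp p)
   p@_m * \prod_i F y i ^+ m i)); first by move=> y; rewrite mevalE.
apply: ra_sum => m _; apply: (rs_mul rX); first exact: rs_cst.
by apply: ra_prod => i _; exact: ra_exp.
Qed.

Lemma reg_rat U f : opn X U -> (forall x, U x -> regat X x f) -> reg X U f.
Proof. by move=> oU h; apply/(rs_reg rX). Qed.

End RSpace.

Section Morphisms.
Variables (k : fieldType).

Definition mor S T (X : Defs.space k S) (Y : Defs.space k T) (f : S -> T) :=
  forall x, (forall W, nbh Y (f x) W -> nbh X x (f @^-1` W)) /\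
            (forall g, regat Y (f x) g -> regat X x (g \o f)).

Lemma morP S T (X : Defs.space k S) (Y : Defs.space k T) f : rspace X -> rspace Y ->
  morphism X Y f <-> mor X Y f.
Proof.
move=> rX rY; split=> [mf x|mf V oV].
  split=> [W [V [oV Vx VW]]|g [V [oV Vx rV]]].
    have [oV' _] := mf V oV; exists (f @^-1` V); split=> // y; exact: VW.
  have [oV' rV'] := mf V oV; exists (f @^-1` V); split=> //; exact: rV'.
have oV' : opn X (f @^-1` V).
  by apply/(opnP rX) => x Vx; apply: (proj1 (mf x)); exact: nbh_open.
split=> // g rg; apply: (reg_rat rX) => // x Vx.
by apply: (proj2 (mf x)); exists V.
Qed.

Lemma mor_comp S T U (X : Defs.space k S) (Y : Defs.space k T) (Z : Defs.space k U) f g :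
  mor X Y f -> mor Y Z g -> mor X Z (g \o f).
Proof.
move=> mf mg x; split=> [W hW|h hh].
  exact: (proj1 (mf x)) _ ((proj1 (mg (f x))) _ hW).
exact: (proj2 (mf x)) _ ((proj2 (mg (f x))) _ hh).
Qed.

Lemma mor_id S (X : Defs.space k S) : mor X X id.
Proof. by []. Qed.

Lemma mor_cst S T (X : Defs.space k S) (Y : Defs.space k T) c : rspace X ->
  mor X Y (fun=> c).
Proof.
move=> rX x; split=> [W hW|g _]; last exact: (rs_cst rX x (g c)).
by apply: nbhS (nbhT rX x) => y _; exact: nbh_pt hW.
Qed.

Lemma mor_ext S T (X : Defs.space k S) (Y : Defs.space k T) f g :
  (forall x, f x = g x) -> mor X Y f -> mor X Y g.
Proof. by move=> /funext ->. Qed.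

End Morphisms.

(** * Products of spaces with functions *)

Section Products.
Variables (k : fieldType) (S T : Type) (X : Defs.space k S) (Y : Defs.space k T).
Hypotheses (rX : rspace X) (rY : rspace Y).


Lemma tensor_fin (I : finType) (U : set S) (V : set T) f g h :
  (forall i : I, reg X U (f i) /\ reg Y V (g i)) ->
  (forall x y, U x -> V y -> h (x, y) = \sum_i f i x * g i y) ->
  tensor_reg X Y U V h.
Proof.
move=> hr he; exists #|I|, (f \o enum_val), (g \o enum_val); split=> [i|x y Ux Vy].
  exact: hr.
by rewrite he // (reindex _ (onW_bij _ (enum_val_bij I))).
Qed.

Definition bx (w : S * T) (P : set (S * T)) :=
  exists U V, [/\ opn X U /\ U w.1, opn Y V /\ V w.2 &
    forall w', U w'.1 -> V w'.2 -> P w'].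

Definition lten (w : S * T) (h : S * T -> k) :=
  exists U V, [/\ opn X U /\ U w.1, opn Y V /\ V w.2 & tensor_reg X Y U V h].

Lemma reg_sub U U' f : opn X U -> opn X U' -> U' `<=` U -> reg X U f -> reg X U' f.
Proof. by move=> oU oU' UU rf; apply: reg_rat => // x /UU Ux; exists U. Qed.

Lemma bxI w P Q : bx w P -> bx w Q -> bx w (P `&` Q).
Proof.
move=> [U [V [[oU Ux] [oV Vx] h]]] [U' [V' [[oU' Ux'] [oV' Vx'] h']]].
exists (U `&` U'), (V `&` V'); split; first by split=> //; exact: rs_openI.
  by split=> //; exact: rs_openI.
by move=> w' [? ?] [? ?]; split; [apply: h | apply: h'].
Qed.

Lemma bxS w (P Q : set (S * T)) : P `<=` Q -> bx w P -> bx w Q.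
Proof.
by move=> PQ [U [V [? ? h]]]; exists U, V; split=> // w' ? ?; apply/PQ/h.
Qed.

Lemma bx_box w U V : nbh X w.1 U -> nbh Y w.2 V ->
  bx w [set w' | U w'.1 /\ V w'.2].
Proof.
move=> [U' [oU Ux hU]] [V' [oV Vx hV]]; exists U', V'; split=> // w' /hU ? /hV.
by [].
Qed.

Lemma bxT w P : (forall w', P w') -> bx w P.
Proof.
move=> h; apply: bxS (bx_box (nbhT rX _) (nbhT rY _)) => w' _; exact: h.
Qed.

End Products.
Arguments bx {k S T} X Y w P.
Arguments lten {k S T} X Y w h.

Section Products2.
Variables (k : fieldType) (S T : Type) (X : Defs.space k S) (Y : Defs.space k T).
Hypotheses (rX : rspace X) (rY : rspace Y).

Lemma ten_sub U V U' V' h : opn X U -> opn X U' -> U' `<=` U ->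
  opn Y V -> opn Y V' -> V' `<=` V ->
  tensor_reg X Y U V h -> tensor_reg X Y U' V' h.
Proof.
move=> oU oU' UU oV oV' VV [m [f [g [hr he]]]]; exists m, f, g; split=> [i|x y Ux Vy].
  have [? ?] := hr i; split; first by apply: (reg_sub rX oU).
  exact: (reg_sub rY oV).
by apply: he; [exact: UU | exact: VV].
Qed.

Lemma lten2 w h h' : lten X Y w h -> lten X Y w h' ->
  exists U V, [/\ opn X U /\ U w.1, opn Y V /\ V w.2,
    tensor_reg X Y U V h & tensor_reg X Y U V h'].
Proof.
move=> [U [V [[oU Ux] [oV Vx] t]]] [U' [V' [[oU' Ux'] [oV' Vx'] t']]].
have oUU := rs_openI rX oU oU'; have oVV := rs_openI rY oV oV'.
exists (U `&` U'), (V `&` V'); split=> //.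
  by apply: ten_sub t => //.
by apply: ten_sub t' => //.
Qed.

Lemma lten_prod w f g : regat X w.1 f -> regat Y w.2 g ->
  lten X Y w (fun w' => f w'.1 * g w'.2).
Proof.
move=> [U [oU Ux rf]] [V [oV Vx rg]]; exists U, V; split=> //.
apply: (@tensor_fin _ _ _ X Y unit U V (fun=> f) (fun=> g)) => // x y _ _.
by rewrite (big_pred1 tt) // => -[].
Qed.

Lemma lten_cst w c : lten X Y w (fun=> c).
Proof.
have [U [V [hU hV [m [f [g [hr he]]]]]]] :=
  lten_prod (rs_cst rX w.1 c) (rs_cst rY w.2 1).
exists U, V; split=> //; exists m, f, g; split=> // x y Ux Vy.
by rewrite -he //= mulr1.
Qed.

Lemma lten_ext w h h' : (forall w', h w' = h' w') -> lten X Y w h -> lten X Y w h'.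
Proof. by move=> /funext ->. Qed.

Lemma lten_add w h h' : lten X Y w h -> lten X Y w h' ->
  lten X Y w (fun w' => h w' + h' w').
Proof.
move=> hh hh'; have [U [V [oU oV]]] := lten2 hh hh'.
move=> [m [f [g [hr he]]]] [m' [f' [g' [hr' he']]]]; exists U, V; split=> //.
apply: (@tensor_fin _ _ _ X Y ('I_m + 'I_m')%type U V
  (fun i => match i with inl i => f i | inr i => f' i end)
  (fun i => match i with inl i => g i | inr i => g' i end)).
  by case=> i; [exact: hr | exact: hr'].
by move=> x y Ux Vy; rewrite he // he' // big_sumType.
Qed.

Lemma lten_mul w h h' : lten X Y w h -> lten X Y w h' ->
  lten X Y w (fun w' => h w' * h' w').
Proof.
move=> hh hh'; have [U [V [oU oV]]] := lten2 hh hh'.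
move=> [m [f [g [hr he]]]] [m' [f' [g' [hr' he']]]]; exists U, V; split=> //.
have rm (W Z : Type) (Q : Defs.space k Z) (u v : Z -> k) (O : set Z) : rspace Q ->
    opn Q O -> reg Q O u -> reg Q O v -> reg Q O (fun z => u z * v z).
  move=> rQ oO ru rv; apply: (reg_rat rQ) => // z Oz; apply: (rs_mul rQ); by exists O.
apply: (@tensor_fin _ _ _ X Y ('I_m * 'I_m')%type U V
  (fun i x => f i.1 x * f' i.2 x) (fun i y => g i.1 y * g' i.2 y)).
  move=> [i j] /=; have [? ?] := hr i; have [? ?] := hr' j.
  by split; apply: rm => //; [case: oU | case: oV].
move=> x y Ux Vy; rewrite he // he' // big_distrlr /= pair_big /=.
by apply: eq_bigr => -[i j] _ /=; rewrite mulrACA.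
Qed.

(** Around a fixed point open boxes can be intersected, so a basic open set is the nonvanishing
    locus of one function in [lten] inside a box [bx]. With the analogue for germs, questions about
    products become computations with tensors at one point. *)
Lemma prod_nbhP w W : nbh (prod_space X Y) w W <->
  exists h, [/\ lten X Y w h, h w != 0 & bx X Y w [set w' | h w' != 0 -> W w']].
Proof.
split=> [[V [oV Vw VW]]|[h [[U [V [[oU Ux] [oV Vx] th]]] hw [U' [V' [[oU' Ux'] [oV' Vx'] hW]]]]]].
  have [U [U' [h [[oU Ux] [oU' Ux'] th hw hh]]]] := oV _ Vw.
  exists h; split=> //; first by exists U, U'.
  by exists U, U'; split=> // w' ? ? ?; apply/VW/hh.
have oUU := rs_openI rX oU oU'; have oVV := rs_openI rY oV oV'.
exists [set w' | [/\ (U `&` U') w'.1, (V `&` V') w'.2 & h w' != 0]]; split=> //.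
  move=> w' [hU hV hw']; exists (U `&` U'), (V `&` V'), h; split=> //.
  by apply: ten_sub th => //.
by move=> w' [[? ?] [? ?] ?]; apply: hW.
Qed.

Lemma bx_nbh w P : bx X Y w P -> nbh (prod_space X Y) w P.
Proof.
move=> hb; apply/prod_nbhP; exists (fun=> 1); split; first exact: lten_cst.
  exact: oner_neq0.
by apply: bxS hb => w' hw' _.
Qed.

Lemma prod_ratP w F : regat (prod_space X Y) w F <->
  exists h d, [/\ lten X Y w h, lten X Y w d, d w != 0 &
    bx X Y w [set w' | d w' != 0 -> F w' = h w' / d w']].
Proof.
split=> [[W [oW Ww rF]]|[h [d [hh hd dw [U' [V' [[oU' Ux'] [oV' Vx'] he]]]]]]].
  have [U [V [h [d [[oU Ux] [oV Vx] [th td] dw he]]]]] := rF _ Ww.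
  have [U' [V' [g [[oU' Ux'] [oV' Vx'] tg gw hg]]]] := oW _ Ww.
  have lg : lten X Y w g by exists U', V'.
  exists (fun w' => h w' * g w'), (fun w' => d w' * g w'); split.
  - by apply: lten_mul lg; exists U, V.
  - by apply: lten_mul lg; exists U, V.
  - by rewrite mulf_neq0.
  have := bxI rX rY (bx_box (nbh_open oU Ux) (nbh_open oV Vx))
    (bx_box (nbh_open oU' Ux') (nbh_open oV' Vx')).
  apply: bxS => w' /= [[Uw Vw] [Uw' Vw']].
  rewrite mulf_eq0 => /norP[d0 g0]; rewrite he //; last exact: hg.
  by rewrite invfM mulrACA divff // mulr1.
have [U [V [[oU Ux] [oV Vx] th td]]] := lten2 hh hd.
have oUU := rs_openI rX oU oU'; have oVV := rs_openI rY oV oV'.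
have hsub : forall h, tensor_reg X Y U V h ->
  tensor_reg X Y (U `&` U') (V `&` V') h.
  by move=> u; apply: ten_sub => //.
exists [set w' | [/\ (U `&` U') w'.1, (V `&` V') w'.2 & d w' != 0]]; split=> //.
  move=> w' [hU hV hw']; exists (U `&` U'), (V `&` V'), d; split=> //.
  exact: hsub.
move=> w' [hU hV hw']; exists (U `&` U'), (V `&` V'), h, d; split=> //.
  by split; exact: hsub.
by move=> w'' _ [_ ?] [_ ?] ?; exact: he.
Qed.

Lemma prod_rspace : rspace (prod_space X Y).
Proof.
have bT w : bx X Y w setT by exact: bxT.
split.
- move=> w _; exists setT, setT, (fun=> 1); split=> //.
  + by split=> //; exact: rs_openT.
  + by split=> //; exact: rs_openT.
  + apply: (@tensor_fin _ _ _ X Y unit _ _ (fun _ _ => 1) (fun _ _ => 1)).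
      move=> _; split; apply: reg_rat => //.
      * exact: rs_openT.
      * by move=> x _; exact: rs_cst.
      * exact: rs_openT.
      * by move=> x _; exact: rs_cst.
    by move=> x y _ _; rewrite (big_pred1 tt) ?mulr1 // => -[].
  + exact: oner_neq0.
- have oI : forall U V w, opn (prod_space X Y) U -> opn (prod_space X Y) V ->
     U w -> V w -> nbh (prod_space X Y) w (U `&` V).
    move=> U V w oU oV Uw Vw; apply/prod_nbhP.
    have [h [lh hw hb]] := (prod_nbhP w U).1 (nbh_open oU Uw).
    have [h' [lh' hw' hb']] := (prod_nbhP w V).1 (nbh_open oV Vw).
    exists (fun w' => h w' * h' w'); split; first exact: lten_mul.
      by rewrite mulf_neq0.
    apply: bxS (bxI rX rY hb hb') => w' [/= h1 h2]; rewrite mulf_eq0 => /norP[? ?].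
    by split; [apply: h1 | apply: h2].
  move=> U V oU oV w [Uw Vw]; have [W [oW Ww WUV]] := oI U V w oU oV Uw Vw.
  have [A [C [h [? ? ? ? hh]]]] := oW _ Ww.
  by exists A, C, h; split=> // w' ? ? ?; apply/WUV/hh.
- move=> U hU w Uw; have [W [oW Ww WU]] := hU _ Uw.
  have [A [C [h [? ? ? ? hh]]]] := oW _ Ww.
  by exists A, C, h; split=> // w' ? ? ?; apply/WU/hh.
- move=> U f oU; split=> [rf x Ux|hf w Uw]; first by exists U.
  have [h [d [hh hd dw hb]]] := (prod_ratP w f).1 (hf w Uw).
  have [A [C [hA hC th td]]] := lten2 hh hd.
  have [A' [C' [[oA' Aw'] [oC' Cw'] he]]] := hb.
  case: hA hC => oA Aw [oC Cw].
  have oAA := rs_openI rX oA oA'; have oCC := rs_openI rY oC oC'.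
  exists (A `&` A'), (C `&` C'), h, d; split=> //.
    by split; [apply: ten_sub th | apply: ten_sub td] => //.
  by move=> w' _ [_ ?] [_ ?] ?; exact: he.
- move=> w f g /prod_nbhP[u [lu uw hu]] /prod_ratP[h [d [hh hd dw hb]]].
  apply/prod_ratP; exists (fun w' => h w' * u w'), (fun w' => d w' * u w').
  split; [exact: lten_mul | exact: lten_mul | by rewrite mulf_neq0 |].
  apply: bxS (bxI rX rY hu hb) => w' [/= h1 h2]; rewrite mulf_eq0 => /norP[d0 u0].
  by rewrite -h1 // h2 // invfM mulrACA divff // mulr1.
- move=> w c; apply/prod_ratP; exists (fun=> c), (fun=> 1).
  split; [exact: lten_cst | exact: lten_cst | exact: oner_neq0 |].
  by apply: bxS (bT w) => w' _ _; rewrite divr1.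
- move=> w f g /prod_ratP[h [d [hh hd dw hb]]] /prod_ratP[h' [d' [hh' hd' dw' hb']]].
  apply/prod_ratP; exists (fun w' => h w' * d' w' + h' w' * d w'), (fun w' => d w' * d' w').
  split.
  + by apply: lten_add; apply: lten_mul.
  + exact: lten_mul.
  + by rewrite mulf_neq0.
  apply: bxS (bxI rX rY hb hb') => w' [/= h1 h2]; rewrite mulf_eq0 => /norP[d0 d0'].
  by rewrite h1 // h2 // addf_div.
- move=> w f g /prod_ratP[h [d [hh hd dw hb]]] /prod_ratP[h' [d' [hh' hd' dw' hb']]].
  apply/prod_ratP; exists (fun w' => h w' * h' w'), (fun w' => d w' * d' w').
  split; [exact: lten_mul | exact: lten_mul | by rewrite mulf_neq0 |].
  apply: bxS (bxI rX rY hb hb') => w' [/= h1 h2]; rewrite mulf_eq0 => /norP[d0 d0'].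
  by rewrite h1 // h2 // mulf_div.
- move=> w f /prod_ratP[h [d [hh hd dw hb]]] fw; apply/prod_nbhP.
  have := hb; case=> [U [V [[_ Uw] [_ Vw] /(_ w Uw Vw)]]] /= /(_ dw) fe.
  exists (fun w' => d w' * h w'); split; first exact: lten_mul.
    by rewrite mulf_neq0 //; apply: contraNneq fw => h0; rewrite fe h0 mul0r.
  apply: bxS hb => w' /= h1; rewrite mulf_eq0 => /norP[d0 h0].
  by rewrite h1 // mulf_neq0 // invr_eq0.
- move=> w f /prod_ratP[h [d [hh hd dw hb]]] fw; apply/prod_ratP.
  have := hb; case=> [U [V [[_ Uw] [_ Vw] /(_ w Uw Vw)]]] /= /(_ dw) fe.
  have hw : h w != 0 by apply: contraNneq fw => h0; rewrite fe h0 mul0r.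
  exists (fun w' => d w' * d w'), (fun w' => d w' * h w'); split.
  + exact: lten_mul.
  + exact: lten_mul.
  + by rewrite mulf_neq0.
  apply: bxS hb => w' /= h1; rewrite mulf_eq0 => /norP[d0 h0].
  by rewrite h1 // invf_div invfM mulrACA divff // mul1r.
Qed.

Lemma mor_fst : mor (prod_space X Y) X fst.
Proof.
move=> w; split=> [W hW|g hg].
  apply: bx_nbh; apply: bxS (bx_box hW (nbhT rY w.2)) => w' []; by [].
apply/prod_ratP; exists (g \o fst), (fun=> 1); split.
- by apply: lten_ext (lten_prod hg (rs_cst rY w.2 1)) => w'; rewrite mulr1.
- exact: lten_cst.
- exact: oner_neq0.
by apply: bxT => // w' _; rewrite divr1.
Qed.

Lemma mor_snd : mor (prod_space X Y) Y snd.
Proof.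
move=> w; split=> [W hW|g hg].
  apply: bx_nbh; apply: bxS (bx_box (nbhT rX w.1) hW) => w' []; by [].
apply/prod_ratP; exists (g \o snd), (fun=> 1); split.
- by apply: lten_ext (lten_prod (rs_cst rX w.1 1) hg) => w'; rewrite mul1r.
- exact: lten_cst.
- exact: oner_neq0.
by apply: bxT => // w' _; rewrite divr1.
Qed.

Lemma mor_pair Z (W : Defs.space k Z) f g : rspace W -> mor W X f -> mor W Y g ->
  mor W (prod_space X Y) (fun z => (f z, g z)).
Proof.
move=> rW mf mg z.
have lr h : lten X Y (f z, g z) h -> regat W z (fun z => h (f z, g z)).
  move=> [U [V [[oU Ux] [oV Vx] [m [u [v [hr he]]]]]]].
  apply: (rs_ext rW (f := fun z => \sum_i u i (f z) * v i (g z))).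
    have := nbhI rW (proj1 (mf z) _ (nbh_open oU Ux))
      (proj1 (mg z) _ (nbh_open oV Vx)).
    by apply: nbhS => z' [/= ? ?]; rewrite he.
  apply: ra_sum => // i _; apply: (rs_mul rW).
    by apply: (proj2 (mf z)); exists U; split=> //; exact: (hr i).1.
  by apply: (proj2 (mg z)); exists V; split=> //; exact: (hr i).2.
have bn P : bx X Y (f z, g z) P -> nbh W z [set z' | P (f z', g z')].
  move=> [U [V [[oU Ux] [oV Vx] hP]]].
  have := nbhI rW (proj1 (mf z) _ (nbh_open oU Ux))
      (proj1 (mg z) _ (nbh_open oV Vx)).
  by apply: nbhS => z' [/= ? ?]; exact: hP.
split=> [P /prod_nbhP[h [lh h0 hb]]|F /prod_ratP[h [d [lh ld d0 hb]]]].
  have := nbhI rW (rs_nz rW (lr _ lh) h0) (bn _ hb).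
  by apply: nbhS => z' [/= ?]; apply.
apply: (rs_ext rW (f := fun z => h (f z, g z) / d (f z, g z))).
  have := nbhI rW (rs_nz rW (lr _ ld) d0) (bn _ hb).
  by apply: nbhS => z' [/= h1 h2]; rewrite h2.
by apply: (ra_div rW) d0; exact: lr.
Qed.

End Products2.

(** * Germs and neighbourhoods in an affine chart *)

Section Charts.
Variables (k : fieldType) (T : Type) (X : Defs.space k T).
Hypothesis vX : variety X.

Section OneChart.
Variables (U : set T) (n : nat) (phi : T -> 'I_n -> k).
Hypothesis cU : affine_chart X U phi.

Lemma chart_opn : opn X U. Proof. by case: cU. Qed.

Lemma chart_inj x y : U x -> U y -> phi x = phi y -> x = y.
Proof. by case: cU => _ [_ h _ _]; exact: h. Qed.

(** The image of a chart is closed, so a point satisfying all its equations comes from a point of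
    [U]. Points of A are later constructed in this way from specializations of coordinates. *)
Lemma chart_onto v : (forall p : {mpoly k[n]}, (forall y, U y -> p.@[phi y] = 0) ->
   p.@[v] = 0) -> exists2 x, U x & phi x = v.
Proof.
case: cU => _ [[S hS] _ _ _] hv.
have : [set v | forall p, S p -> p.@[v] = 0] v.
  move=> p Sp; apply: hv => y Uy.
  have : (phi @` U) (phi y) by exists y.
  by rewrite hS; exact.
by rewrite -hS => -[x Ux <-]; exists x.
Qed.

Lemma chart_nbh x W : U x -> (nbh X x W <->
  exists p, p.@[phi x] != 0 /\ forall y, U y -> p.@[phi y] != 0 -> W y).
Proof.
move=> Ux; case: cU => oU [_ _ hop _]; split=> [[V [oV Vx VW]]|[p [px hp]]].
  have [h1 _] := hop (V `&` U) (@subIsetr _ _ _).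
  have [S' hS'] := h1 (opn_setI vX oV oU).
  have : (V `&` U) x by [].
  rewrite hS' => -[_ [p Sp px]]; exists p; split=> // y Uy py.
  have : (V `&` U) y by rewrite hS'; split=> //; exists p.
  by case=> /VW.
exists [set y | U y /\ p.@[phi y] != 0]; split=> // [|y [? ?]]; last exact: hp.
apply/hop; first by move=> y [].
exists [set p]; apply/seteqP; split=> y [Uy] /=; first by move=> h; split=> //; exists p.
by move=> [_ -> ?].
Qed.

Lemma chart_rat x f : U x -> (regat X x f <-> exists a d : {mpoly k[n]},
  d.@[phi x] != 0 /\ forall y, U y -> d.@[phi y] != 0 ->
    f y = a.@[phi y] / d.@[phi y]).
Proof.
move=> Ux; have [oU [_ _ hop hreg]] := cU; split=> [[V [oV Vx rV]]|[a [d [dx h]]]].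
  have oW := opn_setI vX oV oU.
  have rW : reg X (V `&` U) f by apply: (reg_restrict vX oV oW _ rV) => y [].
  have [a [d [dx h]]] := (hreg _ f (@subIsetr _ _ _) oW).1 rW x (conj Vx Ux).
  have [p [px hp]] := (chart_nbh (V `&` U) Ux).1 (nbh_open oW (conj Vx Ux)).
  exists (a * p), (d * p); rewrite mevalM mulf_neq0 //; split=> // y Uy.
  rewrite ?mevalM mulf_eq0 => /norP[dy py]; rewrite h //; last exact: hp.
  by rewrite ?mevalM invfM mulrACA divff // mulr1.
have oW : opn X [set y | U y /\ d.@[phi y] != 0].
  apply/hop; first by move=> y [].
  exists [set d]; apply/seteqP; split=> y [Uy] /=; first by move=> e; split=> //; exists d.
  by move=> [_ -> ?].
exists [set y | U y /\ d.@[phi y] != 0]; split=> //.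
apply/hreg => //; first by move=> y [].
move=> y [Uy dy]; exists a, d; split=> // z [Uz dz] _; exact: h.
Qed.

Lemma chart_poly x (p : {mpoly k[n]}) : U x -> regat X x (fun y => p.@[phi y]).
Proof.
move=> Ux; apply/(chart_rat _ Ux); exists p, 1; rewrite meval1 oner_neq0.
by split=> // y _ _; rewrite ?meval1 divr1.
Qed.

Lemma chart_coord x i : U x -> regat X x (fun y => phi y i).
Proof.
move=> Ux; have := chart_poly 'X_i Ux.
by congr (regat X x _); apply/funext => y; rewrite mevalXU.
Qed.

End OneChart.

Lemma chart_at x : exists n (U : set T) (phi : T -> 'I_n -> k), affine_chart X U phi /\ U x.
Proof.
have [m [U [hU cov]]] := variety_charts vX; have [i Ux] := cov x.
by have [n [phi c]] := hU i; exists n, (U i), phi.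
Qed.

Lemma variety_rspace : rspace X.
Proof.
have oP U : (forall x, U x -> nbh X x U) -> opn X U.
  move=> h; have -> : U = [set x | exists2 V, [set V | opn X V /\ V `<=` U] V & V x].
    apply/seteqP; split=> x; last by case=> V [_ VU] /VU.
    by move=> /h[V [? ? ?]]; exists V.
  by apply: (opn_union vX) => V [].
split=> //.
- exact: opn_setT.
- exact: opn_setI.
- move=> U f oU; split=> [rf x Ux|h]; first by exists U.
  apply/(reg_local vX) => // x Ux; have [V [oV Vx rV]] := h x Ux.
  have oW := opn_setI vX oV oU.
  by exists (V `&` U); split=> //; apply: (reg_restrict vX oV oW _ rV) => y [].
- move=> x f g; have [n [U [phi [c Ux]]]] := chart_at x.
  move=> /(chart_nbh c _ Ux)[p [px hp]] /(chart_rat c _ Ux)[a [d [dx h]]].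
  apply/(chart_rat c _ Ux); exists (a * p), (d * p).
  rewrite mevalM mulf_neq0 //; split=> // y Uy.
  rewrite ?mevalM mulf_eq0 => /norP[dy py]; rewrite -(hp y) // h //.
  by rewrite ?mevalM invfM mulrACA divff // mulr1.
- move=> x c; have [n [U [phi [cU Ux]]]] := chart_at x.
  apply/(chart_rat cU _ Ux); exists c%:MP, 1; rewrite meval1 oner_neq0.
  by split=> // y _ _; rewrite ?meval1 mevalC divr1.
- move=> x f g; have [n [U [phi [c Ux]]]] := chart_at x.
  move=> /(chart_rat c _ Ux)[a [d [dx h]]] /(chart_rat c _ Ux)[a' [d' [dx' h']]].
  apply/(chart_rat c _ Ux); exists (a * d' + a' * d), (d * d').
  rewrite mevalM mulf_neq0 //; split=> // y Uy.
  rewrite ?mevalM mulf_eq0 => /norP[dy dy']; rewrite h // h' // addf_div //.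
  by rewrite ?mevalD ?mevalM.
- move=> x f g; have [n [U [phi [c Ux]]]] := chart_at x.
  move=> /(chart_rat c _ Ux)[a [d [dx h]]] /(chart_rat c _ Ux)[a' [d' [dx' h']]].
  apply/(chart_rat c _ Ux); exists (a * a'), (d * d').
  rewrite mevalM mulf_neq0 //; split=> // y Uy.
  by rewrite ?mevalM mulf_eq0 => /norP[dy dy']; rewrite h // h' // mulf_div ?mevalM.
- move=> x f; have [n [U [phi [c Ux]]]] := chart_at x.
  move=> /(chart_rat c _ Ux)[a [d [dx h]]]; rewrite h // => ax.
  apply/(chart_nbh c _ Ux); exists (a * d); rewrite mevalM mulf_neq0 //; last first.
    by apply: contraNneq ax => ->; rewrite mul0r.
  split=> // y Uy; rewrite ?mevalM mulf_eq0 => /norP[ay dy] /=.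
  by rewrite h // mulf_neq0 // invr_eq0.
- move=> x f; have [n [U [phi [c Ux]]]] := chart_at x.
  move=> /(chart_rat c _ Ux)[a [d [dx h]]]; rewrite h // => ax.
  have ax' : a.@[phi x] != 0 by apply: contraNneq ax => ->; rewrite mul0r.
  apply/(chart_rat c _ Ux); exists (d * d), (a * d); rewrite mevalM mulf_neq0 //.
  split=> // y Uy; rewrite ?mevalM mulf_eq0 => /norP[ay dy].
  by rewrite h // ?mevalM invf_div invfM mulrACA divff // mulr1.
Qed.

Lemma irr_nbh x y V W : nbh X x V -> nbh X y W -> exists z, V z /\ W z.
Proof.
move=> [V' [oV Vx VV]] [W' [oW Wy WW]].
have hV : (setT `&` V') !=set0 by exists x.
have hW : (setT `&` W') !=set0 by exists y.
have [z [[_ Vz] Wz]] := proj2 (variety_irreducible vX) V' W' oV oW hV hW.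
by exists z; split; [apply: VV | apply: WW].
Qed.

End Charts.

(** * The affine line and global functions *)

Section Line.
Variable k : closedFieldType.

Definition line : Defs.space k k :=
  {| opn := fun W => exists S : set {mpoly k[1]},
       W = [set x | exists2 p, S p & p.@[fun=> x] != 0];
     reg := fun W f => forall x, W x -> exists a d : {mpoly k[1]},
       d.@[fun=> x] != 0 /\ forall y, W y -> d.@[fun=> y] != 0 ->
         f y = a.@[fun=> y] / d.@[fun=> y] |}.

Definition uni (p : {mpoly k[1]}) : {poly k} := mmap (@polyC k) (fun=> 'X) p.

Lemma uniE p x : (uni p).[x] = p.@[fun=> x].
Proof.
rewrite /uni mevalE /mmap horner_sum; apply: eq_bigr => m _.
by rewrite hornerM hornerC /mmap1 !big_ord1 hornerXn.
Qed.

Lemma uni0 p x : p.@[fun=> x] != 0 -> uni p != 0.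
Proof. by rewrite -uniE; apply: contraNneq => ->; rewrite horner0. Qed.

(** A root of [p * 'X - 1] is not a root of [p]; this plays the part of the infinity of k. *)
Lemma inf_poly (p : {poly k}) : p != 0 -> exists x, p.[x] != 0.
Proof.
move=> p0; pose q := p * 'X - 1.
have sq : size q != 1.
  rewrite /q -(rwP negP) => /eqP sq.
  have sX : size (p * 'X) = (size p).+1 by rewrite size_mulX.
  move: sq; rewrite size_polyDl ?sX ?size_polyN ?size_poly1 ?ltnS ?size_poly_gt0 //.
  by move=> [] /eqP; rewrite size_poly_eq0 (negPf p0).
have /closed_rootP[x] := sq.
rewrite rootE /q hornerD hornerN hornerM hornerX hornerC subr_eq0 => /eqP h.
by exists x; apply/eqP => e; move/eqP: h; rewrite e mul0r eq_sym oner_eq0.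
Qed.

Lemma line_opnI U V : opn line U -> opn line V -> opn line (U `&` V).
Proof.
move=> [S ->] [S' ->]; exists [set r | exists p q, [/\ S p, S' q & r = p * q]].
apply/seteqP; split=> x /=.
  move=> [[p Sp px] [q Sq qx]]; exists (p * q); first by exists p, q.
  by rewrite mevalM mulf_neq0.
move=> [r [p [q [Sp Sq ->]]]]; rewrite mevalM mulf_eq0 => /norP[? ?].
by split; [exists p | exists q].
Qed.

Lemma line_chart : affine_chart line setT (fun x (_ : 'I_1) => x).
Proof.
have oT : opn line setT.
  by exists setT; apply/seteqP; split=> x // _; exists 1; rewrite ?meval1 ?oner_neq0.
split=> //; split.
- exists set0; apply/seteqP; split=> [v _ p []|v _]; exists (v ord0) => //.
  by apply/funext => i; rewrite (ord1 i).
- by move=> x y _ _ /(congr1 (fun f => f ord0)).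
- move=> W _; split=> -[S ->]; exists S; apply/seteqP; split=> x h; first [by split | by case: h].
- by move=> W f _ _; split.
Qed.

Lemma line_variety : variety line.
Proof.
split.
- by case: line_chart.
- exact: line_opnI.
- move=> F hF; exists [set p | exists S : set {mpoly k[1]}, S p /\
    F [set x | exists2 p, S p & p.@[fun=> x] != 0]].
  apply/seteqP; split=> x /=.
    move=> [U FU Ux]; have [S e] := hF _ FU; subst U.
    by case: Ux => p Sp px; exists p => //; exists S.
  move=> [p [S [Sp FS]] px]; exists [set x | exists2 p, S p & p.@[fun=> x] != 0] => //.
  by exists p.
- move=> U V f _ _ VU rf x /VU Ux; have [a [d [dx h]]] := rf x Ux.
  by exists a, d; split=> // y /VU Uy; exact: h.
- move=> U f oU; split=> [rf x Ux|h x Ux]; first by exists U; split.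
  have [V [[S eV] Vx VU rV]] := h x Ux; have [a [d [dx hd]]] := rV x Vx.
  have : V x by [].
  rewrite {1}eV => -[p Sp px]; exists (a * p), (d * p).
  rewrite mevalM mulf_neq0 //; split=> // y Uy; rewrite ?mevalM mulf_eq0 => /norP[dy py].
  rewrite hd // ?mevalM; last by rewrite eV; exists p.
  by rewrite invfM mulrACA divff // mulr1.
- split; first by exists 0.
  move=> U V [S ->] [S' ->] [x [_ [p Sp px]]] [y [_ [q Sq qy]]].
  have [z] := inf_poly (mulf_neq0 (uni0 px) (uni0 qy)).
  rewrite hornerM mulf_eq0 !uniE => /norP[pz qz]; exists z.
  by split; [split=> //; exists p | exists q].
- exists 1%N, (fun=> setT); split=> [_|x]; last by exists ord0.
  by exists 1%N, (fun x (_ : 'I_1) => x); exact: line_chart.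
- move=> w /= hw; exists setT, setT, (fun w => w.1 - w.2).
  have oT : opn line setT by case: line_chart.
  split=> //; last by move=> w' _ _; rewrite subr_eq0 => /eqP.
    exists 2%N, (fun i => if i == ord0 then id else fun=> 1),
      (fun i => if i == ord0 then fun=> 1 else fun y => - y).
    split=> [i|x y _ _]; last by rewrite big_ord_recl big_ord1 /= mulr1 mul1r.
    have r1 (c : {mpoly k[1]}) g : (forall x, g x = c.@[fun=> x]) -> reg line setT g.
      move=> e x _; exists c, 1; rewrite meval1 oner_neq0; split=> // y _ _.
      by rewrite ?meval1 divr1.
    split; case: ifP => _.
    - by apply: (r1 'X_ord0) => x; rewrite mevalXU.
    - by apply: (r1 1) => x; rewrite meval1.
    - by apply: (r1 1) => x; rewrite meval1.
    - by apply: (r1 (- 'X_ord0)) => x; rewrite mevalN mevalXU.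
  by rewrite subr_eq0; apply/eqP => e; apply: hw; rewrite /= e.
Qed.

Lemma line_rspace : rspace line.
Proof. exact: variety_rspace line_variety. Qed.

Lemma line_id x : regat line x id.
Proof.
have := chart_coord line_variety line_chart ord0 (x := x).
by apply.
Qed.

(* A nonconstant [f] would give the closed set [t * f x = 1] in [A x line],
   whose projection to the line is not closed: it omits [0]. *)
Lemma global_const T (X : Defs.space k T) f : variety X -> complete X ->
  (forall x, regat X x f) -> forall x y, f x = f y.
Proof.
move=> vX cX rf x0 y0; have rX := variety_rspace vX.
pose g x := f x - f y0.
have rg x : regat X x g by apply: (ra_sub rX) => //; exact: rs_cst.
suff : ~ exists x, g x != 0.
  by move=> h; apply/eqP; rewrite -subr_eq0; apply/negPn/negP => h'; apply: h; exists x0.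
move=> [x1 gx1].
pose Z : set (T * k) := [set w | w.2 * g w.1 = 1].
have cZ : clsd (prod_space X line) Z.
  apply: (rs_openU (prod_rspace rX line_rspace)) => w hw.
  apply/(prod_nbhP rX line_rspace); exists (fun w => g w.1 * w.2 - 1); split.
  - exact: (lten_add rX line_rspace (w := w)
      (lten_prod (rg w.1) (line_id w.2)) (lten_cst rX line_rspace w (-1))).
  - by rewrite subr_eq0; apply/eqP => e; apply: hw; rewrite /Z /= mulrC.
  - apply: (bxT rX line_rspace) => w' /=; rewrite subr_eq0 => /eqP h e; apply: h.
    by rewrite mulrC.
have [S hS] := cX _ _ line_variety Z cZ.
have im t : (snd @` Z) t <-> exists x, t * g x = 1.
  by split=> [[[x u] /= h <-]|[x h]]; [exists x | exists (x, t)].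
have h0 : (~` (snd @` Z)) 0.
  by move/im => [x]; rewrite mul0r => /eqP; rewrite eq_sym oner_eq0.
rewrite hS in h0; have [p Sp p0] := h0.
have fin x : g x != 0 -> (uni p).[(g x)^-1] = 0.
  move=> gx; rewrite uniE; apply/eqP/negPn/negP => pn.
  have : (~` (snd @` Z)) (g x)^-1 by rewrite hS; exists p.
  by apply; apply/im; exists x; rewrite mulVf.
have [rs e] := closed_field_poly_normal (uni p).
have l0 : lead_coef (uni p) != 0 by rewrite lead_coef_eq0 (uni0 p0).
have rg1 (qs : seq k) x : regat X x (fun x => g x * \prod_(r <- qs) (1 - r * g x)).
  apply: (rs_mul rX) => //; apply: (ra_prod rX) => r _; apply: (ra_sub rX).
    exact: rs_cst.
  by apply: (rs_mul rX) => //; exact: rs_cst.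
(* By [fin], every nonzero value of [g] is the inverse of some r in [rs]. Each factor 1 - r g is 1
   at [y0], where [g] vanishes, so irreducibility gives a point where all factors and [g] itself are
   nonzero. *)
have [x hx] : exists x, g x * \prod_(r <- rs) (1 - r * g x) != 0.
  elim: rs {e} => [|r qs [x hx]]; first by exists x1; rewrite big_nil mulr1.
  have ry : regat X y0 (fun x => 1 - r * g x).
    apply: (ra_sub rX); first exact: rs_cst.
    by apply: (rs_mul rX) => //; exact: rs_cst.
  have y1 : 1 - r * g y0 != 0 by rewrite /g subrr mulr0 subr0 oner_neq0.
  have [z /= [z1 z2]] := irr_nbh vX (rs_nz rX (rg1 qs x) hx) (rs_nz rX ry y1).
  by exists z; rewrite big_cons mulrCA mulf_neq0.
have gx : g x != 0 by apply: contraNneq hx => ->; rewrite mul0r.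
move: hx; rewrite mulf_eq0 (negPf gx) /= => /negP; apply.
have := fin x gx; rewrite e hornerZ => /eqP.
rewrite mulf_eq0 (negPf l0) /= horner_prod => /eqP h.
have -> : \prod_(r <- rs) (1 - r * g x) =
    \prod_(r <- rs) (g x * ('X - r%:P).[(g x)^-1]).
  by apply: eq_bigr => r _; rewrite hornerXsubC [RHS]mulrBr divff // [g x * r]mulrC.
by rewrite big_split /= h mulr0.
Qed.

(** The image of Z is the projection of the graph of f over Z, and the graph is closed because Y is
    separated. *)
Lemma closed_map T T' (X : Defs.space k T) (Y : Defs.space k T') f :
  variety X -> variety Y -> complete X -> mor X Y f ->
  forall Z, clsd X Z -> clsd Y (f @` Z).
Proof.
move=> vX vY cX mf Z cZ; have rX := variety_rspace vX; have rY := variety_rspace vY.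
have -> : f @` Z = snd @` [set w | Z w.1 /\ f w.1 = w.2].
  by apply/seteqP; split=> y [] => [x Zx <-|[x y'] [/= ? <-] <-]; [exists (x, f x) | exists x].
apply: cX => //; have rXY := prod_rspace rX rY; have rYY := prod_rspace rY rY.
apply: (rs_openU rXY) => -[x y] hw; case: (pselect (Z x)) => Zx.
  have fy : f x <> y by move=> e; apply: hw.
  have mp : mor (prod_space X Y) (prod_space Y Y) (fun w => (f w.1, w.2)).
    apply: mor_pair => //; last exact: mor_snd.
    by apply: mor_comp mf; exact: mor_fst.
  have := proj1 (mp (x, y)) _ (nbh_open (x := (f x, y)) (variety_separated vY) fy).
  by apply: nbhS => w /= h [_ e]; exact: h.
have := proj1 (mor_fst rX rY (x, y)) _ (nbh_open cZ Zx).
by apply: nbhS => w /= h [? _]; exact: h.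
Qed.

End Line.

(** * Line bundles as divisors *)

Section Eqv.
Variables (k : fieldType) (T : Type) (X : Defs.space k T).
Hypothesis rX : rspace X.
Implicit Types (x : T) (f g h : T -> k) (D : T -> T -> k).

(* [g] and [h] generate the same fractional ideal near [x]. *)
Definition eqv x g h :=
  [/\ nbh X x [set y | g y != 0], nbh X x [set y | h y != 0] &
      regat X x (fun y => g y / h y)].

Lemma eqv_refl x g : nbh X x [set y | g y != 0] -> eqv x g g.
Proof.
move=> hg; split=> //; apply: (rs_ext rX _ (rs_cst rX x 1)).
by apply: nbhS hg => y /= ?; rewrite divff.
Qed.

Lemma eqv_sym x g h : eqv x g h -> eqv x h g.
Proof.
move=> [hg hh hr]; split=> //.
have n0 : g x / h x != 0.
  by rewrite mulf_neq0 ?invr_eq0 ?(nbh_pt hg) ?(nbh_pt hh).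
by apply: (ra_ext rX _ (rs_inv rX hr n0)) => y; rewrite invf_div.
Qed.

Lemma eqv_trans x f g h : eqv x f g -> eqv x g h -> eqv x f h.
Proof.
move=> [hf hg r] [_ hh r']; split=> //; apply: (rs_ext rX _ (rs_mul rX r r')).
by apply: nbhS hg => y /= g0; rewrite mulrA divfK.
Qed.

Lemma eqv_mul x f g f' g' : eqv x f g -> eqv x f' g' ->
  eqv x (fun y => f y * f' y) (fun y => g y * g' y).
Proof.
move=> [hf hg r] [hf' hg' r']; split.
- by apply: nbhS (nbhI rX hf hf') => y [/= ? ?]; rewrite mulf_neq0.
- by apply: nbhS (nbhI rX hg hg') => y [/= ? ?]; rewrite mulf_neq0.
by apply: (ra_ext rX _ (rs_mul rX r r')) => y; rewrite mulf_div.
Qed.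

Lemma eqv_inv x f g : eqv x f g -> eqv x (fun y => (f y)^-1) (fun y => (g y)^-1).
Proof.
move=> /eqv_sym[hg hf r]; split.
- by apply: nbhS hf => y /=; rewrite invr_eq0.
- by apply: nbhS hg => y /=; rewrite invr_eq0.
by apply: (ra_ext rX _ r) => y; rewrite invrK mulrC.
Qed.

Lemma eqv_exp x f g m : eqv x f g -> eqv x (fun y => f y ^+ m) (fun y => g y ^+ m).
Proof.
move=> [hf hg r]; split.
- by apply: nbhS hf => y /= ?; rewrite expf_neq0.
- by apply: nbhS hg => y /= ?; rewrite expf_neq0.
by apply: (ra_ext rX _ (ra_exp rX m r)) => y; rewrite expr_div_n.
Qed.

Lemma eqv_ext x f g f' g' : nbh X x [set y | f y = f' y] ->
  nbh X x [set y | g y = g' y] -> eqv x f g -> eqv x f' g'.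
Proof.
move=> ef eg [hf hg r]; split.
- by apply: nbhS (nbhI rX ef hf) => y [/= ->].
- by apply: nbhS (nbhI rX eg hg) => y [/= ->].
by apply: (rs_ext rX _ r); apply: nbhS (nbhI rX ef eg) => y [/= -> ->].
Qed.

Lemma eqv_same x f g f' g' : (forall y, f y = f' y) -> (forall y, g y = g' y) ->
  eqv x f g -> eqv x f' g'.
Proof. by move=> /funext -> /funext ->. Qed.

Lemma eqv1 x f : eqv x f (fun=> 1) <-> regat X x f /\ f x != 0.
Proof.
split=> [[hf _ r]|[r f0]].
  split; last exact: nbh_pt hf.
  by apply: (ra_ext rX _ r) => y; rewrite divr1.
split; first exact: rs_nz.
  by apply: nbhS (nbhT rX x) => y _; rewrite /= oner_neq0.
by apply: (ra_ext rX _ r) => y; rewrite divr1.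
Qed.

Lemma eqv_cancel x u f g : nbh X x [set y | u y != 0] ->
  eqv x (fun y => u y * f y) (fun y => u y * g y) -> eqv x f g.
Proof.
move=> hu h; have hi := eqv_refl hu.
have := eqv_mul (eqv_inv hi) h.
have hh v : nbh X x [set y | (u y)^-1 * (u y * v y) = v y].
  by apply: nbhS hu => y /= ?; rewrite mulKf.
by apply: eqv_ext.
Qed.

(** A divisor is a choice, at each point x, of a local equation [D x]. A local equation is any
    function without zeros near x, regular or not: only ratios of local equations have to be
    regular. *)
Definition dok D := forall x, nbh X x [set y | eqv y (D x) (D y)].

Definition diso D D' f := forall x, eqv x (fun y => f y * D x y) (D' x).

Definition dtriv D f := diso D (fun _ _ => 1) f.

Lemma dok_nz D x : dok D -> nbh X x [set y | D x y != 0].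
Proof. by move=> hD; have : eqv x (D x) (D x) := nbh_pt (hD x); case. Qed.

Lemma diso_nz D D' f x : diso D D' f -> f x != 0.
Proof. move=> /(_ x)[h _ _]; move: (nbh_pt h) => /=; by rewrite mulf_eq0 => /norP[]. Qed.

Lemma diso_refl D : dok D -> diso D D (fun=> 1).
Proof.
move=> hD x; apply: (@eqv_same x (D x) (D x)) => //; first by move=> y; rewrite mul1r.
exact/eqv_refl/dok_nz.
Qed.

Lemma diso_trans D D' D'' f g : diso D D' f -> diso D' D'' g ->
  diso D D'' (fun y => f y * g y).
Proof.
move=> h h' x; have g0 : nbh X x [set y | g y != 0].
  by apply: nbhS (nbhT rX x) => y _; exact: diso_nz h'.
have e : eqv x (fun y => g y * (f y * D x y)) (D'' x).
  exact: eqv_trans (eqv_mul (eqv_refl g0) (h x)) (h' x).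
apply: eqv_same e => // y.
by rewrite mulrCA mulrA.
Qed.

Lemma diso_sym D D' f : diso D D' f -> diso D' D (fun y => (f y)^-1).
Proof.
move=> h x; have g0 : nbh X x [set y | f y != 0].
  by apply: nbhS (nbhT rX x) => y _; exact: diso_nz h.
apply: (eqv_cancel g0); apply: eqv_ext (eqv_sym (h x)).
  by apply: nbhS g0 => y /= f0; rewrite mulVKf.
by apply: nbhS (nbhT rX x) => y.
Qed.

Lemma diso_mul D D' E E' f g : diso D D' f -> diso E E' g ->
  diso (fun x y => D x y * E x y) (fun x y => D' x y * E' x y) (fun y => f y * g y).
Proof.
move=> h h' x; apply: eqv_same (eqv_mul (h x) (h' x)) => // y.
by rewrite mulrACA.
Qed.

Lemma dtriv_div D D' f : dok D' ->
  dtriv (fun x y => D x y / D' x y) f <-> diso D D' f.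
Proof.
move=> hD; split=> h x; have nz := dok_nz x hD.
  have := eqv_mul (h x) (eqv_refl nz); apply: eqv_ext.
    by apply: nbhS nz => y /= ?; rewrite mulrA divfK.
  by apply: nbhS nz => y /= _; rewrite mul1r.
have := eqv_mul (h x) (eqv_inv (eqv_refl nz)); apply: eqv_ext.
  by apply: nbhS nz => y /= ?; rewrite mulrA.
by apply: nbhS nz => y /= ?; rewrite divff.
Qed.

Lemma dok_mul D D' : dok D -> dok D' -> dok (fun x y => D x y * D' x y).
Proof.
move=> h h' x; apply: nbhS (nbhI rX (h x) (h' x)) => y [/= e e'].
exact: eqv_mul.
Qed.

(* The divisor of a line bundle: [e i] is a set-theoretic trivialization on the
   [i]th chart. *)
Definition isdv (L : cocycle k T) D := exists e i0,
  [/\ forall x, Defs.dom L (i0 x) x, forall i y, Defs.dom L i y -> e i y != 0,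
      forall i j y, Defs.dom L i y -> Defs.dom L j y -> tr L i j y = e i y / e j y &
      forall x, D x = e (i0 x)].

Lemma isdv_ex L : line_bundle X L -> exists D, isdv L D.
Proof.
case=> _ cov _ tii tij; have [i0 hi0] := choice cov.
have tn i j x : Defs.dom L i x -> Defs.dom L j x -> tr L i j x != 0.
  move=> di dj; apply/eqP => e; have := tij i j i x di dj di.
  by rewrite e mul0r tii // => /eqP; rewrite eq_sym oner_eq0.
(* The fibre at y is trivialized through the chart [i0 y] chosen at y, without any regularity in y.
   Ratios of two such equations are transition functions, hence regular. *)
exists (fun x y => tr L (i0 x) (i0 y) y), (fun i y => tr L i (i0 y) y), i0; split=> //.
  by move=> i y hi; exact: tn.
move=> i j y hi hj; rewrite -(tij i j (i0 y) y) // mulfK //; exact: tn.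
Qed.

Lemma isdv_dok L D : line_bundle X L -> isdv L D -> dok D.
Proof.
move=> [od _ rt _ _] [e [i0 [hi0 en te eD]]] x.
apply: nbhS (nbh_open (od _) (hi0 x)) => y /= dy; rewrite !eD.
have hd i z : Defs.dom L i z -> nbh X z (Defs.dom L i) by exact: nbh_open.
split.
- by apply: nbhS (hd _ _ dy) => z; exact: en.
- by apply: nbhS (hd _ _ (hi0 y)) => z; exact: en.
have oI := rs_openI rX (od (i0 x)) (od (i0 y)).
apply: (rs_ext rX (f := tr L (i0 x) (i0 y))); last by exists (Defs.dom L (i0 x) `&` Defs.dom L (i0 y)).
by apply: nbhS (nbh_open oI (conj dy (hi0 y))) => z [? ?] /=; rewrite te.
Qed.

Lemma lb_trivP L D : line_bundle X L -> isdv L D ->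
  lb_trivial X L <-> exists f, dtriv D f.
Proof.
move=> hL [e [i0 [hi0 en te eD]]]; have [od _ rt _ _] := hL.
split=> [[s [[rs hs] sn]]|[f hf]].
  exists (fun y => s (i0 y) y / e (i0 y) y) => x; rewrite eD.
  have hx := nbh_open (od _) (hi0 x).
  apply: (eqv_ext (f := s (i0 x)) (g := fun=> 1)).
  - apply: nbhS hx => y /= dy; rewrite (hs _ (i0 y)) // te //.
    by ring.
  - by apply: nbhS hx.
  by apply/eqv1; split; [exists (Defs.dom L (i0 x)) | exact: sn].
exists (fun i y => f y * e i y); split; last first.
  by move=> i x di; rewrite mulf_neq0 ?en //; exact: diso_nz hf.
split=> [i|i j x di dj]; last first.
  by rewrite te // mulrCA divfK ?en.
apply: (reg_rat rX) => // x di.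
have [r _] := (eqv1 _ _).1 (hf x).
have rt' : regat X x (tr L i (i0 x)).
  by exists (Defs.dom L i `&` Defs.dom L (i0 x)); split=> //; exact: rs_openI.
apply: (rs_ext rX _ (rs_mul rX r rt')).
apply: nbhS (nbhI rX (nbh_open (od _) (hi0 x)) (nbh_open (od _) di)) => y [/= h1 h2].
by rewrite eD te // -mulrA [e (i0 x) y * _]mulrC divfK ?en.
Qed.

Lemma isdv_mul L M D E : isdv L D -> isdv M E ->
  isdv (lb_mul L M) (fun x y => D x y * E x y).
Proof.
move=> [e [i0 [hi0 en te eD]]] [e' [i0' [hi0' en' te' eD']]].
exists (fun i y => e i.1 y * e' i.2 y), (fun x => (i0 x, i0' x)); split=> //=.
- by move=> [i j] y [/= ? ?]; rewrite mulf_neq0 ?en ?en'.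
- by move=> [i j] [i' j'] y [/= ? ?] [? ?]; rewrite te // te' // mulf_div.
by move=> x; rewrite eD eD'.
Qed.

Lemma isdv_inv L D : isdv L D -> isdv (lb_inv L) (fun x y => (D x y)^-1).
Proof.
move=> [e [i0 [hi0 en te eD]]].
exists (fun i y => (e i y)^-1), i0; split=> //=.
- by move=> i y di; rewrite invr_eq0 en.
- by move=> i j y di dj; rewrite te // invfM.
by move=> x; rewrite eD.
Qed.

Lemma isdv_exp L D m : isdv L D -> isdv (lb_exp L m) (fun x y => D x y ^+ m).
Proof.
move=> [e [i0 [hi0 en te eD]]].
exists (fun i y => e i y ^+ m), i0; split=> //=.
- by move=> i y di; rewrite expf_neq0 ?en.
- by move=> i j y di dj; rewrite te // expr_div_n.
by move=> x; rewrite eD.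
Qed.

Lemma lb_mul_line L M : line_bundle X L -> line_bundle X M ->
  line_bundle X (lb_mul L M).
Proof.
move=> [od cov rt tii tij] [od' cov' rt' tii' tij']; split=> /=.
- by move=> i; exact: rs_openI.
- by move=> x; have [i ?] := cov x; have [j ?] := cov' x; exists (i, j).
- move=> i j; apply: (reg_rat rX); first by apply: (rs_openI rX); apply: (rs_openI rX).
  move=> x [[? ?] [? ?]]; apply: (rs_mul rX).
    by exists (Defs.dom L i.1 `&` Defs.dom L j.1); split=> //; exact: rs_openI.
  by exists (Defs.dom M i.2 `&` Defs.dom M j.2); split=> //; exact: rs_openI.
- by move=> i x [? ?]; rewrite tii // tii' // mulr1.
by move=> i j l x [? ?] [? ?] [? ?]; rewrite mulrACA tij // tij'.
Qed.

Lemma lb_inv_line L : line_bundle X L -> line_bundle X (lb_inv L).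
Proof.
move=> hL; have [D [e [i0 [_ en te _]]]] := isdv_ex hL.
have [od cov rt tii tij] := hL; split=> //=.
- move=> i j; apply: (reg_rat rX); first exact: rs_openI.
  move=> x [di dj]; apply: (rs_inv rX).
    by exists (Defs.dom L i `&` Defs.dom L j); split=> //; exact: rs_openI.
  by rewrite te // mulf_neq0 ?invr_eq0 ?en.
- by move=> i x di; rewrite tii // invr1.
by move=> i j l x di dj dl; rewrite -invfM tij.
Qed.

Lemma lb_isoP L M D E : line_bundle X L -> line_bundle X M -> isdv L D -> isdv M E ->
  lb_iso X L M <-> exists f, diso D E f.
Proof.
move=> hL hM hD hE; have hE' := isdv_dok hM hE.
have := lb_trivP (lb_mul_line hL (lb_inv_line hM)) (isdv_mul hD (isdv_inv hE)).
rewrite /lb_iso => h; split=> [/h[f /(dtriv_div _ _ hE') hf]|[f hf]]; first by exists f.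
by apply/h; exists f; exact/dtriv_div.
Qed.

End Eqv.

Lemma isdv_pull k S T (phi : S -> T) (L : cocycle k T) D : isdv L D ->
  isdv (pullback phi L) (fun x y => D (phi x) (phi y)).
Proof.
move=> [e [i0 [hi0 en te eD]]].
exists (fun i y => e i (phi y)), (fun x => i0 (phi x)); split=> //=.
- by move=> i y; exact: en.
- by move=> i j y; exact: te.
by move=> x; rewrite eD.
Qed.

Section Pull.
Variables (k : fieldType) (S T : Type) (Y : Defs.space k S) (X : Defs.space k T).
Hypotheses (rY : rspace Y) (rX : rspace X).
Variable phi : S -> T.
Hypothesis mphi : mor Y X phi.

Lemma eqv_pull x g h : eqv X (phi x) g h -> eqv Y x (g \o phi) (h \o phi).
Proof.
move=> [hg hh r]; split.
- exact: (proj1 (mphi x) _ hg).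
- exact: (proj1 (mphi x) _ hh).
exact: (proj2 (mphi x) _ r).
Qed.

Lemma dok_pull D : dok X D -> dok Y (fun x y => D (phi x) (phi y)).
Proof.
move=> hD x; apply: nbhS (proj1 (mphi x) _ (hD (phi x))) => y /= e.
exact: (eqv_pull e).
Qed.

Lemma diso_pull D D' f : diso X D D' f ->
  diso Y (fun x y => D (phi x) (phi y)) (fun x y => D' (phi x) (phi y)) (f \o phi).
Proof. by move=> h x; exact: (eqv_pull (h (phi x))). Qed.

Lemma pull_line L : line_bundle X L -> line_bundle Y (pullback phi L).
Proof.
move=> [od cov rt tii tij].
have oY i : opn Y (phi @^-1` Defs.dom L i).
  apply: (rs_openU rY) => x dx; exact: (proj1 (mphi x) _ (nbh_open (od i) dx)).
split=> //=.
- move=> i j; apply: (reg_rat rY) => [|x [di dj]]; first exact: rs_openI.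
  have r : regat X (phi x) (tr L i j).
    by exists (Defs.dom L i `&` Defs.dom L j); split=> //; exact: rs_openI.
  exact: (proj2 (mphi x) _ r).
- by move=> i x; exact: tii.
by move=> i j l x; exact: tij.
Qed.
End Pull.

(** * Abelian varieties and their duals *)

Section AbVar.
Variable k : closedFieldType.

Lemma ab_rs (A : abvar k) : rspace (ab_sp A).
Proof. exact: variety_rspace (ab_variety A). Qed.
#[local] Hint Resolve ab_rs : core.

Lemma ab_prs (A B : abvar k) : rspace (prod_space (ab_sp A) (ab_sp B)).
Proof. exact: prod_rspace. Qed.
#[local] Hint Resolve ab_prs : core.

Definition hom (A B : abvar k) (f : A -> B) :=
  (forall x y, f (x + y) = f x + f y) /\ mor (ab_sp A) (ab_sp B) f.

Lemma homP (A B : abvar k) (f : A -> B) : is_hom f <-> hom f.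
Proof. by split=> -[fD mf]; split=> //; apply/morP. Qed.

Section Mor.
Variables (T : Type) (X : Defs.space k T) (A : abvar k).
Hypothesis rX : rspace X.
Implicit Types f g : T -> A.

Lemma mor_add f g : mor X (ab_sp A) f -> mor X (ab_sp A) g ->
  mor X (ab_sp A) (fun x => f x + g x).
Proof.
move=> mf mg; have mA : mor (prod_space (ab_sp A) (ab_sp A)) (ab_sp A) (fun w => w.1 + w.2).
  by apply/(morP _ (ab_prs A A) (ab_rs A)); exact: ab_add.
exact: (mor_comp (mor_pair (ab_rs A) (ab_rs A) rX mf mg) mA).
Qed.

Lemma mor_opp f : mor X (ab_sp A) f -> mor X (ab_sp A) (fun x => - f x).
Proof.
move=> mf; have mA : mor (ab_sp A) (ab_sp A) (fun x => - x).
  by apply/(morP _ (ab_rs A) (ab_rs A)); exact: ab_opp.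
exact: (mor_comp mf mA).
Qed.

Lemma mor_muln f m : mor X (ab_sp A) f -> mor X (ab_sp A) (fun x => f x *+ m).
Proof.
move=> mf; elim: m => [|m IH].
  by apply: mor_ext (mor_cst (ab_sp A) 0 rX) => x; rewrite mulr0n.
by apply: mor_ext (mor_add mf IH) => x; rewrite mulrS.
Qed.

End Mor.

Lemma mor_trans (A : abvar k) (a : A) : mor (ab_sp A) (ab_sp A) (fun x => x + a).
Proof. by apply: mor_add => //; exact: mor_cst. Qed.

Section Homs.
Variables A B C : abvar k.
Implicit Types f g : A -> B.

Lemma hom0 f : hom f -> f 0 = 0.
Proof. by case=> fD _; apply: (addrI (f 0)); rewrite -fD !addr0. Qed.

Lemma homN f x : hom f -> f (- x) = - f x.
Proof. by move=> hf; apply/eqP; rewrite -addr_eq0 -(proj1 hf) addNr hom0. Qed.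

Lemma homB f x y : hom f -> f (x - y) = f x - f y.
Proof. by move=> hf; rewrite (proj1 hf) homN. Qed.

Lemma homMn f x m : hom f -> f (x *+ m) = f x *+ m.
Proof. by move=> hf; elim: m => [|m IH]; rewrite ?mulr0n ?hom0 // !mulrS (proj1 hf) IH. Qed.

Lemma homMz f x m : hom f -> f (x *~ m) = f x *~ m.
Proof.
move=> hf; case: m => m; first by rewrite -!pmulrn homMn.
by rewrite NegzE !mulrNz -!pmulrn homN ?homMn.
Qed.

Lemma hom_add f g : hom f -> hom g -> hom (fun x => f x + g x).
Proof.
by move=> [fD mf] [gD mg]; split; [move=> x y; rewrite fD gD addrACA | exact: mor_add].
Qed.

Lemma hom_opp f : hom f -> hom (fun x => - f x).
Proof.
by move=> [fD mf]; split; [move=> x y; rewrite fD opprD | exact: mor_opp].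
Qed.

Lemma hom_muln f m : hom f -> hom (fun x => f x *+ m).
Proof.
by move=> [fD mf]; split; [move=> x y; rewrite fD mulrnDl | exact: mor_muln].
Qed.

Lemma hom_comp (g : B -> C) f : hom f -> hom g -> hom (g \o f).
Proof.
by move=> [fD mf] [gD mg]; split; [move=> x y; rewrite /= fD gD | exact: mor_comp mf mg].
Qed.

End Homs.

Lemma hom_id (A : abvar k) : hom (fun x : A => x).
Proof. by split; last exact: mor_id. Qed.

Lemma hom_muln_id (A : abvar k) m : hom (fun x : A => x *+ m).
Proof. exact: (hom_muln m (hom_id A)). Qed.

Lemma hom_closed (A B : abvar k) (f : A -> B) : hom f ->
  forall Z, clsd (ab_sp A) Z -> clsd (ab_sp B) (f @` Z).
Proof.
by case=> _ mf; apply: closed_map => //; [exact: ab_variety | exact: ab_variety | exact: ab_complete].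
Qed.

(** The ratio of two trivializations is regular everywhere, hence constant since A is complete. *)
Lemma unit_const (A : abvar k) (D D' : A -> A -> k) f g :
  diso (ab_sp A) D D' f -> diso (ab_sp A) D D' g ->
  exists c, forall x, f x = c * g x.
Proof.
move=> hf hg; have hx x : f x / g x = f 0 / g 0.
  apply: (@global_const _ _ _ (fun y => f y / g y) (ab_variety A) (@ab_complete _ A)) => y.
  have := eqv_mul (ab_rs A) (hf y) (eqv_inv (ab_rs A) (hg y)).
  have [_ n _] := hg y.
  have [n' _ _] := hg y.
  move=> h; have : eqv (ab_sp A) y (fun y => f y / g y) (fun=> 1).
    apply: (eqv_ext (ab_rs A) _ _ h); last by apply: nbhS n => z /= ?; rewrite divff.
    apply: nbhS n' => z /=; rewrite mulf_eq0 => /norP[gz Dz].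
    by rewrite invfM mulrACA divff ?mulr1.
  by case/(eqv1 (ab_rs A)).
exists (f 0 / g 0) => x; rewrite -(hx x) divfK //; exact: diso_nz hg.
Qed.

Lemma diso_unit (A : abvar k) (D : A -> A -> k) f : dok (ab_sp A) D ->
  diso (ab_sp A) D D f -> forall x, f x = f 0.
Proof.
move=> hD hf; have [c hc] := unit_const hf (diso_refl (ab_rs A) hD).
by move=> x; rewrite !hc.
Qed.

Section Dual.
Variables (A B : abvar k) (Pc : cocycle k (A * B)) (lam : A -> B).
Hypotheses (hB : is_dual Pc) (hlam : principal_polarization Pc lam).

Local Notation XA := (ab_sp A).
Local Notation XX := (prod_space (ab_sp A) (ab_sp A)).
Local Notation XB := (prod_space (ab_sp A) (ab_sp B)).

Lemma Pc_line : line_bundle XB Pc.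
Proof. by case: hB => -[]. Qed.

Lemma fib_line b : line_bundle XA (fibre Pc b).
Proof. by case: hB => -[_ /(_ b)[]]. Qed.

Lemma DP_ex : exists D, isdv Pc D.
Proof. exact: (isdv_ex Pc_line). Qed.

Definition DP := sval (cid DP_ex).
Lemma DP_dv : isdv Pc DP. Proof. exact: svalP (cid DP_ex). Qed.

Definition Db (b : B) (x y : A) : k := DP (x, b) (y, b).

Lemma Db_dv b : isdv (fibre Pc b) (Db b).
Proof. exact: (isdv_pull (fun x : A => (x, b)) DP_dv). Qed.

Lemma Db_ok b : dok XA (Db b).
Proof. exact: (isdv_dok (ab_rs A) (fib_line b) (Db_dv b)). Qed.

Lemma DP_ok : dok XB DP.
Proof. exact: (isdv_dok (ab_prs A B) Pc_line DP_dv). Qed.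

Lemma DPn w : DP w w != 0.
Proof. exact: (nbh_pt (dok_nz w DP_ok)). Qed.

(** Linear equivalence of divisors; no order is meant. *)
Definition leq_div T (X : Defs.space k T) (D E : T -> T -> k) := exists f, diso X D E f.
Local Notation "D ~~ E" := (leq_div XA D E) (at level 70).

Lemma leq_trans_div T (X : Defs.space k T) D E G : rspace X ->
  leq_div X D E -> leq_div X E G -> leq_div X D G.
Proof. by move=> rX [f hf] [g hg]; exists (fun y => f y * g y); exact: diso_trans hf hg. Qed.

Lemma leq_sym T (X : Defs.space k T) D E : rspace X -> leq_div X D E -> leq_div X E D.
Proof. by move=> rX [f hf]; exists (fun y => (f y)^-1); exact: diso_sym. Qed.

Lemma leq_mul T (X : Defs.space k T) D E D' E' : rspace X ->
  leq_div X D E -> leq_div X D' E' ->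
  leq_div X (fun x y => D x y * D' x y) (fun x y => E x y * E' x y).
Proof. by move=> rX [f hf] [g hg]; exists (fun y => f y * g y); exact: diso_mul. Qed.

Lemma leq_eq T (X : Defs.space k T) D D' E E' : (forall x y, D x y = D' x y) ->
  (forall x y, E x y = E' x y) -> leq_div X D E -> leq_div X D' E'.
Proof.
move=> h h'; have -> : D = D' by apply/funext => x; apply/funext => y.
by have -> : E = E' by apply/funext => x; apply/funext => y.
Qed.

Lemma leq_c T (X : Defs.space k T) (c : k) : rspace X -> c != 0 ->
  leq_div X (fun _ _ => c) (fun _ _ => 1).
Proof.
move=> rX c0; exists (fun=> c^-1) => x; apply/(eqv1 rX); rewrite mulVf //.
by split; [exact: rs_cst | exact: oner_neq0].
Qed.

(** The constant maps with values b and b' both classify the same constant family over A, so the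
    uniqueness of classifying maps identifies them. *)
Lemma dual_inj b b' : Db b ~~ Db b' -> b = b'.
Proof.
move=> [f hf]; pose M := pullback (fun w : A * A => (w.1, b)) Pc.
have mp (c : B) : mor XX XB (fun w : A * A => (w.1, c)).
  by apply: mor_pair => //; [exact: mor_fst | exact: mor_cst].
have lM : line_bundle XX M by exact: (pull_line (ab_prs A A) (ab_prs A B) (mp b) Pc_line).
have famM : Pic0_family XA M.
  split=> //; first by move=> t; have [[_ h _] _] := hB; exact: h.
  have m0 : mor XA XB (fun _ : A => (0 : A, b)) by exact: mor_cst.
  apply/(lb_trivP (ab_rs A) (pull_line (ab_rs A) (ab_prs A B) m0 Pc_line)
     (isdv_pull _ DP_dv)).
  by have [g hg] := leq_c (ab_rs A) (DPn (0, b)); exists g.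
have [h [_ hu]] := (proj2 hB) A XA M (ab_variety A) famM.
have hc (c : B) g : diso XA (Db c) (Db b) g -> (fun=> c) = h.
  move=> hg; apply/esym/funext => t; have -> // : h = fun=> c.
  apply: hu; split; first by apply/(morP _ (ab_rs A) (ab_rs B)); exact: mor_cst.
  apply/(lb_isoP (ab_prs A A) (pull_line (ab_prs A A) (ab_prs A B) (mp c) Pc_line)
     lM (isdv_pull _ DP_dv) (isdv_pull _ DP_dv)).
  exists (g \o fst).
  exact: (diso_pull (mor_fst (ab_rs A) (ab_rs A)) hg).
have e1 := hc b _ (diso_refl (ab_rs A) (Db_ok b)).
have e2 := hc b' _ (diso_sym (ab_rs A) hf).
by have := congr1 (fun u : A -> B => u 0) (etrans e1 (esym e2)).
Qed.

Lemma Db_trans b a : (fun x y => Db b (x + a) (y + a)) ~~ Db b.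
Proof.
have [[_ /(_ b)[_ /(_ a) h] _] _] := hB.
have lt := pull_line (ab_rs A) (ab_rs A) (mor_trans a) (fib_line b).
exact: (lb_isoP (ab_rs A) lt (fib_line b) (isdv_pull (translate a) (Db_dv b)) (Db_dv b)).1 h.
Qed.

Lemma lam_hom : hom lam.
Proof. by case: hlam => /homP. Qed.

Lemma lam_inv : exists mu : B -> A, [/\ mor (ab_sp B) XA mu, cancel lam mu & cancel mu lam].
Proof. by case: hlam => _ [_ [g [mg ? ?]]] _; exists g; split=> //; apply/(morP _ (ab_rs B) (ab_rs A)). Qed.

Lemma lam_inj : injective lam.
Proof. by have [mu [_ h _]] := lam_inv; exact: can_inj h. Qed.

Lemma lam_surj b : exists a, lam a = b.
Proof. by have [mu [_ _ h]] := lam_inv; exists (mu b). Qed.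

Lemma theta_ex : exists DL : A -> A -> k, dok XA DL /\
  forall a, Db (lam a) ~~ (fun x y => DL (x + a) (y + a) / DL x y).
Proof.
case: hlam => _ _ [L [lL _ hL]]; have [DL hDL] := isdv_ex lL; exists DL.
split=> [|a]; first exact: isdv_dok lL hDL.
have lt := lb_mul_line (ab_rs A) (pull_line (ab_rs A) (ab_rs A) (mor_trans a) lL)
  (lb_inv_line (ab_rs A) lL).
exact: (lb_isoP (ab_rs A) (fib_line _) lt (Db_dv _)
  (isdv_mul (isdv_pull (translate a) hDL) (isdv_inv hDL))).1 (hL a).
Qed.

Lemma leq_pull S T (Y : Defs.space k S) (X : Defs.space k T) phi D E :
  mor Y X phi -> leq_div X D E ->
  leq_div Y (fun x y => D (phi x) (phi y)) (fun x y => E (phi x) (phi y)).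
Proof. by move=> mphi [f hf]; exists (f \o phi); exact: diso_pull hf. Qed.

Lemma leq_refl T (X : Defs.space k T) D : rspace X -> dok X D -> leq_div X D D.
Proof. by move=> rX hD; exists (fun=> 1); exact: diso_refl. Qed.

Lemma leq_near T (X : Defs.space k T) D D' E : rspace X ->
  (forall x, nbh X x [set y | D x y = D' x y]) -> leq_div X D E -> leq_div X D' E.
Proof.
move=> rX h [f hf]; exists f => x; apply: (eqv_ext rX _ _ (hf x)).
  by apply: nbhS (h x) => y /= ->.
by apply: nbhS (nbhT rX x) => y.
Qed.

(** Writing t_a for translation, the class of t_(a+b) L - L is that of t_b (t_a L - L) plus that of
    t_b L - L, and the first is invariant under t_b because it lies in Pic^0. *)
Lemma Db_add a b : Db (lam (a + b)) ~~ (fun x y => Db (lam a) x y * Db (lam b) x y).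
Proof.
have [DL [okL hL]] := theta_ex.
have okt (c : A) : dok XA (fun x y => DL (x + c) (y + c)).
  exact: (dok_pull (mor_trans c) okL).
apply: (leq_trans_div (ab_rs A)) (hL (a + b)) _.
have h1 := leq_pull (mor_trans b) (hL a).
have h2 := leq_mul (ab_rs A) (leq_trans_div (ab_rs A)
   (leq_sym (ab_rs A) h1) (Db_trans (lam a) b)) (leq_sym (ab_rs A) (hL b)).
apply: (leq_near (ab_rs A) _ h2) => x.
apply: nbhS (dok_nz x (okt b)) => y /= n0.
by rewrite mulrA divfK // -!addrA ![b + a]addrC.
Qed.

Lemma Db0 : Db 0 ~~ (fun _ _ => 1).
Proof.
have [DL [okL hL]] := theta_ex; have := hL 0; rewrite (hom0 lam_hom).
move/(leq_sym (ab_rs A)) => h; apply: leq_sym => //.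
apply: (leq_near (ab_rs A) _ h) => x; apply: nbhS (dok_nz x okL) => y /= n0.
by rewrite !addr0 divff.
Qed.

Lemma Db_muln b m : Db (b *+ m) ~~ (fun x y => Db b x y ^+ m).
Proof.
elim: m => [|m IH].
  by apply: leq_eq Db0 => // x y; rewrite ?mulr0n.
have [a ea] := lam_surj b; have [c ec] := lam_surj (b *+ m).
have e : b *+ m.+1 = lam (a + c) by rewrite (proj1 lam_hom) ea ec mulrS.
rewrite e; apply: (leq_trans_div (ab_rs A)) (Db_add a c) _; rewrite ea ec.
have h := leq_mul (ab_rs A) (leq_refl (ab_rs A) (Db_ok b)) IH.
by apply: leq_eq h => // x y; rewrite exprS.
Qed.

End Dual.
End AbVar.

#[local] Hint Resolve ab_rs ab_prs : core.
Section Dual2.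
Variable k : closedFieldType.
Variables (A B : abvar k) (Pc : cocycle k (A * B)) (lam : A -> B).
Hypotheses (hB : is_dual Pc) (hlam : principal_polarization Pc lam).

Local Notation XA := (ab_sp A).
Local Notation XX := (prod_space (ab_sp A) (ab_sp A)).
Local Notation XB := (prod_space (ab_sp A) (ab_sp B)).
Local Notation rA := (ab_rs A).
Local Notation rAA := (ab_prs A A).
Local Notation rAB := (ab_prs A B).
Local Notation Db := (Db hB).
Local Notation "D ~~ E" := (leq_div XA D E) (at level 70).
Local Notation one := (fun _ _ => 1).

Lemma leq_one_div T (X : Defs.space k T) D E : rspace X -> dok X E ->
  leq_div X (fun x y => D x y / E x y) one <-> leq_div X D E.
Proof. by move=> rX oE; split=> -[f hf]; exists f; apply/(dtriv_div rX _ _ oE). Qed.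

Lemma fib_add_line b : line_bundle XX
  (lb_mul (lb_mul (pullback (fun w : A * A => w.1 + w.2) (fibre Pc b))
    (lb_inv (pullback fst (fibre Pc b)))) (lb_inv (pullback snd (fibre Pc b)))).
Proof.
have m1 := mor_fst rA rA; have m2 := mor_snd rA rA.
have lb := fib_line hB b; have pl := pull_line rAA rA.
apply: (lb_mul_line rAA); last exact: (lb_inv_line rAA (pl _ m2 _ lb)).
apply: (lb_mul_line rAA); last exact: (lb_inv_line rAA (pl _ m1 _ lb)).
exact: (pl _ (mor_add rAA m1 m2) _ lb).
Qed.

Lemma Pic0_triv L D : line_bundle XA L -> isdv L D -> D ~~ one -> Pic0 A L.
Proof.
move=> lL hD hD1; split=> // a.
have lt := pull_line rA rA (mor_trans a) lL.
apply/(lb_isoP rA lt lL (isdv_pull (translate a) hD) hD).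
apply: (leq_trans_div rA) (leq_sym rA hD1).
exact: (leq_pull (mor_trans a) hD1).
Qed.

(* The theorem of the square: [b] is "additive" in the base point. *)
Lemma Db_seesaw b : exists f, diso XX (fun w w' => Db b (w.1 + w.2) (w'.1 + w'.2))
  (fun w w' => Db b w.1 w'.1 * Db b w.2 w'.2) f.
Proof.
have m1 := mor_fst rA rA; have m2 := mor_snd rA rA.
have okb := Db_ok hB b; have dvb := Db_dv hB b.
pose M := (lb_mul (lb_mul (pullback (fun w : A * A => w.1 + w.2) (fibre Pc b))
    (lb_inv (pullback fst (fibre Pc b)))) (lb_inv (pullback snd (fibre Pc b)))).
pose DM (w w' : A * A) : k := Db b (w.1 + w.2) (w'.1 + w'.2) * (Db b w.1 w'.1)^-1
   * (Db b w.2 w'.2)^-1.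
have lM : line_bundle XX M := fib_add_line b.
have dM : isdv M DM.
  apply: (isdv_mul (isdv_mul (isdv_pull (fun w : A * A => w.1 + w.2) dvb)
    (isdv_inv (isdv_pull fst dvb))) (isdv_inv (isdv_pull snd dvb))).
have nz x : Db b x x != 0 by exact: (nbh_pt (dok_nz x okb)).
have trivt t : (fun x y => DM (x, t) (y, t)) ~~ one.
  have h1 := (leq_one_div _ rA okb).2 (Db_trans hB b t).
  have h2 := leq_c rA (invr_neq0 (nz t)).
  by apply: leq_eq (leq_mul rA h1 h2) => // x y; rewrite mulr1.
have mx t : mor XA XX (fun x => (x, t)).
  by apply: mor_pair => //; exact: mor_cst.
have famM : Pic0_family XA M.
  split=> // [t|].
    exact: (Pic0_triv (pull_line rA rAA (mx t) lM) (isdv_pull _ dM) (trivt t)).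
  have m0 : mor XA XX (fun t : A => (0 : A, t)).
    by apply: mor_pair => //; exact: mor_cst.
  apply/(lb_trivP rA (pull_line rA rAA m0 lM) (isdv_pull _ dM)).
  have [f hf] := leq_c rA (invr_neq0 (nz 0)); exists f => x.
  apply: (eqv_ext rA _ _ (hf x)); last by apply: nbhS (nbhT rA x).
  apply: nbhS (dok_nz x okb) => y /= n0; rewrite /DM /= !add0r.
  by rewrite mulrAC divff // mul1r.
have [h [[mh isoh] _]] := (proj2 hB) A XA M (ab_variety A) famM.
have mh' := (morP _ rA (ab_rs B)).1 mh.
have mp : mor XX XB (fun w : A * A => (w.1, h w.2)).
  by apply: mor_pair => //; exact: (mor_comp m2 mh').
have [u hu] := (lb_isoP rAA (pull_line rAA rAB mp (Pc_line hB)) lM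
   (isdv_pull _ (DP_dv hB)) dM).1 isoh.
(* All fibres of M over points t are trivial, so its classifying map is 0 and M is the pullback of
   the fibre of the Poincare bundle over 0, which is trivial. *)
have h0 t : h t = 0.
  apply: (@dual_inj _ _ _ _ hB).
  have hx : Db (h t) ~~ (fun x y => DM (x, t) (y, t)).
    by exists (u \o (fun x => (x, t))); exact: (diso_pull (mx t) hu).
  exact: (leq_trans_div rA hx (leq_trans_div rA (trivt t) (leq_sym rA (Db0 hB hlam)))).
have [g hg] := Db0 hB hlam.
apply/(leq_one_div _ rAA); first by apply: dok_mul => //; exact: dok_pull.
have h1 : leq_div XX (fun w w' => Db 0 w.1 w'.1) one.
  by exists (g \o fst); exact: (diso_pull m1 hg).
apply: (leq_trans_div rAA) h1; apply: (leq_sym rAA); exists u => w.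
apply: eqv_same (hu w) => y; first by rewrite !h0.
by rewrite /DM invfM mulrA.
Qed.

Lemma Db_pulln b N : (fun x y => Db b (x *+ N) (y *+ N)) ~~ (fun x y => Db b x y ^+ N).
Proof.
have okb := Db_ok hB b; have nz x : Db b x x != 0 by exact: (nbh_pt (dok_nz x okb)).
elim: N => [|N IH].
  by apply: leq_eq (leq_c rA (nz 0)) => x y; rewrite ?mulr0n.
have mp : mor XA XX (fun x : A => (x, x *+ N)).
  by apply: mor_pair => //; exact: mor_muln.
have h := leq_pull mp (Db_seesaw b).
have h' := leq_trans_div rA h (leq_mul rA (leq_refl rA okb) IH).
by apply: leq_eq h' => x y /=; rewrite ?mulrS ?exprS.
Qed.

Lemma Db_tors b N : b *+ N = 0 -> (fun x y => Db b (x *+ N) (y *+ N)) ~~ one.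
Proof.
move=> bN; apply: (leq_trans_div rA) (Db_pulln b N) _.
apply: (leq_trans_div rA) (leq_sym rA (Db_muln hB hlam b N)) _.
by rewrite bN; exact: (Db0 hB hlam).
Qed.

(** The Rosati involution: [be] is the dual of [al] conjugated by [lam], the dual being the pullback
    of line bundles. *)
Definition adj (al be : A -> A) := forall a,
  (fun x y => Db (lam a) (al x) (al y)) ~~ Db (lam (be a)).

Lemma adj_uniq al be be' : adj al be -> adj al be' -> be = be'.
Proof.
move=> h h'; apply/funext => a; apply: (lam_inj hlam); apply: (@dual_inj _ _ _ _ hB).
exact: (leq_trans_div rA (leq_sym rA (h a)) (h' a)).
Qed.

Lemma adj_add al be : adj al be -> hom al -> forall a b, be (a + b) = be a + be b.
Proof.
move=> h [alD mal] a b; apply: (lam_inj hlam); apply: (@dual_inj _ _ _ _ hB).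
have h1 := leq_sym rA (h (a + b)).
have h2 := leq_pull mal (Db_add hB hlam a b).
have h3 := leq_mul rA (h a) (h b).
have h4 := leq_sym rA (Db_add hB hlam (be a) (be b)).
exact: (leq_trans_div rA h1 (leq_trans_div rA h2 (leq_trans_div rA h3 h4))).
Qed.

(** The pullback of the Poincare bundle by [al] on the first factor and [lam] on the second is a
    family in Pic^0 over A. Its classifying map followed by the inverse of [lam] is the adjoint; it
    is additive because the class of a sum is the sum of the classes. *)
Lemma adj_ex al : hom al -> exists be, hom be /\ adj al be.
Proof.
move=> hal; have [alD mal] := hal.
have mlam := proj2 (lam_hom hlam).
pose M := pullback (fun w : A * A => (al w.1, lam w.2)) Pc.
have mp : mor XX XB (fun w : A * A => (al w.1, lam w.2)).
  apply: mor_pair => //; first exact: (mor_comp (mor_fst rA rA) mal).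
  exact: (mor_comp (mor_snd rA rA) mlam).
have lM : line_bundle XX M by exact: (pull_line rAA rAB mp (Pc_line hB)).
have dM := isdv_pull (fun w : A * A => (al w.1, lam w.2)) (DP_dv hB).
have mx t : mor XA XX (fun x => (x, t)).
  by apply: mor_pair => //; exact: mor_cst.
have famM : Pic0_family XA M.
  split=> // [t|].
    have lt := pull_line rA rAA (mx t) lM; split=> // a.
    have dt := isdv_pull (fun x : A => (x, t)) dM.
    have lta := pull_line rA rA (mor_trans a) lt.
    apply/(lb_isoP rA lta lt (isdv_pull (translate a) dt) dt).
    have := leq_pull mal (Db_trans hB (lam t) (al a)).
    by apply: leq_eq => // x y; rewrite /= /translate !alD.
  have m0 : mor XA XX (fun t : A => (0 : A, t)).
    by apply: mor_pair => //; exact: mor_cst.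
  apply/(lb_trivP rA (pull_line rA rAA m0 lM) (isdv_pull _ dM)).
  have [[_ _ t0] _] := hB.
  have mB : mor (ab_sp B) XB (fun t : B => (0 : A, t)).
    by apply: mor_pair => //; exact: mor_cst.
  have [f hf] := (lb_trivP (ab_rs B) (pull_line (ab_rs B) rAB mB (Pc_line hB))
     (isdv_pull _ (DP_dv hB))).1 t0.
  exists (f \o lam) => x; have := diso_pull mlam hf x; apply: eqv_same => // y.
  by rewrite /= (hom0 hal).
have [h [[mh isoh] _]] := (proj2 hB) A XA M (ab_variety A) famM.
have mh' := (morP _ rA (ab_rs B)).1 mh.
have mph : mor XX XB (fun w : A * A => (w.1, h w.2)).
  by apply: mor_pair => //; [exact: mor_fst | exact: (mor_comp (mor_snd rA rA) mh')].
have [u hu] := (lb_isoP rAA (pull_line rAA rAB mph (Pc_line hB)) lM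
   (isdv_pull _ (DP_dv hB)) dM).1 isoh.
have [mu [mmu lK muK]] := lam_inv hlam.
have hadj : adj al (mu \o h).
  move=> a; rewrite /= muK; apply: (leq_sym rA).
  by exists (u \o (fun x => (x, a))); exact: (diso_pull (mx a) hu).
exists (mu \o h); split=> //; split; last exact: (mor_comp mh' mmu).
exact: adj_add hadj hal.
Qed.

Lemma adj_comp al be al' be' : hom al -> adj al be -> adj al' be' ->
  adj (al' \o al) (be \o be').
Proof.
move=> [_ mal] h h' a.
exact: (leq_trans_div rA (leq_pull mal (h' a)) (h (be' a))).
Qed.

Lemma adj_id : adj id id.
Proof. by move=> a; apply: leq_refl => //; exact: Db_ok. Qed.

Lemma adj_sum al be al' be' : hom al -> hom al' -> adj al be -> adj al' be' ->
  adj (fun x => al x + al' x) (fun x => be x + be' x).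
Proof.
move=> [_ mal] [_ mal'] h h' a.
have mp := mor_pair rA rA rA mal mal'.
have h1 := leq_pull mp (Db_seesaw (lam a)).
have h2 := leq_mul rA (h a) (h' a).
exact: (leq_trans_div rA h1 (leq_trans_div rA h2 (leq_sym rA (Db_add hB hlam _ _)))).
Qed.

(** * The Weil pairing *)

(** The sections on the charts are replaced by one function f: on each chart the section is f times
    the set-theoretic equation of the chart. *)
Lemma weilP N a b w : weil Pc N a b w <->
  [/\ a *+ N = 0, b *+ N = 0 & exists f,
     diso XA (fun x y => Db b (x *+ N) (y *+ N)) one f /\
     forall x, f x = w * f (x + a)].
Proof.
have mN : mor XA XA (fun x => x *+ N) by exact: mor_muln.
have lN := pull_line rA rA mN (fib_line hB b).
have dN := isdv_pull (fun x : A => x *+ N) (Db_dv hB b).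
have [od cov rt tii tij] := lN.
have [e [i0 [hi0 en te eD]]] := Db_dv hB b.
split=> -[aN bN [s]].
  move=> [[[rs hs] sn] hw]; split=> //.
  exists (fun y => s (i0 (y *+ N)) y / e (i0 (y *+ N)) (y *+ N)); split=> x.
    have hx := nbh_open (od _) (hi0 (x *+ N)).
    apply: (eqv_ext rA (f := s (i0 (x *+ N))) (g := fun=> 1)).
    - apply: nbhS hx => y /= dy; rewrite eD (hs _ (i0 (y *+ N)) y) //; last exact: hi0.
      by rewrite /= [tr _ _ _ _](te _ _ (y *+ N)) //; ring.
    - by apply: nbhS hx.
    apply/(eqv1 rA); split; last exact: (sn _ _ (hi0 (x *+ N))).
    exists (Defs.dom (fibre Pc b) (i0 (x *+ N)) \o (fun x : A => x *+ N)); split.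
    - exact: (od (i0 (x *+ N))).
    - exact: (hi0 (x *+ N)).
    - exact: (rs (i0 (x *+ N))).
  by rewrite mulrnDl aN addr0 hw ?mulrA //; exact: hi0.
move=> [hf hw]; split=> //.
exists (fun i y => s y * e i (y *+ N)); split; last first.
  by move=> i x dx; rewrite mulrnDl aN addr0 hw mulrA.
split; last by move=> i x di; rewrite mulf_neq0 ?en //; exact: diso_nz hf.
split=> [i|i j x di dj]; last first.
  by rewrite [tr _ _ _ _](te i j (x *+ N)) // mulrCA divfK // en.
apply: (reg_rat rA) => // x di.
have [r _] := (eqv1 rA _ _).1 (hf x).
have hi := hi0 (x *+ N).
have rt' := rt i (i0 (x *+ N)).
have oI := rs_openI rA (od i) (od (i0 (x *+ N))).
apply: (rs_ext rA _ (rs_mul rA r (g := fun y => tr (fibre Pc b) i (i0 (x *+ N)) (y *+ N)) _)).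
  apply: nbhS (nbh_open oI (conj di hi)) => y [/= h1 h2].
  by rewrite eD [tr _ _ _ _](te i (i0 (x *+ N)) (y *+ N)) // -mulrA [X in _ * X]mulrC divfK ?en.
by exists (Defs.dom (pullback (fun x : A => x *+ N) (fibre Pc b)) i `&`
   Defs.dom (pullback (fun x : A => x *+ N) (fibre Pc b)) (i0 (x *+ N))).
Qed.

End Dual2.

Section Weil.
Variable k : closedFieldType.
Variables (A B : abvar k) (Pc : cocycle k (A * B)) (lam : A -> B).
Hypotheses (hB : is_dual Pc) (hlam : principal_polarization Pc lam).

Local Notation XA := (ab_sp A).
Local Notation rA := (ab_rs A).
Local Notation Db := (Db hB).
Local Notation "D ~~ E" := (leq_div XA D E) (at level 70).
Local Notation one := (fun _ _ => 1).
Local Notation weil := (weil Pc).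

Lemma ntriv_trans b N a f : a *+ N = 0 ->
  diso XA (fun x y => Db b (x *+ N) (y *+ N)) one f ->
  diso XA (fun x y => Db b (x *+ N) (y *+ N)) one (fun x => f (x + a)).
Proof.
move=> aN hf x; have := diso_pull (mor_trans a) hf x; apply: eqv_same => // y.
by rewrite !mulrnDl aN !addr0.
Qed.

(** Translation by a point of A[N] does not change the divisor pulled back by N, so a trivialization
    and its translate differ by a constant. *)
Lemma weil_ex N a b : a *+ N = 0 -> b *+ N = 0 -> exists w, weil N a b w.
Proof.
move=> aN bN; have [f hf] := Db_tors hB hlam bN.
have [c hc] := unit_const hf (ntriv_trans aN hf).
by exists c; apply/(weilP hB); split=> //; exists f.
Qed.

Lemma weil_triv N a b w g : weil N a b w ->
  diso XA (fun x y => Db b (x *+ N) (y *+ N)) one g -> forall x, g x = w * g (x + a).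
Proof.
move=> /(weilP hB)[aN bN [f [hf hw]]] hg x; have [c hc] := unit_const hg hf.
by rewrite !hc hw mulrCA.
Qed.

Lemma weil_uniq N a b w w' : weil N a b w -> weil N a b w' -> w = w'.
Proof.
move=> h /(weilP hB)[aN bN [f [hf hw]]]; have := weil_triv h hf 0.
by rewrite hw => /mulIf -> //; exact: diso_nz hf.
Qed.

Lemma weil_neq0 N a b w : weil N a b w -> w != 0.
Proof.
move=> /(weilP hB)[aN bN [f [hf hw]]]; apply/eqP => w0.
by have := diso_nz 0 hf; rewrite hw w0 mul0r eqxx.
Qed.

Lemma weil_addl N a a' b w w' : weil N a b w -> weil N a' b w' ->
  weil N (a + a') b (w * w').
Proof.
move=> /(weilP hB)[aN bN [f [hf hw]]] /[dup] /(weilP hB)[aN' _ _] h'.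
apply/(weilP hB); split=> //; first by rewrite mulrnDl aN aN' addr0.
by exists f; split=> // x; rewrite hw (weil_triv h' hf) -mulrA addrA.
Qed.

Lemma weil_addr N a b b' w w' : weil N a b w -> weil N a b' w' ->
  weil N a (b + b') (w * w').
Proof.
move=> /(weilP hB)[aN bN [f [hf hw]]] /(weilP hB)[_ bN' [f' [hf' hw']]].
apply/(weilP hB); split=> //; first by rewrite mulrnDl bN bN' addr0.
have [c ec] := lam_surj hlam b; have [c' ec'] := lam_surj hlam b'.
have mN : mor XA XA (fun x => x *+ N) by exact: mor_muln.
have [u hu] := Db_add hB hlam c c'.
rewrite (proj1 (lam_hom hlam)) ec ec' in hu.
have hu' := diso_pull mN hu.
have h := diso_trans rA hu' (diso_mul rA hf hf').
exists (fun y => u (y *+ N) * (f y * f' y)); split.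
  by move=> x; apply: eqv_same (h x) => // y; rewrite mulr1.
by move=> x; rewrite mulrnDl aN addr0 hw hw'; ring.
Qed.

Lemma weil_0l N b : b *+ N = 0 -> weil N 0 b 1.
Proof.
move=> bN; have [f hf] := Db_tors hB hlam bN.
apply/(weilP hB); split=> //; first by rewrite mul0rn.
by exists f; split=> // x; rewrite addr0 mul1r.
Qed.

Lemma weil_mulnl N a b w m : weil N a b w -> weil N (a *+ m) b (w ^+ m).
Proof.
move=> h; elim: m => [|m IH].
  by rewrite mulr0n expr0; apply: weil_0l; case/(weilP hB): h.
by rewrite mulrS exprS; exact: weil_addl.
Qed.

Lemma weil_root N a b w : weil N a b w -> w ^+ N = 1.
Proof.
move=> h; have [aN bN _] := (weilP hB _ _ _ _).1 h.
have := weil_mulnl N h; rewrite aN => h'; exact: weil_uniq h' (weil_0l bN).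
Qed.

Lemma weil_adj N al be a b w : hom al -> adj lam hB al be -> a *+ N = 0 ->
  weil N (al a) (lam b) w -> weil N a (lam (be b)) w.
Proof.
move=> hal hadj aN /(weilP hB)[alN bN [f [hf hw]]].
have [_ mal] := hal.
have b0 : b *+ N = 0.
  by apply: (lam_inj hlam); rewrite (homMn _ _ (lam_hom hlam)) bN (hom0 (lam_hom hlam)).
have beN : be b *+ N = 0.
  have beD := adj_add hlam hadj hal.
  have be0 : be 0 = 0 by apply: (addrI (be 0)); rewrite -beD !addr0.
  have beM m x : be (x *+ m) = be x *+ m.
    by elim: m => [|m IH]; rewrite ?mulr0n // !mulrS beD IH.
  by rewrite -beM b0.
apply/(weilP hB); split=> //.
  by rewrite -(homMn _ _ (lam_hom hlam)) beN (hom0 (lam_hom hlam)).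
have mN : mor XA XA (fun x => x *+ N) by exact: mor_muln.
have [u hu] := hadj b.
have h1 := diso_sym rA (diso_pull mN hu).
have h2 := diso_pull mal hf.
have h3 : diso XA (fun x y => Db (lam b) (al (x *+ N)) (al (y *+ N))) one (f \o al).
  by move=> x; apply: eqv_same (h2 x) => // y; rewrite !(homMn _ _ hal).
exists (fun y => ((u \o (fun x => x *+ N)) y)^-1 * (f \o al) y); split.
  exact: (diso_trans rA h1 h3).
by move=> x /=; rewrite mulrnDl aN addr0 (proj1 hal) hw; ring.
Qed.

(* If [y] is an [N]-th part of [a] and [f] is a rational function with divisor
   [N^* (t_a^* L - L)], then the product of the [f (x + i y)] over [i < N] is
   constant by telescoping; comparing its values at [x] and [x + y] gives
   [f x = f (x + N y)]. *)
Lemma weil_alt N a : a *+ N = 0 -> (exists y, y *+ N = a) -> weil N a (lam a) 1.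
Proof.
move=> aN [y ya]; have [w hw] : exists w, weil N a (lam a) w.
  apply: weil_ex => //; by rewrite -(homMn _ _ (lam_hom hlam)) aN (hom0 (lam_hom hlam)).
suff w1 : w = 1 by rewrite w1 in hw.
have [_ _ [f [hf fw]]] := (weilP hB _ _ _ _).1 hw.
have [DL [okL hL]] := theta_ex hB hlam.
have mN : mor XA XA (fun x => x *+ N) by exact: mor_muln.
have [u hu] := hL a.
pose g x := (u (x *+ N))^-1 * f x.
have hg : diso XA (fun x z => DL (x *+ N + a) (z *+ N + a) / DL (x *+ N) (z *+ N)) one g.
  exact: (diso_trans rA (diso_sym rA (diso_pull mN hu)) hf).
have gw x : g x = w * g (x + a) by rewrite /g mulrnDl aN addr0 fw; ring.
pose e i (x z : A) : k := DL (x *+ N + a *+ i) (z *+ N + a *+ i).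
have oke i : dok XA (e i).
  exact: (dok_pull (mor_comp mN (mor_trans (a *+ i))) okL).
have hgi i : diso XA (fun x z => e i.+1 x z / e i x z) one (fun x => g (x + y *+ i)).
  move=> x; have := diso_pull (mor_trans (y *+ i)) hg x; apply: eqv_same => // z.
  have eq t : (t + y *+ i) *+ N = t *+ N + a *+ i by rewrite mulrnDl mulrnAC ya.
  by rewrite /e !eq mulrSr !addrA.
have hP m : diso XA (fun x z => e m x z / e 0%N x z) one
    (fun x => \prod_(i < m) g (x + y *+ i)).
  elim: m => [|m IH].
    apply/(dtriv_div rA _ _ (oke 0%N)) => x.
    have := diso_refl rA (oke 0%N) x; apply: eqv_same => // z.
    by rewrite big_ord0.
  move=> x; have := diso_mul rA IH (hgi m) x.
  apply: (eqv_ext rA).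
    have n0 := dok_nz x (oke m); apply: nbhS n0 => z /= n0.
    rewrite big_ord_recr /=; move: n0; move: (e m x z) (e m.+1 x z) => p q n0.
    by move: (e 0%N x z)^-1 => v; field.
  by apply: nbhS (nbhT rA x) => z _ /=; rewrite mulr1.
pose p x := \prod_(i < N) g (x + y *+ i).
have pc : forall x, p x = p 0.
  apply: (diso_unit (oke 0%N)); apply/(dtriv_div rA _ _ (oke 0%N)).
  move=> x; apply: eqv_same (hP N x) => // z.
  by rewrite /e aN mulr0n.
have g0 x : g x != 0 by exact: diso_nz hg.
have : p 0 = p y by rewrite (pc y).
(* For N = 0 the product has no factor to compare, but then a = y *+ 0 = 0. *)
case: N => [|N'] in aN ya hw hf fw mN g hg gw e oke hgi hP p pc g0 *.
  by move=> _; have := weil_root hw; rewrite -{}ya mulr0n in hw * => _;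
   apply: weil_uniq hw _; apply: weil_0l; rewrite mulr0n.
rewrite /p big_ord_recl [RHS]big_ord_recr /= mulr0n addr0.
have -> : \prod_(i < N') g (0 + y *+ bump 0 i) = \prod_(i < N') g (y + y *+ i).
  by apply: eq_bigr => i _; rewrite add0r mulrS.
rewrite mulrC => /mulfI h; have {h} : g 0 = g (y + y *+ N') by apply: h; apply/prodf_neq0 => i _; exact: g0.
rewrite -mulrS ya gw add0r -[RHS]mul1r; apply: mulIf; exact: g0.
Qed.

Lemma weil_anti N a b w w' : (forall z, exists y : A, y *+ N = z) ->
  weil N a (lam b) w -> weil N b (lam a) w' -> w * w' = 1.
Proof.
move=> surj h h'.
have [aN bN' _] := (weilP hB _ _ _ _).1 h; have [bN aN' _] := (weilP hB _ _ _ _).1 h'.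
have haa := weil_alt aN (surj a); have hbb := weil_alt bN (surj b).
have hab := weil_alt (N := N) (a := a + b); rewrite mulrnDl aN bN addr0 in hab.
have {}hab := hab erefl (surj _).
have := weil_addl (weil_addr haa h) (weil_addr h' hbb).
rewrite -(proj1 (lam_hom hlam)) => h2.
by have := weil_uniq h2 hab; rewrite mul1r mulr1.
Qed.

(** Moving [al] and then [be] across the pairing, with the arguments exchanged by antisymmetry,
    shows that [al a] and [be2 a] pair equally with every point of A[N]. The double adjoint is thus
    compared with [al] on torsion only, without biduality. *)
Lemma adj_adj al be be2 : hom al -> hom be -> adj lam hB al be -> adj lam hB be be2 ->
  forall N, (forall z, exists y : A, y *+ N = z) ->
  (forall b, b *+ N = 0 -> (forall a, a *+ N = 0 -> weil N b (lam a) 1) -> b = 0) ->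
  forall a, a *+ N = 0 -> be2 a = al a.
Proof.
move=> hal hbe h1 h2 N surj nd a aN.
have hbe2D := adj_add hlam h2 hbe.
have be20 : be2 0 = 0 by apply: (addrI (be2 0)); rewrite -hbe2D !addr0.
have be2M m x : be2 (x *+ m) = be2 x *+ m.
  by elim: m => [|m IH]; rewrite ?mulr0n // !mulrS hbe2D IH.
have be2N : be2 a *+ N = 0 by rewrite -be2M aN.
have alN : al a *+ N = 0 by rewrite -(homMn _ _ hal) aN hom0.
have lamN (c : A) : c *+ N = 0 -> lam c *+ N = 0.
  by move=> cN; rewrite -(homMn _ _ (lam_hom hlam)) cN (hom0 (lam_hom hlam)).
suff e c : c *+ N = 0 -> exists w, weil N (be2 a) (lam c) w /\ weil N (al a) (lam c) w.
  apply/eqP; rewrite -subr_eq0; apply/eqP; apply: nd.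
    by rewrite mulrnBl be2N alN subr0.
  move=> c cN; have [w [hw hw']] := e c cN.
  have w0 := weil_neq0 hw'.
  have nN : (- al a) *+ N = 0 by rewrite mulNrn alN oppr0.
  have [v hv] := weil_ex nN (lamN _ cN).
  have := weil_addl hw' hv; rewrite subrr => h0.
  have e1 := weil_uniq h0 (weil_0l (lamN _ cN)).
  by rewrite -e1; exact: weil_addl.
move=> cN; have [w hw] := weil_ex alN (lamN _ cN).
have hw1 := weil_adj hal h1 aN hw.
have beN : be c *+ N = 0 by rewrite -(homMn _ _ hbe) cN hom0.
have [v hv] := weil_ex beN (lamN _ aN).
have wv := weil_anti surj hw1 hv.
have hv2 := weil_adj hbe h2 cN hv.
have [w' hw'] := weil_ex be2N (lamN _ cN).
have w'v := weil_anti surj hw' hv2.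
exists w; split=> //; suff -> : w = w' by [].
have v0 := weil_neq0 hv; apply: (mulIf v0); by rewrite wv w'v.
Qed.

End Weil.

(** * The basis theorem *)

Lemma mpoly_ring_ind n (R : comNzRingType) (P : {mpoly R[n]} -> Prop) :
  (forall c, P c%:MP) -> (forall i, P 'X_i) -> (forall p q, P p -> P q -> P (p + q)) ->
  (forall p q, P p -> P q -> P (p * q)) -> forall p, P p.
Proof.
move=> hC hX hD hM p; rewrite (mpolyE p).
apply: big_ind => [||m _]; [by rewrite -mpolyC0 | exact: hD |].
rewrite -mul_mpolyC; apply: (hM) => //; rewrite mpolyXE_id.
apply: big_ind => [||i _]; [by rewrite -mpolyC1 | exact: hM |].
by elim: (m i) => [|d IH]; [rewrite expr0 -mpolyC1 | rewrite exprS; apply: hM].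
Qed.

Inductive idg (R : comNzRingType) (S : set R) : R -> Prop :=
| idg0 : idg S 0
| idg_gen x : S x -> idg S x
| idg_add x y : idg S x -> idg S y -> idg S (x + y)
| idg_mul r x : idg S x -> idg S (r * x).

Definition noeth (R : comNzRingType) := forall S : set R, exists s : seq R,
  (forall x, x \in s -> S x) /\ forall x, S x -> idg [set` s] x.

Section Idg.
Variable R : comNzRingType.
Implicit Types S T : set R.

Lemma idgS S T x : S `<=` T -> idg S x -> idg T x.
Proof.
move=> ST; elim=> [|y /ST|y z _ ? _|r y _]; [exact: idg0 | exact: idg_gen | exact: idg_add | exact: idg_mul].
Qed.

Lemma idg_idg S T x : S `<=` idg T -> idg S x -> idg T x.
Proof.
by move=> ST; elim=> [|y /ST|y z _ ? _|r y _] //; [exact: idg0 | exact: idg_add | exact: idg_mul].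
Qed.

Lemma idg_opp S x : idg S x -> idg S (- x).
Proof. by rewrite -mulN1r; exact: idg_mul. Qed.

Lemma idg_fin S x : idg S x -> exists s : seq R,
  (forall y, y \in s -> S y) /\ idg [set` s] x.
Proof.
elim=> [|y Sy|y z _ [s [hs h]] _ [t [ht h']]|r y _ [s [hs h]]].
- by exists [::]; split=> //; exact: idg0.
- exists [:: y]; split=> [z|]; first by rewrite inE => /eqP ->.
  by apply: idg_gen; rewrite /= inE.
- exists (s ++ t); split=> [w|]; first by rewrite mem_cat => /orP[/hs|/ht].
  apply: idg_add; [apply: idgS h | apply: idgS h'] => w /= hw;
  by rewrite mem_cat hw ?orbT.
- by exists s; split=> //; exact: idg_mul.
Qed.

Lemma idg_fins S (t : seq R) : (forall x, x \in t -> idg S x) -> exists s : seq R,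
  (forall y, y \in s -> S y) /\ forall x, x \in t -> idg [set` s] x.
Proof.
elim: t => [|x t IH] h; first by exists [::].
have [|s [hs h1]] := IH; first by move=> y yt; apply: h; rewrite inE yt orbT.
have [s' [hs' h2]] := idg_fin (h x (mem_head _ _)).
exists (s ++ s'); split=> [w|y]; first by rewrite mem_cat => /orP[/hs|/hs'].
rewrite inE => /orP[/eqP ->|/h1 h3]; [apply: idgS h2|apply: idgS h3] => w /= hw; by rewrite mem_cat hw ?orbT.
Qed.

End Idg.

Lemma noeth_surj (R R' : comNzRingType) (phi : R -> R') :
  phi 0 = 0 -> (forall x y, phi (x + y) = phi x + phi y) ->
  (forall x y, phi (x * y) = phi x * phi y) -> (forall y, exists x, phi x = y) ->
  noeth R -> noeth R'.
Proof.
move=> f0 fD fM fs hR S; have [s [hs h]] := hR (phi @^-1` S).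
exists (map phi s); split=> [y /mapP[x xs ->]|y Sy]; first exact: hs.
have [x ex] := fs y; have Sx : S (phi x) by rewrite ex.
rewrite -ex; elim: (h x Sx) => [|z zs|z w _ ? _|r z _ ?].
- by rewrite f0; exact: idg0.
- by apply: idg_gen; apply/mapP; exists z.
- by rewrite fD; exact: idg_add.
- by rewrite fM; exact: idg_mul.
Qed.

Lemma noeth_field (F : fieldType) : noeth F.
Proof.
move=> S; case: (pselect (exists2 x, S x & x != 0)) => [[x Sx x0]|h].
  exists [:: x]; split=> [y|y Sy]; first by rewrite inE => /eqP ->.
  rewrite -[y](divfK x0); apply: idg_mul; apply: idg_gen; by rewrite /= inE.
exists [::]; split=> // x Sx; case: (eqVneq x 0) => [->|x0]; first exact: idg0.
by case: h; exists x.
Qed.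

Section Hilbert.
Variable R : comNzRingType.
Hypothesis nR : noeth R.
Variable S : set {poly R}.
Let I := idg S.

Let L d : set R := [set a | exists f : {poly R}, [/\ I f, (size f <= d.+1)%N & f`_d = a]].

Lemma hilbert_lift (D : nat) (V : set R) : (forall a, V a -> L D a) -> exists T : seq {poly R},
  (forall f, f \in T -> I f) /\ forall a, V a -> exists g,
    [/\ idg [set` T] g, (size g <= D.+1)%N & g`_D = a].
Proof.
move=> VL; have [s [hs hsV]] := nR V.
have [T [hT hTs]] : exists T : seq {poly R}, (forall f, f \in T -> I f) /\
    forall a, a \in s -> exists f, [/\ f \in T, (size f <= D.+1)%N & f`_D = a].
  elim: s hs {hsV} => [|a s IH] hs; first by exists [::].
  have [|T [hT h]] := IH; first by move=> x xs; apply: hs; rewrite inE xs orbT.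
  have [f [If sf fa]] := VL _ (hs a (mem_head _ _)).
  exists (f :: T); split=> [g|b]; first by rewrite inE => /orP[/eqP ->|/hT].
  rewrite inE => /orP[/eqP ->|/h[g [gT ? ?]]]; first by exists f; rewrite mem_head.
  by exists g; rewrite inE gT orbT.
exists T; split=> // a /hsV; elim=> {a} [|a /hTs[f [fT sf fa]]|a b _ [f [h1 h2 h3]] _ [g [h4 h5 h6]]|r a _ [f [h1 h2 h3]]].
- by exists 0; rewrite size_poly0 coef0; split=> //; exact: idg0.
- by exists f; split=> //; exact: idg_gen.
- exists (f + g); split; first exact: idg_add.
    by apply: leq_trans (size_polyD _ _) _; rewrite geq_max h2 h5.
  by rewrite coefD h3 h6.
- exists (r%:P * f); split; first exact: idg_mul.
    by apply: leq_trans (size_polyMleq _ _) _; rewrite size_polyC; case: (r != 0); rewrite ?add1n ?add0n //= (leq_trans (leq_pred _)).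
  by rewrite coefCM h3.
Qed.

(** From degree [D] on, the leading coefficients are generated by those of finitely many elements,
    collected in [T]; [U] treats each of the finitely many degrees below [D] separately. *)
Lemma hilbert_aux : exists s : seq {poly R},
  (forall f, f \in s -> I f) /\ forall f, I f -> idg [set` s] f.
Proof.
have [s [hs hsL]] := nR [set a | exists d, L d a].
have [D hD] : exists D, forall a, a \in s -> L D a.
  have LS d d' a : (d <= d')%N -> L d a -> L d' a.
    move=> dd [f [If sf fa]]; exists ('X^(d' - d) * f); split; first exact: idg_mul.
      apply: leq_trans (size_polyMleq _ _) _; rewrite size_polyXn addSn /=.
      by rewrite -[in X in (_ <= X)%N](subnK dd) -addnS leq_add2l.
    by rewrite coefXnM ltnNge leq_subr /= subKn.
  elim: s hs {hsL} => [|a s IH] hs; first by exists 0%N.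
  have [|D h] := IH; first by move=> x xs; apply: hs; rewrite inE xs orbT.
  have [d hd] := hs a (mem_head _ _); exists (maxn d D) => b.
  rewrite inE => /orP[/eqP ->|/h hb]; first exact: LS (leq_maxl _ _) hd.
  exact: LS (leq_maxr _ _) hb.
have [T [hT hTL]] := hilbert_lift (D := D) (V := [set` s]) hD.
have [U [hU hUL]] : exists U : seq {poly R}, (forall f, f \in U -> I f) /\
    forall d a, (d < D)%N -> L d a -> exists g, [/\ idg [set` U] g, (size g <= d.+1)%N & g`_d = a].
  elim: (D) => [|e [U [hU h]]]; first by exists [::]; split.
  have [V [hV h']] := hilbert_lift (D := e) (V := L e) (fun a h => h).
  exists (U ++ V); split=> [f|d a]; first by rewrite mem_cat => /orP[/hU|/hV].
  rewrite ltnS leq_eqVlt => /orP[/eqP ->|de] La.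
    have [g [h1 h2 h3]] := h' a La; exists g; split=> //.
    by apply: idgS h1 => w /= hw; rewrite mem_cat hw orbT.
  have [g [h1 h2 h3]] := h d a de La; exists g; split=> //.
  by apply: idgS h1 => w /= hw; rewrite mem_cat hw.
exists (T ++ U); split=> [f|f If]; first by rewrite mem_cat => /orP[/hT|/hU].
have hTU : forall g, idg [set` T] g \/ idg [set` U] g -> idg [set` T ++ U] g.
  by move=> g []; apply: idgS => w /= hw; rewrite mem_cat hw ?orbT.
have IT g : idg [set` T ++ U] g -> I g.
  by apply: idg_idg => h /=; rewrite mem_cat => /orP[/hT|/hU].
have [m] := ubnP (size f); elim: m f If => // m IH f If; rewrite ltnS => sf.
case: (posnP (size f)) => [/eqP|sf0]; first by rewrite size_poly_eq0 => /eqP ->; exact: idg0.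
pose d := (size f).-1; have sd : size f = d.+1 by rewrite prednK.
have [g [gi sg ga]] : exists g, [/\ idg [set` T ++ U] g, (size g <= d.+1)%N & g`_d = f`_d].
  have La : L d f`_d by exists f; rewrite sd.
  case: (ltnP d D) => dD.
    by have [g [? ? ?]] := hUL d _ dD La; exists g; split=> //; apply: hTU; right.
  have [g [h1 h2 h3]] : exists g, [/\ idg [set` T] g, (size g <= D.+1)%N & g`_D = f`_d].
    have := hsL f`_d (ex_intro _ d La).
    elim=> [|a /hTL //|a b _ [g [h1 h2 h3]] _ [h [h4 h5 h6]]|r a _ [g [h1 h2 h3]]].
    - by exists 0; rewrite size_poly0 coef0; split=> //; exact: idg0.
    - exists (g + h); split; first exact: idg_add.
        by apply: leq_trans (size_polyD _ _) _; rewrite geq_max h2 h5.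
      by rewrite coefD h3 h6.
    - exists (r%:P * g); split; first exact: idg_mul.
        by apply: leq_trans (size_polyMleq _ _) _; rewrite size_polyC; case: (r != 0); rewrite ?add1n ?add0n //= (leq_trans (leq_pred _)).
      by rewrite coefCM h3.
  exists ('X^(d - D) * g); split; first by apply: idg_mul; apply: hTU; left.
    apply: leq_trans (size_polyMleq _ _) _; rewrite size_polyXn addSn /=.
    by rewrite -[in X in (_ <= X)%N](subnK dD) -addnS leq_add2l.
  by rewrite coefXnM subKn // ltnNge leq_subr.
rewrite -[f](subrK g); apply: idg_add => //; apply: IH.
  by apply: idg_add => //; apply: idg_opp; exact: IT.
apply: (@leq_trans d.+1); last by rewrite -sd.
rewrite ltnS; apply/leq_sizeP => j; rewrite leq_eqVlt => /orP[/eqP <-|dj].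
  by rewrite coefB ga subrr.
by rewrite coefB !nth_default ?subr0 ?sd // (leq_trans sg).
Qed.
End Hilbert.

Lemma noeth_poly (R : comNzRingType) : noeth R -> noeth {poly R}.
Proof.
move=> nR S; have [t [ht h]] := hilbert_aux nR S; have [s [hs hst]] := idg_fins ht.
exists s; split=> // x Sx; have := h x (idg_gen Sx).
by apply: idg_idg => y yt; exact: hst.
Qed.

Lemma noeth_mpoly (F : fieldType) n : noeth {mpoly F[n]}.
Proof.
elim: n => [|n IH].
  apply: (@noeth_surj F {mpoly F[0]} (fun c => c%:MP)); last exact: noeth_field.
  - by rewrite mpolyC0.
  - by move=> x y; rewrite mpolyCD.
  - by move=> x y; rewrite mpolyCM.
  move=> p; exists p@_0; elim/mpoly_ring_ind: p => [c|[]//|p q ep eq|p q ep eq].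
  - by rewrite mcoeffC eqxx mulr1.
  - by rewrite mcoeffD mpolyCD ep eq.
  - by rewrite -ep -eq -mpolyCM !mcoeffC !eqxx !mulr1.
pose phi (P : {poly {mpoly F[n]}}) := (map_poly (@mwiden n F) P).['X_ord_max].
apply: (@noeth_surj _ {mpoly F[n.+1]} phi _ _ _ _ (noeth_poly IH)).
- by rewrite /phi rmorph0 horner0.
- by move=> P Q; rewrite /phi rmorphD hornerD.
- by move=> P Q; rewrite /phi rmorphM hornerM.
elim/mpoly_ring_ind => [c|i|p q [P <-] [Q <-]|p q [P <-] [Q <-]].
- by exists (c%:MP)%:P; rewrite /phi map_polyC hornerC /= mwidenC.
- case: (unliftP ord_max i) => [j ->|->].
    exists ('X_j)%:P; rewrite /phi map_polyC hornerC /= mwidenX mnmwiden1.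
    by congr 'X_[U_(_)]; apply/val_inj; rewrite /= /bump leqNgt ltn_ord.
  by exists 'X; rewrite /phi map_polyX hornerX.
- by exists (P + Q); rewrite /phi rmorphD hornerD.
- by exists (P * Q); rewrite /phi rmorphM hornerM.
Qed.

(** * Descending chains of closed sets *)

Section DCC.
Variables (k : fieldType) (T : Type) (X : Defs.space k T).
Hypothesis vX : variety X.
Implicit Types Z : set T.

Lemma clsd_chart U n (phi : T -> 'I_n -> k) : affine_chart X U phi -> forall Z Z',
  clsd X Z -> (forall p : {mpoly k[n]}, (forall x, U x -> Z x -> p.@[phi x] = 0) ->
     forall x, U x -> Z' x -> p.@[phi x] = 0) -> U `&` Z' `<=` Z.
Proof.
move=> c Z Z' cZ h x [Ux Zx]; apply: contrapT => nZ.
have [p [px hp]] := (chart_nbh vX c _ Ux).1 (nbh_open cZ nZ).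
move/eqP: px; apply; apply: h Ux Zx => y Uy Zy; apply/eqP/negPn/negP => py.
exact: (hp y Uy py).
Qed.

(** Otherwise one could choose a sequence of closed sets whose traces on U strictly decrease,
    although the ideals of polynomials vanishing on them stabilize. *)
Lemma dcc_chart U n (phi : T -> 'I_n -> k) (FF : set (set T)) : affine_chart X U phi ->
  FF `<=` clsd X -> FF !=set0 -> exists2 Z, FF Z &
    forall Z', FF Z' -> Z' `<=` Z -> U `&` Z `<=` Z'.
Proof.
move=> c FFc [Z0 FZ0]; apply: contrapT => hno.
have step (Z : {Z | FF Z}) : exists Z' : {Z | FF Z},
    sval Z' `<=` sval Z /\ ~ (U `&` sval Z `<=` sval Z').
  apply: contrapT => h; apply: hno; exists (sval Z); first exact: svalP.
  move=> Z' FZ' ZZ; apply: contrapT => h'; apply: h; by exists (exist _ Z' FZ').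
have [nx hnx] := choice step.
pose W i := sval (iter i nx (exist _ Z0 FZ0)).
have WS i j : (i <= j)%N -> W j `<=` W i.
  move=> /subnK <-; elim: (j - i)%N => // m IH x; rewrite addSn.
  by move=> /(proj1 (hnx _)); exact: IH.
pose I i : set {mpoly k[n]} := [set p | forall x, U x -> W i x -> p.@[phi x] = 0].
have IS i j : (i <= j)%N -> I i `<=` I j.
  by move=> ij p Ip x Ux /(WS _ _ ij); exact: Ip.
have [s [hs hI]] := noeth_mpoly (F := k) (n := n) [set p | exists i, I i p].
have [N hN] : exists N, forall p, p \in s -> I N p.
  elim: s hs {hI} => [|p s IH] hs; first by exists 0%N.
  have [|N h] := IH; first by move=> q qs; apply: hs; rewrite inE qs orbT.
  have [i Ii] := hs p (mem_head _ _); exists (maxn i N) => q.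
  rewrite inE => /orP[/eqP ->|/h hb]; first exact: IS (leq_maxl _ _) _ Ii.
  exact: IS (leq_maxr _ _) _ hb.
have [_] := hnx (iter N nx (exist _ Z0 FZ0)); apply.
apply: (clsd_chart c (Z := W N.+1)); first by apply: FFc; exact: svalP.
move=> p Ip x Ux Wx; have := hI p (ex_intro _ N.+1 Ip).
elim=> [|q /hN Iq|q r _ e _ e'|r q _ e].
- by rewrite meval0.
- exact: Iq.
- by rewrite mevalD e e' addr0.
- by rewrite mevalM e mulr0.
Qed.

(** The charts are treated one after the other: shrinking the set for a new chart does not change
    its trace on the charts already treated. *)
Lemma dcc (FF : set (set T)) : FF `<=` clsd X -> FF !=set0 ->
  exists2 Z, FF Z & forall Z', FF Z' -> Z' `<=` Z -> Z' = Z.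
Proof.
move=> FFc FF0; have [m [U [hU cov]]] := variety_charts vX.
suff : forall j, (j <= m)%N -> exists2 Z, FF Z & forall Z', FF Z' -> Z' `<=` Z ->
    forall i : 'I_m, (i < j)%N -> U i `&` Z `<=` Z'.
  move=> /(_ m (leqnn _))[Z FZ hZ]; exists Z => // Z' FZ' ZZ; apply/seteqP; split=> // x Zx.
  by have [i Ui] := cov x; exact: (hZ Z' FZ' ZZ i).
elim=> [|j IH] jm; first by have [Z FZ] := FF0; exists Z.
have [Z FZ hZ] := IH (ltnW jm).
have [n [phi c]] := hU (Ordinal jm).
pose G := [set Z' | FF Z' /\ Z' `<=` Z].
have Gc : G `<=` clsd X by move=> W [/FFc].
have G0 : G !=set0 by exists Z; split.
have [Z1 [F1 Z1Z] h1] := dcc_chart c Gc G0.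
exists Z1 => // Z' FZ' Z'Z1 i; rewrite ltnS leq_eqVlt => /orP[/eqP ij|ij].
  have -> : i = Ordinal jm by exact: val_inj.
  by apply: h1 => //; split=> //; exact: subset_trans Z1Z.
by move=> x [Ux /Z1Z Zx]; apply: (hZ Z' FZ' _ i ij) => //; exact: subset_trans Z1Z.
Qed.
End DCC.

(** * Extension of specializations *)

Section Ext.
Variables (k : closedFieldType) (T : Type) (W : set T) (x : nat -> T -> k).

(** The functions x 0, x 1, ... on W play the part of a generic point: [zer] singles out its
    algebraic relations, and [spec] its specializations with values in k. Points are infinite
    sequences so that one point serves for every number m of variables. *)
Definition ev m (p : {mpoly k[m]}) (v : nat -> k) : k := p.@[fun i : 'I_m => v i].
Definition zer m (p : {mpoly k[m]}) := forall t, W t -> ev p (fun i => x i t) = 0.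
Definition spec m (v : nat -> k) := forall p : {mpoly k[m]}, zer p -> ev p v = 0.

Hypothesis dom : forall m (p q : {mpoly k[m]}), zer (p * q) -> zer p \/ zer q.

Lemma evM m (p q : {mpoly k[m]}) v : ev (p * q) v = ev p v * ev q v.
Proof. by rewrite /ev mevalM. Qed.

Lemma evD m (p q : {mpoly k[m]}) v : ev (p + q) v = ev p v + ev q v.
Proof. by rewrite /ev mevalD. Qed.

Lemma ev_eq m (p : {mpoly k[m]}) v v' : (forall i, (i < m)%N -> v i = v' i) ->
  ev p v = ev p v'.
Proof. by move=> h; apply: meval_eq => i; apply: h. Qed.

Definition evP m (P : {poly {mpoly k[m]}}) (v : nat -> k) : {poly k} :=
  map_poly (meval (fun i : 'I_m => v i)) P.

Definition mup m (P : {poly {mpoly k[m]}}) : {mpoly k[m.+1]} :=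
  (map_poly (@mwiden m k) P).['X_ord_max].

Lemma ev_widen m (p : {mpoly k[m]}) v : ev (mwiden p) v = ev p v.
Proof.
rewrite /ev; elim/mpoly_ring_ind: p => [c|i|p q ep eq|p q ep eq].
- by rewrite mwidenC !mevalC.
- by rewrite mwidenX mnmwiden1 !mevalXU.
- by rewrite mwidenD !mevalD ep eq.
- by rewrite mwidenM !mevalM ep eq.
Qed.

Lemma ev_mup m (P : {poly {mpoly k[m]}}) v : ev (mup P) v = (evP P v).[v m].
Proof.
rewrite /mup /evP; elim/poly_ind: P => [|P c IH].
  by rewrite !rmorph0 !horner0 /ev meval0.
rewrite !rmorphD !rmorphM /= !map_polyX !map_polyC /= !hornerE /=.
move: IH (ev_widen c v); rewrite /ev => IH ec.
by rewrite mevalD mevalM IH ec mevalXU.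
Qed.

Lemma mup_surj m (p : {mpoly k[m.+1]}) : exists P, mup P = p.
Proof.
elim/mpoly_ring_ind: p => [c|i|p q [P <-] [Q <-]|p q [P <-] [Q <-]].
- by exists (c%:MP)%:P; rewrite /mup map_polyC hornerC /= mwidenC.
- case: (unliftP ord_max i) => [j ->|->].
    exists ('X_j)%:P; rewrite /mup map_polyC hornerC /= mwidenX mnmwiden1.
    by congr 'X_[U_(_)]; apply/val_inj; rewrite /= /bump leqNgt ltn_ord.
  by exists 'X; rewrite /mup map_polyX hornerX.
- by exists (P + Q); rewrite /mup rmorphD hornerD.
- by exists (P * Q); rewrite /mup rmorphM hornerM.
Qed.

Section Step.
Variable m : nat.
Implicit Types P Q G : {poly {mpoly k[m]}}.

Definition zc P := forall i, zer P`_i.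

Lemma mupM P Q : mup (P * Q) = mup P * mup Q.
Proof. by rewrite /mup rmorphM hornerM. Qed.
Lemma mupD P Q : mup (P + Q) = mup P + mup Q.
Proof. by rewrite /mup rmorphD hornerD. Qed.
Lemma mupC (c : {mpoly k[m]}) : mup c%:P = mwiden c.
Proof. by rewrite /mup map_polyC hornerC. Qed.

Lemma zer_widen (c : {mpoly k[m]}) : zer (mwiden c) <-> zer c.
Proof. by split=> h t Wt; have := h t Wt; rewrite ev_widen. Qed.

Lemma zerD n (p q : {mpoly k[n]}) : zer p -> zer q -> zer (p + q).
Proof. by move=> hp hq t Wt; rewrite evD hp // hq // addr0. Qed.

Lemma zerM n (p q : {mpoly k[n]}) : zer q -> zer (p * q).
Proof. by move=> hq t Wt; rewrite evM hq // mulr0. Qed.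

Lemma zer0 n : zer (0 : {mpoly k[n]}).
Proof. by move=> t _; rewrite /ev meval0. Qed.

Lemma zerN n (p : {mpoly k[n]}) : zer p -> zer (- p).
Proof. by move=> h; rewrite -mulN1r; apply: zerM. Qed.

Lemma zerX n (p : {mpoly k[n]}) c : zer (p ^+ c) -> W !=set0 -> zer p.
Proof.
move=> h [t Wt]; elim: c h => [|c IH]; last by rewrite exprS => /dom[].
by move=> /(_ t Wt); rewrite expr0 /ev meval1 => /eqP; rewrite oner_eq0.
Qed.

Lemma zc_spec P v : zc P -> spec m v -> evP P v = 0.
Proof.
move=> h hv; apply/polyP => i; rewrite coef0 /evP coef_map /=; exact: hv (h i).
Qed.

Lemma zc_zer P : zc P -> zer (mup P).
Proof.
move=> h t Wt; rewrite ev_mup (zc_spec h) ?horner0 // => p; exact.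
Qed.

Lemma zcM P Q : zc Q -> zc (P * Q).
Proof.
move=> zg i; rewrite coefM; apply: big_ind => [|? ? ? ?|j _].
- exact: zer0.
- exact: zerD.
- exact: zerM.
Qed.

Lemma zcB P Q : zc P -> zc Q -> zc (P - Q).
Proof. by move=> hP hQ i; rewrite coefB; apply: zerD (hP i) (zerN (hQ i)). Qed.

Lemma trunc P : ~ zc P -> exists P', [/\ zc (P - P'), (size P' <= size P)%N &
  ~ zer (lead_coef P')].
Proof.
have [d] := ubnP (size P); elim: d P => // d IH P; rewrite ltnS => sP nz.
case: (pselect (zer (lead_coef P))) => [zl|]; last first.
  by exists P; split=> // i; rewrite subrr coef0; exact: zer0.
have P0 : P != 0 by apply/eqP => P0; apply: nz => i; rewrite P0 coef0; exact: zer0.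
pose R : {poly {mpoly k[m]}} := lead_coef P *: 'X^((size P).-1).
have zR : zc R.
  move=> i; rewrite coefZ coefXn; case: eqP => _; rewrite ?mulr1 ?mulr0 //; exact: zer0.
have sPR : (size (P - R)%R < size P)%N.
  have sp : (0 < size P)%N by rewrite size_poly_gt0.
  rewrite -[X in (_ < X)%N](prednK sp) ltnS; apply/leq_sizeP => j.
  rewrite leq_eqVlt => /orP[/eqP <-|hj].
    by rewrite coefB coefZ coefXn eqxx mulr1 subrr.
  rewrite coefB coefZ coefXn gtn_eqF // mulr0 subr0 nth_default //.
  by rewrite -(prednK sp).
have [||P' [h1 h2 h3]] := IH (P - R); first exact: leq_trans sPR sP.
  move=> h; apply: nz => i; have := zerD (h i) (zR i).
  by rewrite coefB subrK.
exists P'; split=> //; last exact: leq_trans h2 (ltnW sPR).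
move=> i; have := zerD (h1 i) (zR i).
by rewrite !coefB addrAC subrK.
Qed.

Lemma div_eq P G : exists c Q r, G != 0 ->
  lead_coef G ^+ c *: P = Q * G + r /\ (size r < size G)%N.
Proof.
exists (scalp P G), (P %/ G), (P %% G) => G0.
by rewrite Pdiv.Idomain.divp_eq ltn_modp.
Qed.

Definition transc := forall P, zer (mup P) -> zc P.

Lemma lead_nz G : ~ zer (lead_coef G) -> G != 0.
Proof. by move=> h; apply/eqP => G0; apply: h; rewrite G0 lead_coef0; exact: zer0. Qed.

Lemma zer_mupB P Q : zc (P - Q) -> zer (mup P) -> zer (mup Q).
Proof.
move=> h hP; have -> : Q = P + - 1 * (P - Q) by rewrite mulN1r subKr.
by rewrite mupD mupM; apply: zerD => //; apply: zerM; exact: zc_zer.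
Qed.

(** Coefficients vanishing on W are first removed by [trunc]. A relation of least degree with
    nonvanishing leading coefficient then serves as minimal polynomial of [x m], without passing to
    a field of fractions. *)
Lemma minpoly : ~ transc -> exists G, [/\ zer (mup G), ~ zer (lead_coef G) &
  forall P, (size P < size G)%N -> zer (mup P) -> zc P].
Proof.
move=> nt; have [P0 [zP0 nP0]] : exists P, zer (mup P) /\ ~ zc P.
  by apply: contrapT => h; apply: nt => P zP; apply: contrapT => nz; apply: h; exists P.
have [d] := ubnP (size P0); elim: d P0 zP0 nP0 => // d IH P zP nP; rewrite ltnS => sP.
have [P' [h1 h2 h3]] := trunc nP; have zP' := zer_mupB h1 zP.
case: (pselect (exists Q, [/\ (size Q < size P')%N, zer (mup Q) & ~ zc Q])) => [[Q [sQ zQ nQ]]|h].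
  by apply: (IH Q) => //; apply: leq_trans sQ (leq_trans h2 sP).
exists P'; split=> // Q sQ zQ; apply: contrapT => nQ; apply: h; by exists Q.
Qed.

(** Pseudo-division of P by G leaves a remainder which is a relation of smaller degree, so all its
    coefficients vanish on W and at the specialization v. *)
Lemma minpoly_spec G P v tau : (forall P, (size P < size G)%N -> zer (mup P) -> zc P) ->
  zer (mup G) -> ~ zer (lead_coef G) -> zer (mup P) -> spec m v ->
  ev (lead_coef G) v != 0 -> (evP G v).[tau] = 0 -> (evP P v).[tau] = 0.
Proof.
move=> hm zG nG zP hv lv Gv; have G0 := lead_nz nG.
have [c [Q [r /(_ G0)[e sr]]]] := div_eq P G.
have zr : zc r.
  apply: hm => //; have -> : r = (lead_coef G ^+ c)%:P * P + - Q * G.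
    by rewrite mul_polyC e mulNr addrC addKr.
  by rewrite mupD !mupM; apply: zerD; exact: zerM.
have := congr1 (fun R => (evP R v).[tau]) e.
rewrite /evP -mul_polyC !rmorphD !rmorphM /= map_polyC /= -!/(evP _ _) (zc_spec zr hv).
rewrite addr0 !hornerM Gv mulr0 hornerC rmorphXn /= => /eqP.
by rewrite mulf_eq0 expf_eq0 (negPf (lv : (lead_coef G).@[_] != 0)) andbF => /eqP.
Qed.

(** This is the invertibility of P0 in the field generated by [x m] over the previous functions,
    with denominator c. An element e of least degree is taken in the ideal of G and P0, computed
    modulo polynomials whose coefficients vanish on W. *)
Lemma bezout G P0 : zer (mup G) -> ~ zer (lead_coef G) ->
  (forall P, (size P < size G)%N -> zer (mup P) -> zc P) -> ~ zer (mup P0) ->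
  exists c u w r, [/\ ~ zer c, zc r & c%:P = u * G + w * P0 + r].
Proof.
move=> zG nG hm nP0; have [t Wt] : W !=set0.
  by apply: contrapT => h; apply: nP0 => t Wt; case: h; exists t.
pose J e := exists u w r, zc r /\ e = u * G + w * P0 + r.
have Jlin e e' a b : J e -> J e' -> J (a * e + b * e').
  move=> [u [w [r [zr ->]]]] [u' [w' [r' [zr' ->]]]].
  exists (a * u + b * u'), (a * w + b * w'), (a * r + b * r'); split; last by ring.
  by move=> i; rewrite coefD; apply: zerD; exact: zcM.
have Jz e e' : J e -> zc (e - e') -> J e'.
  move=> [u [w [r [zr ->]]]] h; exists u, w, (r - (u * G + w * P0 + r - e')).
  by split; [exact: zcB | ring].
have zz : zc 0 by move=> i; rewrite coef0; exact: zer0.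
have JG : J G by exists 1, 0, 0; split=> //; ring.
have JP : J P0 by exists 0, 1, 0; split=> //; ring.
have [e [Je ne he]] : exists e, [/\ J e, ~ zer (lead_coef e) &
    forall f, J f -> (size f < size e)%N -> zc f].
  suff H d e : J e -> ~ zer (lead_coef e) -> (size e < d)%N -> exists e,
      [/\ J e, ~ zer (lead_coef e) & forall f, J f -> (size f < size e)%N -> zc f].
    exact: H JG nG (ltnSn _).
  elim: d e => // d IH e Je ne; rewrite ltnS => se.
  case: (pselect (exists f, [/\ J f, (size f < size e)%N & ~ zc f])) => [[f [Jf sf nf]]|h].
    have [f' [h1 h2 h3]] := trunc nf.
    apply: (IH f') => //; first exact: Jz Jf h1.
    exact: leq_trans (leq_ltn_trans h2 sf) se.
  exists e; split=> // f Jf sf; apply: contrapT => nf; apply: h; by exists f.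
have e0 := lead_nz ne.
have red P : J P -> exists c Q, zc (lead_coef e ^+ c *: P - Q * e).
  move=> JPP; have [c [Q [r /(_ e0)[eq sr]]]] := div_eq P e; exists c, Q.
  rewrite eq addrC addKr; apply: he => //.
  have -> : r = (lead_coef e ^+ c)%:P * P + - Q * e by rewrite mul_polyC eq mulNr addrC addKr.
  exact: Jlin.
have zdom P Q : zer (mup (P * Q)) -> zer (mup P) \/ zer (mup Q).
  by rewrite mupM; exact: dom.
have zscal P c : zer (mup (lead_coef e ^+ c *: P)) -> zer (mup P).
  rewrite -mul_polyC => /zdom[] //; rewrite mupC => /zer_widen h.
  by case: ne; apply: zerX h _; exists t.
case: (ltnP 1 (size e)) => [se|se]; last first.
  have [u [w [r [zr ee]]]] := Je; have := size1_polyC se => e1.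
  exists e`_0, u, w, r; split=> //; last by rewrite -e1.
  by move: ne; rewrite {1}e1 lead_coefC.
(* Here e has positive degree and divides G and P0 up to powers of its leading coefficient. If e is
   a relation, so is P0. Otherwise the cofactor [Q] of G is a relation of smaller degree, its
   coefficients vanish on W, and so would a leading coefficient of e or G. *)
case: nP0; have [c [Q zQ]] := red _ JG.
have zQe : zer (mup (Q * e)).
  apply: zer_mupB zQ _; rewrite -mul_polyC mupM; exact: zerM.
case: (zdom _ _ zQe) => [zQ'|ze]; last first.
  have [c' [Q' zQ'']] := red _ JP; apply: (zscal _ c').
  apply: (@zer_mupB (Q' * e)); last by rewrite mupM; exact: zerM.
  by have := zcB zz zQ''; rewrite sub0r opprB.
have G0 := lead_nz nG.
have zcQ : zc Q.
  apply: contrapT => nQ; have [Q' [h1 h2 h3]] := trunc nQ.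
  have zQ'' := zer_mupB h1 zQ'.
  have zQe' : zc (lead_coef e ^+ c *: G - Q' * e).
    have -> : lead_coef e ^+ c *: G - Q' * e =
       (lead_coef e ^+ c *: G - Q * e) - (- 1 * e) * (Q - Q') by ring.
    by apply: zcB => //; exact: zcM.
  have sQ : (size Q' < size G)%N.
    rewrite ltnNge; apply/negP => hQ.
    have zt : zer (lead_coef Q' * lead_coef e).
      have := zQe' (size (Q' * e)).-1; rewrite coefB coefZ -[(Q' * e)`_ _]/(lead_coef (Q' * e)).
      rewrite lead_coefM nth_default ?mulr0 ?sub0r.
        by move=> h; have := zerN h; rewrite opprK.
      rewrite size_mul ?(lead_nz h3) //; apply: leq_trans hQ _.
      by case: (size e) se => [|[|s]] // _; rewrite !addnS /= leq_addr.
    by case: (dom zt).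
  by apply: h3; exact: (hm Q' sQ zQ'').
have h := zQ (size G).-1; rewrite coefB coefZ in h.
have h2 : zer (Q * e)`_(size G).-1.
  by rewrite coefM; apply: big_ind => [|? ? ? ?|j _]; [exact: zer0 | exact: zerD | rewrite mulrC; exact: zerM].
have := zerD h h2; rewrite subrK => h3; case: (dom h3) => [h'|//].
by case: ne; apply: zerX h' _; exists t.
Qed.

Lemma step P0 : ~ zer (mup P0) -> exists s : {mpoly k[m]}, ~ zer s /\
 ((transc /\ forall v, spec m v -> ev s v != 0 -> evP P0 v != 0) \/
  exists G, [/\ zer (mup G), (1 < size G)%N, ~ zer (lead_coef G) &
    forall v, spec m v -> ev s v != 0 -> ev (lead_coef G) v != 0 /\
      forall tau, (evP G v).[tau] = 0 -> (evP P0 v).[tau] != 0 /\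
        forall P, zer (mup P) -> (evP P v).[tau] = 0]).
Proof.
move=> nP0; case: (pselect transc) => [ht|/minpoly[G [zG nG hm]]].
  have [i hi] : exists i, ~ zer P0`_i.
    by apply: contrapT => h; apply/nP0/zc_zer => i; apply: contrapT => h'; apply: h; exists i.
  exists P0`_i; split=> //; left; split=> // v hv; apply: contra_neq => P00.
  have : (evP P0 v)`_i = 0 by rewrite P00 coef0.
  by rewrite /evP coef_map.
have [c [u [w [r [nc zr e]]]]] := bezout zG nG hm nP0.
exists (lead_coef G * c); split; first by move=> /dom[].
right; exists G; split=> //.
  rewrite ltnNge; apply/negP => sG; apply: nG; move: zG; rewrite (size1_polyC sG).
  by rewrite mupC lead_coefC => /zer_widen.
move=> v hv; rewrite evM mulf_eq0 => /norP[lv cv]; split=> // tau Gv; split; last first.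
  by move=> P zP; exact: (minpoly_spec hm zG nG zP hv lv Gv).
have := congr1 (fun R => (evP R v).[tau]) e.
rewrite /evP !rmorphD !rmorphM /= map_polyC /= -!/(evP _ _) (zc_spec zr hv).
rewrite addr0 hornerC hornerD !hornerM Gv mulr0 add0r => e2.
by apply: contraNneq cv => P00; rewrite /ev e2 P00 mulr0.
Qed.

Lemma ext1 (p : {mpoly k[m.+1]}) : ~ zer p -> exists s : {mpoly k[m]}, ~ zer s /\
  forall v, spec m v -> ev s v != 0 -> exists v',
    [/\ forall i, (i < m)%N -> v' i = v i, spec m.+1 v' & ev p v' != 0].
Proof.
have [P <-] := mup_surj p => /step[s [ns hs]]; exists s; split=> // v hv sv.
have upd tau : (forall Q, zer (mup Q) -> (evP Q v).[tau] = 0) -> (evP P v).[tau] != 0 ->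
    exists v', [/\ forall i, (i < m)%N -> v' i = v i, spec m.+1 v' & ev (mup P) v' != 0].
  move=> h1 h2; exists (fun i => if i == m then tau else v i).
  have lt i : (i < m)%N -> (if i == m then tau else v i) = v i by move=> im; rewrite ltn_eqF.
  have eP Q : evP Q (fun i => if i == m then tau else v i) = evP Q v.
    apply/polyP => i; rewrite !coef_map /=; apply: meval_eq => j.
    by rewrite ltn_eqF.
  split=> //; last by rewrite ev_mup eP eqxx.
  by move=> q; have [Q <-] := mup_surj q => zQ; rewrite ev_mup eP eqxx h1.
case: hs => [[ht h]|[G [zG sG nG h]]].
  have [tau ht'] := inf_poly (h v hv sv); apply: (upd tau) => // Q /ht zQ.
  by rewrite (zc_spec zQ hv) horner0.
have [lv h'] := h v hv sv.
have sGv : size (evP G v) != 1%N.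
  by rewrite /evP size_map_poly_id0 ?neq_ltn ?sG ?orbT.
have [tau] := closed_rootP _ sGv; rewrite rootE => /eqP /h'[h1 h2].
exact: (upd tau).
Qed.

End Step.

(** Chevalley's theorem for coordinate projections. The point is extended by one coordinate at a
    time, and the open condition [s] produced by each step is the one imposed on the step before. *)
Lemma ext m n (p : {mpoly k[n + m]}) : ~ zer p -> exists s : {mpoly k[m]}, ~ zer s /\
  forall v, spec m v -> ev s v != 0 -> exists v',
    [/\ forall i, (i < m)%N -> v' i = v i, spec (n + m) v' & ev p v' != 0].
Proof.
elim: n p => [|n IH] p np; first by exists p; split=> // v hv pv; exists v.
have [s [ns hs]] := ext1 (m := n + m) np; have [s' [ns' hs']] := IH s ns.
exists s'; split=> // v hv sv; have [v1 [e1 hv1 sv1]] := hs' v hv sv.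
have [v2 [e2 hv2 sv2]] := hs v1 hv1 sv1; exists v2; split=> // i im.
by rewrite e2 ?e1 //; apply: leq_trans im _; exact: leq_addl.
Qed.

End Ext.

(** * Purely inseparable descent *)

Lemma dom_irr (k : closedFieldType) T (X : Defs.space k T) (Z U : set T) (x : nat -> T -> k) :
  rspace X -> irreducible_set X Z -> opn X U ->
  (forall i t, U t -> regat X t (x i)) ->
  forall m (p q : {mpoly k[m]}), zer (Z `&` U) x (p * q) ->
    zer (Z `&` U) x p \/ zer (Z `&` U) x q.
Proof.
move=> rX [_ irr] oU rx m p q h; apply: contrapT => /not_orP[np nq].
have pt (r : {mpoly k[m]}) : ~ zer (Z `&` U) x r ->
    exists V, [/\ opn X V, (Z `&` V) !=set0 &
      forall t, V t -> U t /\ ev r (fun i => x i t) != 0].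
  move=> nr; have [t [[Zt Ut] rt]] : exists t, (Z `&` U) t /\ ev r (fun i => x i t) != 0.
    apply: contrapT => h'; apply: nr => t Wt; apply/eqP/negPn/negP => e.
    by apply: h'; exists t.
  have rr : regat X t (fun t => ev r (fun i => x i t)).
    by apply: (ra_meval rX) => i; exact: rx.
  have [V [oV Vt hV]] := nbhI rX (nbh_open oU Ut) (rs_nz rX rr rt).
  by exists V; split=> //; exists t.
have [V [oV nV hV]] := pt p np; have [V' [oV' nV' hV']] := pt q nq.
have [t [[Zt /hV[Ut pt']] /hV'[_ qt]]] := irr V V' oV oV' nV nV'.
have := h t (conj Zt Ut); rewrite evM => /eqP.
by rewrite mulf_eq0 (negPf pt') (negPf qt).
Qed.

Lemma reindex_mpoly (k : closedFieldType) a M (h : 'I_a -> nat) (p : {mpoly k[a]}) :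
  (forall j, (h j < M)%N) -> exists P : {mpoly k[M]},
    forall v, ev P v = p.@[fun j => v (h j)].
Proof.
move=> hM; elim/mpoly_ring_ind: p => [c|i|p q [P hP] [Q hQ]|p q [P hP] [Q hQ]].
- by exists c%:MP => v; rewrite /ev !mevalC.
- by exists 'X_(Ordinal (hM i)) => v; rewrite /ev !mevalXU.
- by exists (P + Q) => v; rewrite evD mevalD hP hQ.
- by exists (P * Q) => v; rewrite evM mevalM hP hQ.
Qed.

Section FrobRoot.
Variables (k : closedFieldType) (p : nat).
Hypothesis hp : p \in [pchar k].

Lemma subX_frob (v : k) i :
  ('X - v%:P) ^+ (p ^ i)%N = 'X^(p ^ i) - (v ^+ (p ^ i)%N)%:P.
Proof.
have hpp : p \in [pchar {poly k}] := rmorph_pchar (@polyC k) hp.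
elim: i => [|i IH]; first by rewrite expn0 !expr1.
rewrite expnSr !exprM IH -!(pFrobenius_autE hpp) pFrobenius_autB_comm ?pFrobenius_autE; last exact: mulrC.
by rewrite -polyC_exp.
Qed.

(** With r = p^i r' and r' prime to p, G is c (X^(p^i) - v^(p^i))^r'. Its second coefficient in
    X^(p^i) is - c r' v^(p^i), and r' is invertible in k. *)
Lemma frob_root (G : {poly k}) (c v : k) r : (0 < r)%N -> c != 0 ->
  G = c *: ('X - v%:P) ^+ r ->
  let i := logn p r in let r' := (r %/ p ^ i)%N in
  r'%:R != 0 :> k /\ v ^+ (p ^ i) = - G`_(p ^ i * r'.-1) / (c * r'%:R).
Proof.
move=> r0 c0 -> i r'; have pp : prime p by case/andP: hp.
have Pi : (0 < p ^ i)%N by rewrite expn_gt0 prime_gt0.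
have [m cm em] := pfactor_coprime pp r0.
have em' : r' = m by rewrite /r' {1}em mulnK.
have er : r = (p ^ i * r')%N by rewrite em' mulnC.
have r'0 : (0 < r')%N by move: r0; rewrite {1}er muln_gt0 => /andP[].
have cp : ~~ (p %| r')%N by rewrite em' -prime_coprime.
have rn : r'%:R != 0 :> k by rewrite -(dvdn_pcharf hp).
split=> //; have -> : ('X - v%:P) ^+ r = ('X - (v ^+ (p ^ i))%:P) ^+ r' \Po 'X^(p ^ i).
  by rewrite rmorphXn /= comp_polyB comp_polyX comp_polyC -subX_frob -exprM -er.
rewrite coefZ coef_comp_poly_Xn // dvdn_mulr // mulKn //.
have -> : (('X - (v ^+ (p ^ i))%:P) ^+ r')`_r'.-1 = - (v ^+ (p ^ i) *+ r').
  have := @coefPn_prod_XsubC k (nseq r' (v ^+ (p ^ i))).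
  by rewrite size_nseq -lt0n !big_nseq iter_mulr_1 iter_addr_0; apply.
rewrite -mulr_natr; move: (v ^+ (p ^ i)) => u; field.
by rewrite c0 rn.
Qed.

End FrobRoot.

Section PI.
Variables (k : closedFieldType) (p : nat) (A : abvar k).
Hypothesis hp : p \in [pchar k].
Local Notation X := (ab_sp A).
Local Notation rA := (ab_rs A).
Local Notation vA := (ab_variety A).

Lemma nbh_dense x y (V W : set A) : nbh X x V -> nbh X y W -> exists z, V z /\ W z.
Proof. exact: (irr_nbh vA). Qed.

(* [v] is a function such that [v \o al] is regular; its values at [al x] is the
   only root of the minimal polynomial of [v \o al] over the functions of
   [al x], so some [p ^ i]-th power of [v] is a rational function. *)
Lemma insep_descent (al : A -> A) (v : A -> k) (V0 : set A) (y0 : A) :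
  hom al -> (forall y, exists x, al x = y) -> opn X V0 -> V0 y0 ->
  (forall x, V0 (al x) -> regat X x (v \o al)) ->
  exists i V1, [/\ opn X V1, V1 !=set0, V1 `<=` V0 &
     forall y, V1 y -> regat X y (fun y => v y ^+ (p ^ i))].
Proof.
move=> [alD mal] surj oV0 V0y0 hv; have [x0 ex0] := surj y0.
have [n [U [phi [cU Uy0]]]] := chart_at vA y0.
have [n' [U' [phi' [cU' U'x0]]]] := chart_at vA x0.
have rphi y i : U y -> regat X y (fun y => phi y i) by exact: (chart_coord vA cU).
have hco i : exists ad : {mpoly k[n']} * {mpoly k[n']}, ad.2.@[phi' x0] != 0 /\
    forall x, U' x -> ad.2.@[phi' x] != 0 -> phi (al x) i = ad.1.@[phi' x] / ad.2.@[phi' x].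
  have r : regat X x0 (fun x => phi (al x) i).
    by have := proj2 (mal x0) (fun y => phi y i); apply; rewrite ex0; exact: rphi.
  by have [a [d [hd h]]] := (chart_rat vA cU' _ U'x0).1 r; exists (a, d).
have [ad had] := choice hco.
have [a [d [d0 hva]]] : exists a d : {mpoly k[n']}, d.@[phi' x0] != 0 /\
    forall x, U' x -> d.@[phi' x] != 0 -> v (al x) = a.@[phi' x] / d.@[phi' x].
  by apply/(chart_rat vA cU' (v \o al) U'x0); apply: hv; rewrite ex0.
have [g [g0 hg]] : exists g : {mpoly k[n']}, g.@[phi' x0] != 0 /\
    forall x, U' x -> g.@[phi' x] != 0 -> U (al x) /\ V0 (al x).
  apply/(chart_nbh vA cU' [set x | U (al x) /\ V0 (al x)] U'x0).
  have := proj1 (mal x0) (U `&` V0); apply; rewrite ex0.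
  exact: nbhI (nbh_open (chart_opn cU) Uy0) (nbh_open oV0 V0y0).
pose D := d * g * \prod_i (ad i).2.
have DE xi : D.@[xi] != 0 -> [/\ d.@[xi] != 0, g.@[xi] != 0 & forall i, (ad i).2.@[xi] != 0].
  rewrite /D !mevalM !mulf_eq0 => /norP[/norP[? ?] h]; split=> // i.
  by apply: contraNneq h => e; rewrite (bigD1 i) //= mevalM e mul0r.
have D0 : D.@[phi' x0] != 0.
  rewrite /D !mevalM !mulf_neq0 // rmorph_prod; apply/prodf_neq0 => i _.
  exact: (had i).1.
pose W := [set x | U' x /\ D.@[phi' x] != 0].
have oW : opn X W.
  apply: (rs_openU rA) => x [Ux Dx].
  apply: nbhI (nbh_open (chart_opn cU') Ux) _ => //.
  exact: (rs_nz rA (chart_poly vA cU' D Ux) Dx).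
have Wx0 : W x0 by [].
have WU x : W x -> U (al x) /\ V0 (al x) by case=> Ux /DE[_ gx _]; exact: hg.
(* The generic point: n coordinates of [al x], then the value of v at [al x] in position n, then the
   n' coordinates of x itself. *)
pose xx (i : nat) (x : A) : k := if insub i is Some j then phi (al x) j else
  if i == n then v (al x) else
  if insub (i - n.+1)%N is Some j then phi' x j else 0.
have xx1 (i : 'I_n) x : xx i x = phi (al x) i by rewrite /xx valK.
have xx2 x : xx n x = v (al x) by rewrite /xx insubF ?ltnn // eqxx.
have xx3 (j : 'I_n') x : xx (n.+1 + j)%N x = phi' x j.
  rewrite /xx insubF; last by rewrite ltnNge ltnW // leq_addr.
  by rewrite gtn_eqF ?leq_addr // addKn valK.
have rxx i x : W x -> regat X x (xx i).
  move=> Wx; have [Ux V0x] := WU x Wx.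
  rewrite /xx; case: insubP => [j _ _|_].
    by have := proj2 (mal x) (fun y => phi y j); apply; exact: rphi.
  case: eqP => _; first exact: hv.
  case: insubP => [j _ _|_]; last exact: rs_cst.
  by apply: (chart_coord vA cU'); case: Wx.
have dm m (P Q : {mpoly k[m]}) : zer W xx (P * Q) -> zer W xx P \/ zer W xx Q.
  have := @dom_irr _ _ X setT W xx rA (variety_irreducible vA) oW rxx m P Q.
  by rewrite setTI.
have lt3 (j : 'I_n') : (n.+1 + j < n' + n.+1)%N by rewrite (addnC n') ltn_add2l.
have [DD hDD] := @reindex_mpoly k n' (n' + n.+1) (fun j => n.+1 + j)%N D lt3.
have nDD : ~ zer W xx DD.
  move=> /(_ x0 Wx0); rewrite hDD => /eqP; apply/negP.
  by rewrite (_ : (fun j : 'I_n' => xx (n.+1 + j)%N x0) = phi' x0) //; apply/funext => j.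
have [s [ns hs]] := ext dm nDD.
have spec_phi y : U y -> forall w : nat -> k, (forall i : 'I_n, w i = phi y i) -> spec W xx n w.
  move=> Uy w hw P zP; rewrite /ev (meval_eq _ hw); apply/eqP/negPn/negP => Py.
  have [y1 ey1] := surj y.
  have h1 : nbh X (al y1) [set z | P.@[phi z] != 0].
    by rewrite ey1; exact: (rs_nz rA (chart_poly vA cU P Uy) Py).
  have [z [/= Pz Wz]] := nbh_dense (proj1 (mal y1) _ h1) (nbh_open oW Wx0).
  have := zP z Wz; rewrite /ev (_ : (fun i : 'I_n => xx i z) = phi (al z)).
    by move/eqP; rewrite (negPf Pz).
  by apply/funext => i; rewrite xx1.
(* A specialization over [y] comes from a point above [y]. *)
have key y (w : nat -> k) : U y -> (forall i : 'I_n, w i = phi y i) -> spec W xx n.+1 w ->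
    ev s w != 0 -> w n = v y.
  move=> Uy hw sw hsw; have [v' [ev' sv' Dv']] := hs w sw hsw.
  pose xi (j : 'I_n') := v' (n.+1 + j)%N.
  rewrite hDD -/xi in Dv'.
  have [x Ux ex] : exists2 x, U' x & phi' x = xi.
    apply: (chart_onto cU') => q hq.
    have [Q hQ] := @reindex_mpoly k n' (n' + n.+1) (fun j => n.+1 + j)%N q lt3.
    rewrite -hQ; apply: sv' => x Wx; rewrite hQ.
    rewrite (_ : (fun j : 'I_n' => xx (n.+1 + j)%N x) = phi' x).
      by apply: hq; case: Wx.
    by apply/funext => j; rewrite xx3.
  have Wx : W x by split=> //; rewrite ex.
  have rel (i : nat) (b c : {mpoly k[n']}) : (i < n.+1)%N ->
      (forall x, W x -> xx i x = b.@[phi' x] / c.@[phi' x]) ->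
      (forall x, W x -> c.@[phi' x] != 0) -> v' i = xx i x.
    move=> im hbc c0.
    pose h (j : 'I_n'.+1) := if insub (val j) is Some j' then (n.+1 + (j' : 'I_n'))%N else i.
    have lt' (q : {mpoly k[n']}) : exists Q : {mpoly k[n' + n.+1]}, forall v0,
        ev Q v0 = q.@[fun j => v0 (n.+1 + j)%N].
      exact: (@reindex_mpoly k n' (n' + n.+1) (fun j => n.+1 + j)%N q lt3).
    have [Qb hQb] := lt' b; have [Qc hQc] := lt' c.
    have iM : (i < n' + n.+1)%N by apply: leq_trans im _; exact: leq_addl.
    have := sv' (Qc * 'X_(Ordinal iM) - Qb).
    have xe z : (fun j : 'I_n' => xx (n.+1 + j)%N z) = phi' z.
      by apply/funext => j; rewrite xx3.
    rewrite /ev mevalB mevalM mevalXU -!/(ev _ _) /=.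
    rewrite -/(ev Qc v') -/(ev Qb v') hQb hQc -/xi -ex => h1.
    have : c.@[phi' x] * v' i - b.@[phi' x] = 0.
      apply: h1 => z Wz; rewrite /ev mevalB mevalM mevalXU /=.
      rewrite -/(ev Qc (fun i => xx i z)) -/(ev Qb (fun i => xx i z)) hQb hQc xe.
      by rewrite (hbc z Wz) mulrC divfK ?subrr // c0.
    move/eqP; rewrite subr_eq0 => /eqP h2.
    by rewrite (hbc x Wx) -h2 mulrC mulKf ?c0.
  have ay : al x = y.
    apply: (chart_inj cU) => //; first by case: (WU x Wx).
    have im (i : 'I_n) : (i < n.+1)%N := ltnW (ltn_ord i).
    apply/funext => i; rewrite -xx1 -hw -ev' //.
    apply/esym/(rel i (ad i).1 (ad i).2) => [|z [Uz /DE[_ _ h]]|z [Uz /DE[_ _ h]]] //.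
    by rewrite xx1; apply: (proj2 (had i)).
  rewrite -ay -xx2 -ev' //; apply: (rel n a d) => // [z [Uz /DE[h _ _]]|z [Uz /DE[h _ _]]] //.
  by rewrite xx2; exact: hva.
have [S eS] := mup_surj s; have nS : ~ zer W xx (mup S) by rewrite eS.
have [s2 [ns2 hs2]] := step dm nS.
pose wy (y : A) (tau : k) (i : nat) : k := if insub i is Some j then phi y j else tau.
have wy1 y tau (i : 'I_n) : wy y tau i = phi y i by rewrite /wy valK.
have wy2 y tau : wy y tau n = tau by rewrite /wy insubF ?ltnn.
have evwy (P : {poly {mpoly k[n]}}) y tau : evP P (wy y tau) = evP P (wy y 0).
  by apply/polyP => i; rewrite !coef_map; apply: meval_eq => j; rewrite !wy1.
have uniqv y tau : U y -> (forall P : {poly {mpoly k[n]}}, zer W xx (mup P) -> (evP P (wy y 0)).[tau] = 0) ->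
    (evP S (wy y 0)).[tau] != 0 -> tau = v y.
  move=> Uy h1 h2; rewrite -(wy2 y tau); apply: key => //.
    by move=> q; have [Q <-] := mup_surj q => zQ; rewrite ev_mup evwy wy2 h1.
  by rewrite -eS ev_mup evwy wy2.
have [y1 [Uy1 V0y1 s2y1]] : exists y, [/\ U y, V0 y & ev s2 (wy y 0) != 0].
  apply: contrapT => h; apply: ns2 => x Wx; apply/eqP/negPn/negP => e; apply: h.
  have [? ?] := WU x Wx; exists (al x); split=> //; move: e; rewrite /ev.
  by rewrite (@meval_eq _ _ (fun i : 'I_n => wy (al x) 0 i) (fun i : 'I_n => xx i x)) // => i; rewrite wy1 xx1.
case: hs2 => [[ht h]|[G [zG sG nG h]]].
  (* If the value of v were transcendental over the coordinates of [al x], all but finitely many tau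
     would be admissible over y1, whereas [uniqv] admits only [v y1]. *)
  have sp := spec_phi y1 Uy1 (wy y1 0) (wy1 y1 0).
  have n0 := h _ sp s2y1.
  have [tau] := inf_poly (mulf_neq0 n0 (negbT (polyXsubC_eq0 (v y1)))).
  rewrite hornerM hornerXsubC mulf_eq0 => /norP[h1 h2].
  case/negP: h2; rewrite subr_eq0; apply/eqP; apply: uniqv => // P /ht zP.
  by rewrite (zc_spec zP sp) horner0.
pose r := (size G).-1; pose i := logn p r; pose r' := (r %/ p ^ i)%N.
have r0 : (0 < r)%N by rewrite /r; case: (size G) sG => [|[]].
pose c y := ev (lead_coef G) (wy y 0).
have root_form y : U y -> ev s2 (wy y 0) != 0 ->
    c y != 0 /\ evP G (wy y 0) = c y *: ('X - (v y)%:P) ^+ r.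
  move=> Uy sy; have sp := spec_phi y Uy (wy y 0) (wy1 y 0).
  have [lc hroot] := h _ sp sy; split=> //.
  have sGy : size (evP G (wy y 0)) = size G by rewrite /evP size_map_poly_id0.
  have lG : lead_coef (evP G (wy y 0)) = c y.
    by rewrite /lead_coef sGy /evP coef_map.
  have [rs ers] := closed_field_poly_normal (evP G (wy y 0)).
  have all_v z : z \in rs -> z = v y.
    move=> zrs; have [|h1 h2] := hroot z; last exact: uniqv.
    apply/eqP; rewrite -/(root _ z) ers rootZ ?lG // root_prod_XsubC //.
  have srs : size rs = r.
    have := sGy; rewrite ers size_scale ?lG // size_prod_XsubC /r => <- //.
  rewrite ers lG; congr (_ *: _).
  rewrite (eq_big_seq (fun=> 'X - (v y)%:P)); last by move=> z /all_v ->.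
  by rewrite big_const_seq count_predT iter_mulr_1 srs.
pose V1 := [set y | [/\ U y, V0 y & ev s2 (wy y 0) != 0]].
have rpol (P : {mpoly k[n]}) y : U y -> regat X y (fun y => ev P (wy y 0)).
  move=> Uy; apply: (ra_ext rA _ (chart_poly vA cU P Uy)) => z.
  by apply: meval_eq => j; rewrite wy1.
have oV1 : opn X V1.
  apply: (rs_openU rA) => y [Uy Vy sy].
  have := nbhI rA (nbhI rA (nbh_open (chart_opn cU) Uy) (nbh_open oV0 Vy))
    (rs_nz rA (rpol s2 y Uy) sy).
  by apply: nbhS => z [[? ?] ?].
exists i, V1; split=> //; [by exists y1 | by move=> y [] |].
move=> y [Uy Vy sy].
have [rn _] := frob_root hp r0 (proj1 (root_form y Uy sy)) (proj2 (root_form y Uy sy)).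
pose P := G`_(p ^ i * r'.-1).
apply: (rs_ext rA (f := fun y => - ev P (wy y 0) / (c y * r'%:R))).
  apply: nbhS (nbh_open oV1 (And3 Uy Vy sy)) => z [Uz Vz sz] /=.
  have [cz eG] := root_form z Uz sz; have [_ ->] := frob_root hp r0 cz eG.
  by rewrite /evP coef_map.
apply: (ra_div rA); first by apply: (ra_opp rA); exact: rpol.
  by apply: (rs_mul rA); [exact: rpol | exact: rs_cst].
by rewrite mulf_neq0 //; case: (root_form y Uy sy).
Qed.

End PI.

(** * Frobenius and divisibility *)

Lemma iter_hom (k : closedFieldType) (A : abvar k) (F : A -> A) m :
  hom F -> hom (iter m F).
Proof.
move=> hF; elim: m => [|m IH]; first exact: hom_id.
exact: (hom_comp IH hF).
Qed.

Section Frob.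
Variables (k : closedFieldType) (p e q : nat).
Hypotheses (hp : p \in [pchar k])
  (halg : forall x : k, exists m, (0 < m)%N /\ x ^+ (p ^ m) = x)
  (he : (0 < e)%N) (hq : q = (p ^ e)%N).
Variables (A : abvar k) (F : A -> A).
Hypothesis hF : abvar_frobenius q F.
Local Notation X := (ab_sp A).
Local Notation rA := (ab_rs A).
Local Notation vA := (ab_variety A).

Lemma homF : hom F. Proof. by apply/homP; case: hF. Qed.

Definition fchart n (U : set A) (phi : A -> 'I_n -> k) :=
  [/\ affine_chart X U phi, forall x, U (F x) <-> U x &
      forall x j, U x -> phi (F x) j = phi x j ^+ q].

Lemma fchart_ex x : exists n U (phi : A -> 'I_n -> k), fchart U phi /\ U x.
Proof.
have [[m [U [cov h]]] _] := hF; have [i Ui] := cov x.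
by have [n [phi [h1 h2 h3]]] := h i; exists n, (U i), phi.
Qed.

Lemma fchart_iter n U (phi : A -> 'I_n -> k) s : fchart U phi ->
  (forall x, U (iter s F x) <-> U x) /\
  forall x j, U x -> phi (iter s F x) j = phi x j ^+ (q ^ s).
Proof.
move=> [_ hU hphi]; elim: s => [|s [IH1 IH2]]; first by split.
split=> [x|x j Ux]; first by rewrite iterS hU.
by rewrite iterS hphi ?IH1 // IH2 // -exprM expnS mulnC.
Qed.

Lemma prime_p : prime p. Proof. by case/andP: hp. Qed.

Lemma frob_fix (c : k) m j : c ^+ (p ^ m) = c -> c ^+ (p ^ (m * j)) = c.
Proof.
move=> h; elim: j => [|j IH]; first by rewrite muln0 expn0 expr1.
by rewrite mulnS expnD exprM h IH.
Qed.

(** By [halg] each coordinate of x in an F-stable chart lies in a finite field, and a common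
    multiple of the exponents is a period. *)
Lemma F_periodic x : exists m, (0 < m)%N /\ iter m F x = x.
Proof.
have [n [U [phi [fc Ux]]]] := fchart_ex x; have [cU _ _] := fc.
have [mm hm] := choice (fun j => halg (phi x j)).
exists (\prod_j mm j)%N; split; first by apply: prodn_gt0 => j; case: (hm j).
have [h1 h2] := fchart_iter (\prod_j mm j)%N fc.
apply: (chart_inj cU) => //; first exact/h1.
apply/funext => j; rewrite h2 // hq -expnM (bigD1 j) //= mulnCA.
by apply: frob_fix; case: (hm j).
Qed.

Lemma iter_mul_fix x m j : iter m F x = x -> iter (m * j) F x = x.
Proof.
by move=> h; elim: j => [|j IH]; rewrite ?muln0 // mulnS iterD IH.
Qed.

Lemma F_inj : injective F.
Proof.
move=> x y eF; have [m [m0 hx]] := F_periodic x; have [m' [m0' hy]] := F_periodic y.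
rewrite -(iter_mul_fix m' hx) -(iter_mul_fix m hy) [(m' * m)%N]mulnC.
have : (0 < m * m')%N by rewrite muln_gt0 m0.
by case: (m * m')%N => // s _; rewrite !iterSr eF.
Qed.

Lemma F_surj y : exists x, F x = y.
Proof.
have [[|m] [//]] := F_periodic y; rewrite iterS => h; by exists (iter m F y).
Qed.

Lemma F_open V : opn X V -> opn X (F @` V).
Proof.
move=> oV; have : clsd X (F @` (~` V)).
  by apply: hom_closed; [exact: homF | rewrite /clsd setCK].
rewrite /clsd; congr (opn X _); apply/seteqP; split=> y.
  have [x <-] := F_surj y; move=> h; exists x => //; apply: contrapT => nV.
  by apply: h; exists x.
by move=> [x Vx <-] [x' nV /F_inj exx]; apply: nV; rewrite exx.
Qed.

Lemma rational_finite m : (0 < m)%N -> exists s : seq A, forall x, iter m F x = x -> x \in s.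
Proof.
move=> m0; have [[M [U [cov h]]] _] := hF.
have q1 : (1 < q ^ m)%N.
  by rewrite hq -expnM -(exp1n (e * m)) ltn_exp2r ?prime_gt1 ?prime_p // muln_gt0 he.
have [rs hrs] : exists rs : seq k, forall c, c ^+ (q ^ m) = c -> c \in rs.
  have [rs ers] := closed_field_poly_normal ('X^(q ^ m) - 'X : {poly k}).
  exists rs => c hc.
  have s1 : size ('X^(q ^ m) - 'X : {poly k}) = (q ^ m).+1.
    by rewrite size_polyDl size_polyXn // size_polyN size_polyX.
  have n0 : 'X^(q ^ m) - 'X != 0 :> {poly k} by rewrite -size_poly_eq0 s1.
  have : root ('X^(q ^ m) - 'X) c by rewrite rootE !hornerE hc subrr.
  by rewrite ers rootZ ?lead_coef_eq0 // root_prod_XsubC.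
have fin i : exists s : seq A, forall x, U i x -> iter m F x = x -> x \in s.
  have [n [phi fc]] := h i; have [cU _ _] := fc.
  have [h1 h2] := fchart_iter m fc.
  pose pt (f : {ffun 'I_n -> 'I_(size rs)}) : A :=
    if pselect (exists x, U i x /\ forall j, phi x j = nth 0 rs (f j)) is left P
    then sval (cid P) else 0.
  exists [seq pt f | f <- enum {ffun 'I_n -> 'I_(size rs)}] => x Ux hx.
  have hj j : phi x j \in rs by apply: hrs; rewrite -h2 // hx.
  have hi j : (index (phi x j) rs < size rs)%N by rewrite index_mem.
  apply/mapP; exists [ffun j => Ordinal (hi j)]; first by rewrite mem_enum.
  rewrite /pt; case: pselect => [P|[]]; last first.
    by exists x; split=> // j; rewrite ffunE /= nth_index.
  have [Uz hz] := svalP (cid P); apply: (chart_inj cU) => //.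
  by apply/funext => j; rewrite hz ffunE /= nth_index.
have [s hs] := choice fin.
exists (flatten [seq s i | i <- enum 'I_M]) => x hx; have [i Ui] := cov x.
by apply/flattenP; exists (s i); [apply/mapP; exists i; rewrite ?mem_enum | exact: hs].
Qed.

Lemma common_period (ys : seq A) : exists m, (0 < m)%N /\ forall y, y \in ys -> iter m F y = y.
Proof.
elim: ys => [|y ys [m [m0 h]]]; first by exists 1%N.
have [m' [m0' h']] := F_periodic y; exists (m * m')%N; rewrite muln_gt0 m0; split=> // z.
by rewrite inE => /orP[/eqP ->|/h hz]; [rewrite mulnC; exact: iter_mul_fix | exact: iter_mul_fix].
Qed.

Lemma pt_clsd (a : A) : clsd X [set a].
Proof.
apply: (rs_openU rA) => x nx.
have mx : mor X (prod_space X X) (fun x => (x, a)) by apply: mor_pair => //; exact: mor_cst.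
have := proj1 (mx x) _ (nbh_open (x := (x, a)) (variety_separated vA) nx).
by apply: nbhS => y.
Qed.

Section FiniteKernel.
Variable al : A -> A.
Hypotheses (hal : hom al) (comm : forall x, al (F x) = F (al x)).

(** A counting argument in place of dimensions. If the image Z of [al] were not A, it would be a
    proper closed subgroup, and irreducibility would give arbitrarily many points pairwise distinct
    modulo Z. Take one more of them than there are points in H, inside a finite group G of periodic
    points: their cosets of al(G) are disjoint in G, while G has at most as many elements as H times
    al(G). *)
Lemma finite_surj (H : seq A) : (forall x, al x = 0 -> x \in H) ->
  forall y, exists x, al x = y.
Proof.
move=> hH; apply: contrapT => nsurj.
have [z nz] : exists z, ~ exists x, al x = z.
  by apply: contrapT => h; apply: nsurj => y; apply: contrapT => h'; apply: h; exists y.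
pose Z := al @` setT.
have cZ : clsd X Z.
  apply: hom_closed => //; rewrite /clsd setCT.
  by apply: (rs_openU rA).
have ext' j : exists ys : seq A, size ys = j /\ pairwise (fun y y' => `[<~ Z (y - y')>]) ys.
  elim: j => [|j [ys [sy py]]]; first by exists [::].
  have : exists x, forall y, y \in ys -> ~ Z (x - y).
    have on y : exists x, nbh X x [set x | ~ Z (x - y)].
      exists (z + y); have := proj1 (mor_trans (- y) (z + y)) (~` Z); apply.
      apply: nbh_open => //; rewrite addrK => -[x _ ex]; by apply: nz; exists x.
    elim: ys {sy py} => [|y ys [x hx]]; first by exists 0.
    have oall : nbh X x [set x | forall y, y \in ys -> ~ Z (x - y)].
      have : forall y, y \in ys -> nbh X x [set x | ~ Z (x - y)].
        move=> w wy; have := proj1 (mor_trans (- w) x) (~` Z); apply.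
        by apply: nbh_open => //; exact: hx.
      elim: ys {hx} => [|w ys IH] hx; first by apply: nbhS (nbhT rA x).
      have h1 := hx w (mem_head _ _).
      have [|] := nbhI rA h1 (IH _); first by move=> v vy; apply: hx; rewrite inE vy orbT.
      move=> V [oV Vx VV]; exists V; split=> // t /VV[/= h2 h3] v.
      by rewrite inE => /orP[/eqP ->|/h3].
    have [x' hx'] := on y; have [t [/= h1 h2]] := irr_nbh vA oall hx'.
    by exists t => v; rewrite inE => /orP[/eqP ->|/h1].
  move=> [x hx]; exists (x :: ys); rewrite /= sy; split=> //; rewrite py andbT.
  by apply/allP => y yy; apply/asboolP; exact: hx.
have [ys [sy py]] := ext' (size H).+1.
have [m [m0 hm]] := common_period ys; have [G0 hG0] := rational_finite m0.
pose G := undup [seq x <- G0 | iter m F x == x].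
have uG : uniq G by exact: undup_uniq.
have memG x : (x \in G) = (iter m F x == x).
  rewrite mem_undup mem_filter; apply/andP/idP => [[]//|h]; split=> //.
  by apply: hG0; exact/eqP.
have hFm := iter_hom m homF.
have GD x y : x \in G -> y \in G -> x + y \in G.
  by rewrite !memG (proj1 hFm) => /eqP -> /eqP ->.
have Gal x : x \in G -> al x \in G.
  rewrite !memG => /eqP ex; apply/eqP.
  have cm s y : iter s F (al y) = al (iter s F y) by elim: s => //= s ->.
  by rewrite cm ex.
have GN x y : x \in G -> y \in G -> x - y \in G.
  by move=> hx hy; apply: GD => //; move: hy; rewrite !memG (homN _ hFm) => /eqP ->.
pose Im := undup [seq al x | x <- G].
have uI : uniq Im by exact: undup_uniq.
have le1 : (size G <= size H * size Im)%N.
  have [sec hsec] : exists sec : A -> A, forall y, y \in Im -> sec y \in G /\ al (sec y) = y.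
    have : forall y, exists x, y \in Im -> x \in G /\ al x = y.
      move=> y; case yI : (y \in Im); last by exists 0.
      by move: yI; rewrite mem_undup => /mapP[x xG ->]; exists x.
    by move=> /choice[sec hsec]; exists sec.
  have := uniq_leq_size uG (s2 := [seq h + sec y | h <- H, y <- Im]).
  rewrite size_allpairs; apply => x xG; apply/allpairsP.
  have yI : al x \in Im by rewrite mem_undup map_f.
  have [sG sa] := hsec _ yI; exists (x - sec (al x), al x) => /=; split=> //.
    by apply: hH; rewrite (homB _ _ hal) sa subrr.
  by rewrite subrK.
have le2 : (size ys * size Im <= size G)%N.
  rewrite -(size_allpairs (fun y z => y + z)); apply: uniq_leq_size; last first.
    move=> w /allpairsP[[y i] /= [yy iI ->]]; apply: GD.
      by rewrite memG hm.
    by move: iI; rewrite mem_undup => /mapP[x xG ->]; exact: Gal.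
  have ZI i i' : i \in Im -> i' \in Im -> Z (i - i').
    rewrite !mem_undup => /mapP[x _ ->] /mapP[x' _ ->].
    by exists (x - x') => //; rewrite (homB _ _ hal).
  have ZN u : Z u -> Z (- u).
    by move=> [x _ <-]; exists (- x) => //; rewrite (homN _ hal).
  elim: ys py {sy hm} => [|y ys IH] //= /andP[/allP hy py].
  rewrite cat_uniq (IH py) andbT; apply/andP; split.
    by rewrite map_inj_uniq //; exact: addrI.
  apply/hasPn => w /allpairsP[[y' i'] /= [yy iI ->]]; apply/mapP => -[i iI' e2].
  have /asboolP := hy y' yy; apply.
  have ei : i' = y + i - y' by rewrite -e2 addrC addKr.
  rewrite (_ : y - y' = i' - i); last by rewrite ei addrAC addrK.
  exact: ZI.
have I0 : (0 < size Im)%N.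
  have : 0 \in Im by rewrite mem_undup; apply/mapP; exists 0; rewrite ?(hom0 hal) // memG (hom0 hFm).
  by move=> h; rewrite lt0n size_eq0; apply: contraTneq h => ->; rewrite in_nil.
have := leq_trans le2 le1; rewrite sy leq_pmul2r // ltnn //.
Qed.

End FiniteKernel.

End Frob.

Lemma lb_exp_line (k : fieldType) T (X : Defs.space k T) L m : rspace X ->
  line_bundle X L -> line_bundle X (lb_exp L m).
Proof.
move=> rX [od cov rt tii tij]; split=> //=.
- move=> i j; apply: (reg_rat rX); first exact: rs_openI.
  move=> x [di dj]; apply: (ra_exp rX).
  by exists (Defs.dom L i `&` Defs.dom L j); split=> //; exact: rs_openI.
- by move=> i x di; rewrite tii // expr1n.
by move=> i j l x di dj dl; rewrite -exprMn tij.
Qed.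

(** The expansion of first order at the point o, with polynomial cofactors. *)
Lemma mpoly_at_point (k : fieldType) n (o : 'I_n -> k) (P : {mpoly k[n]}) :
  exists c : 'I_n -> {mpoly k[n]},
    P = (P.@[o])%:MP + \sum_i ('X_i - (o i)%:MP) * c i.
Proof.
elim/mpoly_ring_ind: P => [c|i|P Q [c hP] [d hQ]|P Q [c hP] [d hQ]].
- exists (fun=> 0); rewrite mevalC big1 ?addr0 // => i _; exact: mulr0.
- exists (fun j => (j == i)%:R); rewrite mevalXU (bigD1 i) //= eqxx mulr1.
  by rewrite big1 ?addr0 ?(addrC (o i)%:MP) ?subrK // => j /negPf ->; rewrite mulr0.
- exists (fun i => c i + d i); rewrite {1}hP {1}hQ mevalD mpolyCD addrACA -big_split /=.
  by congr (_ + _); apply: eq_bigr => i _; rewrite mulrDr.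
- exists (fun i => c i * Q + (P.@[o])%:MP * d i).
  rewrite mevalM mpolyCM {1}hP mulrDl {1}hQ mulrDr -addrA; congr (_ + _).
  rewrite addrC mulr_sumr mulr_suml -big_split /=; apply: eq_bigr => i _.
  by rewrite mulrDr mulrA mulrCA.
Qed.

(** * Verschiebung, finiteness of torsion and divisibility *)

Section Isolated.
Variables (k : closedFieldType) (p e q : nat).
Hypotheses (hp : p \in [pchar k])
  (halg : forall x : k, exists m, (0 < m)%N /\ x ^+ (p ^ m) = x)
  (he : (0 < e)%N) (hq : q = (p ^ e)%N).
Variables (A : abvar k) (F : A -> A).
Hypothesis hF : abvar_frobenius q F.
Local Notation X := (ab_sp A).
Local Notation rA := (ab_rs A).
Local Notation vA := (ab_variety A).
Local Notation hF' := (homF hF).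

Lemma frob_sub (x y : k) : (x - y) ^+ q = x ^+ q - y ^+ q.
Proof.
rewrite hq; elim: (e) => [|m IH]; first by rewrite expn0 !expr1.
by rewrite expnSr !exprM IH -!(pFrobenius_autE hp) pFrobenius_autB_comm //; exact: mulrC.
Qed.

Lemma frob_sum I (r : seq I) (f : I -> k) : (\sum_(i <- r) f i) ^+ q = \sum_(i <- r) f i ^+ q.
Proof.
have q0 : (0 < q)%N by rewrite hq expn_gt0 (prime_gt0 (prime_p hp)).
elim: r => [|i r IH]; first by rewrite !big_nil expr0n gtn_eqF.
have fD (x y : k) : (x + y) ^+ q = x ^+ q + y ^+ q.
  by have := frob_sub (x + y) y; rewrite addrK => ->; rewrite subrK.
by rewrite !big_cons fD IH.
Qed.

(** The map F psi has zero differential, so its fixed points are isolated. In coordinates, a fixed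
    point near 0 satisfies a linear system [M x] in the differences [phi x i - o i], and [M 0] is
    diagonal and invertible since q > 1. *)
Lemma frob_isolated (psi : A -> A) : hom psi ->
  nbh X 0 [set x | x = F (psi x) -> x = 0].
Proof.
move=> hpsi; have [_ mpsi] := hpsi; have [n [U [phi [fc U0]]]] := fchart_ex hF (0 : A).
have [cU hU hphi] := fc; pose o := phi 0.
have oq j : o j ^+ q = o j by rewrite -hphi // (hom0 hF').
have hco j : exists ad : {mpoly k[n]} * {mpoly k[n]}, ad.2.@[o] != 0 /\
    forall x, U x -> ad.2.@[phi x] != 0 -> phi (psi x) j = ad.1.@[phi x] / ad.2.@[phi x].
  have r : regat X 0 (fun x => phi (psi x) j).
    have := proj2 (mpsi 0) (fun x => phi x j); apply; rewrite (hom0 hpsi).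
    exact: (chart_coord vA cU).
  by have [a [d [hd h]]] := (chart_rat vA cU _ U0).1 r; exists (a, d).
have [ad had] := choice hco.
have vo j : ((ad j).1 - (o j)%:MP * (ad j).2).@[o] = 0.
  have [d0 /(_ 0 U0 d0)] := had j; rewrite (hom0 hpsi) -/o => e1.
  by rewrite mevalB mevalM mevalC {1}e1 divfK ?subrr.
have [c hc] := choice (fun j => mpoly_at_point o ((ad j).1 - (o j)%:MP * (ad j).2)).
pose M (x : A) : 'M[k]_n := \matrix_(j, i) ((i == j)%:R * (ad j).2.@[phi x] ^+ q -
   (phi x i - o i) ^+ q.-1 * (c j i).@[phi x] ^+ q).
have q1 : (1 < q)%N.
  by rewrite hq -(exp1n e) ltn_exp2r ?prime_gt1 ?(prime_p hp).
have key x : U x -> (forall j, (ad j).2.@[phi x] != 0) -> x = F (psi x) ->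
    M x *m (\col_i (phi x i - o i)) = 0.
  move=> Ux dn ex; have Ups : U (psi x) by apply/hU; rewrite -ex.
  apply/matrixP => j z; rewrite !mxE.
  have ej : (ad j).2.@[phi x] ^+ q * (phi x j - o j) =
     \sum_i (phi x i - o i) ^+ q * (c j i).@[phi x] ^+ q.
    have e1 : phi x j - o j = (((ad j).1 - (o j)%:MP * (ad j).2).@[phi x] / (ad j).2.@[phi x]) ^+ q.
      rewrite {1}ex hphi // -{1}oq -frob_sub; congr (_ ^+ q).
      by rewrite (proj2 (had j)) // mevalB mevalM mevalC mulrBl mulfK.
    rewrite e1 expr_div_n mulrC divfK ?expf_neq0 // (hc j) vo mpolyC0 add0r.
    rewrite raddf_sum /= frob_sum; apply: eq_bigr => i _.
    by rewrite mevalM mevalB mevalXU mevalC exprMn.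
  rewrite (eq_bigr (fun i => (i == j)%:R * ((ad j).2.@[phi x] ^+ q * (phi x i - o i)) -
     (phi x i - o i) ^+ q * (c j i).@[phi x] ^+ q)); last first.
    move=> i _; rewrite !mxE mulrBl mulrA; congr (_ - _).
    by rewrite mulrAC -exprSr prednK // ltnW.
  rewrite sumrB (bigD1 j) //= eqxx mul1r big1 ?addr0 => [|i /negPf ->]; last by rewrite mul0r.
  by rewrite ej subrr.
have d0 : \det (M 0) != 0.
  have -> : M 0 = diag_mx (\row_j (ad j).2.@[o] ^+ q).
    apply/matrixP => i j; rewrite !mxE subrr expr0n.
    have -> : q.-1 == 0%N = false by case: (q) q1 => [|[]].
    rewrite mul0r subr0 eq_sym; case: eqP => [->|_]; by rewrite ?mul1r ?mulr1n ?mul0r ?mulr0n.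
  by rewrite det_diag; apply/prodf_neq0 => j _; rewrite mxE expf_neq0 //; case: (had j).
have rM : regat X 0 (fun x => \det (M x)).
  pose m i j x := (j == i)%:R * (ad i).2.@[phi x] ^+ q -
    (phi x j - o j) ^+ q.-1 * (c i j).@[phi x] ^+ q.
  apply: (ra_ext rA (f := fun x => \sum_(s : 'S_n) (-1) ^+ s * \prod_i m i (s i) x)).
    by move=> x; apply: eq_bigr => s _; congr (_ * _); apply: eq_bigr => i _; rewrite mxE.
  apply: (ra_sum rA) => s _; apply: (rs_mul rA); first exact: rs_cst.
  apply: (ra_prod rA) => i _; rewrite /m.
  have rp P : regat X 0 (fun x => P.@[phi x]) by exact: (chart_poly vA cU).
  apply: (ra_sub rA); apply: (rs_mul rA).
  - exact: rs_cst.
  - exact: ra_exp.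
  - apply: (ra_exp rA); apply: (ra_sub rA); [exact: (chart_coord vA cU) | exact: rs_cst].
  - exact: ra_exp.
have hd : nbh X 0 [set x | forall j, (ad j).2.@[phi x] != 0].
  apply: (nbh_forall rA) => j; apply: (rs_nz rA (f := fun x => (ad j).2.@[phi x])).
    exact: (chart_poly vA cU).
  by case: (had j).
have := nbhI rA (nbh_open (chart_opn cU) U0) (nbhI rA hd (rs_nz rA rM d0)).
apply: nbhS => x [Ux [/= dn dM]] ex; apply: (chart_inj cU) => //.
apply/funext => i; apply/eqP; rewrite -subr_eq0; apply/eqP.
have := key x Ux dn ex; move/(congr1 (mulmx (invmx (M x)))).
rewrite mulKmx ?mulmx0 ?unitmxE ?unitfE // => /matrixP/(_ i ord0).
by rewrite !mxE.
Qed.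

(** In an infinite kernel take a minimal infinite closed subset. Its points are isolated by
    translation, so removing one leaves a smaller infinite closed subset. *)
Lemma isolated_finite (al : A -> A) : hom al ->
  nbh X 0 [set x | al x = 0 -> x = 0] -> exists H : seq A, forall x, al x = 0 -> x \in H.
Proof.
move=> hal iso; apply: contrapT => ninf.
have [_ mal] := hal.
pose inf (Z : set A) := ~ exists H : seq A, forall x, Z x -> x \in H.
pose ker := [set x | al x = 0].
have cK : clsd X ker.
  apply: (rs_openU rA) => x nx; have := proj1 (mal x) (~` [set 0]); apply.
  by apply: nbh_open; [exact: pt_clsd | exact: nx].
pose FF := [set Z | [/\ clsd X Z, Z `<=` ker & inf Z]].
have F1 : FF `<=` clsd X by move=> Z [].
have F2 : FF !=set0 by exists ker; split.
have [Z [cZ ZK infZ] minZ] := dcc vA F1 F2.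
have [z Zz] : exists z, Z z.
  by apply: contrapT => h; apply: infZ; exists [::] => x Zx; case: h; exists x.
pose Z' := Z `\` [set z].
have : Z' = Z.
  apply: minZ; last by move=> x [].
  split; last 2 first.
  - by move=> x [/ZK].
  - move=> [H hH]; apply: infZ; exists (z :: H) => x Zx; rewrite inE.
    by case: eqP => //= nx; apply: hH; split.
  apply: (rs_openU rA) => y ny; case: (pselect (Z y)) => Zy; last first.
    by apply: nbhS (nbh_open cZ Zy) => t nt [].
  have yz : y = z by apply: contrapT => h; apply: ny; split.
  subst y; have := proj1 (mor_trans (- z) z) _; rewrite subrr => /(_ _ iso).
  apply: nbhS => t /= ht [Zt nt]; apply: nt => /=; apply/eqP; rewrite -subr_eq0; apply/eqP.
  by apply: ht; rewrite (homB _ _ hal) (ZK _ Zt) (ZK _ Zz) subrr.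
by move=> eZ; have : Z z := Zz; rewrite -eZ => -[_]; apply.
Qed.

Variables (B : abvar k) (Pc : cocycle k (A * B)) (lam : A -> B).
Hypotheses (hB : is_dual Pc) (hlam : principal_polarization Pc lam)
  (hlamF : polarization_over Pc q F lam).

(** V is the Verschiebung. Since [lam] is defined over F_q, the bundle of [lam (F a)] is the
    Frobenius conjugate of that of [lam a], and pulling it back by F raises the transition functions
    of the latter to the q-th power. *)
Lemma adj_frob : exists V, [/\ hom V, adj lam hB F V & forall a, V (F a) = a *+ q].
Proof.
have [V [hV aV]] := adj_ex hB hlam hF'; exists V; split=> // a.
have [_ mF] := hF'.
apply: (lam_inj hlam); apply: (@dual_inj _ _ _ _ hB).
apply: (leq_trans_div rA) (leq_sym rA (aV (F a))) _.
rewrite (homMn _ _ (lam_hom hlam)).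
apply: (leq_trans_div rA) (leq_sym rA (Db_muln hB hlam (lam a) q)).
apply: (leq_sym rA).
have lL := fib_line hB (lam a); have lM := fib_line hB (lam (F a)).
apply/(lb_isoP rA (lb_exp_line q rA lL) (pull_line rA rA mF lM)
   (isdv_exp q (Db_dv hB (lam a))) (isdv_pull F (Db_dv hB (lam (F a))))).
have [d [t [hd ht [s [[rs hs] sn]]]]] := hlamF a.
have [od _ _ _ _] := lL; have [od' _ _ _ _] := lM.
have ed i : d i = F @` Defs.dom (fibre Pc (lam a)) i.
  apply/seteqP; split=> [y|y [x dx <-]]; last exact/hd.
  by have [x <-] := F_surj halg hq hF y => /hd dx; exists x.
have oi i : opn X (d i) by rewrite ed; exact: (F_open halg hq hF).
exists (fun i x => s i (F x)); split; last first.
  by move=> [i i'] x [/hd di di']; apply: (sn (i, i')).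
split=> [[i i']|[i i'] [j j'] x [di di'] [dj dj']]; last first.
  have := hs (i, i') (j, j') (F x) (conj ((hd i x).2 di) di') (conj ((hd j x).2 dj) dj').
  by rewrite /= ht.
apply: (reg_rat rA) => [|x [di di']].
  apply: (rs_openI rA); first exact: (od i).
  apply: (rs_openU rA) => x dx.
  exact: (proj1 (mF x) _ (nbh_open (od' i') dx)).
have := proj2 (mF x) (s (i, i')); apply.
exists (d i `&` Defs.dom (fibre Pc (lam (F a))) i'); split.
- exact: (rs_openI rA).
- by split=> //; exact/hd.
- exact: (rs (i, i')).
Qed.

Lemma comm_muln N (x : A) : F x *+ N = F (x *+ N).
Proof. by rewrite (homMn _ _ hF'). Qed.

(** Euler's theorem gives N^t = 1 + c q with t the totient of q. As q = F V, a point killed by N^t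
    is a fixed point of F composed with - c V, and these are isolated. *)
Lemma kernel_finite N : (0 < N)%N -> coprime N p -> exists H : seq A,
  forall x, x *+ N = 0 -> x \in H.
Proof.
move=> N0 cN; have [V [hV _ VF]] := adj_frob.
have FV y : F (V y) = y *+ q.
  by have [x <-] := F_surj halg hq hF y; rewrite VF comm_muln.
have cq : coprime N q by rewrite hq coprimeXr.
have q0 : (0 < q)%N by rewrite hq expn_gt0 (prime_gt0 (prime_p hp)).
pose t := totient q.
have t0 : (0 < t)%N by rewrite totient_gt0.
have [c hc] : exists c, (N ^ t = 1 + c * q)%N.
  exists ((N ^ t).-1 %/ q)%N; rewrite divnK ?add1n ?prednK ?expn_gt0 ?N0 //.
  rewrite -subn1 -eqn_mod_dvd ?expn_gt0 ?N0 //; apply/eqP.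
  exact: Euler_exp_totient.
have hpsi : hom (fun x => - (V x *+ c)) by exact/hom_opp/hom_muln.
have iso := frob_isolated hpsi.
have isoN : nbh X 0 [set x | x *+ N ^ t = 0 -> x = 0].
  apply: nbhS iso => x /= h xN; apply: h.
  apply/eqP; rewrite (homN _ hF') (homMn _ _ hF') FV -mulrnA -subr_eq0 opprK.
  by rewrite -[X in X + _]mulr1n -mulrnDr [(q * c)%N]mulnC -hc xN.
have [H hH] := isolated_finite (hom_muln_id A (N ^ t)%N) isoN.
exists H => x xN; apply: hH; rewrite -(prednK t0) expnS mulrnA xN mul0rn //.
Qed.

Hypothesis hord : ordinary_surface A p.

(** Surjectivity follows from the finiteness of the kernel; for the factor p of N the finiteness is
    the ordinarity of A. *)
Lemma divisible N : (0 < N)%N -> forall y : A, exists x, x *+ N = y.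
Proof.
move=> N0; have [m cm eN] := pfactor_coprime (prime_p hp) N0.
have m0 : (0 < m)%N by move: N0; rewrite eN muln_gt0 => /andP[].
have sm y : exists x : A, x *+ m = y.
  have [H hH] := kernel_finite m0 (etrans (coprime_sym _ _) cm).
  exact: (finite_surj hp halg he hq hF (hom_muln_id A m) (comm_muln m) hH).
have sp y : exists x : A, x *+ p = y.
  have [s [_ _ hs]] := hord.
  apply: (finite_surj hp halg he hq hF (hom_muln_id A p) (comm_muln p) (H := s)).
  by move=> x xp; rewrite hs xp.
have spi i y : exists x : A, x *+ p ^ i = y.
  elim: i y => [|i IH] y; first by exists y; rewrite expn0 mulr1n.
  by have [x <-] := IH y; have [z <-] := sp x; exists z; rewrite expnS mulrnA.
move=> y; have [x <-] := sm y; have [z <-] := spi (logn p N) x; exists z.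
by rewrite {1}eN mulnC mulrnA.
Qed.

End Isolated.

Lemma coprime_kill (V : zmodType) (x : V) m n : coprime m n -> x *+ m = 0 -> x *+ n = 0 -> x = 0.
Proof.
move=> cmn xm xn; case: (posnP m) => [m0|m0].
  by move: cmn; rewrite m0 /coprime gcd0n => /eqP n1; rewrite -xn n1 mulr1n.
have [u v e _] := egcdnP n m0.
have : x *+ (u * m) = 0 by rewrite mulnC mulrnA xm mul0rn.
by rewrite e (eqP cmn) mulrnDr mulr1n mulnC mulrnA xn mul0rn add0r.
Qed.

(** * Descent through multiplication by N, and nondegeneracy of the Weil pairing *)

Section Descent.
Variables (k : closedFieldType) (p e q : nat).
Hypotheses (hp : p \in [pchar k])
  (halg : forall x : k, exists m, (0 < m)%N /\ x ^+ (p ^ m) = x)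
  (he : (0 < e)%N) (hq : q = (p ^ e)%N).
Variables (A : abvar k) (F : A -> A).
Hypothesis hF : abvar_frobenius q F.
Local Notation X := (ab_sp A).
Local Notation rA := (ab_rs A).
Local Notation vA := (ab_variety A).
Local Notation hF' := (homF hF).
Variables (N : nat).
Hypotheses (N0 : (0 < N)%N) (surjN : forall y : A, exists x, x *+ N = y).

Definition morat (f : A -> A) x := (forall W, nbh X (f x) W -> nbh X x (f @^-1` W)) /\
            (forall g, regat X (f x) g -> regat X x (g \o f)).

Lemma hom_morat (f : A -> A) y1 : (forall x y, f (x + y) = f x + f y) -> morat f y1 -> hom f.
Proof.
move=> fD hf; split=> // x.
have f0 : f 0 = 0 by apply: (addrI (f 0)); rewrite -fD !addr0.
have fN u : f (- u) = - f u by apply/eqP; rewrite -addr_eq0 -fD addNr f0.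
have e1 z : f z = f (z + (y1 - x)) + f (x - y1).
  by rewrite -fD -(opprB y1 x) addrK.
have ex : x + (y1 - x) = y1 by rewrite addrC subrK.
have mt := mor_trans (y1 - x) x; have mt' := mor_trans (f (x - y1)) (f y1).
have ey : f y1 + f (x - y1) = f x by rewrite -fD addrC subrK.
rewrite ex in mt; rewrite ey in mt'; split=> [W /(proj1 mt')/(proj1 hf)/(proj1 mt)|g /(proj2 mt')/(proj2 hf)/(proj2 mt)].
  by apply: nbhS => z /=; rewrite -e1.
by apply: (ra_ext rA) => z /=; rewrite -e1.
Qed.

Lemma open_meet m (V : 'I_m -> set A) : (forall i, opn X (V i)) ->
  (forall i, V i !=set0) -> exists z, forall i, V i z.
Proof.
elim: m V => [|m IH] V oV nV; first by exists 0 => -[].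
have [z hz] := IH (fun i => V (lift ord0 i)) (fun i => oV _) (fun i => nV _).
have [y hy] := nV ord0.
have h1 : nbh X z [set z | forall i, V (lift ord0 i) z].
  by apply: (nbh_forall rA) => i; exact: nbh_open.
have [t [/= h2 h3]] := irr_nbh vA h1 (nbh_open (oV ord0) hy).
by exists t => i; case: (unliftP ord0 i) => [j|] ->.
Qed.

(** The quotient [rho] of f by N is at first a map of sets. Some p-power of each of its coordinates
    is regular near a common point, so a sufficiently high iterate of F makes it regular there, and
    additivity carries this to all points by translation. *)
Lemma factor_frob (f : A -> A) : hom f -> (forall x, x *+ N = 0 -> f x = 0) ->
  exists s g, hom g /\ forall x, g (x *+ N) = iter s F (f x).
Proof.
move=> hf fN; have [_ mf] := hf; have [sec hsec] := choice surjN.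
pose rho y := f (sec y).
have rhoN x : rho (x *+ N) = f x.
  apply/eqP; rewrite -subr_eq0 -(homB _ _ hf); apply/eqP/fN.
  by rewrite mulrnBl hsec subrr.
have rhoD x y : rho (x + y) = rho x + rho y.
  by rewrite -(hsec x) -(hsec y) -mulrnDl !rhoN (proj1 hf).
have [n [U [phi [fc U0]]]] := fchart_ex hF (0 : A); have [cU hU hphi] := fc.
pose V0 := [set y | U (rho y)].
have oV0 : opn X V0.
  have : clsd X ((fun x : A => x *+ N) @` [set x | ~ U (f x)]).
    apply: hom_closed; first exact: hom_muln_id.
    apply: (rs_openU rA) => x /= /contrapT Ux.
    apply: nbhS (proj1 (mf x) _ (nbh_open (chart_opn cU) Ux)) => z Uz.
    by move=> /=; apply.
  rewrite /clsd; congr (opn X _); apply/seteqP; split=> y.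
    by move=> h; apply: contrapT => nU; apply: h; exists (sec y); rewrite ?hsec.
  by move=> Uy [x nU ex]; apply: nU; rewrite -rhoN ex.
have rho0 : rho 0 = 0 by have := rhoN 0; rewrite mul0rn (hom0 hf).
have V00 : V0 0 by rewrite /V0 /= rho0.
have hj j : exists iV : nat * set A, [/\ opn X iV.2, iV.2 !=set0, iV.2 `<=` V0 &
     forall y, iV.2 y -> regat X y (fun y => phi (rho y) j ^+ (p ^ iV.1))].
  have [x|i [V1 [h1 h2 h3 h4]]] := insep_descent hp (v := fun y => phi (rho y) j)
     (hom_muln_id A N) surjN oV0 V00.
    rewrite /V0 /= rhoN => Ux.
    have := proj2 (mf x) (fun y => phi y j) (chart_coord vA cU j Ux).
    by apply: (ra_ext rA) => z /=; rewrite rhoN.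
  by exists (i, V1).
have [iV hiV] := choice hj.
have [y1 [V0y1 hy1]] : exists z, V0 z /\ forall j, (iV j).2 z.
  have [|i|z hz] := @open_meet n.+1 (fun i => if unlift ord0 i is Some j then (iV j).2 else V0).
  - by move=> i; case: (unlift _ _) => [j|] //; case: (hiV j).
  - by case: (unlift _ _) => [j|]; [case: (hiV j) | exists 0].
  exists z; split=> [|j]; first by have := hz ord0; rewrite unlift_none.
  by have := hz (lift ord0 j); rewrite liftK.
pose s := (\sum_j (iV j).1)%N.
have sj j : ((iV j).1 <= e * s)%N.
  apply: leq_trans (leq_pmull s he); by rewrite /s (bigD1 j) //= leq_addr.
have hFs := iter_hom s hF'; have [Us phis] := fchart_iter s fc.
pose g y := iter s F (rho y).
have gD x y : g (x + y) = g x + g y by rewrite /g rhoD (proj1 hFs).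
exists s, g; split; last by move=> x; rewrite /g rhoN.
apply: (hom_morat (y1 := y1) gD).
have nV0 := nbh_open oV0 V0y1.
have rg j : regat X y1 (fun y => phi (g y) j).
  have [o _ _ /(_ y1 (hy1 j)) r] := hiV j.
  apply: (rs_ext rA _ (ra_exp rA (p ^ (e * s - (iV j).1)) r)).
  apply: nbhS nV0 => y V0y /=.
  by rewrite -exprM -expnD subnKC // phis // hq -expnM.
have Ug : U (g y1) by exact/Us.
split=> [W /(chart_nbh vA cU _ Ug)[P [Py hP]]|u /(chart_rat vA cU _ Ug)[a [d [dy hd]]]].
  have rP : regat X y1 (fun y => P.@[phi (g y)]) by apply: (ra_meval rA).
  apply: nbhS (nbhI rA nV0 (rs_nz rA rP Py)) => y [V0y /= Pgy].
  by apply: hP => //; exact/Us.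
have ra P : regat X y1 (fun y => P.@[phi (g y)]) by apply: (ra_meval rA).
apply: (rs_ext rA _ (ra_div rA (ra a) (ra d) dy)).
apply: nbhS (nbhI rA nV0 (rs_nz rA (ra d) dy)) => y [V0y /= dgy].
by rewrite hd //; exact/Us.
Qed.

Variables (B : abvar k) (Pc : cocycle k (A * B)) (lam : A -> B).
Hypotheses (hB : is_dual Pc) (hlam : principal_polarization Pc lam).
Local Notation Db := (Db hB).

(* A trivialization of [N^* M] invariant under [A[N]] descends to a set-theoretic
   trivialization of [M], which becomes regular after raising to a power of [p]. *)
Lemma weil_nondeg b : coprime N p -> b *+ N = 0 ->
  (forall a, a *+ N = 0 -> weil Pc N a (lam b) 1) -> b = 0.
Proof.
move=> cN bN hw; have hlamb : lam b *+ N = 0.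
  by rewrite -(homMn _ _ (lam_hom hlam)) bN (hom0 (lam_hom hlam)).
have okb := Db_ok hB (lam b); pose D := Db (lam b).
have [f hf] := Db_tors hB hlam hlamb.
have fa a x : a *+ N = 0 -> f x = f (x + a).
  by move=> aN; have := weil_triv (hw a aN) hf x; rewrite mul1r.
have [sec hsec] := choice surjN; pose sg y := f (sec y).
have sgN x : sg (x *+ N) = f x.
  have h0 : (x - sec (x *+ N)) *+ N = 0 by rewrite mulrnBl hsec subrr.
  by rewrite /sg (fa _ (sec (x *+ N)) h0) addrC subrK.
have sg0 y : sg y != 0 by exact: diso_nz hf.
have mN := proj2 (hom_muln_id A N).
have [V0 [oV0 V00 hV0]] := okb 0.
have ev0 x : V0 (x *+ N) -> eqv X x (fun x => sg (x *+ N) * D 0 (x *+ N)) (fun=> 1).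
  move=> /hV0 e1; have fn : nbh X x [set x | f x != 0].
    by apply: nbhS (nbhT rA x) => z _; exact: diso_nz hf.
  have := eqv_trans rA (eqv_mul rA (eqv_refl rA fn) (eqv_pull (x := x) mN e1)) (hf x).
  by apply: (eqv_same (X := X)) => // z; rewrite sgN.
have rv x : V0 (x *+ N) -> regat X x ((fun y => sg y * D 0 y) \o (fun x => x *+ N)).
  by move=> /ev0/(eqv1 rA)[].
have [i [V1 [oV1 [y1 V1y1] V10 rV1]]] := insep_descent hp (hom_muln_id A N) surjN oV0 V00 rv.
pose P := (p ^ i)%N.
have e1 : eqv X y1 (fun y => sg y ^+ P * D y1 y ^+ P) (fun=> 1).
  have [x ex] := surjN y1.
  have h1 : eqv X y1 (fun y => (sg y * D 0 y) ^+ P) (fun=> 1).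
    apply/(eqv1 rA); split; first exact: rV1.
    rewrite expf_neq0 // mulf_neq0 //.
    by have [h _ _] := hV0 _ (V10 _ V1y1); exact: (nbh_pt h).
  have h2 := eqv_exp rA P (eqv_sym rA (hV0 _ (V10 _ V1y1))).
  have sn : nbh X y1 [set y | sg y ^+ P != 0].
    by apply: nbhS (nbhT rA y1) => z _; rewrite /= expf_neq0.
  have h3 := eqv_mul rA (eqv_refl rA sn) h2.
  apply: (eqv_trans rA h3); apply: (eqv_same (X := X)) h1 => // z.
  by rewrite exprMn.
(* Regularity is known at [y1] only. It spreads to any y by the translation by c = y1 - y, because
   the line bundle is invariant under translations; [kap] is the constant by which the two
   trivializations differ. *)
have tr : dtriv X (fun x y => D x y ^+ P) (fun y => sg y ^+ P).
  move=> y; pose c := y1 - y; have [c' ec] := surjN c.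
  have [u hu] := Db_trans hB (lam b) c.
  have h2 : diso X (fun x z => D (x *+ N + c) (z *+ N + c))
     (fun _ _ => 1) (fun x => f (x + c')).
    move=> x; have := diso_pull (mor_trans c') hf x.
    by apply: (eqv_same (X := X)) => // z; rewrite !mulrnDl ec.
  have h1 := diso_trans rA (diso_sym rA (diso_pull mN hu)) h2.
  have [kap hkap] := unit_const h1 hf.
  have un z : u z != 0 by exact: diso_nz hu.
  have kap0 : kap != 0.
    have := hkap 0; rewrite /= => e2; apply: contraTneq (diso_nz 0 h1) => k0.
    by rewrite /= e2 k0 mul0r eqxx.
  have es z : sg z = kap^-1 * (u z)^-1 * sg (z + c).
    have [x ex] := surjN z; rewrite -{1}ex sgN -ex -ec -mulrnDl sgN.
    by have := hkap x; rewrite /= => e2; rewrite -mulrA e2 mulKf.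
  have eyc : y + c = y1 by rewrite addrC subrK.
  have e1c : eqv X (y + c) (fun y => sg y ^+ P * D y1 y ^+ P) (fun=> 1) by rewrite eyc.
  have h3 := eqv_pull (x := y) (mor_trans c) e1c.
  have h4 := eqv_exp rA P (eqv_sym rA (hu y)); rewrite eyc in h4.
  have cn : nbh X y [set z | (kap^-1 * (u z)^-1) ^+ P * sg (z + c) ^+ P != 0].
    by apply: nbhS (nbhT rA y) => z _ /=; rewrite mulf_neq0 ?expf_neq0 ?mulf_neq0 ?invr_eq0.
  have h5 := eqv_mul rA (eqv_refl rA cn) h4.
  have kn : nbh X y [set z : A | kap^-1 ^+ P != 0].
    by apply: nbhS (nbhT rA y) => z _ /=; rewrite expf_neq0 ?invr_eq0.
  have hk : eqv X y (fun z => kap^-1 ^+ P) (fun=> 1).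
    by apply/(eqv1 rA); split; [exact: rs_cst | rewrite expf_neq0 ?invr_eq0].
  have h6 := eqv_mul rA hk h3.
  have : eqv X y (fun z => sg z ^+ P * D y z ^+ P)
     (fun z => (kap^-1 * (u z)^-1) ^+ P * sg (z + c) ^+ P * (u z * D y1 (z + c)) ^+ P).
    by apply: (eqv_same (X := X)) h5 => // z; rewrite (es z) -exprMn.
  move=> h7; apply: (eqv_trans rA h7); apply: (eqv_same (X := X)) h6 => [z|z]; last by rewrite mulr1.
  rewrite /= -!exprMn; congr (_ ^+ P); have := un z; move: (u z) => w w0.
  by move: (kap^-1) => kk; field.
have : lam b *+ P = 0.
  apply: (@dual_inj _ _ _ _ hB); apply: (leq_trans_div rA) (leq_sym rA (Db0 hB hlam)).
  apply: (leq_trans_div rA) (Db_muln hB hlam (lam b) P) _.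
  by exists (fun y => sg y ^+ P).
move=> bP; apply: (lam_inj hlam); rewrite (hom0 (lam_hom hlam)).
apply: (coprime_kill (m := N) (n := P)) => //.
by rewrite coprimeXr.
Qed.
End Descent.

(** * Dimension *)

Lemma mpoly_nz (k : closedFieldType) m (p : {mpoly k[m]}) : p != 0 ->
  exists v : nat -> k, ev p v != 0.
Proof.
elim: m p => [|m IH] p p0.
  have e : p = (ev p (fun=> 0))%:MP.
    elim/mpoly_ring_ind: {p0} p => [c|[]//|p r hp hr|p r hp hr].
    - by rewrite /ev mevalC.
    - by rewrite evD mpolyCD -hp -hr.
    - by rewrite evM mpolyCM -hp -hr.
  exists (fun=> 0); apply: contraNneq p0 => h; by rewrite e h mpolyC0.
have [P eP] := mup_surj p; have P0 : P != 0.
  by apply: contraNneq p0 => P0; rewrite -eP P0 /mup rmorph0 horner0.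
have [w hw] := IH (lead_coef P) (eq_ind_r (fun b => ~~ b) P0 (lead_coef_eq0 P)).
have eP0 : evP P w != 0.
  apply: contra_neq hw => e; have : (evP P w)`_(size P).-1 = 0 by rewrite e coef0.
  by rewrite /evP coef_map.
have [c hc] := inf_poly eP0.
exists (fun i => if i == m then c else w i); rewrite -eP ev_mup eqxx.
rewrite (_ : evP P _ = evP P w) //; apply/polyP => i; rewrite !coef_map.
by apply: meval_eq => j; rewrite ltn_eqF.
Qed.

Section Chain.
Variables (k : closedFieldType) (A : abvar k).
Local Notation X := (ab_sp A).
Local Notation rA := (ab_rs A).
Local Notation vA := (ab_variety A).
Variables (n : nat) (U : set A) (phi : A -> 'I_n -> k).
Hypothesis cU : affine_chart X U phi.

Definition xf (s : seq 'I_n) (i : nat) (t : A) : k := nth 0 [seq phi t j | j <- s] i.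

Definition indep (Z : set A) (s : seq 'I_n) :=
  forall p : {mpoly k[size s]}, zer (Z `&` U) (xf s) p -> p = 0.

Lemma xf_rat s i t : U t -> regat X t (xf s i).
Proof.
move=> Ut; case: (ltnP i (size s)) => hi; last first.
  by apply: (ra_ext rA _ (rs_cst rA t 0)) => y; rewrite /xf nth_default ?size_map.
case: s hi => // j s hi; have := chart_coord vA cU (nth j (j :: s) i) Ut.
by apply: (ra_ext rA) => y; rewrite /xf (nth_map j).
Qed.

Lemma indep_nz Z s (p : {mpoly k[size s]}) : indep Z s -> p != 0 ->
  exists t, [/\ Z t, U t & ev p (fun i => xf s i t) != 0].
Proof.
move=> hi p0; apply: contrapT => h; move/eqP: p0; apply; apply: hi => t [Zt Ut].
by apply/eqP/negPn/negP => e; apply: h; exists t.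
Qed.

Lemma irr_dom Z s : irreducible_set X Z -> forall m (p r : {mpoly k[m]}),
  zer (Z `&` U) (xf s) (p * r) -> zer (Z `&` U) (xf s) p \/ zer (Z `&` U) (xf s) r.
Proof.
move=> irr; apply: (dom_irr rA irr (chart_opn cU)) => i t Ut; exact: xf_rat.
Qed.

(** Apply [ext] to the coordinates s followed by all the coordinates of the chart. The extended
    specialization satisfies the equations of the chart and of Z, so it is a point of Z. *)
Lemma lift_point Z s : clsd X Z -> irreducible_set X Z -> indep Z s ->
  exists S : {mpoly k[size s]}, S != 0 /\ forall v : nat -> k, ev S v != 0 ->
    exists t, [/\ Z t, U t & forall i, (i < size s)%N -> xf s i t = v i].
Proof.
move=> cZ irr ind; pose ss := s ++ enum 'I_n.
have size_ss : size ss = (n + size s)%N by rewrite size_cat size_enum_ord addnC.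
have xs1 i t : (i < size s)%N -> xf ss i t = xf s i t.
  by move=> hi; rewrite /xf map_cat nth_cat size_map hi.
have xs2 (j : 'I_n) t : xf ss (size s + j)%N t = phi t j.
  rewrite /xf map_cat nth_cat size_map ltnNge leq_addr /= addKn.
  by rewrite (nth_map j) ?size_enum_ord // nth_ord_enum.
have zs (p : {mpoly k[size s]}) : zer (Z `&` U) (xf ss) p -> p = 0.
  move=> zp; apply: ind => t Wt; rewrite -(zp t Wt); apply: ev_eq => i hi.
  by rewrite xs1.
have [t0 [Zt0 Ut0 _]] := indep_nz ind (oner_neq0 {mpoly k[size s]}).
have n1 : ~ zer (Z `&` U) (xf ss) (1 : {mpoly k[(n + size s)]}).
  by move=> /(_ t0 (conj Zt0 Ut0))/eqP; rewrite /ev meval1 oner_eq0.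
have [S [nS hS]] := ext (irr_dom (s := ss) irr) n1.
exists S; split.
  by apply/eqP => S0; apply: nS; rewrite S0 => t _; rewrite /ev meval0.
move=> v Sv; have [|v' [ev' sv' _]] := hS v _ Sv.
  by move=> p /zs ->; rewrite /ev meval0.
have lt3 (j : 'I_n) : (size s + j < n + size s)%N by rewrite addnC ltn_add2r.
have [t Ut et] : exists2 t, U t & phi t = (fun j : 'I_n => v' (size s + j)%N).
  apply: (chart_onto cU) => r hr; have [R hR] := reindex_mpoly r lt3.
  rewrite -hR; apply: sv' => t [Zt Ut]; rewrite hR -(hr t Ut).
  by apply: meval_eq => j; rewrite xs2.
have Zt : Z t.
  suff h : U `&` [set t] `<=` Z by exact: (h t (conj Ut erefl)).
  apply: (clsd_chart vA cU cZ) => r hr y Uy ->; have [R hR] := reindex_mpoly r lt3.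
  rewrite et -hR; apply: sv' => z [Zz Uz]; rewrite hR -(hr z Uz Zz).
  by apply: meval_eq => j; rewrite xs2.
exists t; split=> // i hi; rewrite -ev' //.
case: s ind ss size_ss xs1 xs2 zs n1 S nS hS v Sv v' ev' sv' lt3 et hi {t0 Zt0 Ut0} => [//|j0 s'] ind ss size_ss xs1 xs2 zs n1 S nS hS v Sv v' ev' sv' lt3 et hi.
pose s := j0 :: s'; pose j := nth j0 s i.
have i1 : (i < n + size s)%N by apply: leq_trans hi (leq_addl _ _).
have := sv' ('X_(Ordinal i1) - 'X_(Ordinal (lt3 j))).
rewrite /ev mevalB !mevalXU /= => h; have {}h := h _.
have : v' i - v' (size s + j)%N = 0.
  apply: h => z Wz; rewrite /ev mevalB !mevalXU /= xs1 // -/s xs2.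
  by rewrite /xf (nth_map j0) // subrr.
move/eqP; rewrite subr_eq0 => /eqP ->; rewrite /xf (nth_map j0) // et.
by [].
Qed.

(** The last coordinate is fixed at a suitable value c, which keeps the others independent. Among
    the closed subsets of Z with this property a minimal one is taken. *)
Lemma chain_step Z s j : clsd X Z -> irreducible_set X Z -> indep Z (rcons s j) ->
  exists Z', [/\ clsd X Z', irreducible_set X Z', Z' `<` Z & indep Z' s].
Proof.
move=> cZ irr ind; have [S [S0 hS]] := lift_point cZ irr ind.
have ss : size (rcons s j) = (size s).+1 by rewrite size_rcons.
move: S S0 hS; rewrite ss => S S0 hS.
have [P eP] := mup_surj S.
(* The value c is taken from a point where [S] does not vanish, so that [S] remains nonzero after
   substitution of c for the last variable. *)
have [w hw] := mpoly_nz S0; pose c := w (size s).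
have Pc0 : P.[c%:MP] != 0.
  apply: contraNneq hw => e; rewrite -eP ev_mup.
  suff -> : (evP P w).[c] = ev P.[c%:MP] w by rewrite e /ev meval0.
  by rewrite /evP /ev -horner_map /= mevalC.
have xr i t : (i < size s)%N -> xf (rcons s j) i t = xf s i t.
  by move=> hi; rewrite /xf map_rcons nth_rcons size_map hi.
have xl t : xf (rcons s j) (size s) t = phi t j.
  by rewrite /xf map_rcons nth_rcons size_map ltnn eqxx.
pose FF := [set Y | [/\ clsd X Y, Y `<=` Z, forall t, Y t -> U t -> phi t j = c & indep Y s]].
have F1 : FF `<=` clsd X by move=> Y [].
have F2 : FF !=set0.
  exists (Z `&` [set t | ~ (U t /\ phi t j != c)]); split.
  - apply: (rs_openU rA) => t nt; case: (pselect (Z t)) => Zt; last first.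
      by apply: nbhS (nbh_open cZ Zt) => z nz [].
    have [Ut nc] : U t /\ phi t j != c by apply: contrapT => h; apply: nt; split.
    have rt : regat X t (fun t => phi t j - c).
      by apply: (ra_sub rA); [exact: (chart_coord vA cU) | exact: rs_cst].
    have := nbhI rA (nbh_open (chart_opn cU) Ut) (rs_nz rA rt _); rewrite subr_eq0 => /(_ nc).
    by apply: nbhS => z [Uz /=]; rewrite subr_eq0 => hz [_ /=]; apply.
  - by move=> t [].
  - by move=> t [_ /= h] Ut; apply/eqP/negPn/negP => e; apply: h.
  move=> p zp; apply/eqP/negPn/negP => p0.
  have [v hv] := mpoly_nz (mulf_neq0 p0 Pc0); move: hv; rewrite evM mulf_eq0 => /norP[pv Pv].
  pose v' i := if i == size s then c else v i.
  have [|t [Zt Ut et]] := hS v'.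
    rewrite -eP ev_mup {2}/v' eqxx (_ : evP P v' = evP P v).
      by rewrite /evP -[c](@mevalC _ k (fun i : 'I_(size s) => v i)) horner_map.
    by apply/polyP => i; rewrite !coef_map; apply: meval_eq => l; rewrite /v' ltn_eqF.
  move/eqP: pv; apply; rewrite (@ev_eq _ _ _ v (fun i => xf s i t)); last first.
    by move=> i hi; rewrite -xr // et ?ltnS ?(ltnW hi) // /v' ltn_eqF.
  apply: zp; split=> //; split=> //= -[_]; rewrite -xl et ?ss //.
  by rewrite /v' eqxx eqxx.
(* Minimality gives irreducibility: each closed set [Z' \ W] smaller than Z' carries a nonzero
   relation between the coordinates s, and if two open sets were disjoint on Z' the product of their
   relations would hold on Z'. *)
have [Z' [cZ' Z'Z hc ind'] minZ] := dcc vA F1 F2.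
exists Z'; split=> //.
  have [t [Zt _ _]] := indep_nz ind' (oner_neq0 {mpoly k[size s]}).
  split; first by exists t.
  move=> V V' oV oV' [x [Zx Vx]] [y [Zy Vy]]; apply: contrapT => h.
  have sm W x' : opn X W -> Z' x' -> W x' -> exists p : {mpoly k[size s]}, p != 0 /\
      zer ((Z' `&` ~` W) `&` U) (xf s) p.
    move=> oW Zx' Wx'; apply: contrapT => h'.
    have e : Z' `&` ~` W = Z'.
      apply: minZ; last by move=> z [].
      split.
      - apply: (rs_openU rA) => z nz; case: (pselect (Z' z)) => Zz; last first.
          by apply: nbhS (nbh_open cZ' Zz) => u nu [].
        have Wz : W z by apply: contrapT => nW; apply: nz.
        by apply: nbhS (nbh_open oW Wz) => u Wu [_]; apply.
      - by move=> z [/Z'Z].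
      - by move=> z [Zz _]; exact: hc.
      - by move=> p zp; apply/eqP/negPn/negP => p0; apply: h'; exists p.
    by have : Z' x' := Zx'; rewrite -e => -[_]; apply.
  have [p [p0 zp]] := sm V x oV Zx Vx; have [r [r0 zr]] := sm V' y oV' Zy Vy.
  move/eqP: (mulf_neq0 p0 r0); apply; apply: ind' => z [Zz Uz]; rewrite evM.
  case: (pselect (V z)) => Vz; last by rewrite zp ?mul0r.
  rewrite zr ?mulr0 //; split=> //; split=> // V'z; apply: h; by exists z.
split=> // e; have := ind; rewrite /indep ss => ind2.
have h : 'X_ord_max - c%:MP = 0 :> {mpoly k[(size s).+1]}.
  apply: ind2 => t [Zt Ut]; rewrite /ev mevalB mevalXU mevalC /= xl hc ?subrr //; exact: e.
have : ev ('X_ord_max - c%:MP : {mpoly k[(size s).+1]}) (fun=> c + 1) = 0.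
  by rewrite h /ev meval0.
by rewrite /ev mevalB mevalXU mevalC addrAC subrr add0r => /eqP; rewrite oner_eq0.
Qed.

Lemma no_indep3 a b c : dimension_is X 2 -> ~ indep setT [:: a; b; c].
Proof.
move=> [_ nch] ind; apply: nch.
have cT : clsd X setT by rewrite /clsd setCT; apply: (rs_openU rA).
have iT := variety_irreducible vA.
have [Z2 [c2 i2 s2 d2]] := chain_step (s := [:: a; b]) (j := c) cT iT ind.
have [Z1 [c1 i1 s1 d1]] := chain_step (s := [:: a]) (j := b) c2 i2 d2.
have [Z0 [c0 i0 s0 d0]] := chain_step (s := [::]) (j := a) c1 i1 d1.
exists (fun i => match i with 0%N => Z0 | 1%N => Z1 | 2%N => Z2 | _ => setT end).
by split=> [[|[|[|i]]]|[|[|[|i]]]].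
Qed.

Lemma max_indep : dimension_is X 2 -> U !=set0 -> exists s, [/\ indep setT s,
  (size s <= 2)%N & forall j, ~ indep setT (rcons s j)].
Proof.
move=> hd [t0 Ut0].
have ind0 : indep setT [::].
  move=> p zp; apply/eqP/negPn/negP => p0; have [v hv] := mpoly_nz p0.
  move/eqP: hv; apply; rewrite -(zp t0 (conj I Ut0)); exact: ev_eq.
case: (pselect (exists a, indep setT [:: a])) => [[a ia]|h1]; last first.
  by exists [::]; split=> // j hj; apply: h1; exists j.
case: (pselect (exists b, indep setT [:: a; b])) => [[b ib]|h2]; last first.
  by exists [:: a]; split=> // j hj; apply: h2; exists j.
by exists [:: a; b]; split=> // j; exact: no_indep3.
Qed.

End Chain.

(** * Growth of the coordinate ring *)

Lemma lin_dep (k : fieldType) (J : finType) N (v : 'I_N -> J -> k) : (#|J| < N)%N ->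
  exists lam : 'I_N -> k, (exists i, lam i != 0) /\ forall j, \sum_i lam i * v i j = 0.
Proof.
move=> hN; pose M := \matrix_(i < N, j < #|J|) v i (enum_val j).
have : kermx M != 0.
  rewrite -mxrank_eq0 mxrank_ker -lt0n subn_gt0.
  exact: leq_ltn_trans (rank_leq_col M) hN.
move=> /rowV0Pn[u /sub_kermxP uM u0]; exists (u 0); split.
  by have [j uj] := matrix0Pn _ u0; move: uj => [j' uj]; exists j'; rewrite -(ord1 j).
move=> j; have := congr1 (fun B : 'rV_#|J| => B 0 (enum_rank j)) uM; rewrite !mxE => uM0.
rewrite -[RHS]uM0; apply: eq_bigr => i _; by rewrite mxE enum_rankK.
Qed.

Section Growth.
Variables (k : closedFieldType) (A : abvar k).
Local Notation X := (ab_sp A).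
Local Notation rA := (ab_rs A).
Local Notation vA := (ab_variety A).
Variables (n : nat) (U : set A) (phi : A -> 'I_n -> k).
Hypothesis cU : affine_chart X U phi.

Lemma reg_prod0 f g : (forall t, U t -> regat X t f) -> (forall t, U t -> regat X t g) ->
  (forall t, U t -> f t * g t = 0) -> (exists2 t, U t & f t != 0) ->
  forall t, U t -> g t = 0.
Proof.
move=> rf rg h [t0 Ut0 ft0] t Ut; apply/eqP/negPn/negP => gt.
have n1 := nbhI rA (nbh_open (chart_opn cU) Ut0) (rs_nz rA (rf _ Ut0) ft0).
have n2 := rs_nz rA (rg _ Ut) gt.
have [z [[Uz fz] gz]] := irr_nbh vA n1 n2.
by move/eqP: (h z Uz); rewrite mulf_eq0 (negPf fz) (negPf gz).
Qed.

Variable s : seq 'I_n.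
Hypothesis maxs : forall j, ~ indep U phi setT (rcons s j).
Hypothesis inds : indep U phi setT s.
Local Notation xs := (xf phi s).
Local Notation pv P t := (ev P (fun i => xs i t)).

Lemma pv_reg (P : {mpoly k[size s]}) t : U t -> regat X t (fun t => pv P t).
Proof. by move=> Ut; apply: (ra_meval rA) => i; exact: (xf_rat cU). Qed.

Lemma alg_rel j : exists (P : {poly {mpoly k[size s]}}), P != 0 /\
  forall t, U t -> \sum_(i < size P) pv P`_i t * phi t j ^+ i = 0.
Proof.
have := @maxs j; rewrite /indep size_rcons => /existsNP[p /not_implyP[zp /eqP p0]].
have [P eP] := mup_surj p; exists P; split.
  by apply: contraNneq p0 => P0; rewrite -eP P0 /mup rmorph0 horner0.
move=> t Ut; have := zp t (conj I Ut); rewrite -eP ev_mup (horner_coef_wide _ (size_poly _ _)).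
have -> : xf phi (rcons s j) (size s) t = phi t j.
  by rewrite /xf map_rcons nth_rcons size_map ltnn eqxx.
have eq (Q : {mpoly k[size s]}) : ev Q (fun i => xf phi (rcons s j) i t) = pv Q t.
  by apply: ev_eq => l hl; rewrite /xf map_rcons nth_rcons size_map hl.
move=> h0; rewrite -[RHS]h0; apply: eq_bigr => i _; by rewrite /evP coef_map /= -[meval _ _]/(ev _ _) eq.
Qed.

Section Span.
Variable D : nat.

Definition mono (ka : nat -> nat) (io : 'I_n -> nat) (t : A) : k :=
  (\prod_(i < size s) xs i t ^+ ka i) * \prod_(j < n) phi t j ^+ io j.

(** The span on U of the monomials with exponents below c in the transcendence basis and below D in
    all coordinates: at most c^(size s) D^n of them, of which only the first factor grows. *)
Inductive Sp (c : nat) : (A -> k) -> Prop :=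
| Sp0 : Sp c (fun=> 0)
| Sp_add f g : Sp c f -> Sp c g -> Sp c (fun t => f t + g t)
| Sp_scale a f : Sp c f -> Sp c (fun t => a * f t)
| Sp_mono ka io : (forall i, (ka i < c)%N) -> (forall j, (io j < D)%N) -> Sp c (mono ka io)
| Sp_ext f g : Sp c f -> (forall t, U t -> f t = g t) -> Sp c g.

Lemma SpS c c' f : (c <= c')%N -> Sp c f -> Sp c' f.
Proof.
move=> h; elim=> {f} [|f g _ ? _|a f _|ka io hk hi|f g _ H e].
- exact: Sp0.
- exact: Sp_add.
- exact: Sp_scale.
- by apply: Sp_mono => // i; apply: leq_trans (hk i) h.
- exact: Sp_ext H e.
Qed.

Lemma Sp_sum (I : Type) (r : seq I) c (f : I -> A -> k) : (forall i, Sp c (f i)) ->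
  Sp c (fun t => \sum_(i <- r) f i t).
Proof.
move=> h; elim: r => [|i r IH].
  by apply: Sp_ext (Sp0 c) _ => t _; rewrite big_nil.
by apply: Sp_ext (Sp_add (h i) IH) _ => t _; rewrite big_cons.
Qed.

Lemma Sp_map (m : A -> k) c c' :
  (forall ka io, (forall i, (ka i < c)%N) -> (forall j, (io j < D)%N) ->
     Sp c' (fun t => m t * mono ka io t)) ->
  forall f, Sp c f -> Sp c' (fun t => m t * f t).
Proof.
move=> h f; elim=> {f} [|f g _ H _ H'|a f _ H|ka io hk hi|f g _ H e].
- by apply: Sp_ext (Sp0 _) _ => t _; rewrite mulr0.
- by apply: Sp_ext (Sp_add H H') _ => t _; rewrite mulrDr.
- by apply: Sp_ext (Sp_scale a H) _ => t _; rewrite mulrCA.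
- exact: h.
- by apply: Sp_ext H _ => t Ut; rewrite e.
Qed.

Lemma Sp_x c (i : 'I_(size s)) f : Sp c f -> Sp c.+1 (fun t => xs i t * f t).
Proof.
apply: Sp_map => ka io hk hi.
apply: Sp_ext (Sp_mono (ka := fun l => (ka l + (l == i))%N) _ hi) _ => [l|t _].
  by have := hk l; case: (_ == _); lia.
rewrite /mono mulrA; congr (_ * _); rewrite (bigD1 i) //= [in RHS](bigD1 i) //= eqxx addn1 exprS mulrA.
by congr (_ * _); apply: eq_bigr => l; rewrite -val_eqE => /negPf ->; rewrite addn0.
Qed.

Lemma Sp_poly (P : {mpoly k[size s]}) : exists e, forall c f, Sp c f ->
  Sp (c + e) (fun t => pv P t * f t).
Proof.
elim/mpoly_ring_ind: P => [a|i|P Q [e h] [e' h']|P Q [e h] [e' h']].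
- exists 0%N => c f hf; rewrite addn0; apply: Sp_ext (Sp_scale a hf) _ => t _.
  by rewrite /ev mevalC.
- exists 1%N => c f hf; rewrite addn1; apply: Sp_ext (Sp_x i hf) _ => t _.
  by rewrite /ev mevalXU.
- exists (e + e')%N => c f hf; rewrite addnA.
  have h1 := SpS (leq_addr e' _) (h c f hf).
  have h2 := SpS (leq_addr e _) (h' c f hf).
  rewrite addnAC in h2; apply: Sp_ext (Sp_add h1 h2) _ => t _; by rewrite evD mulrDl.
exists (e' + e)%N => c f hf; rewrite addnA.
by apply: Sp_ext (h _ _ (h' _ _ hf)) _ => t _; rewrite evM mulrA.
Qed.

Lemma Sp_coef c f : Sp c f ->
  exists co : {ffun 'I_(size s) -> 'I_c} * {ffun 'I_n -> 'I_D} -> k, forall t, U t ->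
    f t = \sum_z co z * mono (fun i => if insub i is Some i' then val (z.1 i') else 0%N)
                             (fun j => val (z.2 j)) t.
Proof.
elim=> {f} [|f g _ [co h] _ [co' h']|a f _ [co h]|ka io hk hi|f g _ [co h] e].
- by exists (fun=> 0) => t _; rewrite big1 // => z _; rewrite mul0r.
- exists (fun z => co z + co' z) => t Ut; rewrite h // h' // -big_split.
  by apply: eq_bigr => z _; rewrite mulrDl.
- exists (fun z => a * co z) => t Ut; rewrite h // mulr_sumr.
  by apply: eq_bigr => z _; rewrite mulrA.
- pose z0 : {ffun 'I_(size s) -> 'I_c} * {ffun 'I_n -> 'I_D} :=
    ([ffun i => Ordinal (hk (val i))], [ffun j => Ordinal (hi j)]).
  exists (fun z => (z == z0)%:R) => t Ut; rewrite (bigD1 z0) //= eqxx mul1r big1 ?addr0.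
    rewrite /mono; congr (_ * _); apply: eq_bigr => i _; last by rewrite ffunE.
    by rewrite valK ffunE.
  by move=> z /negPf ->; rewrite mul0r.
by exists co => t Ut; rewrite -e // h.
Qed.

End Span.

(* [a] clears the leading coefficients of the algebraic relations of the coordinates over the
   transcendence basis, so that multiplying by [a] reduces the powers above [D]. *)
Lemma Sp_coord : exists (D : nat) (a : {mpoly k[size s]}), [/\ (0 < D)%N, a != 0 &
  forall j, exists e, forall c f, Sp D c f ->
    Sp D (c + e) (fun t => pv a t * (phi t j * f t))].
Proof.
have /choice[P hP] := alg_rel.
pose D := (\sum_j size (P j)).+1; exists D, (\prod_j lead_coef (P j)); split=> //.
  by rewrite prodf_seq_neq0; apply/allP => j _; rewrite lead_coef_eq0; case: (hP j).
move=> j; set a' := \prod_(j' | j' != j) lead_coef (P j').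
have ea t : pv (\prod_j lead_coef (P j)) t = pv a' t * pv (lead_coef (P j)) t.
  by rewrite (bigD1 j) //= evM mulrC.
have [e0 h0] := Sp_poly D (\prod_j lead_coef (P j)).
have [e1 h1] := Sp_poly D a'.
have /choice[ei hi] : forall i : 'I_(size (P j)), exists e, forall c f, Sp D c f ->
  Sp D (c + e) (fun t => pv (P j)`_i t * f t) by move=> i; exact: Sp_poly.
pose E := (\sum_i ei i)%N; exists (e0 + (E + e1))%N => c f hf.
have sP : (0 < size (P j))%N by rewrite size_poly_gt0; case: (hP j).
have sD : (size (P j) < D)%N by rewrite ltnS (bigD1 j) //= leq_addr.
suff : Sp D (c + (e0 + (E + e1))) (fun t => (pv (\prod_j lead_coef (P j)) t * phi t j) * f t).
  by move=> h; apply: Sp_ext h _ => t _; rewrite mulrA.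
apply: Sp_map hf => ka io hk hio.
case: (ltnP (io j).+1 D) => hj.
  have m1 : Sp D c (fun t => phi t j * mono ka io t).
    apply: Sp_ext (Sp_mono (io := fun l => (io l + (l == j))%N) hk _) _ => [l|t _].
      by case: eqP => [->|_]; rewrite ?addn1 ?addn0.
    rewrite /mono mulrCA; congr (_ * _); rewrite (bigD1 j) //= [in RHS](bigD1 j) //= eqxx addn1 exprS mulrA.
    by congr (_ * _); apply: eq_bigr => l /negPf ->; rewrite addn0.
  have := SpS (leq_addr (E + e1) _) (h0 _ _ m1); rewrite -addnA => h.
  by apply: Sp_ext h _ => t _; rewrite mulrA.
have ej : (io j).+1 = D by apply/eqP; rewrite eqn_leq hio.
(* In the remaining case multiplication by the coordinate produces the exponent D. The relation
   [P j], multiplied by the d-th power of the coordinate, has D as its highest exponent and rewrites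
   this power. *)
pose d := (D - (size (P j)).-1)%N.
have hd : ((size (P j)).-1 + d)%N = D by rewrite subnKC //; lia.
have mi (i : 'I_(size (P j))) : (i < (size (P j)).-1)%N ->
    Sp D c (mono ka (fun l => if l == j then (i + d)%N else io l)).
  move=> hi'; apply: Sp_mono => // l; case: eqP => // _.
  by rewrite -hd ltn_add2r.
have m2 : Sp D (c + E) (fun t => \sum_(i < size (P j) | (i < (size (P j)).-1)%N)
    - pv (P j)`_i t * mono ka (fun l => if l == j then (i + d)%N else io l) t).
  have hh (i : 'I_(size (P j))) : Sp D (c + E) (fun t => if (i < (size (P j)).-1)%N then
    - pv (P j)`_i t * mono ka (fun l => if l == j then (i + d)%N else io l) t else 0).
    case: (boolP (i < (size (P j)).-1)%N) => hi'; last exact: Sp0.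
    have := Sp_scale (-1) (hi i _ _ (mi i hi')) => h.
    apply: (@SpS _ (c + ei i)); first by rewrite leq_add2l /E (bigD1 i) //= leq_addr.
    by apply: Sp_ext h _ => t _; rewrite mulN1r mulNr.
  by apply: Sp_ext (Sp_sum (index_enum _) hh) _ => t _; rewrite -big_mkcond.
have := SpS (leq_addr e0 _) (h1 _ _ m2).
have -> : (c + E + e1 + e0 = c + (e0 + (E + e1)))%N by lia.
move=> h.
apply: Sp_ext h _ => t Ut; rewrite ea -!mulrA; congr (_ * _).
have mE i : mono ka (fun l => if l == j then i else io l) t =
    phi t j ^+ i * ((\prod_(i < size s) xs i t ^+ ka i) * \prod_(l < n | l != j) phi t l ^+ io l).
  rewrite /mono [\prod_(l < n) _](bigD1 j) //= eqxx mulrCA; congr (_ * (_ * _)).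
  by apply: eq_bigr => l /negPf ->.
have -> : mono ka io t = mono ka (fun l => if l == j then io j else io l) t.
  by congr (_ * _); apply: eq_bigr => l _; case: eqP => // ->.
rewrite mE [phi t j * _]mulrA -exprS ej -hd exprD.
under eq_bigr do rewrite mE exprD !mulrA; rewrite !mulrA -!mulr_suml; congr (_ * _ * _ * _).
have [_ /(_ t Ut)] := hP j; move: (P j) sP => Q; rewrite /lead_coef.
case: (size Q) => // z _; rewrite big_ord_recr /= => /eqP; rewrite addrC addr_eq0 => /eqP ->.
rewrite -sumrN big_mkcond big_ord_recr /= ltnn addr0.
by apply: eq_bigr => i _; rewrite ltn_ord mulNr.
Qed.

(** After multiplication by a^M, a polynomial of degree M lies in [Sp] with bound 1 + M E, which is
    linear in M. More polynomials than spanning monomials are linearly dependent, and a^M can be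
    cancelled because A is irreducible. *)
Lemma growth : exists C, forall M N (f : 'I_N -> {mpoly k[n]}),
  (forall i, msize (f i) <= M.+1)%N -> (C * M.+1 ^ size s < N)%N ->
  exists lam : 'I_N -> k, (exists i, lam i != 0) /\
    forall t, U t -> \sum_i lam i * (f i).@[phi t] = 0.
Proof.
have [D [a [D0 a0 /choice[e he]]]] := Sp_coord.
have [e0 he0] := Sp_poly D a; pose E := (e0 + \sum_j e j)%N.
have hE c f : Sp D c f -> Sp D (c + E) (fun t => pv a t * f t).
  by move=> hf; apply: SpS (he0 _ _ hf); rewrite leq_add2l leq_addr.
have hEj j c f : Sp D c f -> Sp D (c + E) (fun t => pv a t * (phi t j * f t)).
  move=> hf; apply: SpS (he j _ _ hf); rewrite leq_add2l /E (bigD1 j) //=.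
  by rewrite addnCA leq_addr.
have mon M (m : 'X_{1..n}) : (mdeg m <= M)%N ->
    Sp D (1 + M * E) (fun t => pv a t ^+ M * 'X_[m].@[phi t]).
  elim: M m => [|M IH] m hm.
    have m0 : m = 0%MM by apply/eqP; rewrite -mdeg_eq0 -leqn0.
    have h1 : Sp D (1 + 0 * E) (mono (fun=> 0%N) (fun=> 0%N)) by exact: Sp_mono.
    apply: Sp_ext h1 _ => t _.
    by rewrite m0 mpolyX0 meval1 mulr1 /mono; do 2 (rewrite big1 ?mul1r; last by move=> i _; rewrite expr0).
  rewrite mulSnr addnA; case: (posnP (mdeg m)) => hm0.
    have := hE _ _ (IH m _); rewrite hm0 => /(_ isT) h.
    by apply: Sp_ext h _ => t _; rewrite mulrA -exprS.
  have [j hj] : exists j, (0 < m j)%N.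
    apply: contrapT => h; move: hm0; rewrite mdegE big1 // => j _.
    by case: (posnP (m j)) => // hj; case: h; exists j.
  have mE : m = (m - U_(j) + U_(j))%MM.
    rewrite submK //; apply/mnm_lepP => l; rewrite mnm1E; case: eqP => // <-.
    by [].
  have hm' : (mdeg (m - U_(j))%MM <= M)%N.
    by move: hm; rewrite {1}mE mdegD mdeg1 addn1.
  apply: Sp_ext (hEj j _ _ (IH _ hm')) _ => t _.
  rewrite [in RHS]mE mpolyXD mevalM [_.@[_] * 'X_[U_(j)].@[_]]mulrC mevalXU exprS.
  by rewrite -!mulrA; congr (_ * _); rewrite mulrCA.
have pol M (f : {mpoly k[n]}) : (msize f <= M.+1)%N ->
    Sp D (1 + M * E) (fun t => pv a t ^+ M * f.@[phi t]).
  move=> hf.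
  have hh m : Sp D (1 + M * E) (fun t => if m \in msupp f then
      f@_m * (pv a t ^+ M * 'X_[m].@[phi t]) else 0).
    case: (boolP (m \in msupp f)) => hm; last exact: Sp0.
    by apply: Sp_scale; apply: mon; rewrite -ltnS; apply: leq_trans hf; apply: msize_mdeg_lt.
  apply: Sp_ext (Sp_sum (msupp f) hh) _ => t _.
  rewrite [in RHS](mpolyE f) raddf_sum /= mulr_sumr big_seq [RHS]big_seq; apply: eq_bigr => m hm.
  by rewrite hm mevalZ mulrCA.
exists (E.+1 ^ size s * D ^ n)%N => M N f hf hN.
have /choice[co hco] := fun i => Sp_coef (pol M (f i) (hf i)).
have [|lam [hl h]] := lin_dep co.
  rewrite card_prod !card_ffun !card_ord; apply: leq_ltn_trans hN.
  rewrite mulnAC leq_mul2r; apply/orP; right; rewrite -expnMn.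
  by case: (size s) => // g; rewrite leq_exp2r //; nia.
exists lam; split=> //.
apply: (@reg_prod0 (fun t => pv a t ^+ M)) => [t Ut|t Ut|t Ut|].
- by apply: (ra_exp rA); exact: pv_reg.
- apply: (ra_sum rA) => i _; apply: (rs_mul rA); [exact: rs_cst | exact: (chart_poly vA cU)].
- rewrite mulr_sumr; under eq_bigr do rewrite mulrCA (hco _ t Ut) mulr_sumr.
  rewrite exchange_big big1 // => z _; under eq_bigr do rewrite mulrA.
  by rewrite -mulr_suml h mul0r.
have [t [_ Ut h']] := indep_nz inds a0.
by exists t => //; exact: expf_neq0.
Qed.

End Growth.

(** * Degrees of endomorphisms *)

Section MSize.
Variables (R : idomainType) (n : nat).
Implicit Types p r : {mpoly R[n]}.

Lemma msize_add d p r : (msize p <= d -> msize r <= d -> msize (p + r) <= d)%N.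
Proof. by move=> hp hr; apply: leq_trans (msizeD_le p r) _; rewrite geq_max hp. Qed.

Lemma msize_mul d e p r : (msize p <= d.+1 -> msize r <= e.+1 -> msize (p * r) <= (d + e).+1)%N.
Proof.
case: (eqVneq p 0) => [->|p0]; first by rewrite mul0r msize0.
case: (eqVneq r 0) => [->|r0]; first by rewrite mulr0 msize0.
by move=> hp hr; rewrite msizeM //; lia.
Qed.

Lemma msize_exp d p i : (msize p <= d.+1 -> msize (p ^+ i) <= (i * d).+1)%N.
Proof.
move=> hp; elim: i => [|i IH]; first by rewrite expr0 msize1.
by rewrite exprS mulSn; exact: msize_mul.
Qed.

Lemma msize_widen d e p : (d <= e -> msize p <= d.+1 -> msize p <= e.+1)%N.
Proof. by move=> h1 h2; apply: leq_trans h2 _. Qed.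

End MSize.

Section Degree.
Variables (k : closedFieldType) (A : abvar k).
Local Notation X := (ab_sp A).
Local Notation rA := (ab_rs A).
Local Notation vA := (ab_variety A).
Variables (n : nat) (U : set A) (phi : A -> 'I_n -> k).
Hypothesis cU : affine_chart X U phi.

Definition frac (a : 'I_n -> {mpoly k[n]}) (b : {mpoly k[n]}) v x :=
  [/\ U x, b.@[v] != 0 & forall j, phi x j = (a j).@[v] / b.@[v]].

Definition small d (a : 'I_n -> {mpoly k[n]}) (b : {mpoly k[n]}) :=
  (msize b <= d.+1)%N /\ forall j, (msize (a j) <= d.+1)%N.

(* If [x] and [y] are given by fractions of degrees [d] and [d'] in [v], then [h x y] is one
   of degree [de * (d + d')]. *)
Definition BP de (h : A -> A -> k) := forall d d' a b a' b', small d a b -> small d' a' b' ->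
  exists q : {mpoly k[n]}, (msize q <= (de * (d + d')).+1)%N /\
    forall v x y, frac a b v x -> frac a' b' v y ->
      q.@[v] = h x y * (b.@[v] * b'.@[v]) ^+ de.

Lemma BP_leq de de' h : (de <= de')%N -> BP de h -> BP de' h.
Proof.
move=> le hh d d' a b a' b' s s'; have [q [sq hq]] := hh _ _ _ _ _ _ s s'.
exists (q * (b * b') ^+ (de' - de)); split.
  rewrite -(subnKC le) mulnDl subnKC //; apply: msize_mul => //.
  by apply: msize_exp; apply: msize_mul; [case: s | case: s'].
move=> v x y f f'; rewrite mevalM rmorphXn /= mevalM (hq v x y) // -mulrA -exprD subnKC //.
Qed.

Lemma BP_cst c : BP 0 (fun _ _ => c).
Proof.
move=> d d' a b a' b' _ _; exists c%:MP; split=> [|v x y _ _]; last by rewrite mevalC mulr1.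
by rewrite msizeC; case: (_ != _).
Qed.

Lemma BP_x j : BP 1 (fun x _ => phi x j).
Proof.
move=> d d' a b a' b' [_ s1] [s2 _]; exists (a j * b'); rewrite mul1n; split.
  exact: msize_mul.
by move=> v x y [_ b0 ->] _; rewrite mevalM expr1 mulrA divfK.
Qed.

Lemma BP_y j : BP 1 (fun _ y => phi y j).
Proof.
move=> d d' a b a' b' [s1 _] [_ s2]; exists (b * a' j); rewrite mul1n; split.
  exact: msize_mul.
by move=> v x y _ [_ b0 ->]; rewrite mevalM expr1 mulrCA divfK.
Qed.

Lemma BP_add de h h' : BP de h -> BP de h' -> BP de (fun x y => h x y + h' x y).
Proof.
move=> hh hh' d d' a b a' b' s s'; have [q [sq hq]] := hh _ _ _ _ _ _ s s'.
have [r [sr hr]] := hh' _ _ _ _ _ _ s s'; exists (q + r); split; first exact: msize_add.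
by move=> v x y f f'; rewrite mevalD (hq v x y) // (hr v x y) // mulrDl.
Qed.

Lemma BP_mul de de' h h' : BP de h -> BP de' h' -> BP (de + de') (fun x y => h x y * h' x y).
Proof.
move=> hh hh' d d' a b a' b' s s'; have [q [sq hq]] := hh _ _ _ _ _ _ s s'.
have [r [sr hr]] := hh' _ _ _ _ _ _ s s'; exists (q * r); split.
  by rewrite mulnDl; exact: msize_mul.
by move=> v x y f f'; rewrite mevalM (hq v x y) // (hr v x y) // exprD mulrACA.
Qed.

Definition BPf h := exists de, BP de h.

Lemma BPf_cst c : BPf (fun _ _ => c). Proof. by exists 0%N; exact: BP_cst. Qed.

Lemma BPf_add h h' : BPf h -> BPf h' -> BPf (fun x y => h x y + h' x y).
Proof.
move=> [d hd] [e he]; exists (d + e)%N.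
by apply: BP_add; [apply: BP_leq hd; exact: leq_addr | apply: BP_leq he; exact: leq_addl].
Qed.

Lemma BPf_mul h h' : BPf h -> BPf h' -> BPf (fun x y => h x y * h' x y).
Proof. by move=> [d hd] [e he]; exists (d + e)%N; exact: BP_mul. Qed.

Lemma BPf_prod (J : Type) (r : seq J) (h : J -> A -> A -> k) : (forall j, BPf (h j)) ->
  BPf (fun x y => \prod_(j <- r) h j x y).
Proof.
move=> hh; elim: r => [|j r IH].
  rewrite (_ : (fun _ _ => _) = fun _ _ => 1); first exact: BPf_cst.
  by apply/funext => x; apply/funext => y; rewrite big_nil.
rewrite (_ : (fun _ _ => _) = fun x y => h j x y * \prod_(i <- r) h i x y); first exact: BPf_mul.
by apply/funext => x; apply/funext => y; rewrite big_cons.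
Qed.

Lemma BPf_meval (w : A -> A -> 'I_n -> k) p : (forall j, BPf (fun x y => w x y j)) ->
  BPf (fun x y => p.@[w x y]).
Proof.
move=> hw; elim/mpoly_ring_ind: p => [c|j|p r hp hr|p r hp hr].
- rewrite (_ : (fun _ _ => _) = fun _ _ => c); first exact: BPf_cst.
  by apply/funext => x; apply/funext => y; rewrite mevalC.
- rewrite (_ : (fun _ _ => _) = fun x y => w x y j) //.
  by apply/funext => x; apply/funext => y; rewrite mevalXU.
- rewrite (_ : (fun _ _ => _) = fun x y => p.@[w x y] + r.@[w x y]); first exact: BPf_add.
  by apply/funext => x; apply/funext => y; rewrite mevalD.
rewrite (_ : (fun _ _ => _) = fun x y => p.@[w x y] * r.@[w x y]); first exact: BPf_mul.
by apply/funext => x; apply/funext => y; rewrite mevalM.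
Qed.

Section Local.
Variables (x0 y0 : A).
Hypotheses (Ux : U x0) (Uy : U y0).

(** [BN] and [RF] are the neighbourhoods of (x0, y0) and the regular germs there, expressed by
    functions whose degree is controlled by [BP]. *)
Definition BN (P : A -> A -> Prop) := exists e, [/\ BPf e, e x0 y0 != 0 &
  forall x y, U x -> U y -> e x y != 0 -> P x y].

Definition RF (f : A -> A -> k) := exists g e, [/\ BPf g, BPf e, e x0 y0 != 0 &
  forall x y, U x -> U y -> e x y != 0 -> f x y = g x y / e x y].

Lemma RF_near (P : A -> A -> Prop) f f' : BN P -> (forall x y, P x y -> f x y = f' x y) ->
  RF f -> RF f'.
Proof.
move=> [e [he e0 eP]] ff [g [e' [hg he' e0' h]]].
exists (fun x y => g x y * e x y), (fun x y => e' x y * e x y); split.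
- exact: BPf_mul.
- exact: BPf_mul.
- exact: mulf_neq0.
move=> x y hx hy; rewrite mulf_eq0 => /norP[h1 h2].
by rewrite -ff ?h //; [rewrite -mulf_div divff // mulr1 | exact: eP].
Qed.

Lemma RF_x f : regat X x0 f -> RF (fun x _ => f x).
Proof.
move/(chart_rat vA cU _ Ux) => [a [d [d0 h]]].
exists (fun x _ => a.@[phi x]), (fun x _ => d.@[phi x]); split=> // [||x y hx _]; last exact: h.
- by apply: (BPf_meval (w := fun x _ => phi x)) => j; exists 1%N; exact: BP_x.
- by apply: (BPf_meval (w := fun x _ => phi x)) => j; exists 1%N; exact: BP_x.
Qed.

Lemma RF_y f : regat X y0 f -> RF (fun _ y => f y).
Proof.
move/(chart_rat vA cU _ Uy) => [a [d [d0 h]]].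
exists (fun _ y => a.@[phi y]), (fun _ y => d.@[phi y]); split=> // [||x y _ hx]; last exact: h.
- by apply: (BPf_meval (w := fun _ y => phi y)) => j; exists 1%N; exact: BP_y.
- by apply: (BPf_meval (w := fun _ y => phi y)) => j; exists 1%N; exact: BP_y.
Qed.

Lemma RF_mul f f' : RF f -> RF f' -> RF (fun x y => f x y * f' x y).
Proof.
move=> [g [e [hg he e0 h]]] [g' [e' [hg' he' e0' h']]].
exists (fun x y => g x y * g' x y), (fun x y => e x y * e' x y); split.
- exact: BPf_mul.
- exact: BPf_mul.
- exact: mulf_neq0.
by move=> x y hx hy; rewrite mulf_eq0 => /norP[h1 h2]; rewrite h // h' // mulf_div.
Qed.

Lemma RF_add f f' : RF f -> RF f' -> RF (fun x y => f x y + f' x y).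
Proof.
move=> [g [e [hg he e0 h]]] [g' [e' [hg' he' e0' h']]].
exists (fun x y => g x y * e' x y + g' x y * e x y), (fun x y => e x y * e' x y); split.
- by apply: BPf_add; exact: BPf_mul.
- exact: BPf_mul.
- exact: mulf_neq0.
by move=> x y hx hy; rewrite mulf_eq0 => /norP[h1 h2]; rewrite h // h' // addf_div.
Qed.

Lemma RF_inv f : f x0 y0 != 0 -> RF f -> RF (fun x y => (f x y)^-1).
Proof.
move=> f0 [g [e [hg he e0 h]]]; exists (fun x y => e x y * e x y), (fun x y => g x y * e x y).
have g0 : g x0 y0 != 0 by apply: contraNneq f0; rewrite h // => ->; rewrite mul0r.
split; [exact: BPf_mul | exact: BPf_mul | exact: mulf_neq0 | move=> x y hx hy].
by rewrite mulf_eq0 => /norP[h1 h2]; rewrite h // invf_div -mulf_div divff // mulr1.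
Qed.

Lemma RF_sum m (f : 'I_m -> A -> A -> k) : (forall i, RF (f i)) ->
  RF (fun x y => \sum_i f i x y).
Proof.
elim: m f => [|m IH] f hf.
  exists (fun _ _ => 0), (fun _ _ => 1); split=> [|||x y _ _ _].
  - exact: BPf_cst.
  - exact: BPf_cst.
  - exact: oner_neq0.
  by rewrite big_ord0 mul0r.
rewrite (_ : (fun _ _ => _) = fun x y => f ord0 x y + \sum_i f (lift ord0 i) x y).
  by apply: RF_add => //; apply: IH.
by apply/funext => x; apply/funext => y; rewrite big_ord_recl.
Qed.

Lemma BN_bx P : bx X X (x0, y0) P -> BN (fun x y => P (x, y)).
Proof.
move=> [V [W [[oV Vx] [oW Wy] h]]].
have [p [p0 hp]] := (chart_nbh vA cU _ Ux).1 (nbh_open oV Vx).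
have [r [r0 hr]] := (chart_nbh vA cU _ Uy).1 (nbh_open oW Wy).
exists (fun x y => p.@[phi x] * r.@[phi y]); split.
- apply: BPf_mul; [apply: (BPf_meval (w := fun x _ => phi x)) => j; exists 1%N; exact: BP_x|].
  by apply: (BPf_meval (w := fun _ y => phi y)) => j; exists 1%N; exact: BP_y.
- exact: mulf_neq0.
by move=> x y hx hy; rewrite mulf_eq0 => /norP[h1 h2]; apply: h => /=; [apply: hp | apply: hr].
Qed.

Lemma RF_lten h : lten X X (x0, y0) h -> RF (fun x y => h (x, y)).
Proof.
move=> [V [W [[oV Vx] [oW Wy] [m [u [v [hr he]]]]]]].
have b : bx X X (x0, y0) [set w | V w.1 /\ W w.2] by exists V, W.
apply: (RF_near (f := fun x y => \sum_i u i x * v i y) (BN_bx b)) => [x y [/= ? ?]|].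
  by rewrite he.
apply: RF_sum => i; apply: RF_mul; [apply: RF_x|apply: RF_y]; have [h1 h2] := hr i.
  by exists V.
by exists W.
Qed.

Lemma RF_regat f : regat (prod_space X X) (x0, y0) f -> RF (fun x y => f (x, y)).
Proof.
move/(prod_ratP rA rA) => [h [d [lh ld d0 hb]]].
have [e [he e0 eP]] := BN_bx hb; have rd := RF_lten ld.
have hdP : BN (fun x y => d (x, y) != 0 /\ f (x, y) = h (x, y) / d (x, y)).
  have [g' [e' [hg' he' e0' h']]] := rd.
  exists (fun x y => (g' x y * e' x y) * e x y); split.
  - by apply: BPf_mul => //; exact: BPf_mul.
  - rewrite !mulf_neq0 //; apply: contraNneq d0; rewrite h' // => ->; by rewrite mul0r.
  move=> x y hx hy; rewrite !mulf_eq0 => /norP[/norP[h1 h2] h3].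
  have dn : d (x, y) != 0 by rewrite h' // mulf_neq0 ?invr_eq0.
  by split=> //; exact: eP.
apply: (RF_near (f := fun x y => h (x, y) * (d (x, y))^-1) hdP) => [x y [_ ->] //|].
by apply: RF_mul; [exact: RF_lten | apply: RF_inv].
Qed.

Lemma BN_nbh W : nbh (prod_space X X) (x0, y0) W -> BN (fun x y => W (x, y)).
Proof.
move/(prod_nbhP rA rA) => [h [lh h0 hb]].
have [e [he e0 eP]] := BN_bx hb; have [g' [e' [hg' he' e0' h']]] := RF_lten lh.
exists (fun x y => (g' x y * e' x y) * e x y); split.
- by apply: BPf_mul => //; exact: BPf_mul.
- rewrite !mulf_neq0 //; apply: contraNneq h0; rewrite h' // => ->; by rewrite mul0r.
move=> x y hx hy; rewrite !mulf_eq0 => /norP[/norP[h1 h2] h3].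
by apply: (eP x y hx hy h3); rewrite h' // mulf_neq0 ?invr_eq0.
Qed.

(** The fractions giving the coordinates are brought to a common denominator, which also carries the
    condition that the image stays in [U]. *)
Lemma two_var (f : A * A -> A) : mor (prod_space X X) X f -> U (f (x0, y0)) ->
  exists de (g : 'I_n -> A -> A -> k) (e : A -> A -> k),
    [/\ forall j, BP de (g j), BP de e, e x0 y0 != 0 &
      forall x y, U x -> U y -> e x y != 0 ->
        U (f (x, y)) /\ forall j, phi (f (x, y)) j = g j x y / e x y].
Proof.
move=> mf Uf; have [e [he e0 eP]] := BN_nbh ((mf (x0, y0)).1 _ (nbh_open (chart_opn cU) Uf)).
have /choice[g /choice[e' h]] : forall j, RF (fun x y => phi (f (x, y)) j).
  by move=> j; apply: (RF_regat (f := fun w => phi (f w) j)); exact: (proj2 (mf (x0, y0)) (fun y => phi y j) (chart_coord vA cU j Uf)).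
have fin (h' : 'I_n -> A -> A -> k) : (forall j, BPf (h' j)) -> exists de, forall j, BP de (h' j).
  move=> /choice[de hde]; exists (\sum_j de j)%N => j; apply: BP_leq (hde j).
  by rewrite (bigD1 j) //= leq_addr.
pose g2 j x y := g j x y * ((\prod_(l <- index_enum 'I_n) (if l == j then 1 else e' l x y)) * e x y).
pose e2 x y := (\prod_(l <- index_enum 'I_n) e' l x y) * e x y.
have [d1 h1] : exists de, forall j, BP de (g2 j).
  apply: fin => j; apply: BPf_mul; first by case: (h j).
  apply: BPf_mul => //; apply: (BPf_prod _ (h := fun l x y => if l == j then 1 else e' l x y)) => l.
  by case: eqP => _; [exact: BPf_cst | case: (h l)].
have [d2 h2] : BPf e2.
  by apply: BPf_mul => //; apply: (BPf_prod _ (h := e')) => l; case: (h l).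
exists (d1 + d2)%N, g2, e2; split.
- by move=> j; apply: BP_leq (h1 j); exact: leq_addr.
- by apply: BP_leq h2; exact: leq_addl.
- by rewrite mulf_neq0 // prodf_seq_neq0; apply/allP => l _; case: (h l).
move=> x y hx hy; rewrite /e2 mulf_eq0 => /norP[/prodf_neq0 n1 n2]; split; first exact: eP.
move=> j; have [_ _ _ ->] // := h j; last by apply: n1.
rewrite /g2 /e2.
have -> : \prod_(l <- index_enum 'I_n) (if l == j then 1 else e' l x y) =
          \prod_(l | l != j) e' l x y.
  by rewrite (bigD1 j) //= eqxx mul1r; apply: eq_bigr => l /negPf ->.
rewrite [X in _ = _ / (X * _)](bigD1 j) //=.
have Z0 : (\prod_(l | l != j) e' l x y) * e x y != 0.
  by apply: mulf_neq0 => //; apply/prodf_neq0 => l _; exact: n1.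
by rewrite -[e' j x y * _ * _]mulrA -mulf_div (divff Z0) mulr1.
Qed.

End Local.
End Degree.

Section DegreeCalculus.
Variables (k : closedFieldType) (p e q : nat).
Hypotheses (hp : p \in [pchar k])
  (halg : forall x : k, exists m, (0 < m)%N /\ x ^+ (p ^ m) = x)
  (he : (0 < e)%N) (hq : q = (p ^ e)%N).
Variables (A : abvar k) (F : A -> A).
Hypothesis hF : abvar_frobenius q F.
Local Notation X := (ab_sp A).
Local Notation rA := (ab_rs A).
Local Notation vA := (ab_variety A).
Variables (n : nat) (U : set A) (phi : A -> 'I_n -> k).
Hypotheses (hU : fchart q F U phi) (U0 : U 0).
Local Notation cU := (let: And3 c _ _ := hU in c).

(* Generic translates of [al] are given by fractions of degree [d] which are defined at 0. *)
Definition Dg (al : A -> A) d := exists Om : set A,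
  [/\ opn X Om, Om !=set0, Om `<=` U & forall c, Om c -> exists a b,
    [/\ small d a b, b.@[phi 0] != 0 & forall u, U u -> b.@[phi u] != 0 ->
      frac U phi a b (phi u) (al u + c)]].

Lemma small_X : small 1 (fun j : 'I_n => 'X_j : {mpoly k[n]}) 1.
Proof. by split=> [|j]; rewrite ?msize1 ?msizeX ?mdeg1. Qed.

Lemma small_C (c : A) : small 0 (fun j : 'I_n => (phi c j)%:MP : {mpoly k[n]}) 1.
Proof. by split=> [|j]; rewrite ?msize1 // msizeC; case: (_ != _). Qed.

Lemma frac_X u : U u -> frac U phi (fun j => 'X_j) 1 (phi u) u.
Proof. by move=> Uu; split=> // [|j]; rewrite meval1 ?oner_neq0 // mevalXU divr1. Qed.

Lemma frac_C v c : U c -> frac U phi (fun j => (phi c j)%:MP) 1 v c.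
Proof. by move=> Uu; split=> // [|j]; rewrite meval1 ?oner_neq0 // mevalC divr1. Qed.

Lemma BP_open_r de (h : A -> A -> k) c y : BP U phi de h -> U c -> U y -> h c y != 0 ->
  nbh X y [set z | U z /\ h c z != 0].
Proof.
move=> hh Uc Uy h0; have [r [_ hr]] := hh _ _ _ _ _ _ (small_C c) small_X.
have hE z : U z -> r.@[phi z] = h c z.
  by move=> Uz; rewrite (hr (phi z) c z (frac_C _ Uc) (frac_X Uz)) meval1 mulr1 expr1n mulr1.
apply/(chart_nbh vA cU _ Uy); exists r; rewrite hE //; split=> // z Uz; by rewrite hE.
Qed.

Lemma BP_open_l de (h : A -> A -> k) c y : BP U phi de h -> U c -> U y -> h y c != 0 ->
  nbh X y [set z | U z /\ h z c != 0].
Proof.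
move=> hh Uc Uy h0; have [r [_ hr]] := hh _ _ _ _ _ _ small_X (small_C c).
have hE z : U z -> r.@[phi z] = h z c.
  by move=> Uz; rewrite (hr (phi z) z c (frac_X Uz) (frac_C _ Uc)) meval1 mulr1 expr1n mulr1.
apply/(chart_nbh vA cU _ Uy); exists r; rewrite hE //; split=> // z Uz; by rewrite hE.
Qed.

Lemma open_sub (V : set A) x : nbh X x V -> exists W, [/\ opn X W, W x & W `<=` V].
Proof. by move=> [W [oW Wx WV]]; exists W. Qed.

Lemma Dg_any al : hom al -> exists d, Dg al d.
Proof.
move=> hal; pose f (w : A * A) := al w.1 + w.2.
have mf : mor (prod_space X X) X f.
  apply: (mor_add (ab_prs A A)); last exact: mor_snd.
  exact: (mor_comp (mor_fst rA rA) hal.2).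
have Uf : U (f (0, 0)) by rewrite /f /= (hom0 hal) addr0.
have [de [g [ep [hg hep e0 h]]]] := two_var cU U0 U0 mf Uf.
exists de; have [Om [oO O0 hO]] := open_sub (BP_open_r hep U0 U0 e0).
exists Om; split=> //; [by exists 0 | by move=> c /hO[] | move=> c /hO[Uc ec]].
have /choice[a ha] := fun j => hg j _ _ _ _ _ _ small_X (small_C c).
have [b [sb hb]] := hep _ _ _ _ _ _ small_X (small_C c).
rewrite addn0 muln1 in ha sb.
have bE u : U u -> b.@[phi u] = ep u c.
  by move=> Uu; rewrite (hb (phi u) u c (frac_X Uu) (frac_C _ Uc)) meval1 mulr1 expr1n mulr1.
have aE u j : U u -> (a j).@[phi u] = g j u c.
  move=> Uu; have [_ haj] := ha j; rewrite (haj _ _ _ (frac_X Uu) (frac_C _ Uc)).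
  by rewrite meval1 mulr1 expr1n mulr1.
exists a, b; split=> [||u Uu bu].
- by split=> // j; case: (ha j).
- by rewrite bE.
rewrite bE // in bu; have [h1 h2] := h u c Uu Uc bu; split=> // [|j]; rewrite bE //.
by rewrite aE // -h2.
Qed.

(** The constant E depends only on the addition law near (0, 0), not on the two maps. This
    uniformity is what allows the addition of one digit after another with a fixed loss. *)
Lemma Dg_add : exists E, forall al be d1 d2, al 0 = 0 -> be 0 = 0 -> Dg al d1 -> Dg be d2 ->
  Dg (fun x => al x + be x) (E * (d1 + d2)).
Proof.
pose f (w : A * A) := w.1 + w.2.
have mf : mor (prod_space X X) X f.
  by apply: (mor_add (ab_prs A A)); [exact: mor_fst | exact: mor_snd].
have Uf : U (f (0, 0)) by rewrite /f /= addr0.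
have [de [g [ep [hg hep e0 h]]]] := two_var cU U0 U0 mf Uf.
exists de.+1 => al be d1 d2 al0 be0 [O1 [oO1 [x1 O1x] sO1 h1]] [O2 [oO2 [x2 O2x] sO2 h2]].
have [c1 [[Uc1 ec1] O1c1]] := irr_nbh vA (BP_open_l hep U0 U0 e0) (nbh_open oO1 O1x).
have [c2 [[Uc2 ec2] O2c2]] := irr_nbh vA (BP_open_r hep Uc1 U0 ec1) (nbh_open oO2 O2x).
have n2 := nbhI rA (BP_open_r hep Uc1 Uc2 ec2) (nbh_open oO2 O2c2).
have [W [oW Wc2 hW]] := open_sub n2.
have [a1 [b1 [s1 b10 f1]]] := h1 _ O1c1.
exists [set c | W (c - c1)]; split.
- apply: (rs_openU rA) => c Wc; apply: (proj1 (mor_trans (- c1) c)); exact: nbh_open.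
- by exists (c2 + c1); rewrite /= addrK.
- move=> c /hW[[Uc ec] _]; have [hh _] := h c1 (c - c1) Uc1 Uc ec.
  by move: hh; rewrite /f /= addrC subrK.
move=> c /hW[[Uc ec] /h2[a2 [b2 [s2 b20 f2]]]].
have /choice[a ha] := fun j => hg j _ _ _ _ _ _ s1 s2.
have [b [sb hb]] := hep _ _ _ _ _ _ s1 s2.
have sE r : (msize r <= (de * (d1 + d2)).+1)%N -> (msize (r * (b1 * b2)) <= (de.+1 * (d1 + d2)).+1)%N.
  by move=> hr; rewrite mulSnr; apply: msize_mul => //; apply: msize_mul; [case: s1|case: s2].
(* The extra factor [b1 * b2] makes the nonvanishing of the new denominator imply that of both old
   ones; it accounts for [de.+1]. *)
exists (fun j => a j * (b1 * b2)), (b * (b1 * b2)); split.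
- by split=> [|j]; apply: sE => //; case: (ha j).
- rewrite !mevalM !mulf_neq0 //.
  have F1 := f1 0 U0 b10; have F2 := f2 0 U0 b20; rewrite al0 add0r in F1; rewrite be0 add0r in F2.
  by rewrite (hb (phi 0) _ _ F1 F2) mulf_neq0 // expf_neq0 // mulf_neq0.
move=> u Uu; rewrite !mevalM !mulf_eq0 => /norP[nb /norP[nb1 nb2]].
have F1 := f1 u Uu nb1; have F2 := f2 u Uu nb2.
have bE := hb _ _ _ F1 F2; have ee : ep (al u + c1) (be u + (c - c1)) != 0.
  by apply: contraNneq nb => ee; rewrite bE ee mul0r.
have [U1 _ _] := F1; have [U2 _ _] := F2; have [h3 h4] := h _ _ U1 U2 ee.
have sumE : f (al u + c1, be u + (c - c1)) = al u + be u + c.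
  by rewrite /f /= addrACA [c1 + _]addrC subrK.
rewrite sumE in h3 h4; split=> // [|j]; first by rewrite !mevalM !mulf_neq0.
rewrite h4 !mevalM bE; have [_ haj] := ha j; rewrite (haj _ _ _ F1 F2).
rewrite -mulf_div divff ?mulr1 ?mulf_neq0 // -mulf_div divff ?mulr1 //.
by rewrite expf_neq0 // mulf_neq0.
Qed.

(** Raising coordinates to the q-th power multiplies degrees by q and by nothing else, whereas each
    addition costs a constant. Hence many applications of F are made for one addition. *)
Lemma Dg_frob al d : Dg al d -> Dg (fun x => F (al x)) (q * d).
Proof.
have [_ FU Fphi] := hU; have [hFD _] := homF hF.
move=> [Om [oO [x0 Ox0] sO h]]; exists (F @` Om); split.
- exact: (F_open halg hq hF).
- by exists (F x0), x0.
- by move=> _ [x /sO Ux <-]; apply/FU.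
move=> _ [c /h[a [b [[sb sa] b0 hf]]] <-].
exists (fun j => a j ^+ q), (b ^+ q); split.
- by split=> [|j]; exact: msize_exp.
- by rewrite rmorphXn /= expf_neq0.
move=> u Uu; rewrite rmorphXn /= => bq.
have q0 : q != 0%N by rewrite hq -lt0n expn_gt0 (prime_gt0 (prime_p hp)).
have bu : b.@[phi u] != 0 by apply: contraNneq bq => ->; rewrite expr0n (negPf q0).
have [h1 h2 h3] := hf u Uu bu; rewrite -hFD; split; [by apply/FU | by rewrite rmorphXn|].
by move=> j; rewrite Fphi // h3 expr_div_n !rmorphXn.
Qed.

Lemma Dg_iter m al d : Dg al d -> Dg (fun x => iter m F (al x)) (q ^ m * d).
Proof.
move=> h; elim: m => [|m IH]; first by rewrite mul1n.
by rewrite expnS -mulnA; exact: Dg_frob.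
Qed.

End DegreeCalculus.

(** * The number of points in a kernel *)

Lemma interpolate (k : fieldType) n (I : finType) (v : I -> 'I_n -> k) : injective v ->
  exists ee : I -> {mpoly k[n]}, forall i j, (ee i).@[v j] = (i == j)%:R.
Proof.
move=> inj.
have sep i j : exists p : {mpoly k[n]}, i != j -> p.@[v i] = 1 /\ p.@[v j] = 0.
  case: (eqVneq i j) => [_|ij]; first by exists 0.
  have [l hl] : exists l, v i l != v j l.
    apply: contrapT => h; move/eqP: ij; apply; apply: inj; apply/funext => l.
    by apply/eqP/negPn/negP => hl; apply: h; exists l.
  exists ((v i l - v j l)^-1%:MP * ('X_l - (v j l)%:MP)) => _.
  by rewrite !mevalM !mevalB !mevalC !mevalXU subrr mulr0 mulVf // subr_eq0.
have [ee he] : exists ee : I -> I -> {mpoly k[n]}, forall i j, i != j -> (ee i j).@[v i] = 1 /\ (ee i j).@[v j] = 0.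
  have /choice[f hf] := fun ij : I * I => sep ij.1 ij.2.
  by exists (fun i j => f (i, j)) => i j; exact: (hf (i, j)).
exists (fun i => \prod_(j | j != i) ee i j) => i j.
rewrite rmorph_prod; case: (eqVneq i j) => [<-|ij] /=.
  by rewrite big1 // => l li; have [] := he i l; rewrite // eq_sym.
by rewrite (bigD1 j) 1?eq_sym //=; have [_ ->] := he i j ij; rewrite mul0r.
Qed.

Section Count.
Variables (k : closedFieldType) (p e q : nat).
Hypotheses (hp : p \in [pchar k])
  (halg : forall x : k, exists m, (0 < m)%N /\ x ^+ (p ^ m) = x)
  (he : (0 < e)%N) (hq : q = (p ^ e)%N).
Variables (A : abvar k) (F : A -> A).
Hypothesis hF : abvar_frobenius q F.
Local Notation X := (ab_sp A).
Local Notation rA := (ab_rs A).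
Local Notation vA := (ab_variety A).
Variables (n : nat) (U : set A) (phi : A -> 'I_n -> k).
Hypotheses (hU : fchart q F U phi) (U0 : U 0).
Local Notation cU := (let: And3 c _ _ := hU in c).

Lemma open_pre (f : A -> A) V : mor X X f -> opn X V -> opn X (f @^-1` V).
Proof.
move=> mf oV; apply: (rs_openU rA) => x Vx; apply: (proj1 (mf x)); exact: nbh_open.
Qed.

Lemma opens3 O1 O2 O3 : opn X O1 -> opn X O2 -> opn X O3 -> O1 !=set0 -> O2 !=set0 ->
  O3 !=set0 -> exists z, [/\ O1 z, O2 z & O3 z].
Proof.
move=> o1 o2 o3 [x1 h1] [x2 h2] [x3 h3].
have [z [z1 z2]] := irr_nbh vA (nbh_open o1 h1) (nbh_open o2 h2).
have [w [[w1 w2] w3]] := irr_nbh vA (nbhI rA (nbh_open o1 z1) (nbh_open o2 z2)) (nbh_open o3 h3).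
by exists w.
Qed.

Lemma open_det (m : nat) (E : A -> 'M[k]_m) (V : set A) : opn X V ->
  (forall i j t, V t -> regat X t (fun t => E t i j)) -> opn X [set t | V t /\ \det (E t) != 0].
Proof.
move=> oV h; apply: (rs_openU rA) => t [Vt dt].
have rd : regat X t (fun t => \det (E t)).
  rewrite /determinant; apply: (ra_sum rA) => s _; apply: (rs_mul rA); first exact: rs_cst.
  by apply: (ra_prod rA) => i _; exact: h.
by apply: nbhS (nbhI rA (nbh_open oV Vt) (rs_nz rA rd dt)) => z [].
Qed.

(* Let e_s be polynomials interpolating on a fibre of [al], with s in S.  The products of the
   e_s with the monomials in the pullbacks of two coordinates are linearly independent, and
   there are too many of them for [growth] when S is large. *)
Lemma kernel_count : dimension_is X 2 -> exists C, forall al d (S : seq A), hom al ->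
  (forall y, exists x, al x = y) -> Dg U phi al d -> uniq S -> (forall x, x \in S -> al x = 0) ->
  (size S <= C * d.+1 ^ 2)%N.
Proof.
move=> hdim; have [s [inds s2 maxs]] := max_indep cU hdim (ex_intro _ 0 U0).
have [C0 hC] := growth cU maxs inds; exists (C0 * 4)%N => al d S hal surj hD uS kS.
set g := size s in s2 hC *; set N := size S.
have [Om [oO [c Oc] sO /(_ c Oc)[a [b [[sb sa] b0 hab]]]]] := hD.
have trS i : opn X ((fun z => z + nth 0 S i) @^-1` U).
  by apply: open_pre (chart_opn cU); exact: mor_trans.
have [u0 hu0] : exists u0, forall i : 'I_N, U (u0 + nth 0 S i).
  apply: (open_meet (V := fun i : 'I_N => (fun z => z + nth 0 S i) @^-1` U)) => i //.
  by exists (- nth 0 S i); rewrite /= addNr.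
have injv : injective (fun i : 'I_N => phi (u0 + nth 0 S i)).
  move=> i j /(chart_inj cU (hu0 i) (hu0 j))/addrI/eqP; rewrite nth_uniq // => /eqP ij.
  exact: val_inj.
have [ee hee] := interpolate injv.
pose dE := (\sum_i msize (ee i))%N; pose m := (dE + 1)%N.
pose J := ('I_N * {ffun 'I_g -> 'I_m})%type.
case: (posnP N) => [N0|N0]; first by rewrite N0.
have /choice[sl hsl] : forall l : 'I_g, exists j : 'I_n, forall z, xf phi s l z = phi z j.
  move=> l; have : (l < size s)%N by []; rewrite /xf; case: (s) => // j0 s' hl.
  by exists (nth j0 (j0 :: s') l) => z; rewrite (nth_map j0).
pose f (w : J) := ee w.1 * \prod_(l < g) (a (sl l) ^+ w.2 l * b ^+ (m - w.2 l)).
have prod_size (h : 'I_g -> {mpoly k[n]}) D :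
    (forall l, msize (h l) <= D.+1)%N -> (msize (\prod_l h l) <= (g * D).+1)%N.
  move=> hh; rewrite -[g in (g * D)%N]card_ord -sum1_card mulnC big_distrr /=.
  rewrite muln1 -/g; elim/big_ind2: _ => [|x1 y1 x2 y2|l _]; rewrite ?msize1 //.
  exact: msize_mul.
have fsz w : (msize (f w) <= (dE + g * (m * d)).+1)%N.
  apply: msize_mul.
    by apply: leq_trans (leqnSn _); rewrite /dE (bigD1 w.1) //= leq_addr.
  apply: prod_size => l; have lm : (w.2 l <= m)%N by apply: ltnW.
  have -> : (m * d = w.2 l * d + (m - w.2 l) * d)%N by rewrite -mulnDl subnKC.
  by apply: msize_mul; apply: msize_exp.
rewrite leqNgt; apply/negP => hlt.
have [||lam [[i0 li0] hlam]] := hC (dE + g * (m * d))%N #|{: J}| (f \o enum_val).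
- by move=> i; exact: fsz.
(* With m = dE + 1 exponents in each of g variables there are N m^g products, of degree at most dE +
   g m d, which is m (1 + g d) - 1. Since g <= 2, (1 + g d)^g <= (2 (d + 1))^2, whence the constant
   [C0 * 4]. *)
- rewrite card_prod card_ffun !card_ord -/N.
  apply: leq_ltn_trans (_ : (C0 * (m * (1 + g * d)) ^ g < N * m ^ g)%N).
    by rewrite leq_mul2l; apply/orP; right; case: (g) => // g'; rewrite leq_exp2r //; rewrite /m; nia.
  rewrite expnMn mulnCA mulnC ltn_mul2r expn_gt0 /m addn1 /=; apply: leq_ltn_trans hlt.
  rewrite -mulnA leq_mul2l; apply/orP; right.
  have -> : (4 * d.+1 ^ 2 = (2 * d.+1) ^ 2)%N by rewrite expnMn.
  apply: (@leq_trans ((1 + g * d) ^ 2)); first by rewrite leq_pexp2l.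
  by rewrite leq_exp2r //; nia.
pose la (w : J) := lam (enum_rank w).
have lz t : U t -> \sum_(w : J) la w * (f w).@[phi t] = 0.
  move=> Ut; rewrite -[RHS](hlam t Ut) (reindex_onto (@enum_val _ _) enum_rank) /=.
    by apply: eq_big => [w|w _]; rewrite /la enum_valK ?eqxx.
  by move=> w _; rewrite enum_rankK.
pose mon (ka : {ffun 'I_g -> 'I_m}) : 'X_{1..g} := [multinom val (ka l) | l < g].
pose Q i : {mpoly k[g]} := \sum_(ka : {ffun 'I_g -> 'I_m}) la (i, ka) *: 'X_[mon ka].
have [i1 Q1] : exists i, Q i != 0.
  exists (enum_val i0).1; apply: contraNneq li0 => Q0.
  have := congr1 (mcoeff (mon (enum_val i0).2)) Q0; rewrite mcoeff0 raddf_sum /=.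
  rewrite (bigD1 (enum_val i0).2) //= mcoeffZ mcoeffX eqxx mulr1 big1.
    by rewrite addr0 /la -surjective_pairing enum_valK => ->.
  move=> ka hka; rewrite mcoeffZ mcoeffX; case: eqP => [e1|_]; last by rewrite mulr0.
  case/negP: hka; apply/eqP/ffunP => l; apply: val_inj.
  by have := congr1 (fun M : 'X_{1..g} => M l) e1; rewrite !mnmE.
have key t : U t -> b.@[phi t] != 0 ->
    \sum_i (ee i).@[phi t] * ev (Q i) (fun l => xf phi s l (al t + c)) = 0.
  move=> Ut bt; have [Uc _ hphi] := hab t Ut bt.
  have bg0 : b.@[phi t] ^+ m ^+ g != 0 by rewrite !expf_neq0.
  apply: (mulfI bg0); rewrite mulr0 -[RHS](lz t Ut).
  have -> : \sum_w la w * (f w).@[phi t] = \sum_i \sum_ka la (i, ka) * (f (i, ka)).@[phi t].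
    by rewrite pair_bigA; apply: eq_bigr => -[i ka] _.
  rewrite mulr_sumr; apply: eq_bigr => i _; rewrite /ev /Q raddf_sum /= !mulr_sumr.
  apply: eq_bigr => ka _; rewrite mevalZ mevalX /f mevalM rmorph_prod /=.
  set Y := \prod_(l < g) xf _ _ _ _ ^+ _; set Z := \prod_(l < g) _.
  suff YZ : b.@[phi t] ^+ m ^+ g * Y = Z by rewrite -YZ; ring.
  rewrite /Y /Z.
  rewrite -[g in _ ^+ g]card_ord -prodr_const -big_split; apply: eq_bigr => l _ /=.
  have lm : (ka l <= m)%N by apply: ltnW.
  rewrite mnmE hsl hphi expr_div_n mevalM !rmorphXn /= -{1}(subnKC lm) exprD.
  by rewrite mulrC mulrA divfK ?expf_neq0.
pose E z : 'M[k]_N := \matrix_(i', i) (ee i).@[phi (z + nth 0 S i')].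
have oall (V : 'I_N -> set A) : (forall i, opn X (V i)) -> opn X [set z | forall i, V i z].
  by move=> oV; apply: (rs_openU rA) => z Vz; apply: (nbh_forall rA) => i; apply: nbh_open.
have oV := oall _ (fun i : 'I_N => trS i).
have O1 : opn X [set z | (forall i : 'I_N, U (z + nth 0 S i)) /\ \det (E z) != 0].
  apply: (open_det oV) => i j z Vz.
  apply: (ra_ext rA (f := fun z => (ee j).@[phi (z + nth 0 S i)])) => [y|]; first by rewrite mxE.
  exact: (proj2 (mor_trans _ z) (fun y => (ee j).@[phi y]) (chart_poly vA cU _ (Vz i))).
have Ob : opn X [set u | U u /\ b.@[phi u] != 0].
  apply: (rs_openU rA) => u [Uu bu].
  by apply: nbhS (nbhI rA (nbh_open (chart_opn cU) Uu) (rs_nz rA (chart_poly vA cU b Uu) bu)) => z [].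
have trb i : opn X ((fun z => z + nth 0 S i) @^-1` [set u | U u /\ b.@[phi u] != 0]).
  by apply: open_pre Ob; exact: mor_trans.
have O2 := oall _ (fun i : 'I_N => trb i).
have mc : mor X X (fun z => al z + c) by apply: (mor_comp hal.2 (mor_trans c)).
have OQ : opn X [set u | U u /\ ev (Q i1) (fun l => xf phi s l u) != 0].
  apply: (rs_openU rA) => u [Uu bu].
  have rQ : regat X u (fun u => ev (Q i1) (fun l => xf phi s l u)) by exact: (pv_reg cU).
  by apply: nbhS (nbhI rA (nbh_open (chart_opn cU) Uu) (rs_nz rA rQ bu)) => z [].
(* At the N points z + s, with s in S, the values of the [Q i] coincide because al s = 0, so the
   relation [key] becomes the linear system [E z *m w = 0]. [E] is the identity at u0, hence
   invertible for generic z, while the entry i1 of w is generically nonzero. *)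
have [|||z [[Vz dz] z2 [_ z3]]] := opens3 O1 O2 (open_pre mc OQ).
- exists u0; split=> //; rewrite (_ : E u0 = 1%:M) ?det1 ?oner_neq0 //.
  by apply/matrixP => i' i; rewrite !mxE hee eq_sym.
- apply: (open_meet (V := fun i : 'I_N => (fun z => z + nth 0 S i) @^-1` [set u | U u /\ b.@[phi u] != 0])) => i.
    exact: trb.
  by exists (- nth 0 S i); rewrite /= addNr.
- have [u [_ Uu hu]] := indep_nz inds Q1; have [z hz] := surj (u - c).
  by exists z; rewrite /= hz subrK.
pose w : 'cV[k]_N := \col_i ev (Q i) (fun l => xf phi s l (al z + c)).
have Ew : E z *m w = 0.
  apply/matrixP => i' j; rewrite !mxE -[RHS](key _ (z2 i').1 (z2 i').2).
  apply: eq_bigr => i _; rewrite !mxE hal.1.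
  by rewrite [al (nth _ _ _)]kS ?addr0 // mem_nth.
have Eu : E z \in unitmx by rewrite unitmxE unitfE.
have w0 : w = 0 by rewrite -[w](mulKmx Eu) Ew mulmx0.
by move/eqP: z3; apply; have := congr1 (fun M : 'cV[k]_N => M i1 0) w0; rewrite !mxE.
Qed.

End Count.

(** * Orders and their action *)

Section Order.
Variables (K : fieldExtType rat) (O : set K).
Hypothesis hO : is_order O.

Lemma ord1_ : O 1. Proof. by case: hO. Qed.
Lemma ordM x y : O x -> O y -> O (x * y). Proof. by case: hO => _ h _; exact: h. Qed.

Lemma ordD x y : O x -> O y -> O (x + y).
Proof.
case: hO => _ _ [b [_ ->]] [c ->] [d ->]; exists (fun i => c i + d i).
by rewrite -big_split; apply: eq_bigr => i _; rewrite mulrzDr.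
Qed.

Lemma ordN x : O x -> O (- x).
Proof.
case: hO => _ _ [b [_ ->]] [c ->]; exists (fun i => - c i).
by rewrite -sumrN; apply: eq_bigr => i _; rewrite mulrNz.
Qed.

Lemma ordB x y : O x -> O y -> O (x - y).
Proof. by move=> hx hy; apply: ordD => //; exact: ordN. Qed.

Lemma ord0_ : O 0. Proof. by rewrite -(subrr 1); apply: ordB; exact: ord1_. Qed.

Lemma ordMn x m : O x -> O (x *+ m).
Proof.
by move=> hx; elim: m => [|m IH]; rewrite ?mulr0n ?mulrS; [exact: ord0_ | exact: ordD].
Qed.

Lemma ordMz x m : O x -> O (x *~ m).
Proof. by move=> hx; case: m => m; rewrite ?NegzE ?mulrNz; [|apply: ordN]; exact: ordMn. Qed.

Lemma ordX x m : O x -> O (x ^+ m).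
Proof. by move=> hx; elim: m => [|m IH]; rewrite ?expr0 ?exprS; [exact: ord1_ | exact: ordM]. Qed.

Lemma ord_nat m : O m%:R. Proof. by apply: ordMn; exact: ord1_. Qed.

Lemma scale_nat (x : K) m : m%:R *: x = x *+ m.
Proof. by rewrite scaler_nat. Qed.

Lemma ord_scale x : exists d, (0 < d)%N /\ O (x *+ d).
Proof.
case: hO => _ _ [b [bb ->]]; pose c i := coord b i x.
have xE : x = \sum_i c i *: b`_i by exact: (coord_basis bb (memvf x)).
pose d := (\prod_i `|denq (c i)|)%N; exists d; split.
  by rewrite prodn_gt0 // => i; rewrite absz_gt0 denq_neq0.
exists (fun i => numq (c i) * (\prod_(j | j != i) `|denq (c j)|)%N%:Z).
rewrite {1}xE -sumrMnl; apply: eq_bigr => i _.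
rewrite (tnth_nth 0) /d (bigD1 i) //= -scaler_int -scale_nat scalerA; congr (_ *: _).
rewrite natrM intrM; set Z := (\prod_(_ | _) _)%N.
have -> : `|denq (c i)|%:R = (denq (c i))%:~R :> rat.
  by rewrite -{2}(gez0_abs (ltW (denq_gt0 (c i)))).
by rewrite numqE -pmulrn; ring.
Qed.

Lemma ord_digits N : (0 < N)%N -> exists S : seq K, (forall x, x \in S -> O x) /\
  forall x, O x -> exists a y, [/\ a \in S, O y & x = a + y *+ N].
Proof.
move=> N0; case: (hO) => _ _ [b [bb eO]].
pose dg (c : {ffun 'I_(\dim {:K}) -> 'I_N}) := \sum_i tnth b i *+ c i.
exists [seq dg c | c : {ffun 'I_(\dim {:K}) -> 'I_N}]; split=> [x /mapP[c _ ->]|x].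
  by rewrite eO; exists (fun i => c i : int).
rewrite eO => -[c ->].
have h i : (`|(c i %% N)%Z| < N)%N.
  by rewrite -ltz_nat gez0_abs ?modz_ge0 ?ltz_pmod //; lia.
exists (dg [ffun i => Ordinal (h i)]), (\sum_i tnth b i *~ (c i %/ N)%Z); split.
- by apply: map_f; rewrite mem_enum.
- by exists (fun i => (c i %/ N)%Z).
rewrite -sumrMnl /dg -big_split; apply: eq_bigr => i _ /=; rewrite ffunE /=.
have mg : 0 <= (c i %% N)%Z by apply: modz_ge0; lia.
rewrite [X in X + _]pmulrn gez0_abs //.
by rewrite {1}(divz_eq (c i) N) mulrzDr mulrzA addrC.
Qed.

Lemma ord_div0 ell x : (1 < ell)%N -> (forall t, exists2 y, O y & x = y *+ (ell ^ t)) -> x = 0.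
Proof.
move=> l1; case: (hO) => _ _ [b [bb eO]] h.
have fb := basis_free bb.
have cE (c : 'I_(\dim {:K}) -> int) i : coord b i (\sum_i tnth b i *~ c i) = (c i)%:~R.
  rewrite -[RHS](coord_sum_free (fun i => (c i)%:~R) i fb); congr (coord b i _).
  by apply: eq_bigr => j _; rewrite (tnth_nth 0) scaler_int.
have [y0 Oy0 e0] := h 0%N; move: Oy0; rewrite eO => -[c yE].
have xE : x = \sum_i tnth b i *~ c i by rewrite e0 expn0 yE.
rewrite xE big1 // => i _; suff -> : c i = 0 by rewrite mulr0z.
apply: contrapT => /eqP ci.
have [y] := h `|c i|%N; rewrite eO => -[c' ->] e1.
have : coord b i x = (c' i * (ell ^ `|c i|)%N%:Z)%:~R.
  rewrite e1 -scaler_nat linearZ /= cE intrM mulrC; congr (_ * _).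
rewrite xE cE => /intr_inj e2; have := ltn_expl `|c i| l1.
move: ci; rewrite e2 mulf_eq0 => /norP[c'0 _]; rewrite {1}e2 abszM ltnNge leq_pmull //.
by rewrite absz_gt0.
Qed.

End Order.

(** The action of O by honest endomorphisms, without denominators. The values of [en] outside O are
    arbitrary. *)
Record cm_act (K : fieldExtType rat) (O : set K) (k : closedFieldType) (A : abvar k) (io : K -> qend A)
    (en : K -> A -> A) : Prop := CmAct {
  en_hom : forall x, O x -> hom (en x);
  en_io : forall x, O x -> qend_eq (io x) (en x, 1%N);
  en_add : forall x y a, O x -> O y -> en (x + y) a = en x a + en y a;
  en_mul : forall x y a, O x -> O y -> en (x * y) a = en x (en y a);
  en_1 : forall a, en 1 a = a;
  en_inj : forall x y, O x -> O y -> (forall a, en x a = en y a) -> x = y;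
  en_surj : forall f, hom f -> exists2 x, O x & forall a, en x a = f a }.

Lemma hom_tf (k : closedFieldType) (A A' : abvar k) (f g : A -> A') m :
  (forall N, (0 < N)%N -> forall y : A, exists x, x *+ N = y) -> (0 < m)%N ->
  hom f -> hom g -> (forall a, f a *+ m = g a *+ m) -> forall a, f a = g a.
Proof.
move=> dv m0 hf hg h a; have [b <-] := dv m m0 a.
by rewrite (homMn _ _ hf) (homMn _ _ hg).
Qed.

Section ActEx.
Variables (K : fieldExtType rat) (O : set K) (k : closedFieldType) (A : abvar k).
Hypothesis hO : is_order O.
Variable io : K -> qend A.
Hypothesis hio : has_CM_by O io.
Hypothesis dv : forall N, (0 < N)%N -> forall y : A, exists x, x *+ N = y.

Lemma cm_act_ex : exists en, cm_act O io en.
Proof.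
have [[io_end io1 ioD ioM io_inj] hOin hsur] := hio.
have /choice[en hen] : forall x, exists f, O x -> is_end f /\ qend_eq (io x) (f, 1%N).
  move=> x; case: (pselect (O x)) => [/hOin[f h1 h2]|nO]; last by exists id.
  by exists f.
have h1 x : O x -> hom (en x) by move=> /hen[/homP].
have h2 x a : O x -> (io x).1 a = en x a *+ (io x).2.
  by move=> /hen[_ /(_ a)] /=; rewrite mulr1n.
have n0 x : (0 < (io x).2)%N by case: (io_end x).
exists en; split=> //.
- by move=> x Ox; case: (hen x Ox).
- move=> x y a Ox Oy; have Oxy := ordD hO Ox Oy.
  apply: (hom_tf dv (m := ((io (x + y)).2 * ((io x).2 * (io y).2))%N) (f := en (x + y))
    (g := fun a => en x a + en y a)).
  - by rewrite !muln_gt0 !n0.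
  - exact: h1.
  - exact: (hom_add (h1 _ Ox) (h1 _ Oy)).
  move=> b; have := ioD x y b; rewrite /= !h2 // => e.
  by rewrite mulrnA e !mulrnDl -!mulrnA; congr (_ *+ _ + _ *+ _); ring.
- move=> x y a Ox Oy; have Oxy := ordM hO Ox Oy.
  apply: (hom_tf dv (m := ((io (x * y)).2 * ((io x).2 * (io y).2))%N) (f := en (x * y))
    (g := fun a => en x (en y a))).
  - by rewrite !muln_gt0 !n0.
  - exact: h1.
  - exact: (hom_comp (h1 _ Oy) (h1 _ Ox)).
  move=> b; have := ioM x y b; rewrite /= !h2 // (homMn _ _ (h1 x Ox)) => e.
  by rewrite mulrnA e -!mulrnA; congr (_ *+ _); ring.
- move=> a; have O1 := ord1_ hO.
  apply: (hom_tf dv (m := (io 1).2) (f := en 1) (g := fun x => x) (n0 1) (h1 _ O1) (hom_id A)).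
  by move=> b; have := io1 b; rewrite /= h2 // mulr1n.
- move=> x y Ox Oy e; apply: io_inj => a /=; rewrite !h2 // e -!mulrnA mulnC //.
move=> f hf; have [x Ox hx] := hsur f ((homP f).2 hf); exists x => //.
apply: (hom_tf dv (m := (io x).2)) => //; first exact: h1.
by move=> b; have := hx b; rewrite /= mulr1n h2.
Qed.

End ActEx.

Section Act.
Variables (K : fieldExtType rat) (O : set K) (k : closedFieldType) (A : abvar k).
Hypothesis hO : is_order O.
Variables (io : K -> qend A) (en : K -> A -> A).
Hypothesis hen : cm_act O io en.

Lemma en_D x a b : O x -> en x (a + b) = en x a + en x b.
Proof. by move=> /(en_hom hen)[]. Qed.

Lemma en_0 x : O x -> en x 0 = 0.
Proof. by move=> /(en_hom hen)/hom0. Qed.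

Lemma en_Mn x m a : O x -> en (x *+ m) a = en x a *+ m.
Proof.
move=> Ox; elim: m => [|m IH]; last by rewrite !mulrS (en_add hen) ?IH //; exact: ordMn.
rewrite !mulr0n; have := en_add hen a (ord0_ hO) (ord0_ hO).
by rewrite addr0 => /eqP; rewrite addrC -subr_eq subrr eq_sym => /eqP.
Qed.

Lemma en_Mnr x m a : O x -> en x (a *+ m) = en x a *+ m.
Proof. by move=> /(en_hom hen) hx; rewrite (homMn _ _ hx). Qed.

Lemma en_nat m a : en m%:R a = a *+ m.
Proof. by rewrite en_Mn ?(en_1 hen) //; exact: ord1_. Qed.

Lemma en_z0 a : en 0 a = 0. Proof. exact: (en_nat 0). Qed.

Lemma en_N x a : O x -> en (- x) a = - en x a.
Proof.
move=> Ox; apply/eqP; rewrite -addr_eq0 -(en_add hen) ?addNr ?en_z0 //; exact: ordN.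
Qed.

Lemma en_B x y a : O x -> O y -> en (x - y) a = en x a - en y a.
Proof. by move=> Ox Oy; rewrite (en_add hen) ?en_N //; exact: ordN. Qed.

Lemma en_comm x y a : O x -> O y -> en x (en y a) = en y (en x a).
Proof. by move=> Ox Oy; rewrite -!(en_mul hen) // mulrC. Qed.

Variables (p e q : nat).
Hypotheses (hp : p \in [pchar k])
  (halg : forall x : k, exists m, (0 < m)%N /\ x ^+ (p ^ m) = x)
  (he : (0 < e)%N) (hq : q = (p ^ e)%N).
Variable F : A -> A.
Hypothesis hF : abvar_frobenius q F.
Hypothesis dv : forall N, (0 < N)%N -> forall y : A, exists x, x *+ N = y.
Variables (f v : K).
Hypotheses (Of : O f) (Ov : O v) (enf : forall a, en f a = F a) (fv : v * f = q%:R).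

(** Descent gives f^s x = N y for some s and some y in O. Multiplying by v^s turns f^s into q^s,
    which is prime to N, and a Bezout relation divides x itself by N. *)
Lemma divide_kernel N x : (0 < N)%N -> coprime N p -> O x ->
  (forall a, a *+ N = 0 -> en x a = 0) -> exists2 y, O y & x = y *+ N.
Proof.
move=> N0 cN Ox hx; have [s [g [hg gE]]] := factor_frob hp he hq hF (dv N0) (en_hom hen Ox) hx.
have [y Oy yE] := en_surj hen hg.
have iE a : en (f ^+ s) a = iter s F a.
  elim: s {gE} a => [|s IH] a; first by rewrite expr0 (en_1 hen).
  by rewrite exprS (en_mul hen) ?IH ?enf //; exact: ordX.
have e1 : y *+ N = f ^+ s * x.
  apply: (en_inj hen); [exact: ordMn | by apply: ordM => //; exact: ordX |].
  move=> a; rewrite en_Mn // yE (en_mul hen) //; last exact: ordX.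
  by rewrite iE -gE (homMn _ _ hg).
have e2 : x *+ (q ^ s) = (v ^+ s * y) *+ N.
  by rewrite -mulrnAr e1 mulrA -exprMn fv -natrX mulr_natl.
have : coprime N (q ^ s) by rewrite hq -expnM coprimeXr.
move=> cq; have q0 : (0 < q ^ s)%N by rewrite hq -expnM expn_gt0 (prime_gt0 (prime_p hp)).
have [u w uw _] := egcdnP N q0; rewrite gcdnC (eqP cq) in uw.
exists (v ^+ s * y *+ u - x *+ w).
  by apply: ordB => //; apply: ordMn => //; apply: ordM => //; exact: ordX.
rewrite mulrnBl mulrnAC -e2 -!mulrnA [(_ * u)%N]mulnC uw.
by rewrite mulrnDr mulr1n addrAC subrr add0r.
Qed.

End Act.

(** * Quartic CM fields *)

(** Any z outside E generates M, and completing the square moves its square into E. *)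
Lemma quad_ext (L : fieldExtType rat) (E M : {subfield L}) : (E <= M)%VS ->
  \dim M = (2 * \dim E)%N -> exists th, [/\ th \in M, th \notin E, th ^+ 2 \in E &
    forall x, x \in M -> exists a b, [/\ a \in E, b \in E & x = a + b * th]].
Proof.
move=> EM dM; have d0 := adim_gt0 E.
have /subvPn[z zM zE] : ~~ (M <= E)%VS.
  by apply/negP => /dimvS; rewrite dM leqNgt -{1}[\dim E]mul1n ltn_pmul2r.
have z0 : z != 0 by apply: contraNneq zE => ->; exact: mem0v.
have cap0 : (E :&: (E * <[z]>) = 0)%VS.
  apply/eqP; rewrite -subv0; apply/subvP => x /memv_capP[xE /memv_cosetP[b bE xb]].
  rewrite memv0 xb; case: (eqVneq b 0) => [->|b0]; first by rewrite mul0r.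
  by case/negP: zE; rewrite -[z](mulKf b0) -xb rpredM ?rpredV.
have eM : (E + E * <[z]> = M)%VS.
  apply/eqP; rewrite eqEdim dimv_disjoint_sum // dim_cosetv // dM mul2n addnn leqnn andbT.
  rewrite subv_add EM /=; apply/subvP => x /memv_cosetP[b bE ->].
  by rewrite rpredM // (subvP EM).
have rep x : x \in M -> exists a b, [/\ a \in E, b \in E & x = a + b * z].
  rewrite -eM => /memv_addP[a aE [y /memv_cosetP[b bE ->] ->]].
  by exists a, b.
have [t [s [tE sE zz]]] := rep (z ^+ 2) (rpredX 2 zM).
have hE : (2%:R : L) \in E by rewrite rpredMn ?rpred1.
have n2 : (2%:R : L) != 0.
  by rewrite -(rmorph_nat (GRing.in_alg L)) fmorph_eq0 pnatr_eq0.
exists (z - s / 2%:R); split.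
- by rewrite rpredB // rpredM ?rpredV ?(subvP EM).
- apply: contra zE => h; rewrite -(subrK (s / 2%:R) z) rpredD // rpredM ?rpredV //.
- have -> : (z - s / 2%:R) ^+ 2 = t + (s / 2%:R) ^+ 2.
    have h2 : s = s / 2%:R * 2%:R by rewrite divfK.
    have -> : (z - s / 2%:R) ^+ 2 = z ^+ 2 - (s / 2%:R * 2%:R) * z + (s / 2%:R) ^+ 2 by ring.
    by rewrite -h2 zz; ring.
  by rewrite rpredD // rpredX // rpredM ?rpredV.
move=> x /rep[a [b [aE bE ->]]]; exists (a + b * (s / 2%:R)), b; split=> //; last by ring.
by rewrite rpredD // rpredM // rpredM ?rpredV.
Qed.

Definition qa (K : fieldExtType rat) (a : rat) : K := a *: 1.

Section Qa.
Variable K : fieldExtType rat.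
Local Notation ia := (@qa K).

Lemma qaD a b : ia (a + b) = ia a + ia b. Proof. exact: scalerDl. Qed.
Lemma qaN a : ia (- a) = - ia a. Proof. exact: scaleNr. Qed.
Lemma qaB a b : ia (a - b) = ia a - ia b. Proof. by rewrite qaD qaN. Qed.
Lemma qaM a b : ia (a * b) = ia a * ia b.
Proof. by rewrite /qa -scalerAl mul1r scalerA. Qed.
Lemma qa0 : ia 0 = 0. Proof. exact: scale0r. Qed.
Lemma qa1 : ia 1 = 1. Proof. exact: scale1r. Qed.
Lemma qa_eq0 a : (ia a == 0) = (a == 0).
Proof. by rewrite scaler_eq0 oner_eq0 orbF. Qed.
Lemma qa_nat n : ia n%:R = n%:R. Proof. exact: scaler_nat. Qed.
Lemma qa_vs a (E : {subfield K}) : ia a \in E. Proof. by rewrite rpredZ ?rpred1. Qed.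

End Qa.

Section Quartic.
Variables (K : fieldExtType rat) (K0 : {subfield K}).
Local Notation ia := (@qa K).

Definition mk (w dl : K) (a b a' b' : rat) := ia a + ia b * w + (ia a' + ia b' * w) * dl.

Section Gens.
Variables (w dl : K) (d u v : rat).
Hypotheses (hw : w ^+ 2 = ia d) (hdl : dl ^+ 2 = - (ia u + ia v * w)).
Hypothesis rep : forall x, exists a b a' b', x = mk w dl a b a' b'.
Hypothesis uniq0 : forall a b a' b', mk w dl a b a' b' = 0 -> [/\ a = 0, b = 0, a' = 0 & b' = 0].
Local Notation mk := (mk w dl).

Lemma hu : ia u = - dl ^+ 2 - ia v * w. Proof. by rewrite hdl; ring. Qed.

Lemma mkD a b a' b' c e c' e' : mk a b a' b' + mk c e c' e' = mk (a + c) (b + e) (a' + c') (b' + e').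
Proof. by rewrite /mk !qaD; ring. Qed.

Lemma mkM a b a' b' c e c' e' : mk a b a' b' * mk c e c' e' =
  mk (a * c + d * b * e - (u * (a' * c' + d * b' * e') + v * d * (a' * e' + b' * c')))
     (a * e + b * c - (u * (a' * e' + b' * c') + v * (a' * c' + d * b' * e')))
     (a * c' + d * b * e' + a' * c + d * b' * e) (a * e' + b * c' + a' * e + b' * c).
Proof. by rewrite /mk !(qaN, qaD, qaM) hu -hw; ring. Qed.

Lemma mk_inj a b a' b' c e c' e' : mk a b a' b' = mk c e c' e' ->
  [/\ a = c, b = e, a' = c' & b' = e'].
Proof.
move=> h; have : mk (a - c) (b - e) (a' - c') (b' - e') = 0.
  by move/eqP: h; rewrite -subr_eq0 => /eqP <-; rewrite /mk !qaB; ring.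
by case/uniq0 => /eqP; rewrite subr_eq0 => /eqP -> /eqP; rewrite subr_eq0 => /eqP -> /eqP;
  rewrite subr_eq0 => /eqP -> /eqP; rewrite subr_eq0 => /eqP ->.
Qed.

(** The hypotheses on K0 and K concern embeddings into algC. These are the embeddings on which they
    are tested: one for each pair of complex numbers satisfying the equations of w and dl. *)
Lemma embed (s t : algC) : s ^+ 2 = ratr d -> t ^+ 2 = - (ratr u + ratr v * s) ->
  exists sg : {rmorphism K -> algC}, forall a b a' b',
    sg (mk a b a' b') = ratr a + ratr b * s + (ratr a' + ratr b' * s) * t.
Proof.
move=> hs ht; have /choice[co hco] : forall x, exists c : rat * rat * (rat * rat),
  x = mk c.1.1 c.1.2 c.2.1 c.2.2.
  by move=> x; have [a [b [a' [b' ->]]]] := rep x; exists (a, b, (a', b')).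
pose sg x : algC := let c := co x in ratr c.1.1 + ratr c.1.2 * s + (ratr c.2.1 + ratr c.2.2 * s) * t.
have sgE a b a' b' : sg (mk a b a' b') = ratr a + ratr b * s + (ratr a' + ratr b' * s) * t.
  by have [e1 e2 e3 e4] := mk_inj (hco (mk a b a' b')); rewrite /sg -e1 -e2 -e3 -e4.
have ht' : ratr u = - t ^+ 2 - ratr v * s :> algC by rewrite ht; ring.
have sgB : zmod_morphism sg.
  move=> x y; rewrite (hco x) (hco y).
  have -> : forall a b a' b' c e c' e', mk a b a' b' - mk c e c' e' =
      mk (a - c) (b - e) (a' - c') (b' - e').
    by move=> *; rewrite /mk !qaB; ring.
  by rewrite !sgE !rmorphB; ring.
have sgM : monoid_morphism sg.
  split=> [|x y].
    have -> : 1 = mk 1 0 0 0 by rewrite /mk qa1 qa0; ring.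
    by rewrite sgE rmorph1 rmorph0; ring.
  rewrite (hco x) (hco y) mkM !sgE !(rmorphN, rmorphD, rmorphM) /= ht' -hs; ring.
pose m1 := GRing.isZmodMorphism.Build _ _ sg sgB.
pose m2 := GRing.isMonoidMorphism.Build _ _ sg sgM.
pose sg' : {rmorphism K -> algC} := HB.pack sg m1 m2.
by exists sg'.
Qed.

End Gens.

(** If u + v s were not positive for a square root s of d, then dl would have a real image and the
    embedding would be real. The positivity of u and of u^2 - v^2 d comes from the sum and the
    product of the two conjugates of u + v s. *)
Lemma cm_gens : quartic_cm K0 -> exists w dl d u v,
  [/\ w \in K0, w ^+ 2 = ia d, dl ^+ 2 = - (ia u + ia v * w), 
     [/\ forall x, exists a b a' b', x = mk w dl a b a' b',
         forall a b a' b', mk w dl a b a' b' = 0 -> [/\ a = 0, b = 0, a' = 0 & b' = 0] &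
         forall x, x \in K0 -> exists a b, x = mk w dl a b 0 0] &
     [/\ 0 < d, 0 < u & v ^+ 2 * d < u ^+ 2]].
Proof.
move=> [dK dK0 re im].
have [|w [wK0 w1 w2 wrep]] := @quad_ext K 1%AS K0 (sub1v _); first by rewrite dK0 dimv1.
have [||dl [_ dl0 dl2 dlrep]] := @quad_ext K K0 {:K}%AS; first exact: subvf.
  by rewrite dK dK0.
have in1 x : x \in (1%AS : {subfield K}) -> exists a, x = ia a.
  by move=> /vlineP[a ->]; exists a.
have [d hw] := in1 _ w2.
have K0rep x : x \in K0 -> exists a b, x = ia a + ia b * w.
  by move=> /wrep[a [b [/in1[a' ->] /in1[b' ->] ->]]]; exists a', b'.
have [|u [v huv]] := K0rep (- dl ^+ 2); first by rewrite rpredN.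
have hdl : dl ^+ 2 = - (ia u + ia v * w) by rewrite -huv opprK.
have rep x : exists a b a' b', x = mk w dl a b a' b'.
  have [a [b [/K0rep[a1 [a2 ->]] /K0rep[b1 [b2 ->]] ->]]] := dlrep x (memvf x).
  by exists a1, a2, b1, b2.
have inK0 a b : ia a + ia b * w \in K0.
  by rewrite rpredD ?rpredM ?qa_vs.
have uniq1 a b : ia a + ia b * w = 0 -> a = 0 /\ b = 0.
  move=> h; have b0 : b = 0.
    apply/eqP; apply: contraNT w1 => b0.
    have -> : w = (- (a / b)) *: 1.
      have b1 : ia b != 0 by rewrite qa_eq0.
      apply: (mulfI b1); rewrite -[RHS]/(ia b * ia (- (a / b))) -qaM mulrN mulrCA divff // mulr1.
      rewrite qaN; apply/eqP; rewrite -addr_eq0 addrC; exact/eqP.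
    by rewrite rpredZ ?rpred1.
  split=> //; apply/eqP; rewrite -(qa_eq0 K); move: h; rewrite b0 qa0 mul0r addr0.
  by move=> ->.
have uniq0 a b a' b' : mk w dl a b a' b' = 0 -> [/\ a = 0, b = 0, a' = 0 & b' = 0].
  move=> h; case: (eqVneq (ia a' + ia b' * w) 0) => [h'|n0].
    have [-> ->] := uniq1 _ _ h'; move: h; rewrite /mk h' mul0r addr0 => /uniq1[-> ->].
    by split.
  case/negP: dl0; have -> : dl = - (ia a + ia b * w) / (ia a' + ia b' * w).
    apply: (mulIf n0); rewrite divfK // mulrC; apply/eqP; rewrite -addr_eq0 addrC; exact/eqP.
  by rewrite rpredM ?rpredV ?rpredN ?inK0.
have rr (a : rat) : (ratr a : algC) \is Num.real by rewrite realE ler0q lerq0 le_total.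
have emb (s : algC) : s ^+ 2 = ratr d -> s \is Num.real /\ 0 < ratr u + ratr v * s.
  move=> hs; have ht := sqrtCK (- (ratr u + ratr v * s)); set t := sqrtC _ in ht.
  have [sg hsg] := embed hw hdl rep uniq0 hs ht.
  have sr : s \is Num.real.
    have := re sg w wK0; have -> : w = mk w dl 0 1 0 0.
      by rewrite /mk qa0 qa1; ring.
    by rewrite hsg !rmorph0 rmorph1 add0r mul1r !mul0r addr0 mul0r addr0.
  split=> //; have Dr : ratr u + ratr v * s \is Num.real.
    by apply: realD; rewrite ?rr //; apply: realM; rewrite ?rr.
  rewrite real_ltNge ?real0 //; apply/negP => D0.
  have tr : t \is Num.real by apply: ger0_real; rewrite sqrtC_ge0 oppr_ge0.
  have [x _ /negP] := im sg; apply; have [a [b [a' [b' ->]]]] := rep x.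
  rewrite hsg; apply: realD; first by apply: realD; rewrite ?rr //; apply: realM; rewrite ?rr.
  by apply: realM => //; apply: realD; rewrite ?rr //; apply: realM; rewrite ?rr.
have [sr D1] := emb _ (sqrtCK (ratr d)).
have [_ D2] := emb (- sqrtC (ratr d)) ltac:(by rewrite sqrrN sqrtCK).
exists w, dl, d, u, v; split=> //.
  by split=> // x /K0rep[a [b ->]]; exists a, b; rewrite /mk qa0; ring.
split.
- rewrite lt_def; apply/andP; split.
    apply: contraNneq w1 => d0; move/eqP: hw; rewrite d0 qa0 expf_eq0 /= => /eqP ->.
    exact: mem0v.
  by rewrite -(ler0q algC) -(sqrtCK (ratr d)) -real_normK // exprn_ge0.
- rewrite -(ltr0q algC) -(pmulr_rgt0 _ (ltr0n algC 2)) /=.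
  have -> : 2%:R * ratr u = (ratr u + ratr v * sqrtC (ratr d)) + (ratr u + ratr v * - sqrtC (ratr d)) :> algC by ring.
  exact: addr_gt0.
rewrite -subr_gt0 -(ltr0q algC).
have -> : ratr (u ^+ 2 - v ^+ 2 * d) = (ratr u + ratr v * sqrtC (ratr d)) * (ratr u + ratr v * - sqrtC (ratr d)) :> algC.
  by rewrite !(rmorphB, rmorphM, rmorphXn) /= -[ratr d in LHS]sqrtCK; ring.
exact: mulr_gt0.
Qed.
End Quartic.

Lemma sq_pm (K : fieldType) (x y : K) : x ^+ 2 = y ^+ 2 -> x = y \/ x = - y.
Proof. by move/eqP; rewrite eqf_sqr => /orP[]/eqP; [left | right]. Qed.

Lemma imag_quad (K : fieldExtType rat) (th : K) r : primitive_cm K ->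
  th ^+ 2 = qa K r -> r < 0 -> False.
Proof.
move=> hprim hth r0; apply: hprim; exists <<1; th>>%AS.
have sq (sg : {rmorphism K -> algC}) : sg th ^+ 2 = ratr r.
  by rewrite -rmorphXn hth /qa alg_num_field fmorph_rat.
split; last first.
  move=> sg; exists th; first exact: memv_adjoin.
  apply/negP => sr; have : 0 <= sg th ^+ 2 by rewrite -real_normK // exprn_ge0.
  by rewrite sq ler0q leNgt r0.
have th1 : th \notin (1%AS : {subfield K}).
  apply/negP => /vlineP[a ha]; move: hth; rewrite ha -[a *: 1]/(qa K a) expr2 -qaM => /eqP.
  rewrite -subr_eq0 -qaB qa_eq0 subr_eq0 => /eqP e; move: r0; rewrite -e -expr2.
  by rewrite ltNge sqr_ge0.
have d2 : (adjoin_degree 1 th <= 2)%N.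
  rewrite -ltnS -size_minPoly -(size_XnsubC (qa K r) (isT : (0 < 2)%N)).
  apply: dvdp_leq; first by rewrite -size_poly_eq0 size_XnsubC.
  apply: minPoly_dvdp.
    by rewrite rpredB ?rpredX ?polyOverX // polyOverC qa_vs.
  by rewrite rootE !hornerE hth subrr.
have d1 : adjoin_degree 1 th != 1%N by rewrite adjoin_deg_eq1.
have d0 : (0 < adjoin_degree 1 th)%N by rewrite /adjoin_degree.
rewrite dim_Fadjoin dimv1 muln1; move: d2 d1 d0.
by case: (adjoin_degree _ _) => [|[|[|m]]].
Qed.

Section Norm.
Variables (K : fieldExtType rat) (K0 : {subfield K}).
Hypotheses (hCM : quartic_cm K0) (hprim : primitive_cm K).
Local Notation ia := (@qa K).
Variable T : K -> K.
Hypotheses (TD : forall x y, T (x + y) = T x + T y) (TM : forall x y, T (x * y) = T x * T y)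
  (T1 : T 1 = 1) (TT : forall x, T (T x) = x).

Lemma T_0 : T 0 = 0. Proof. by apply: (addrI (T 0)); rewrite -TD !addr0. Qed.
Lemma T_N x : T (- x) = - T x.
Proof. by apply/eqP; rewrite -addr_eq0 -TD addNr T_0. Qed.
Lemma T_nat m : T m%:R = m%:R.
Proof. by elim: m => [|m IH]; rewrite ?T_0 // -natr1 TD IH T1. Qed.

Lemma T_qa a : T (ia a) = ia a.
Proof.
have Ti (z : int) : T z%:~R = z%:~R.
  by case: z => m; rewrite ?NegzE ?mulrNz ?T_N -?pmulrn T_nat.
have qi (z : int) : ia z%:~R = z%:~R by rewrite /qa scaler_int.
have e : ia a * (denq a)%:~R = (numq a)%:~R by rewrite -!qi -qaM numqE.
have d0 : ((denq a)%:~R : K) != 0 by rewrite -qi qa_eq0 intr_eq0 denq_neq0.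
by have := congr1 T e; rewrite TM !Ti -e => /(mulIf d0).
Qed.

(* K = Q(w, dl) with w^2 rational and dl^2 in Q(w); [h x] is a quarter of the trace of [x] times
   its complex conjugate.  If T moved w, then dl + T dl or dl - T dl would generate an
   imaginary quadratic field. *)
Lemma cm_norm : (forall x, x \in K0 -> T x = x) /\ exists h : K -> rat,
  [/\ forall x, 0 <= h x, forall x, x != 0 -> 0 < h x,
      forall x y, h (x + y) + h (x - y) = h x * 2%:R + h y * 2%:R,
      forall x m, h (x *+ m) = (m%:R) ^+ 2 * h x &
      (forall f Q, 0 < Q -> T f * f = ia Q -> forall x, h (T f * x) = Q * h x) /\
      forall O : set K, is_order O -> exists m, (0 < m)%N /\
        forall x, O x -> exists z : int, h x *+ m = z%:~R].
Proof.
have [w [dl [d [u [v [wK0 hw hdl [rep uniq0 K0rep] [d0 u0 uv]]]]]]] := cm_gens hCM.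
have mkM := mkM hw hdl; have mki := mk_inj uniq0; have mkD := mkD w dl.
move: mkM mki mkD rep K0rep uniq0; set mk' := mk w dl => mkM mki mkD rep K0rep uniq0.
have iaE a : ia a = mk' a 0 0 0 by rewrite /mk' /mk qa0; ring.
have wE : w = mk' 0 1 0 0 by rewrite /mk' /mk qa0 qa1; ring.
have dlE : dl = mk' 0 0 1 0 by rewrite /mk' /mk qa0 qa1; ring.
have /choice[co hco] : forall x, exists c : rat * rat * (rat * rat),
  x = mk' c.1.1 c.1.2 c.2.1 c.2.2.
  by move=> x; have [a [b [a' [b' ->]]]] := rep x; exists (a, b, (a', b')).
pose re x := (co x).1.1.
pose c x := let z := co x in mk' z.1.1 z.1.2 (- z.2.1) (- z.2.2).
have reE a b a' b' : re (mk' a b a' b') = a.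
  by have [e _ _ _] := mki _ _ _ _ _ _ _ _ (hco (mk' a b a' b')); rewrite /re -e.
have cE a b a' b' : c (mk' a b a' b') = mk' a b (- a') (- b').
  by have [e1 e2 e3 e4] := mki _ _ _ _ _ _ _ _ (hco (mk' a b a' b')); rewrite /c -e1 -e2 -e3 -e4.
have reD x y : re (x + y) = re x + re y by rewrite (hco x) (hco y) mkD !reE.
have reQ r x : re (ia r * x) = r * re x by rewrite iaE (hco x) mkM !reE; ring.
have cD x y : c (x + y) = c x + c y by rewrite (hco x) (hco y) mkD !cE mkD; congr mk'; ring.
have cM x y : c (x * y) = c x * c y by rewrite (hco x) (hco y) mkM !cE mkM; congr mk'; ring.
have cc x : c (c x) = x by rewrite (hco x) !cE !opprK.
have cq a : c (ia a) = ia a by rewrite iaE cE oppr0.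
have cN x : c (- x) = - c x by rewrite -mulN1r -[1](qa1 K) -qaN cM cq qaN qa1 mulN1r.
have cw : c w = w by rewrite wE cE oppr0.
have cdl : c dl = - dl by rewrite -[RHS]mulN1r -[1](qa1 K) -qaN iaE dlE cE mkM; congr mk'; ring.
pose h x := re (x * c x).
have hE a b a' b' : h (mk' a b a' b') =
    a ^+ 2 + d * b ^+ 2 + (u * (a' ^+ 2 + d * b' ^+ 2) + 2%:R * v * d * (a' * b')).
  by rewrite /h cE mkM reE; ring.
(* The square is completed in a': as u, d and u^2 - v^2 d are positive, u h is a sum of squares with
   positive coefficients. *)
have uh a b a' b' : u * h (mk' a b a' b') = u * a ^+ 2 + u * d * b ^+ 2 +
    ((u * a' + v * d * b') ^+ 2 + d * (u ^+ 2 - v ^+ 2 * d) * b' ^+ 2).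
  by rewrite hE; ring.
have uv0 : 0 < u ^+ 2 - v ^+ 2 * d by rewrite subr_gt0.
have pz (r s : rat) : 0 < r -> 0 <= r * s ^+ 2 by move=> r0; rewrite mulr_ge0 ?sqr_ge0 // ltW.
have ud : 0 < u * d by exact: mulr_gt0.
have duv : 0 < d * (u ^+ 2 - v ^+ 2 * d) by exact: mulr_gt0.
have h0 x : 0 <= h x.
  rewrite (hco x) -(pmulr_rge0 _ u0) uh; apply: addr_ge0; first by rewrite addr_ge0 ?pz.
  by rewrite addr_ge0 ?pz ?sqr_ge0.
have hpos x : x != 0 -> 0 < h x.
  move=> x0; rewrite lt_def h0 andbT; apply: contraNneq x0 => hx.
  move: (uh (co x).1.1 (co x).1.2 (co x).2.1 (co x).2.2); rewrite -hco hx mulr0 => /esym/eqP.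
  have p1 := pz _ (co x).1.1 u0; have p2 := pz _ (co x).1.2 ud.
  have p3 : 0 <= (u * (co x).2.1 + v * d * (co x).2.2) ^+ 2 by rewrite sqr_ge0.
  have p4 := pz _ (co x).2.2 duv.
  rewrite paddr_eq0 ?addr_ge0 // paddr_eq0 // paddr_eq0 //.
  rewrite !mulf_eq0 (gt_eqF u0) (gt_eqF d0) (gt_eqF uv0) /= !orbb.
  move=> /andP[/andP[/eqP e1 /eqP e2] /andP[e3 /eqP e4]]; move: e3.
  rewrite e4 mulr0 addr0 mulf_eq0 (gt_eqF u0) /= => /eqP e3.
  by rewrite (hco x) e1 e2 e3 e4 -iaE qa0.
have hpolar x y : h (x + y) + h (x - y) = h x * 2%:R + h y * 2%:R.
  rewrite /h -reD; have -> : (x + y) * c (x + y) + (x - y) * c (x - y) =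
     (x * c x + x * c x) + (y * c y + y * c y) by rewrite !cD cN; ring.
  by rewrite !reD; ring.
have hQ x r : h (ia r * x) = r ^+ 2 * h x.
  by rewrite /h cM cq mulrACA -qaM reQ expr2.
have Tw : T w = w.
  have [//|Tw] : T w = w \/ T w = - w.
    by apply: sq_pm; rewrite expr2 -TM -expr2 hw T_qa.
  exfalso; pose y := T dl.
  have y2 : y ^+ 2 = - (ia u - ia v * w).
    by rewrite expr2 -TM -expr2 hdl T_N TD TM !T_qa Tw mulrN.
  have rey : re (y ^+ 2) = - u.
    by rewrite y2 iaE wE (_ : - _ = mk' (- u) v 0 0) ?reE // /mk' /mk !qaN !qa0 qa1; ring.
  (* The square of y has rational part - u < 0, so c y = y would make h y negative. *)
  have cy : c y = - y.
    have [cy|//] : c y = y \/ c y = - y.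
      by apply: sq_pm; rewrite expr2 -cM -expr2 y2 cN cD cN cM !cq cw.
    by have := h0 y; rewrite /h cy -expr2 rey oppr_ge0 leNgt u0.
  have cm : c (y * dl) = y * dl by rewrite cM cy cdl mulrNN.
  have Tm : T (y * dl) = y * dl by rewrite TM TT mulrC.
  (* Being fixed by c, y dl lies in Q(w); being fixed by T, which maps w to - w, it is rational.
     Then (dl + y)^2 and (dl - y)^2 are both rational, and one of them is negative. *)
  have [a ma] : exists a, y * dl = ia a.
    move: cm Tm; rewrite (hco (y * dl)) cE; set z := co _; move=> /mki[_ _ e1 e2].
    have z1 : z.2.1 = 0 by apply/eqP; move/eqP: e1; rewrite eqNr.
    have z2 : z.2.2 = 0 by apply/eqP; move/eqP: e2; rewrite eqNr.
    rewrite z1 z2; have -> : mk' z.1.1 z.1.2 0 0 = ia z.1.1 + ia z.1.2 * w.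
      by rewrite /mk' /mk qa0; ring.
    rewrite TD TM !T_qa Tw mulrN => /addrI/eqP.
    rewrite eq_sym -addr_eq0 -mulr2n -mulr_natl mulf_eq0 -(qa_nat K 2) qa_eq0 pnatr_eq0 /=.
    rewrite mulf_eq0 qa_eq0 => /orP[].
      by move=> /eqP ->; exists z.1.1; rewrite qa0 mul0r addr0.
    move=> /eqP w0; exfalso; move: hw; rewrite w0 expr0n /= => /esym/eqP.
    by rewrite qa_eq0 (gt_eqF d0).
  have s1 : (dl + y) ^+ 2 = ia (a * 2%:R - u * 2%:R).
    have -> : (dl + y) ^+ 2 = dl ^+ 2 + y ^+ 2 + (y * dl) * 2%:R by ring.
    by rewrite hdl y2 ma qaB !qaM !qa_nat; ring.
  have s2 : (dl - y) ^+ 2 = ia (- a * 2%:R - u * 2%:R).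
    have -> : (dl - y) ^+ 2 = dl ^+ 2 + y ^+ 2 - (y * dl) * 2%:R by ring.
    by rewrite hdl y2 ma qaB !qaM qaN !qa_nat; ring.
  case: (ltP a u) => au; first by apply: (imag_quad hprim s1); rewrite -mulrBl pmulr_llt0 // subr_lt0.
  apply: (imag_quad hprim s2); rewrite -mulrBl pmulr_llt0 // subr_lt0.
  by apply: (lt_trans _ u0); rewrite oppr_lt0; exact: (lt_le_trans u0 au).
split=> [x /K0rep[a [b ->]]|]; first by rewrite /mk' /mk qa0 !mul0r !addr0 !mul0r !addr0 !(TD, TM, T_qa) Tw.
exists h; split=> //.
  by move=> x m; have -> : x *+ m = ia m%:R * x by [rewrite qa_nat mulr_natl]; rewrite hQ.
split=> [f Q Q0 fQ x|O hO].
  suff e : T f * c (T f) = ia Q by rewrite /h cM mulrACA e reQ.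
  (* Since T fixes w, it is the identity or complex conjugation. In the first case f^2 = Q > 0, and
     c f = - f would give h f = - Q; in both cases T f times its conjugate is Q. *)
  have [Td|Td] : T dl = dl \/ T dl = - dl.
    by apply: sq_pm; rewrite expr2 -TM -expr2 hdl T_N TD TM !T_qa Tw.
  - have Tid x' : T x' = x'.
      by rewrite (hco x') /mk' /mk !(TD, TM, T_qa) Tw Td.
    move: fQ; rewrite !Tid => ff; have [-> //|cf] : c f = f \/ c f = - f.
      by apply: sq_pm; rewrite expr2 -cM ff cq.
    have := h0 f; rewrite /h cf mulrN ff -qaN -[ia _]mulr1 reQ -(qa1 K) iaE reE mulr1.
    by rewrite oppr_ge0 leNgt Q0.
  have Tc x' : T x' = c x'.
    by rewrite (hco x') cE /mk' /mk !(TD, TM, T_qa, qaN) Tw Td; ring.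
  by rewrite -[c _]Tc TT.
case: (hO) => _ _ [b [_ eO]].
pose g i j := re (tnth b i * c (tnth b j)).
pose m := (\prod_i \prod_j `|denq (g i j)|)%N; exists m; split.
  by rewrite prodn_gt0 // => i; rewrite prodn_gt0 // => j; rewrite absz_gt0 denq_neq0.
move=> x; rewrite eO => -[z ->].
have gm i j : exists n : int, g i j *+ m = n%:~R.
  exists (numq (g i j) * ((\prod_(j' | j' != j) `|denq (g i j')|) *
     (\prod_(i' | i' != i) \prod_j `|denq (g i' j)|))%N%:Z).
  rewrite /m (bigD1 i) //= (bigD1 j) //= intrM numqE -pmulrn -mulr_natr !natrM.
  have -> : `|denq (g i j)|%:R = (denq (g i j))%:~R :> rat.
    by rewrite -{2}(gez0_abs (ltW (denq_gt0 (g i j)))).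
  by ring.
have cz y (n : int) : c (y *~ n) = c y *~ n.
  have -> : y *~ n = ia n%:~R * y by rewrite /qa scaler_int mulrzl.
  by rewrite cM cq /qa scaler_int mulrzl.
have rez y (n : int) : re (y *~ n) = re y *~ n.
  have -> : y *~ n = ia n%:~R * y by rewrite /qa scaler_int mulrzl.
  by rewrite reQ mulrzl.
have re0 : re 0 = 0 by rewrite -(qa0 K) iaE reE.
have c0 : c 0 = 0 by rewrite -(qa0 K) cq.
rewrite /h (big_morph c cD c0) mulr_suml (big_morph re reD re0) -sumrMnl.
apply: (big_ind (fun y : rat => exists n : int, y = n%:~R)) => [|_ _ [n1 ->] [n2 ->]|i _].
- by exists 0.
- by exists (n1 + n2); rewrite intrD.
rewrite mulr_sumr (big_morph re reD re0) -sumrMnl.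
apply: (big_ind (fun y : rat => exists n : int, y = n%:~R)) => [|_ _ [n1 ->] [n2 ->]|j _].
- by exists 0.
- by exists (n1 + n2); rewrite intrD.
have [n hn] := gm i j; exists (n * (z i * z j)).
rewrite cz mulrzAl mulrzAr !rez intrM -hn intrM -/(g i j); move: (g i j) (z i) (z j) => r s t.
by rewrite -(mulrzr r t) -(mulrzr _ s) -(mulr_natr r m) -(mulr_natr _ m); ring.
Qed.

End Norm.

(** Modulo N = 4 H m + 1 each residue class has at most one element with h <= H. Indeed a difference
    N z satisfies h (N z) <= 4 H, while h z >= 1/m for z nonzero, so that N^2 <= 4 H m, which is
    absurd. The list picks one element from each class that has one. *)
Lemma finite_h (K : fieldExtType rat) (O : set K) (h : K -> rat) m (H : nat) : is_order O ->
  (forall x y, h (x + y) + h (x - y) = h x * 2%:R + h y * 2%:R) -> (forall x, 0 <= h x) ->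
  (forall x, x != 0 -> 0 < h x) -> (forall x n, h (x *+ n) = n%:R ^+ 2 * h x) ->
  (forall x, O x -> exists z : int, h x *+ m = z%:~R) -> (0 < m)%N ->
  exists S : seq K, (forall x, x \in S -> O x) /\ forall x, O x -> h x <= H%:R -> x \in S.
Proof.
move=> hO hpol h0 hpos hM hint m0; pose N := (4 * H * m).+1.
have [S0 [hS0 dig]] := ord_digits hO (ltn0Sn (4 * H * m)).
have /choice[r hr] : forall a, exists r, O r /\ ((exists x y, [/\ O x, O y, x = a + y *+ N & h x <= H%:R]) ->
    exists y, [/\ O y, r = a + y *+ N & h r <= H%:R]).
  move=> a; case: (pselect (exists x y, [/\ O x, O y, x = a + y *+ N & h x <= H%:R])) => [[x [y [Ox Oy e hx]]]|n].
    by exists x; split=> // _; exists y.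
  by exists 0; split=> //; exact: ord0_.
exists (map r S0); split=> [x /mapP[a _ ->]|x Ox hx]; first by case: (hr a).
have [a [y [aS Oy xE]]] := dig x Ox; have [Or hra] := hr a.
have [|y' [Oy' rE hr']] := hra; first by exists x, y.
suff -> : x = r a by exact: map_f.
apply/eqP; rewrite -subr_eq0; have -> : x - r a = (y - y') *+ N.
  by rewrite {1}xE rE mulrnBl opprD addrACA subrr add0r.
case: (eqVneq (y - y') 0) => [->|z0]; first by rewrite mul0rn.
exfalso; have Oz := ordB hO Oy Oy'; have [z hz] := hint _ Oz.
have z1 : 1 <= h (y - y') * m%:R.
  rewrite mulr_natr hz -[1]/(1%:~R) ler_int -gtz0_ge1 -(ltr0z rat) -hz.
  by rewrite pmulrn_lgt0 // hpos.
have le : h ((y - y') *+ N) <= (4 * H)%:R.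
  have -> : (y - y') *+ N = x - r a by rewrite {1}xE rE mulrnBl opprD addrACA subrr add0r.
  have := hpol x (r a); have := h0 (x + r a); have : (4 * H)%:R = 4%:R * H%:R :> rat by rewrite natrM.
  by lra.
rewrite hM in le.
have : N%:R ^+ 2 <= (4 * H * m)%:R :> rat.
  apply: (@le_trans _ _ (N%:R ^+ 2 * (h (y - y') * m%:R))).
    by rewrite ler_peMr // exprn_ge0.
  by rewrite mulrA natrM ler_wpM2r.
by rewrite -natrX ler_nat /N; nia.
Qed.

(** * The Rosati involution on K *)

Section Dag.
Variables (K : fieldExtType rat) (K0 : {subfield K}).
Hypotheses (hCM : quartic_cm K0) (hprim : primitive_cm K).
Variables (k : closedFieldType) (p e q : nat).
Hypotheses (hp : p \in [pchar k])
  (halg : forall x : k, exists m, (0 < m)%N /\ x ^+ (p ^ m) = x)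
  (he : (0 < e)%N) (hq : q = (p ^ e)%N).
Variables (A : abvar k) (F : A -> A).
Hypotheses (hdim : dimension_is (ab_sp A) 2) (hF : abvar_frobenius q F).
Hypothesis dv : forall N, (0 < N)%N -> forall y : A, exists x, x *+ N = y.
Variables (B : abvar k) (Pc : cocycle k (A * B)) (lam : A -> B).
Hypotheses (hB : is_dual Pc) (hlam : principal_polarization Pc lam).
Variables (O : set K) (io : K -> qend A) (en : K -> A -> A).
Hypotheses (hO : is_order O) (hen : cm_act O io en).
Variables (f v : K).
Hypotheses (Of : O f) (Ov : O v) (enf : forall a, en f a = F a) (fv : v * f = q%:R)
  (adjF : adj lam hB F (en v)).
Variable ell : nat.
Hypotheses (pell : prime ell) (hpl : p <> ell).

Local Notation ad x y := (adj lam hB (en x) (en y)).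

Lemma copl t : coprime (ell ^ t) p.
Proof.
by rewrite coprimeXl // prime_coprime // dvdn_prime2 ?(prime_p hp) //; apply/eqP => h; exact: hpl.
Qed.

Lemma left_nondeg N b : (0 < N)%N -> coprime N p -> b *+ N = 0 ->
  (forall a, a *+ N = 0 -> weil Pc N b (lam a) 1) -> b = 0.
Proof.
move=> N0 cN bN h; apply: (weil_nondeg hp (dv N0) hB hlam cN bN) => a aN.
have lb : lam b *+ N = 0 by rewrite -(homMn _ _ (lam_hom hlam)) bN (hom0 (lam_hom hlam)).
have [w hw] := weil_ex hB hlam aN lb.
by have := weil_anti hB hlam (dv N0) (h a aN) hw; rewrite mul1r => w1; rewrite -w1.
Qed.

Lemma dag_ex : exists t : K -> K, forall x, O x -> O (t x) /\ ad x (t x).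
Proof.
suff h x : exists y, O x -> O y /\ ad x y by have [t ht] := choice h; exists t.
case: (pselect (O x)) => Ox; last by exists 0.
have [be [hbe abe]] := adj_ex hB hlam (en_hom hen Ox).
by have [y Oy /funext ye] := en_surj hen hbe; exists y => _; rewrite ye.
Qed.

Lemma ad_inj x y y' : O y -> O y' -> ad x y -> ad x y' -> y = y'.
Proof.
move=> Oy Oy' h h'; apply: (en_inj hen) => // a.
by rewrite (adj_uniq hlam h h').
Qed.

Lemma ad_add x y x' y' : O x -> O x' -> O y -> O y' -> ad x y -> ad x' y' -> ad (x + x') (y + y').
Proof.
move=> Ox Ox' Oy Oy' h h'; have := adj_sum hlam (en_hom hen Ox) (en_hom hen Ox') h h'.
by congr adj; apply/funext => a; rewrite (en_add hen).
Qed.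

Lemma ad_mul x y x' y' : O x -> O x' -> O y -> O y' -> ad x y -> ad x' y' -> ad (x * x') (y * y').
Proof.
move=> Ox Ox' Oy Oy' h h'; have := adj_comp (en_hom hen Ox') h' h.
congr adj; apply/funext => a /=; rewrite (en_mul hen) //.
exact: (en_comm hen).
Qed.

Lemma ad_1 : ad 1 1.
Proof.
have := adj_id lam hB; congr adj; apply/funext => a; rewrite (en_1 hen) //.
Qed.

(** The double adjoint of x agrees with x on A[ell^t] for every t, so the difference is divisible in
    O by all powers of ell. *)
Lemma ad_ad x y z : O x -> O y -> O z -> ad x y -> ad y z -> z = x.
Proof.
move=> Ox Oy Oz h h'; apply/eqP; rewrite -subr_eq0; apply/eqP.
apply: (ord_div0 hO (prime_gt1 pell)) => t.
have l0 : (0 < ell ^ t)%N by rewrite expn_gt0 prime_gt0.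
apply: (divide_kernel hO hen hp he hq hF dv Of Ov enf fv l0 (copl t)); first exact: ordB.
move=> a al; rewrite (en_B hO hen) //.
rewrite (adj_adj hlam (en_hom hen Ox) (en_hom hen Oy) h h' (dv l0) _ al) ?subrr //.
by move=> b bN hb; exact: (left_nondeg l0 (copl t) bN hb).
Qed.

(** The Rosati involution of O, extended to K by clearing the denominators [d x], is an involution
    to which [cm_norm] applies. It maps f to v, and v f = q explains the factor q in the action of v
    on h. *)
Lemma cm_real : (forall x, O x -> x \in K0 -> ad x x) /\ exists h : K -> rat,
  [/\ forall x, 0 <= h x, forall x, x != 0 -> 0 < h x,
      forall x y, h (x + y) + h (x - y) = h x * 2%:R + h y * 2%:R,
      forall x m, h (x *+ m) = (m%:R) ^+ 2 * h x &
      (forall x, h (v * x) = q%:R * h x) /\ exists m, (0 < m)%N /\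
        forall x, O x -> exists z : int, h x *+ m = z%:~R].
Proof.
have [t ht] := dag_ex.
have Ot x : O x -> O (t x) by move=> /ht[].
have tD x y : O x -> O y -> t (x + y) = t x + t y.
  move=> Ox Oy; have Oxy := ordD hO Ox Oy.
  apply: (ad_inj (x := x + y)); [exact: Ot | by apply: (ordD hO); exact: Ot | by case: (ht _ Oxy)|].
  by apply: ad_add; rewrite //; [exact: Ot | exact: Ot | case: (ht _ Ox) | case: (ht _ Oy)].
have tM x y : O x -> O y -> t (x * y) = t x * t y.
  move=> Ox Oy; have Oxy := ordM hO Ox Oy.
  apply: (ad_inj (x := x * y)); [exact: Ot | by apply: (ordM hO); exact: Ot | by case: (ht _ Oxy)|].
  by apply: ad_mul; rewrite //; [exact: Ot | exact: Ot | case: (ht _ Ox) | case: (ht _ Oy)].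
have O1 := ord1_ hO.
have t1 : t 1 = 1 by apply: (ad_inj (x := 1)); [exact: Ot | | by case: (ht _ O1) | exact: ad_1].
have tt x : O x -> t (t x) = x.
  move=> Ox; have [O2 a1] := ht x Ox; have [O3 a2] := ht _ O2; exact: (ad_ad Ox O2 O3 a1 a2).
have t0 : t 0 = 0 by have := tD 0 0 (ord0_ hO) (ord0_ hO); rewrite addr0 => /eqP; rewrite -subr_eq0 opprD addrA subrr sub0r oppr_eq0 => /eqP.
have tMn x m : O x -> t (x *+ m) = t x *+ m.
  move=> Ox; elim: m => [|m IH]; first by rewrite !mulr0n.
  by rewrite !mulrS tD ?IH //; exact: (ordMn hO).
have nz m : (0 < m)%N -> (m%:R : K) != 0.
  by move=> m0; rewrite -qa_nat qa_eq0 pnatr_eq0 -lt0n.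
have /choice[d hd] := ord_scale hO.
pose T x := t (x *+ d x) / (d x)%:R.
have Ts x m : (0 < m)%N -> O (x *+ m) -> T x = t (x *+ m) / m%:R.
  move=> m0 Oxm; have [d0 Oxd] := hd x; rewrite /T; apply/eqP; rewrite eqr_div ?nz //.
  rewrite !mulr_natr -!tMn // -!mulrnA mulnC; exact/eqP.
have TO x : O x -> T x = t x by move=> Ox; rewrite (@Ts x 1) // divr1.
have TD x y : T (x + y) = T x + T y.
  have [dx Ox] := hd x; have [dy Oy] := hd y.
  have m0 : (0 < d x * d y)%N by rewrite muln_gt0 dx.
  have Ox' : O (x *+ (d x * d y)) by rewrite mulrnA; exact: (ordMn hO).
  have Oy' : O (y *+ (d x * d y)) by rewrite mulnC mulrnA; exact: (ordMn hO).
  rewrite !(@Ts _ _ m0) ?mulrnDl //; last exact: (ordD hO).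
  by rewrite tD // mulrDl.
have TM x y : T (x * y) = T x * T y.
  have [dx Ox] := hd x; have [dy Oy] := hd y.
  have m0 : (0 < d x * d y)%N by rewrite muln_gt0 dx.
  have e1 : x * y *+ (d x * d y) = (x *+ d x) * (y *+ d y) by rewrite mulrnA -mulrnAl -mulrnAr.
  rewrite (@Ts _ _ m0) e1; last exact: (ordM hO).
  by rewrite tM // (Ts x _ dx) // (Ts y _ dy) // mulf_div natrM.
have T1 : T 1 = 1 by rewrite TO.
have TT x : T (T x) = x.
  have [dx Ox] := hd x.
  have e1 : T x *+ d x = t (x *+ d x) by rewrite -mulr_natr (Ts x _ dx) // divfK ?nz.
  rewrite (Ts (T x) _ dx) e1; last exact: Ot.
  by rewrite tt // -[x *+ _]mulr_natr mulfK ?nz.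
have [Tr [h [h0 hpos hpol hM [hf hint]]]] := cm_norm hCM hprim TD TM T1 TT.
split=> [x Ox xK0|].
  by have [_] := ht x Ox; rewrite -TO // Tr.
have tf : T f = v.
  rewrite TO //; apply: (ad_inj (x := f)); [exact: Ot | exact: Ov | by case: (ht _ Of)|].
  by have -> : en f = F by apply/funext.
exists h; split=> //; split; last exact: hint hO.
move=> x; rewrite -tf; apply: hf; last by rewrite tf fv qa_nat.
by rewrite ltr0n hq expn_gt0 (prime_gt0 (prime_p hp)).
Qed.

End Dag.

(** * Upper bound for the torsion *)

Section Bound.
Variables (k : closedFieldType) (p e q : nat).
Hypotheses (hp : p \in [pchar k])
  (halg : forall x : k, exists m, (0 < m)%N /\ x ^+ (p ^ m) = x)
  (he : (0 < e)%N) (hq : q = (p ^ e)%N).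
Variables (A : abvar k) (F : A -> A).
Hypotheses (hdim : dimension_is (ab_sp A) 2) (hF : abvar_frobenius q F).
Hypothesis dv : forall N, (0 < N)%N -> forall y : A, exists x, x *+ N = y.
Variables (K : fieldExtType rat) (O : set K) (io : K -> qend A) (en : K -> A -> A).
Hypotheses (hO : is_order O) (hen : cm_act O io en).
Variables (f v : K).
Hypotheses (Of : O f) (Ov : O v) (enf : forall a, en f a = F a) (fv : v * f = q%:R).
Variable h : K -> rat.
Hypotheses (h0 : forall x, 0 <= h x) (hpos : forall x, x != 0 -> 0 < h x)
  (hpol : forall x y, h (x + y) + h (x - y) = h x * 2%:R + h y * 2%:R)
  (hM : forall x m, h (x *+ m) = m%:R ^+ 2 * h x)
  (hv : forall x, h (v * x) = q%:R * h x)
  (hint : exists m, (0 < m)%N /\ forall x, O x -> exists z : int, h x *+ m = z%:~R).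

Lemma Dg_leq n (U : set A) (phi : A -> 'I_n -> k) al d d' : (d <= d')%N ->
  Dg U phi al d -> Dg U phi al d'.
Proof.
move=> dd [Om [o1 o2 o3 ho]]; exists Om; split=> // c /ho[a [b [[sb sa] b0 hb]]].
exists a, b; split=> //; split=> [|j]; exact: msize_widen dd _.
Qed.

Lemma h_sub x y : h (x - y) <= 2%:R * h x + 2%:R * h y.
Proof. by have := hpol x y; have := h0 (x + y); lra. Qed.

Lemma hvX m x : h (v ^+ m * x) = (q ^ m)%N%:R * h x.
Proof.
elim: m => [|m IH]; first by rewrite expr0 mul1r expn0 mul1r.
by rewrite exprS -mulrA hv IH expnS natrM mulrA.
Qed.

Lemma enfX s a : en (f ^+ s) a = iter s F a.
Proof.
elim: s => [|s IH]; first by rewrite expr0 (en_1 hen).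
by rewrite exprS (en_mul hen) ?IH ?enf //; exact: (ordX hO).
Qed.

(* Writing x = a_0 + f^M (a_1 + f^M (a_2 + ...)) with digits a_i in a finite set, each digit
   multiplies the degree by about q^M and divides h by about q^M. *)
Lemma degree_bound : exists n (U : set A) (phi : A -> 'I_n -> k) M E d0 H,
  [/\ fchart q F U phi /\ U 0, (0 < H)%N, (2 ^ 20 * E.+1 ^ 4 <= q ^ M)%N, h 1 <= H%:R &
   forall j x, O x -> h x <= H%:R * (q ^ M %/ 4)%:R ^+ j ->
     Dg U phi (en x) ((2 * E.+1 * q ^ M) ^ j * d0)].
Proof.
have [n [U [phi [hU U0]]]] := fchart_ex hF 0.
have [E0 hE] := Dg_add hU U0; pose E := E0.
have q2 : (1 < q)%N.
  by rewrite hq; apply: leq_trans (prime_gt1 (prime_p hp)) _; rewrite -{1}[p]expn1 leq_pexp2l // prime_gt0 // (prime_p hp).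
(* Chosen so that 2 R^4 <= B^5 later, with R = 2 (E + 1) q^M and B = q^M %/ 4. As B >= q^M / 8, it
   suffices that q^M is at least 2 * 2^4 * 8^5 (E + 1)^4, and 2 * 2^4 * 8^5 = 2^20. *)
pose M := (20 + E.+1 ^ 4)%N.
have qM : (2 ^ 20 * E.+1 ^ 4 <= q ^ M)%N.
  apply: (@leq_trans (2 ^ M)); last by rewrite leq_exp2r // /M addn_gt0.
  by rewrite /M expnD leq_mul2l (ltnW (ltn_expl _ _)) ?orbT.
have qM0 : (0 < q ^ M)%N by rewrite expn_gt0 ltnW.
have [S0 [hS0 dig]] := ord_digits hO qM0.
have degs (S : seq K) : (forall x, x \in S -> O x) -> exists d, forall x, x \in S -> Dg U phi (en x) d.
  elim: S => [|x S IH] hS; first by exists 0%N.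
  have [|d hd] := IH; first by move=> y yS; apply: hS; rewrite inE yS orbT.
  have [d' hd'] := Dg_any hU U0 (en_hom hen (hS x (mem_head _ _))).
  exists (d + d')%N => y; rewrite inE => /orP[/eqP ->|/hd hy].
    by apply: Dg_leq hd'; exact: leq_addl.
  by apply: Dg_leq hy; exact: leq_addr.
have [H [H1 hH]] : exists H : nat, h 1 <= H%:R /\ forall a, a \in S0 -> h a <= H%:R.
  elim: (S0) => [|a S [H [H1 hH]]].
    exists (Num.Def.archi_bound (h 1)); split=> //; apply: ltW; exact: archi_boundP.
  exists (H + Num.Def.archi_bound (h a))%N; split=> [|b].
    by apply: le_trans H1 _; rewrite ler_nat leq_addr.
  rewrite inE => /orP[/eqP ->|/hH hb]; last by apply: le_trans hb _; rewrite ler_nat leq_addr.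
  by apply: le_trans (ltW (archi_boundP (h0 a))) _; rewrite ler_nat leq_addl.
have H0 : (0 < H)%N.
  by rewrite -(ltr0n rat); apply: lt_le_trans H1; apply: hpos; exact: oner_neq0.
have [m [m0 hm]] := hint.
have [S1 [hS1 fin]] := finite_h H hO hpol h0 hpos hM hm m0.
have [d1 hd1] := degs _ hS0; have [d2 hd2] := degs _ hS1.
exists n, U, phi, M, E, (d1 + d2)%N, H; split=> //; elim=> [|j IH] x Ox hx.
  by rewrite mul1n; apply: Dg_leq (hd2 _ (fin x Ox _)); [exact: leq_addl | rewrite expr0 mulr1 in hx].
have [a [y [aS Oy xE]]] := dig x Ox; have Oa := hS0 a aS.
set Bj := _%:R ^+ j.+1 in hx *.
have Oz : O (v ^+ M * y) by apply: (ordM hO) => //; exact: (ordX hO).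
have vf : f ^+ M * (v ^+ M * y) = y *+ q ^ M.
  by rewrite mulrA -exprMn [f * v]mulrC fv -natrX mulr_natl.
have Q0 : 0 < (q ^ M)%:R :> rat by rewrite ltr0n.
have B1 : 1 <= (q ^ M %/ 4)%:R :> rat.
  rewrite ler1n divn_gt0 //; apply: leq_trans qM; apply: (@leq_trans (2 ^ 20 * 1)) => //.
  by rewrite leq_mul2l expn_gt0.
have BQ : 4%:R * (q ^ M %/ 4)%:R <= (q ^ M)%:R :> rat by rewrite -natrM ler_nat mulnC leq_trunc_div.
(* q^M times h (v^M y) is h (x - a) <= 2 h x + 2 h a, at most 4 H B^(j+1) for B = q^M %/ 4. The
   division by 4 in B is there to absorb this 4. *)
have hz : h (v ^+ M * y) <= H%:R * (q ^ M %/ 4)%:R ^+ j.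
  rewrite hvX -(ler_pM2l Q0) mulrA -expr2 -hM.
  have -> : y *+ q ^ M = x - a by rewrite xE addrAC subrr add0r.
  apply: le_trans (h_sub x a) _.
  have b1 : 1 <= (q ^ M %/ 4)%:R ^+ j :> rat by exact: exprn_ege1.
  have H0' : 0 <= H%:R :> rat by [].
  move: hx (hH a aS); rewrite /Bj exprS; move: b1 H0' BQ B1.
  move: (q ^ M %/ 4)%:R ((q ^ M %/ 4)%:R ^+ j) H%:R (q ^ M)%:R (h x) (h a) => b c H' Q X Y c1 H'0 bQ b1 hX hY.
  have s1 : H' * 1 <= H' * (b * c) by rewrite ler_wpM2l // mulr_ege1.
  have s2 : 4%:R * b * (H' * c) <= Q * (H' * c) by rewrite ler_wpM2r // mulr_ge0 // (le_trans ler01).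
  by rewrite mulr1 in s1; nra.
have D1 := Dg_iter hp halg hq hF hU M (IH _ Oz hz).
have al0 : en a 0 = 0 by exact: (en_0 hen).
have be0 : iter M F (en (v ^+ M * y) 0) = 0.
  by rewrite (en_0 hen) // -enfX (en_0 hen) //; exact: (ordX hO).
have D2 := hE _ _ _ _ al0 be0 (hd1 a aS) D1.
apply: Dg_leq (_ : Dg U phi (en x) _); last first.
  have -> : en x = (fun t => en a t + iter M F (en (v ^+ M * y) t)); last exact: D2.
  apply/funext => t; rewrite -enfX -(en_mul hen) ?vf //; last exact: (ordX hO).
  by rewrite xE (en_add hen) //; exact: (ordMn hO).
set R := (2 * E.+1 * q ^ M)%N; have gen (E1 Q1 : nat) : (0 < Q1 -> 0 < 2 * E1.+1 * Q1)%N by nia.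
have R1 : (1 <= R ^ j)%N by rewrite expn_gt0 (gen _ _ qM0).
have fin1 (e1 Q1 Z1 a1 b1 : nat) : (0 < Q1 -> 0 < Z1 ->
    e1 * (a1 + Q1 * (Z1 * (a1 + b1))) <= 2 * e1.+1 * Q1 * Z1 * (a1 + b1))%N.
  move=> Q1' Z1'; have aW : (a1 <= Q1 * (Z1 * (a1 + b1)))%N.
    apply: leq_trans (leq_addr b1 a1) _; apply: leq_trans (leq_pmull _ Z1') _.
    exact: leq_pmull.
  rewrite -!mulnA mulnA; move: aW; set W := (Q1 * _)%N => aW.
  by rewrite mulnA; nia.
by rewrite expnS; exact: fin1.
Qed.

(** Division by ell lifts the ell^5 given points of A[ell] to each level, every lift leaving ell^5
    choices. *)
Lemma torsion_lists ell t (g : {ffun 'I_5 -> 'I_ell} -> A) : (0 < ell)%N -> injective g ->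
  (forall c, g c *+ ell = 0) -> exists S : seq A, [/\ uniq S, size S = (ell ^ (5 * t))%N &
    forall x, x \in S -> x *+ (ell ^ t) = 0].
Proof.
move=> l0 ginj g0; elim: t => [|t [S [uS sS kS]]].
  by exists [:: 0]; split=> // x; rewrite inE => /eqP ->; rewrite mul0rn.
have /choice[r hr] := dv l0.
exists [seq g c + r x | c <- enum {: {ffun 'I_5 -> 'I_ell}}, x <- S]; split.
- apply: allpairs_uniq => //; first exact: enum_uniq.
  move=> [c x] [c' x'] _ _ /= e1.
  have : (g c + r x) *+ ell = (g c' + r x') *+ ell by rewrite e1.
  rewrite !mulrnDl !g0 !add0r !hr => e2; rewrite e2 in e1 *.
  by move/addIr/ginj: e1 => ->.
- by rewrite size_allpairs sS -cardE card_ffun !card_ord -expnD; congr expn; lia.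
move=> x /allpairsP[[c y] /= [_ yS ->]].
by rewrite expnS mulrnA mulrnDl g0 add0r hr kS.
Qed.

(** Let t be largest with ell^(2t) <= B^j. Then h (ell^t) <= H B^j, so multiplication by ell^t has
    degree about R^j and its kernel at most C (R^j d)^2 elements for a constant d, yet at least
    ell^(5t). Squaring, B^(5j) is less than a constant Z times R^(4j); as 2 R^4 <= B^5, this gives
    2^j < Z for every j. *)
Lemma torsion_bound ell (g : {ffun 'I_5 -> 'I_ell} -> A) : (1 < ell)%N -> injective g ->
  (forall c, g c *+ ell = 0) -> False.
Proof.
move=> l1 ginj g0; have l0 := ltnW l1.
have [n [U [phi [M [E [d0 [H [[hU U0] H0 qM h1 hD]]]]]]]] := degree_bound.
have [C hC] := kernel_count hp he hq hU U0 hdim.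
set Q := (q ^ M)%N in qM hD; set B1 := (Q %/ 4)%N in hD.
pose R := (2 * E.+1 * Q)%N; pose Z := (ell ^ 10 * C ^ 2 * d0.+1 ^ 4)%N.
have BR : (2 * R ^ 4 <= B1 ^ 5)%N.
  have BQ : (Q <= B1 * 8)%N by rewrite /B1; lia.
  have e1 : (2 * R ^ 4 * 8 ^ 5 = Q ^ 4 * (2 ^ 20 * E.+1 ^ 4))%N by rewrite /R; ring.
  rewrite -(@leq_pmul2r (8 ^ 5)) // e1 -expnMn.
  apply: (@leq_trans (Q ^ 5)); last by rewrite leq_exp2r.
  by rewrite [X in (_ <= X)%N]expnSr leq_mul2l qM orbT.
have B0 : (0 < B1)%N.
  by rewrite divn_gt0 //; apply: leq_trans qM; apply: (@leq_trans (2 ^ 20 * 1)) => //; rewrite leq_mul2l expn_gt0.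
have R0 : (0 < R)%N.
  by rewrite /R !muln_gt0 /=; apply: leq_trans qM; rewrite muln_gt0 !expn_gt0.
have key j : (2 ^ j < Z)%N.
  pose t := trunc_log (ell ^ 2) (B1 ^ j).
  have Bj : (0 < B1 ^ j)%N by rewrite expn_gt0 B0.
  have l2 : (1 < ell ^ 2)%N by rewrite -(exp1n 2) ltn_exp2r.
  have /andP[t1 t2] := trunc_log_bounds l2 Bj; rewrite -/t -!expnM in t1 t2.
  have lt0 : (0 < ell ^ t)%N by rewrite expn_gt0 l0.
  have [S [uS sS kS]] := torsion_lists t l0 ginj g0.
  have hx : h (ell ^ t)%N%:R <= H%:R * B1%:R ^+ j.
    rewrite hM mulrC ler_pM ?exprn_ge0 // -!natrX ler_nat -expnM mulnC; exact: t1.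
  have Ol := ord_nat hO (ell ^ t).
  have surj y : exists x, en (ell ^ t)%N%:R x = y.
    by have [x <-] := dv lt0 y; exists x; rewrite (en_nat hO hen).
  have := hC _ _ _ (en_hom hen Ol) surj (hD j _ Ol hx) uS.
  rewrite sS => hS; have {hS} : (ell ^ (5 * t) <= C * ((R ^ j * d0).+1) ^ 2)%N.
    by apply: hS => x /kS; rewrite (en_nat hO hen).
  move=> hS; have hS2 : (ell ^ (5 * t) <= C * (R ^ j * d0.+1) ^ 2)%N.
    apply: leq_trans hS _; rewrite leq_mul2l leq_exp2r //; apply/orP; right.
    by have : (0 < R ^ j)%N by [rewrite expn_gt0 R0]; nia.
  have s1 : ((B1 ^ j) ^ 5 < (ell ^ (2 * t.+1)) ^ 5)%N by rewrite ltn_exp2r.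
  have s2 : ((ell ^ (2 * t.+1)) ^ 5 = ell ^ 10 * (ell ^ (5 * t)) ^ 2)%N.
    by rewrite -!expnM -expnD; congr expn; lia.
  have s3 : ((ell ^ (5 * t)) ^ 2 <= (C * (R ^ j * d0.+1) ^ 2) ^ 2)%N by rewrite leq_exp2r.
  have s4 : ((2 * R ^ 4) ^ j <= (B1 ^ j) ^ 5)%N.
    by rewrite -[((B1 ^ j) ^ 5)%N]expnM [(j * 5)%N]mulnC expnM; case: (j) => // j'; rewrite leq_exp2r.
  have s5 : (ell ^ 10 * (C * (R ^ j * d0.+1) ^ 2) ^ 2 = Z * (R ^ j) ^ 4)%N by rewrite /Z; ring.
  have s6 : ((2 * R ^ 4) ^ j = 2 ^ j * (R ^ j) ^ 4)%N by rewrite expnMn -!expnM [(4 * j)%N]mulnC.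
  have RR : (0 < (R ^ j) ^ 4)%N by rewrite !expn_gt0 R0.
  rewrite -(ltn_pmul2r RR) -s6 -s5; apply: leq_ltn_trans s4 (leq_trans s1 _).
  by rewrite s2 leq_mul2l s3 orbT.
by have := key Z; rewrite ltnNge (ltnW (ltn_expl _ _)).
Qed.

End Bound.

(** * Ideals *)

Section Integral.
Variables (K : fieldExtType rat) (K0 : {subfield K}).
Local Notation R := (int_ring K0).

Lemma R0 : R 0. Proof. by split; [exact: mem0v | exact: integral0]. Qed.
Lemma R1 : R 1. Proof. by split; [exact: rpred1 | exact: integral1]. Qed.
Lemma RD x y : R x -> R y -> R (x + y).
Proof. by move=> [x1 x2] [y1 y2]; split; [exact: rpredD | exact: integral_add]. Qed.
Lemma RM x y : R x -> R y -> R (x * y).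
Proof. by move=> [x1 x2] [y1 y2]; split; [exact: rpredM | exact: integral_mul]. Qed.
Lemma RN x : R x -> R (- x).
Proof. by move=> [x1 x2]; split; [rewrite rpredN | exact: integral_opp]. Qed.

Lemma RX x m : R x -> R (x ^+ m).
Proof. by move=> hx; elim: m => [|m IH]; rewrite ?expr0 ?exprS; [exact: R1 | exact: RM]. Qed.
Lemma RMn x m : R x -> R (x *+ m).
Proof. by move=> hx; elim: m => [|m IH]; rewrite ?mulr0n ?mulrS; [exact: R0 | exact: RD]. Qed.
Lemma Rnat m : R m%:R. Proof. by apply: RMn; exact: R1. Qed.

Definition pid (a : K) : set K := scale_set a R.

Lemma pidP a x : pid a x <-> exists2 r, R r & x = a * r.
Proof. by split=> [[r hr <-]|[r hr ->]]; exists r. Qed.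

Lemma pidMr a r : R r -> pid a (a * r). Proof. by move=> hr; exists r. Qed.
Lemma pidD a x y : pid a x -> pid a y -> pid a (x + y).
Proof. by move=> [r hr <-] [s hs <-]; exists (r + s); rewrite ?mulrDr //; exact: RD. Qed.
Lemma pidM a r x : R r -> pid a x -> pid a (r * x).
Proof. by move=> hr [s hs <-]; exists (r * s); [exact: RM | rewrite mulrCA]. Qed.
Lemma pidN a x : pid a x -> pid a (- x).
Proof. by move=> [r hr <-]; exists (- r); [exact: RN | rewrite mulrN]. Qed.
Lemma pidB a x y : pid a x -> pid a y -> pid a (x - y).
Proof. by move=> hx hy; apply: pidD => //; exact: pidN. Qed.

Lemma pid_mul a b : ideal_mul (pid a) (pid b) = pid (a * b).
Proof.
apply/seteqP; split=> x.
  move=> [s [hs ->]]; rewrite big_seq; apply: (big_ind (fun y => pid (a * b) y)) => [||u us].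
  - by exists 0; [exact: R0 | rewrite mulr0].
  - by move=> y z; exact: pidD.
  have [[r hr <-] [r' hr' <-]] := hs u us.
  by exists (r * r'); [exact: RM | rewrite mulrACA].
move=> [r hr <-]; exists [:: (a * 1, b * r)]; split; last by rewrite big_seq1 mulr1 mulrA.
by move=> u; rewrite inE => /eqP ->; split; apply: pidMr; [exact: R1 | ].
Qed.

Lemma pid1 : pid 1 = R.
Proof. by apply/seteqP; split=> x => [[r hr <-]|hx]; rewrite ?mul1r //; exists x; rewrite ?mul1r. Qed.

Lemma pid_exp a m : ideal_exp R (pid a) m = pid (a ^+ m).
Proof.
elim: m => [|m IH]; first by rewrite /ideal_exp /= pid1.
by rewrite /ideal_exp iterS -/(ideal_exp R (pid a) m) IH pid_mul exprS.
Qed.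

(** Translation by x permutes the representatives modulo N; comparing their sums before and after
    leaves d times x in N. *)
Lemma lagrange (N : set K) d : (forall x y, N x -> N y -> N (x - y)) ->
  index_is R N d -> forall x, R x -> N (x *+ d).
Proof.
move=> NB [s [[us sd] sR rep uq]] x Rx.
have N0 : N 0.
  by have [y ys Ny] := rep _ R0; rewrite -(subrr (0 - y)); exact: NB.
have ND y z : N y -> N z -> N (y + z).
  by move=> hy hz; rewrite -[z]opprK; apply: (NB) => //; rewrite -sub0r; exact: NB.
have /choice[g hg] : forall y, exists z, y \in s -> z \in s /\ N (y + x - z).
  move=> y; case: (boolP (y \in s)) => ys; last by exists 0.
  by have [z zs hz] := rep (y + x) (RD (sR y ys) Rx); exists z.
have gi : {in s &, injective g}.
  move=> y z ys zs e; have [h1 h2] := hg y ys; have [h3 h4] := hg z zs.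
  by apply: uq => //; have := NB _ _ h2 h4; rewrite e; congr N; ring.
have ug : uniq (map g s) by rewrite map_inj_in_uniq.
have sub : {subset map g s <= s} by move=> _ /mapP[y ys ->]; case: (hg y ys).
have [_ eg] := uniq_min_size ug sub (eq_leq (esym (size_map g s))).
have pg : perm_eq (map g s) s by exact: (uniq_perm ug us eg).
have e : \sum_(y <- s) g y = \sum_(y <- s) y by rewrite -[RHS](perm_big _ pg) big_map.
have : N (\sum_(y <- s) (y + x - g y)).
  rewrite big_seq; apply: (big_ind N) => // y ys; exact: (hg y ys).2.
rewrite sumrB big_split /= e addrAC subrr add0r.
by rewrite big_const_seq count_predT iter_addr_0 sd.
Qed.

(** The basis of O is an eigenvector, with eigenvalue x, of the integral matrix of multiplication by
    x. *)
Lemma order_integral (O : set K) x : is_order O -> O x -> integralOver (intr : int -> K) x.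
Proof.
move=> hO Ox; have [_ OM [b [bb eO]]] := hO.
have Ob i : O (tnth b i).
  rewrite eO; exists (fun j => (j == i)%:Z); rewrite (bigD1 i) //= eqxx big1 ?addr0 //.
  by move=> j /negPf ->.
have /choice[c hc] : forall j, exists c : 'I_(\dim {:K}) -> int, x * tnth b j = \sum_i tnth b i *~ c i.
  by move=> j; have := OM _ _ Ox (Ob j); rewrite eO.
pose M : 'M[int]_(\dim {:K}) := \matrix_(i, j) c j i.
exists (char_poly M); first exact: char_poly_monic.
rewrite map_char_poly -eigenvalue_root_char; apply/eigenvalueP.
exists (\row_i tnth b i).
  apply/rowP => j; rewrite !mxE hc; apply: eq_bigr => i _; by rewrite !mxE mulrzr.
apply/negP => /eqP/rowP h; have := oner_neq0 K.
rewrite (coord_basis bb (memvf 1)) big1 ?eqxx // => i _.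
by have := h i; rewrite !mxE (tnth_nth 0) => ->; rewrite scaler0.
Qed.

Section Split.
Variables (ell : nat) (eta eta' w : K) (f : nat).
Hypotheses (pell : prime ell) (Re : R eta) (Re' : R eta') (Rw : R w) (hw : eta * eta' * w = ell%:R)
  (pr : is_prime_ideal R (pid eta)) (pr' : is_prime_ideal R (pid eta'))
  (neq : pid eta <> pid eta') (idx : index_is R (pid eta) ell) (idx' : index_is R (pid eta') ell).

(** The residue ring has ell elements and the multiples b *+ i with i < ell are distinct in it, so
    one of them is 1. The inverse is thus an integer: the residue field is the prime field. *)
Lemma inv_modg th b : is_prime_ideal R (pid th) -> index_is R (pid th) ell -> pid th ell%:R ->
  R b -> ~ pid th b -> exists i, pid th (1 - b *+ i).
Proof.
move=> [_ n1 hp] [s [[us sd] sR rep uq]] lth Rb nb.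
have /choice[g hg] : forall x, exists y, R x -> y \in s /\ pid th (x - y).
  move=> x; case: (pselect (R x)) => Rx; last by exists 0.
  by have [y ys hy] := rep x Rx; exists y.
pose h (i : 'I_ell) := g (b *+ i).
have Rbi i : R (b *+ i) by exact: RMn.
have hi : injective h.
  suff aux (i j : 'I_ell) : (i < j)%N -> h i = h j -> False.
    move=> i j e; case: (ltngtP i j) => ij; last exact: val_inj.
      by case: (aux i j).
    by case: (aux j i).
  move=> ij e; have [_ h1] := hg _ (Rbi i); have [_ h2] := hg _ (Rbi j).
  have : pid th ((j - i)%N%:R * b).
    have := pidB h2 h1; rewrite -/(h i) -/(h j) e; congr pid.
    by rewrite opprB addrA subrK mulr_natl mulrnBr ?(ltnW ij).
  move=> /(hp _ _ (Rnat _) Rb)[hji|//]; apply: n1.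
  have c1 : coprime (j - i) ell.
    by rewrite coprime_sym prime_coprime // gtnNdvd ?subn_gt0 //; apply: leq_ltn_trans (leq_subr _ _) _.
  have j0 : (0 < j - i)%N by rewrite subn_gt0.
  have [u v uv _] := egcdnP ell j0; rewrite (eqP c1) in uv.
  have -> : 1 = u%:R * (j - i)%N%:R - v%:R * ell%:R :> K.
    by rewrite -!natrM uv natrD addrAC subrr add0r.
  by apply: pidB; apply: pidM => //; exact: Rnat.
have uh : uniq (map h (enum 'I_ell)) by rewrite map_inj_uniq ?enum_uniq.
have sh : {subset map h (enum 'I_ell) <= s} by move=> _ /mapP[i _ ->]; case: (hg _ (Rbi i)).
have [|_ eh] := uniq_min_size uh sh; first by rewrite size_map size_enum_ord sd.
have [g1 h1] := hg 1 R1; rewrite -eh in g1; have /mapP[i _ e] := g1.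
have [_ h2] := hg _ (Rbi i); exists i.
have := pidB h1 h2; rewrite -/(h i) -e; congr pid; by rewrite opprB addrA subrK.
Qed.

Lemma ell_in : pid eta ell%:R.
Proof. by rewrite -hw -mulrA; apply: pidMr; exact: RM. Qed.
Lemma ell_in' : pid eta' ell%:R.
Proof. by rewrite -hw [eta * eta']mulrC -mulrA; apply: pidMr; exact: RM. Qed.

Lemma inv_mod b : R b -> ~ pid eta b -> exists i, pid eta (1 - b *+ i).
Proof. exact: (inv_modg pr idx ell_in). Qed.

Lemma comax : exists a b, [/\ pid eta a, pid eta' b & a + b = 1].
Proof.
have [h|h] := pselect (pid eta' `<=` pid eta); last first.
  have [b [b1 b2]] : exists b, pid eta' b /\ ~ pid eta b.
    by apply: contrapT => nb; apply: h => b hb; apply: contrapT => h'; apply: nb; exists b.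
  have Rb : R b by have [[sub _ _ _] _ _] := pr'; exact: sub.
  have [i hi] := inv_mod Rb b2; exists (1 - b *+ i), (b *+ i); split=> //; last by rewrite subrK.
  by rewrite -mulr_natl; apply: pidM => //; exact: Rnat.
have [b [b1 b2]] : exists b, pid eta b /\ ~ pid eta' b.
  apply: contrapT => nb; apply: neq; apply/seteqP; split=> // b hb.
  by apply: contrapT => h'; apply: nb; exists b.
have Rb : R b by have [[sub _ _ _] _ _] := pr; exact: sub.
have [i hi] := inv_modg pr' idx' ell_in' Rb b2.
exists (b *+ i), (1 - b *+ i); split=> //; last by rewrite addrC subrK.
by rewrite -mulr_natl; apply: pidM => //; exact: Rnat.
Qed.

Lemma comaxX s : exists u, pid (eta' ^+ s) u /\ pid (eta ^+ s) (1 - u).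
Proof.
have [a [b [/pidP[a' Ra ->] /pidP[b' Rb ->] ab]]] := comax.
elim: s => [|s [u [/pidP[u1 Ru e1] /pidP[u2 Ru' e2]]]].
  by exists 0; rewrite !expr0 pid1 subr0; split; [exact: R0 | exact: R1].
have cop (x y x1 y1 : K) m : R x -> R y -> R x1 -> R y1 -> x * x1 + y * y1 = 1 ->
    exists x2 y2, [/\ R x2, R y2 & x ^+ m * x2 + y * y2 = 1].
  move=> Rx Ry Rx1 Ry1 e; elim: m => [|m [x2 [y2 [Rx2 Ry2 IH]]]].
    by exists 1, 0; rewrite expr0 mulr1 mulr0 addr0; split=> //; [exact: R1 | exact: R0].
  exists (x1 * x2), (y1 + y2 * x * x1); split; [exact: RM | by apply: RD => //; do 2 apply: RM => // |].
  have -> : x ^+ m.+1 * (x1 * x2) + y * (y1 + y2 * x * x1) = x * x1 * (x ^+ m * x2 + y * y2) + y * y1.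
    by rewrite exprS; ring.
  by rewrite IH mulr1.
have [x1 [y1 [Rx1 Ry1 h1]]] := cop _ _ _ _ s.+1 Re Re' Ra Rb ab.
have [y2 [x2 [Ry2 Rx2 h2]]] := cop _ _ _ _ s.+1 Re' (RX s.+1 Re) Ry1 Rx1 (etrans (addrC _ _) h1).
exists (eta' ^+ s.+1 * y2); split; first exact: pidMr.
by rewrite -h2 addrAC subrr add0r; exact: pidMr.
Qed.

End Split.
End Integral.

(** * Localization *)

Section Local.
Variables (K : fieldExtType rat) (K0 : {subfield K}).
Local Notation R := (int_ring K0).
Variables (ell : nat) (eta eta' w : K).
Hypotheses (pell : prime ell) (Re : R eta) (Re' : R eta') (Rw : R w) (hw : eta * eta' * w = ell%:R)
  (pr : is_prime_ideal R (pid K0 eta)) (ne' : ~ pid K0 eta eta') (nw : ~ pid K0 eta w).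
Local Notation l := (pid K0 eta).
Variable O2 : set K.
Hypothesis O2s : forall x, exists m, (0 < m)%N /\ O2 (x *+ m).
Local Notation S2 := (ideal_mul R O2).

(** [loc_mem] is the localization at l of the R-module generated by O2, written without fractions,
    and [loc_max] is its product with l. *)
Definition loc_mem (x : K) := exists d, [/\ R d, ~ l d & S2 (d * x)].
Definition loc_max (x : K) := exists d y, [/\ R d, ~ l d, S2 y & d * x = eta * y].

Lemma S2D x y : S2 x -> S2 y -> S2 (x + y).
Proof.
move=> [s [hs ->]] [t [ht ->]]; exists (s ++ t); split; last by rewrite big_cat.
by move=> u; rewrite mem_cat => /orP[/hs|/ht].
Qed.

Lemma S2M r x : R r -> S2 x -> S2 (r * x).
Proof.
move=> Rr [s [hs ->]]; exists [seq (r * u.1, u.2) | u <- s]; split.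
  by move=> _ /mapP[u us ->] /=; have [h1 h2] := hs u us; split=> //; exact: RM.
by rewrite big_map mulr_sumr; apply: eq_bigr => u _; rewrite /= mulrA.
Qed.

Lemma S2i r x : R r -> O2 x -> S2 (r * x).
Proof. by move=> Rr Ox; exists [:: (r, x)]; split; [move=> u; rewrite inE => /eqP -> | rewrite big_seq1]. Qed.

Lemma nlM d d' : R d -> R d' -> ~ l d -> ~ l d' -> ~ l (d * d').
Proof. by have [_ _ hp] := pr; move=> Rd Rd' nd nd' /(hp _ _ Rd Rd')[]. Qed.

Lemma loc_memD x y : loc_mem x -> loc_mem y -> loc_mem (x + y).
Proof.
move=> [d [Rd nd hd]] [d' [Rd' nd' hd']]; exists (d * d'); split; [exact: RM | exact: nlM |].
rewrite mulrDr; apply: S2D; last by rewrite -mulrA; exact: S2M.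
by rewrite mulrAC mulrC; exact: S2M.
Qed.

Lemma loc_maxD x y : loc_max x -> loc_max y -> loc_max (x + y).
Proof.
move=> [d [u [Rd nd hu hd]]] [d' [u' [Rd' nd' hu' hd']]].
exists (d * d'), (d' * u + d * u'); split; [exact: RM | exact: nlM | by apply: S2D; exact: S2M |].
have -> : d * d' * (x + y) = d' * (d * x) + d * (d' * y) by ring.
by rewrite hd hd'; ring.
Qed.

Lemma loc_maxM r x : R r -> loc_max x -> loc_max (r * x).
Proof.
move=> Rr [d [u [Rd nd hu hd]]]; exists d, (r * u); split=> //; first exact: S2M.
by rewrite mulrCA hd mulrCA.
Qed.

Lemma loc_max_mem x : loc_max x -> loc_mem x.
Proof. by move=> [d [u [Rd nd hu hd]]]; exists d; split=> //; rewrite hd; exact: S2M. Qed.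

Lemma S2_mem x : S2 x -> loc_mem x.
Proof. by have [_ n1 _] := pr; move=> hx; exists 1; split=> //; [exact: R1 | rewrite mul1r]. Qed.

Lemma nl_nat m : coprime m ell -> ~ l m%:R.
Proof.
move=> cm hm; have [_ n1 _] := pr; apply: n1.
case: (posnP m) => [m0|m0].
  by move: cm pell; rewrite m0 /coprime gcd0n => /eqP ->.
have [u v uv _] := egcdnP ell m0; rewrite (eqP cm) in uv.
have -> : 1 = u%:R * m%:R - v%:R * ell%:R :> K.
  by rewrite -!natrM uv natrD addrAC subrr add0r.
apply: pidB; apply: pidM => //; try exact: Rnat.
by rewrite -hw -mulrA; apply: pidMr; exact: RM.
Qed.

(** By [ne'] and [nw], ell is eta times an element outside l. Some m x lies in O2; the part of m
    prime to ell is outside l, the rest of m is a power of eta up to elements outside l, and one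
    more factor eta leads into [loc_max]. *)
Lemma absorb x : exists s, forall r, R r -> loc_max (eta ^+ s * r * x).
Proof.
have [m [m0 hm]] := O2s x; have [_ n1 _] := pr.
have [c cm em] := pfactor_coprime pell m0.
have nX y s : R y -> ~ l y -> ~ l (y ^+ s).
  move=> Ry ny; elim: s => [|s IH]; first by rewrite expr0.
  by rewrite exprS; apply: nlM => //; exact: RX.
exists (logn ell m).+1 => r Rr; exists (c%:R * (eta' * w) ^+ logn ell m), (r * (x *+ m)); split.
- by apply: RM; [exact: Rnat | apply: RX; exact: RM].
- apply: nlM; [exact: Rnat | by apply: RX; exact: RM | by apply: nl_nat; rewrite coprime_sym |].
  by apply: nX; [exact: RM | exact: nlM].
- exact: S2i.
have emK : m%:R = c%:R * (eta * eta' * w) ^+ logn ell m :> K by rewrite hw -natrX -natrM -em.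
by rewrite exprS -[x *+ m]mulr_natr emK !exprMn; ring.
Qed.

(* The balanced map sends (x, z) to the class of x z_i modulo [loc_max], which is constant for
   large i. *)
Lemma local_sub_mem O1 x : local_sub R l O1 O2 -> O1 x -> loc_mem x.
Proof.
move=> ls Ox; have [_ n1 _] := pr.
pose S : K -> bool := fun y => `[< loc_max y >].
have maxN y : loc_max y -> loc_max (- y).
  by rewrite -mulN1r; apply: loc_maxM; apply: RN; exact: R1.
have max0 : loc_max 0.
  exists 1, 0; split; [exact: R1 | by [] | by exists [::]; rewrite big_nil | by rewrite !mulr0].
have zS : zmod_closed S.
  split=> [|y z]; first by apply/asboolP.
  by move=> /asboolP hy /asboolP hz; apply/asboolP; apply: loc_maxD => //; exact: maxN.
pose Wc : zmodClosed K := HB.pack S (GRing.isZmodClosed.Build K S zS).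
pose V := Quotient.quot Wc.
pose cl (y : K) : V := (\pi_V y)%qT.
have clD y z : cl (y + z) = cl y + cl z by exact: Quotient.pi_add.
have clE y z : cl y = cl z <-> loc_max (y - z).
  split=> [/eqP|h].
    by rewrite -Quotient.idealrBE => /asboolP.
  by apply/eqP; rewrite -Quotient.idealrBE; apply/asboolP.
pose C := completion R l.
have /choice[N hN] : forall xz : K * (nat -> K), exists N, C xz.2 -> forall i j,
    (N <= i)%N -> (N <= j)%N -> loc_max (xz.1 * (xz.2 i - xz.2 j)).
  move=> [y z] /=; case: (pselect (C z)) => [[Rz hz]|]; last by exists 0%N.
  have [s hs] := absorb y; have [N hN] := hz s; exists N => _ i j hi hj.
  have := hN i j hi hj; rewrite pid_exp // => /pidP[r Rr ->].
  by rewrite mulrC; exact: hs.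
pose b (y : K) (z : nat -> K) : V := cl (y * z (N (y, z))).
have bE y z i : C z -> (N (y, z) <= i)%N -> b y z = cl (y * z i).
  by move=> Cz hi; apply/clE; rewrite -mulrBr; apply: (hN (y, z)).
have ex s : ideal_exp R l s = pid K0 (eta ^+ s) by exact: pid_exp.
have CD z z' : C z -> C z' -> C (fun i => z i + z' i).
  move=> [Rz hz] [Rz' hz']; split=> [i|s]; first exact: RD.
  have [m1 h1] := hz s; have [m2 h2] := hz' s; exists (m1 + m2)%N => i j hi hj.
  rewrite opprD addrACA ex; apply: pidD; rewrite -ex; [apply: h1|apply: h2]; lia.
have CM c z : R c -> C z -> C (fun i => c * z i).
  move=> Rc [Rz hz]; split=> [i|s]; first exact: RM.
  have [m1 h1] := hz s; exists m1 => i j hi hj.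
  by rewrite -mulrBr ex; apply: pidM => //; rewrite -ex; exact: h1.
have up (a1 a2 a3 : nat) : exists i, [/\ (a1 <= i)%N, (a2 <= i)%N & (a3 <= i)%N].
  by exists (a1 + a2 + a3)%N; split; lia.
have bal : balanced R l b.
  split.
  - move=> y z z' Cz Cz' nd; have [s hs] := absorb y; have [m1 h1] := nd s.
    have [i [i1 i2 i3]] := up (N (y, z)) (N (y, z')) m1.
    rewrite (bE y z i Cz i1) (bE y z' i Cz' i2); apply/clE; rewrite -mulrBr.
    have := h1 i i3; rewrite ex => /pidP[r Rr ->].
    by rewrite mulrC; exact: hs.
  - move=> y y' z Cz; have [i [i1 i2 i3]] := up (N (y, z)) (N (y', z)) (N (y + y', z)).
    by rewrite (bE _ _ i Cz i1) (bE _ _ i Cz i2) (bE _ _ i Cz i3) mulrDl clD.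
  - move=> y z z' Cz Cz'.
    have [i [i1 i2 i3]] := up (N (y, z)) (N (y, z')) (N (y, fun i => z i + z' i)).
    by rewrite (bE _ _ i Cz i1) (bE _ _ i Cz' i2) (bE _ _ i (CD _ _ Cz Cz') i3) mulrDr clD.
  move=> c y z Rc Cz; have [i [i1 i2 _]] := up (N (c * y, z)) (N (y, fun i => c * z i)) 0%N.
  by rewrite (bE _ _ i Cz i1) (bE _ _ i (CM _ _ Rc Cz) i2) mulrCA mulrA.
have C1 : C (fun=> 1).
  split=> [_|s]; first exact: R1.
  by exists 0%N => i j _ _; rewrite subrr ex; apply/pidP; exists 0; [exact: R0 | rewrite mulr0].
have [t' ht' /(_ V b bal)] := ls [:: (x, fun=> 1)] ltac:(by case).
rewrite big_seq1 (@bE x _ _ C1 (leqnn _)) mulr1.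
have [y Sy ->] : exists2 y, S2 y & \sum_(u <- t') b u.1 u.2 = cl y.
  elim: t' ht' => [|u t' IH] ht'.
    exists 0; first by exists [::]; rewrite big_nil.
    rewrite big_nil; apply: (addrI (cl 0)); by rewrite -clD !addr0.
  have [|y Sy ey] := IH; first by move=> i hi; exact: (ht' i.+1).
  have [O2u Cu] := ht' 0%N isT; have [Ru _] := Cu.
  exists (u.1 * u.2 (N (u.1, u.2)) + y).
    by apply: S2D => //; rewrite mulrC; exact: S2i.
  by rewrite big_cons ey clD.
(* The tensor identity only shows that x is congruent modulo [loc_max] to an element y of R O2; this
   is enough because [loc_max] is contained in [loc_mem]. *)
move/clE => /loc_max_mem h; rewrite -(subrK y x); apply: loc_memD => //; exact: S2_mem.
Qed.

End Local.

(** * Alternating pairings on torsion *)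

Lemma zinv (V : zmodType) (x : V) ell m : prime ell -> x *+ ell = 0 -> ~~ (ell %| m)%Z ->
  exists d : int, x *~ m *~ d = x.
Proof.
move=> pell xl nm; have [u [u' e]] := Bezoutz m ell.
have g1 : gcdz m ell = 1.
  have /eqP c : coprime `|m| ell by rewrite coprime_sym prime_coprime.
  by rewrite /gcdz absz_nat c.
exists u; rewrite -mulrzA mulrC; have -> : u * m = 1 - u' * ell%:Z by rewrite -g1 -e addrK.
by rewrite mulrzBr mulr1z mulrC mulrzA -pmulrn xl mul0rz subr0.
Qed.

Lemma cyc_step (V : zmodType) (S : set V) ell z (c c' : 'I_ell) s s' : prime ell ->
  z *+ ell = 0 -> (forall x y, S x -> S y -> S (x - y)) -> (forall x m, S x -> S (x *~ m)) ->
  ~ S z -> S s -> S s' -> s + z *+ c = s' + z *+ c' -> c = c' /\ s = s'.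
Proof.
move=> pell zl SB SM nz hs hs' e.
suff ec : c = c' by split=> //; move: e; rewrite ec => /addIr.
apply: contrapT => nc; apply: nz.
have ez : z *~ (c%:Z - c'%:Z) = s' - s.
  rewrite mulrzBr -!pmulrn; apply/eqP; rewrite subr_eq addrAC eq_sym subr_eq eq_sym [z *+ c + s]addrC.
  by apply/eqP.
have [|d <-] := zinv (m := c%:Z - c'%:Z) pell zl; last by apply: SM; rewrite ez; exact: SB.
apply/negP => /dvdzP[m hm]; apply: nc; apply: val_inj => /=.
have h1 := ltn_ord c; have h2 := ltn_ord c'.
case: m hm => [[|m]|m] hm; [by lia | by nia | by nia].
Qed.

Section Comp.
Variables (V : zmodType) (k : fieldType) (ell n : nat).
Hypotheses (pell : prime ell) (n0 : (0 < n)%N) (dv : forall y : V, exists x, x *+ (ell ^ n.-1) = y).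
Local Notation N := (ell ^ n)%N.
Local Notation tor a := (a *+ N = 0).
Variable e : V -> V -> k.
Hypotheses (eDl : forall a a' b, tor a -> tor a' -> tor b -> e (a + a') b = e a b * e a' b)
  (eDr : forall a b b', tor a -> tor b -> tor b' -> e a (b + b') = e a b * e a b')
  (eaa : forall a, tor a -> e a a = 1) (enz : forall a b, tor a -> tor b -> e a b != 0)
  (end_ : forall a, tor a -> (forall b, tor b -> e a b = 1) -> a = 0).

Lemma torMn (a : V) m : tor a -> tor (a *+ m).
Proof. by move=> h; rewrite mulrnAC h mul0rn. Qed.
Lemma torMz (a : V) m : tor a -> tor (a *~ m).
Proof. by move=> h; rewrite pmulrn -mulrzA mulrC mulrzA -pmulrn h mul0rz. Qed.
Lemma tor0 : tor (0 : V). Proof. exact: mul0rn. Qed.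

Lemma e0l b : tor b -> e 0 b = 1.
Proof.
move=> tb; have := eDl tor0 tor0 tb; rewrite addr0 => h.
by apply: (mulfI (enz tor0 tb)); rewrite mulr1.
Qed.
Lemma e0r b : tor b -> e b 0 = 1.
Proof.
move=> tb; have := eDr tb tor0 tor0; rewrite addr0 => h.
by apply: (mulfI (enz tb tor0)); rewrite mulr1.
Qed.

Lemma eMnl a b m : tor a -> tor b -> e (a *+ m) b = e a b ^+ m.
Proof.
move=> ta tb; elim: m => [|m IH]; first by rewrite mulr0n e0l.
by rewrite mulrS eDl ?IH ?exprS //; exact: torMn.
Qed.
Lemma eMnr a b m : tor a -> tor b -> e a (b *+ m) = e a b ^+ m.
Proof.
move=> ta tb; elim: m => [|m IH]; first by rewrite mulr0n e0r.
by rewrite mulrS eDr ?IH ?exprS //; exact: torMn.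
Qed.

Lemma e1Mz a b m : tor a -> tor b -> e a b = 1 -> e a (b *~ m) = 1.
Proof.
move=> ta tb h; case: m => m; first by rewrite -pmulrn eMnr // h expr1n.
rewrite NegzE mulrNz -pmulrn; have tm := torMn m.+1 tb.
have tN : tor (- (b *+ m.+1)) by rewrite mulNrn tm oppr0.
by have := eDr ta tm tN; rewrite subrr e0r // eMnr // h expr1n mul1r.
Qed.

Lemma e1Mzl a b m : tor a -> tor b -> e a b = 1 -> e (a *~ m) b = 1.
Proof.
move=> ta tb h; case: m => m; first by rewrite -pmulrn eMnl // h expr1n.
rewrite NegzE mulrNz -pmulrn; have tm := torMn m.+1 ta.
have tN : tor (- (a *+ m.+1)) by rewrite mulNrn tm oppr0.
by have := eDl tm tN tb; rewrite subrr e0l // eMnl // h expr1n mul1r.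
Qed.

Section Projector.
Variable ep : V -> V.
Hypotheses (epD : forall x y, ep (x + y) = ep x + ep y) (ept : forall a, tor a -> ep (ep a) = ep a)
  (epadj : forall a b, tor a -> tor b -> e (ep a) b = e a (ep b)).

(** The part of the ell^s-torsion cut out by the projector [ep]. It is used both for A[l^s] and,
    with 1 - ep, for the complementary summand. *)
Definition comp s a := a *+ (ell ^ s) = 0 /\ ep a = a.

Lemma ep0 : ep 0 = 0. Proof. by apply: (addrI (ep 0)); rewrite -epD !addr0. Qed.
Lemma epN x : ep (- x) = - ep x.
Proof. by apply/eqP; rewrite -addr_eq0 -epD addNr ep0. Qed.
Lemma epMn x m : ep (x *+ m) = ep x *+ m.
Proof. by elim: m => [|m IH]; rewrite ?ep0 // !mulrS epD IH. Qed.
Lemma epMz x m : ep (x *~ m) = ep x *~ m.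
Proof. by case: m => m; rewrite ?NegzE ?mulrNz ?epN -!pmulrn epMn. Qed.

Lemma compD s a b : comp s a -> comp s b -> comp s (a + b).
Proof. by move=> [h1 h2] [h3 h4]; split; rewrite ?mulrnDl ?h1 ?h3 ?addr0 // epD h2 h4. Qed.

Lemma compMz s a m : comp s a -> comp s (a *~ m).
Proof.
move=> [h1 h2]; split; last by rewrite epMz h2.
by rewrite pmulrn -mulrzA mulrC mulrzA -pmulrn h1 mul0rz.
Qed.
Lemma compMn s a m : comp s a -> comp s (a *+ m). Proof. exact: (@compMz s a m). Qed.
Lemma comp0 s : comp s 0. Proof. by split; rewrite ?mul0rn ?ep0. Qed.
Lemma comp_tor s a : (s <= n)%N -> comp s a -> tor a.
Proof. by move=> sn [h _]; rewrite -(subnKC sn) expnD mulrnA h mul0rn. Qed.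

Lemma lift y : comp 1 y -> exists y', comp n y' /\ y' *+ (ell ^ n.-1) = y.
Proof.
move=> [yl yE]; have [b hb] := dv y; exists (ep b).
have tb : tor b by rewrite -(prednK n0) expnSr mulrnA hb -yl expn1.
split; last by rewrite -epMn hb yE.
by split; [rewrite -epMn tb ep0 | exact: ept].
Qed.

(** Nakayama's argument: an element killed by ell^(t+1) is corrected by a combination of x and y
    into one killed by ell^t. *)
Lemma gens x y : comp n x -> comp n y ->
  (forall z, comp 1 z -> exists i j, z = x *+ (ell ^ n.-1) *~ i + y *+ (ell ^ n.-1) *~ j) ->
  forall z, comp n z -> exists i j, z = x *~ i + y *~ j.
Proof.
move=> cx cy h1; suff aux t : (t <= n)%N -> forall z, comp t z -> exists i j, z = x *~ i + y *~ j.
  exact: aux.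
elim: t => [|t IH] tn z cz.
  by exists 0, 0; case: cz => z1 _; rewrite expn0 mulr1n in z1; rewrite z1 !mulr0z addr0.
have [zt zE] := cz; have c1 : comp 1 (z *+ (ell ^ t)).
  by split; [rewrite -mulrnA -expnSr | rewrite epMn zE].
have [i [j hij]] := h1 _ c1; set m := (ell ^ (n.-1 - t))%N.
have em : (ell ^ n.-1 = m * ell ^ t)%N by rewrite /m -expnD subnK // -ltnS prednK.
pose z' := z - (x *~ i + y *~ j) *+ m.
have sw (a : V) d (i' : int) : a *+ d *~ i' = a *~ i' *+ d.
  by case: i' => i'; rewrite ?NegzE ?mulrNz -!pmulrn ?mulNrn mulrnAC.
have [|i' [j' hz']] := IH (ltnW tn) z'.
  split.
    rewrite /z' mulrnBl -mulrnA -em hij mulrnDl.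
    by rewrite !sw subrr.
  rewrite /z' epD epN epMn epD !epMz zE.
  by case: cx => _ ->; case: cy => _ ->.
exists (i' + i * m), (j' + j * m); have -> : z = z' + (x *~ i + y *~ j) *+ m by rewrite /z' subrK.
by rewrite hz' mulrnDl !mulrzDr !mulrzA addrACA.
Qed.

Lemma triv u x y : tor u -> ep u = u -> comp n x -> comp n y ->
  (forall z, comp n z -> exists i j, z = x *~ i + y *~ j) -> e u x = 1 -> e u y = 1 -> u = 0.
Proof.
move=> tu uE cx cy g ux uy; apply: end_ => // b tb; rewrite -uE epadj //.
have cb : comp n (ep b) by split; [rewrite -epMn tb ep0 | exact: ept].
have [i [j ->]] := g _ cb; have [tx ty] := (comp_tor (leqnn n) cx, comp_tor (leqnn n) cy).
by rewrite eDr ?e1Mz ?mulr1 //; exact: torMz.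
Qed.

(** If x generated [comp 1], a lift x' of x would generate [comp n]. Then x = ell^(n-1) x' would be
    orthogonal to x' by alternation, hence to everything, and would vanish. *)
Lemma not_cyclic x : comp 1 x -> x <> 0 -> exists y, comp 1 y /\ ~ cyclic_gen x y.
Proof.
move=> cx x0; apply: contrapT => h; apply: x0.
have all_ z : comp 1 z -> cyclic_gen x z.
  by move=> cz; apply: contrapT => nz; apply: h; exists z.
have [x' [cx' ex]] := lift cx; have tx' := comp_tor (leqnn n) cx'.
apply: (triv (x := x') (y := 0)) => //.
- exact: comp_tor n0 cx.
- by case: cx.
- exact: comp0.
- apply: gens => //; first exact: comp0.
  move=> z /all_[i ->]; exists i, 0; by rewrite ex mulr0z addr0.
- by rewrite -ex eMnl // eaa // expr1n.
by rewrite e0r //; exact: comp_tor n0 cx.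
Qed.

Hypothesis two : forall x y, comp 1 x -> x <> 0 -> comp 1 y -> ~ cyclic_gen x y ->
  forall z, comp 1 z -> exists i j, z = x *~ i + y *~ j.

Lemma perp x y : comp n x -> x *+ (ell ^ n.-1) <> 0 -> comp 1 y -> e y x = 1 ->
  cyclic_gen (x *+ (ell ^ n.-1)) y.
Proof.
move=> cx x0 cy yx; apply: contrapT => ny.
have cx1 : comp 1 (x *+ (ell ^ n.-1)).
  case: cx => h1 h2; split; last by rewrite epMn h2.
  by rewrite expn1 -mulrnA mulnC -expnS prednK.
have [y' [cy' ey]] := lift cy.
suff y0 : y = 0 by apply: ny; exists 0; rewrite y0 mulr0z.
apply: (triv (x := x) (y := y')) => //.
- exact: comp_tor n0 cy.
- by case: cy.
- apply: gens => // z cz; rewrite ey; exact: two.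
by rewrite -{1}ey eMnl ?eaa ?expr1n //; exact: comp_tor (leqnn n) cy'.
Qed.

End Projector.
End Comp.

(** * The l-torsion *)

Section Span.
Variables (V : zmodType) (ell : nat) (pell : prime ell) (ep : V -> V).
Hypothesis epD : forall x y, ep (x + y) = ep x + ep y.

Definition span2 (x y : V) : set V := [set z | exists i j : int, z = x *~ i + y *~ j].

(** The projector separates x, y, z from u, u'. Within each group the coefficients are recovered one
    at a time, the last vector first. *)
Lemma five_indep x y z u u' : x *+ ell = 0 -> y *+ ell = 0 -> z *+ ell = 0 ->
  u *+ ell = 0 -> u' *+ ell = 0 -> ep x = x -> ep y = y -> ep z = z -> ep u = 0 -> ep u' = 0 ->
  x <> 0 -> ~ cyclic_gen x y -> ~ span2 x y z -> u <> 0 -> ~ cyclic_gen u u' ->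
  exists g : {ffun 'I_5 -> 'I_ell} -> V, injective g /\ forall c, g c *+ ell = 0.
Proof.
move=> xl yl zl ul ul' ex ey ez eu eu' x0 nxy nxyz u0 nuu.
pose o (i : nat) (h : (i < 5)%N) : 'I_5 := Ordinal h.
(* The leading zeros give every partial sum the shape expected by [cyc_step], down to the first
   vector. *)
pose g (c : {ffun 'I_5 -> 'I_ell}) := (0 + x *+ c (@o 0 isT) + y *+ c (@o 1 isT) + z *+ c (@o 2 isT)) +
  (0 + u *+ c (@o 3 isT) + u' *+ c (@o 4 isT)).
exists g; split; last first.
  by move=> c; rewrite /g !mulrnDl mul0rn ![_ *+ _ *+ ell]mulrnAC xl yl zl ul ul' !mul0rn !addr0.
have e0 := ep0 epD; have eMn := epMn epD.
have S0B (s t : V) : s = 0 -> t = 0 -> s - t = 0 by move=> -> ->; rewrite subrr.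
have S0M (s : V) (m : int) : s = 0 -> s *~ m = 0 by move=> ->; rewrite mul0rz.
have S1B a s t : cyclic_gen (a : V) s -> cyclic_gen a t -> cyclic_gen a (s - t).
  by move=> [i ->] [j ->]; exists (i - j); rewrite mulrzBr.
have S1M a s m : cyclic_gen (a : V) s -> cyclic_gen a (s *~ m).
  by move=> [i ->]; exists (i * m); rewrite mulrzA.
have S2B s t : span2 x y s -> span2 x y t -> span2 x y (s - t).
  move=> [i [j ->]] [i' [j' ->]]; exists (i - i'), (j - j').
  by rewrite !mulrzBr opprD addrACA.
have S2M s m : span2 x y s -> span2 x y (s *~ m).
  by move=> [i [j ->]]; exists (i * m), (j * m); rewrite mulrzDl !mulrzA.
have cg (a : V) m : cyclic_gen a (0 + a *+ m) by exists (m : int); rewrite add0r.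
move=> c c' e; have e1 := congr1 ep e.
rewrite /g !epD !eMn ex ey ez eu eu' !e0 !mul0rn !addr0 in e1.
have [c2 e2] := cyc_step pell zl S2B S2M nxyz (ex_intro _ (c (@o 0 isT) : int) (ex_intro _ (c (@o 1 isT) : int)
   (congr1 (fun t => t + _) (add0r _)))) (ex_intro _ (c' (@o 0 isT) : int) (ex_intro _ (c' (@o 1 isT) : int)
   (congr1 (fun t => t + _) (add0r _)))) e1.
have [c1 e3] := cyc_step pell yl (@S1B x) (@S1M x) nxy (cg _ _) (cg _ _) e2.
have [c0 _] := cyc_step (S := [set 0]) pell xl S0B S0M x0 erefl erefl e3.
have e4 : 0 + u *+ c (@o 3 isT) + u' *+ c (@o 4 isT) = 0 + u *+ c' (@o 3 isT) + u' *+ c' (@o 4 isT).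
  by apply: (addrI (0 + x *+ c (@o 0 isT) + y *+ c (@o 1 isT) + z *+ c (@o 2 isT))); rewrite {2}c0 {2}c1 {2}c2; exact: e.
have [c4 e5] := cyc_step pell ul' (@S1B u) (@S1M u) nuu (cg _ _) (cg _ _) e4.
have [c3 _] := cyc_step (S := [set 0]) pell ul S0B S0M u0 erefl erefl e5.
apply/ffunP => -[[|[|[|[|[|i]]]]] hi] //; rewrite (bool_irrelevance hi isT) //.
Qed.

End Span.

Section Torsion.
Variables (K : fieldExtType rat) (K0 : {subfield K}) (k : closedFieldType) (A : abvar k).
Variables (O : set K) (io : K -> qend A) (en : K -> A -> A).
Hypotheses (hO : is_order O) (hio : has_CM_by O io) (hen : cm_act O io en).
Hypothesis dv : forall N, (0 < N)%N -> forall y : A, exists x, x *+ N = y.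
Variables (ell : nat) (pell : prime ell).
Hypothesis S4 : forall t x, O x -> (forall a, a *+ (ell ^ t) = 0 -> en x a = 0) ->
  exists2 y, O y & x = y *+ (ell ^ t).
Local Notation R := (int_ring K0).
Variables (eta eta' w w' : K) (fd : nat).
Hypotheses (Re : R eta) (Re' : R eta') (Rw : R w) (Rw' : R w')
  (hw : eta * eta' * w = ell%:R) (hw' : eta * eta' = ell%:R * w')
  (pr : is_prime_ideal R (pid K0 eta)) (pr' : is_prime_ideal R (pid K0 eta'))
  (neq : pid K0 eta <> pid K0 eta') (idx : index_is R (pid K0 eta) ell)
  (idx' : index_is R (pid K0 eta') ell)
  (hfd : forall x, R x -> O (x *+ fd)) (cfd : coprime fd ell).

Lemma torsionE J a : torsion O io J a <-> forall be, J be -> O be -> en be a = 0.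
Proof.
split=> h be; first by move=> Jb Ob; apply: (h be) => //; [apply/homP; exact: (en_hom hen) | exact: (en_io hen)].
move=> g Jb Ob /homP hg hq; rewrite -(h be Jb Ob); symmetry.
have [[io_end _ _ _ _] _ _] := hio; have [_ m0] := io_end be.
apply: (hom_tf dv m0 (en_hom hen Ob) hg) => b.
by have := hq b; have := en_io hen Ob b; rewrite /= !mulr1n => -> ->.
Qed.

Lemma en_RM x s a : R x -> a *+ (ell ^ s) = 0 -> O (x *+ (ell ^ s)) -> en (x *+ (ell ^ s)) a = 0.
Proof.
move=> Rx as0 Ox; have Of := hfd Rx.
have c1 : coprime fd (ell ^ s) by rewrite coprimeXr.
apply: (coprime_kill c1); last by rewrite -(en_Mnr hen) // as0 (en_0 hen).
by rewrite -(en_Mn hO hen) // mulrnAC (en_Mn hO hen) // -(en_Mnr hen) // as0 (en_0 hen).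
Qed.

Lemma ell_pid s : pid K0 (eta ^+ s) (ell ^ s)%N%:R.
Proof.
by rewrite natrX -hw -mulrA exprMn; apply: pidMr; apply: RX; exact: RM.
Qed.

(* [ep] is congruent to 0 modulo l'^n and to 1 modulo l^n, so that it projects A[ell^s] onto
   A[l^s]. *)
Lemma eps_ex n : (0 < n)%N -> exists ep, [/\ O ep, ep \in K0,
  forall s a, (s <= n)%N -> (torsion O io (pid K0 (eta ^+ s)) a <-> comp ell (en ep) s a),
  forall a, a *+ (ell ^ n) = 0 -> en ep (en ep a) = en ep a &
  exists2 y, y <> 0 & comp ell (en (1 - ep)) 1 y].
Proof.
move=> n0; have [u [pu pu1]] := comaxX pell Re Re' Rw hw pr pr' neq idx idx' n.
have Ru : R u by have /pidP[r Rr ->] := pu; apply: RM => //; exact: RX.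
have fd0 : (0 < fd)%N.
  by case: (fd) cfd => //; rewrite /coprime gcd0n => /eqP l1; move: pell; rewrite l1.
have [i j ij _] := egcdnP (ell ^ n) fd0; have cn : coprime fd (ell ^ n) by rewrite coprimeXr.
(* The factor fd puts the element in O, and i fd is 1 modulo ell^n, so the congruences satisfied by
   u are kept. *)
rewrite (eqP cn) in ij; pose ep := u *+ (i * fd).
have epE : ep = u *+ i *+ fd by rewrite /ep mulrnA.
have Oep : O ep by rewrite epE; apply: hfd; exact: RMn.
have [e0 _] : R ep by exact: RMn.
have p1 : pid K0 (eta' ^+ n) ep by rewrite /ep -mulr_natl; apply: pidM => //; exact: Rnat.
have p2 : pid K0 (eta ^+ n) (1 - ep).
  have -> : 1 - ep = (1 - u) - u * (j%:R * (ell ^ n)%N%:R).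
    by rewrite /ep ij mulrnDr mulr1n -[u *+ (j * _)]mulr_natr natrM; ring.
  by apply: pidB => //; do 2 apply: pidM => //; [exact: Rnat | exact: ell_pid].
have O1e : O (1 - ep) by apply: (ordB hO) => //; exact: ord1_.
have prod s be : (s <= n)%N -> pid K0 (eta ^+ s) be -> exists2 x, R x & be * ep = x *+ (ell ^ s).
  move=> sn /pidP[r Rr ->]; have /pidP[r' Rr' ->] := p1.
  exists (w' ^+ s * eta' ^+ (n - s) * r * r'); first by do 3 (apply: RM => //); exact: RX.
  rewrite -{1}(subnKC sn) exprD -[_ *+ (ell ^ s)]mulr_natl natrX.
  have -> : eta ^+ s * r * (eta' ^+ s * eta' ^+ (n - s) * r') = (eta * eta') ^+ s * (eta' ^+ (n - s) * r * r').
    by rewrite exprMn; ring.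
  by rewrite hw' exprMn; ring.
exists ep; split=> //.
- move=> s a sn; rewrite torsionE; split=> [h|[al ea] be pb Ob].
    split; first by rewrite -(en_nat hO hen); apply: h; [exact: ell_pid | exact: ord_nat].
    apply/eqP; rewrite eq_sym -subr_eq0 -{1}[a](en_1 hen) -(en_B hO hen) //; last exact: ord1_.
    apply/eqP; apply: h => //; have /pidP[r Rr ->] := p2.
    by rewrite -(subnKC sn) exprD -mulrA; apply: pidMr; apply: RM => //; exact: RX.
  have [x Rx ex] := prod s be sn pb; rewrite -ea -(en_mul hen) // ex.
  by apply: en_RM => //; rewrite -ex; exact: (ordM hO).
- move=> a al; apply/eqP; rewrite eq_sym -subr_eq0 -{1}[en ep a](en_1 hen) -(en_B hO hen) //; last exact: ord1_.
  have [x Rx ex] := prod n (1 - ep) (leqnn _) p2; rewrite -(en_mul hen) // ex.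
  by apply/eqP; apply: en_RM => //; rewrite -ex; exact: (ordM hO).
(* If the complementary part were zero, 1 - ep would kill A[ell] and be ell times an integral
   element. Then 1 would lie in l', which contains both ep and ell. *)
apply: contrapT => h; have [y Oy yE] : exists2 y, O y & 1 - ep = y *+ (ell ^ 1).
  apply: S4 => // a al; apply: contrapT => na; apply: h; exists (en (1 - ep) a) => //.
  split; first by rewrite -(en_Mnr hen) // al (en_0 hen).
  have tn : a *+ (ell ^ n) = 0 by rewrite -(prednK n0) expnS mulrnA -[in X in X *+ _](expn1 ell) al mul0rn.
  have [x Rx ex] := prod n (1 - ep) (leqnn _) p2.
  apply/eqP; rewrite -subr_eq0 -(en_mul hen) // -(en_B hO hen) //; last exact: (ordM hO).
  have -> : (1 - ep) * (1 - ep) - (1 - ep) = - ((1 - ep) * ep) by ring.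
  rewrite (en_N hO hen) ?oppr_eq0; last exact: (ordM hO).
  by apply/eqP; rewrite ex; apply: en_RM => //; rewrite -ex; exact: (ordM hO).
have [_ n1 _] := pr'; apply: n1.
have l0 : (ell%:R : K) != 0 by rewrite -(qa_nat K) qa_eq0 pnatr_eq0 -lt0n prime_gt0.
have Ry : R y.
  split; last exact: (order_integral hO).
  have -> : y = (1 - ep) / ell%:R by rewrite yE expn1 -[y *+ ell]mulr_natr mulfK.
  by rewrite rpredM ?rpredV ?rpredB ?rpred1 // -(qa_nat K) qa_vs.
have -> : 1 = ep + y * ell%:R by rewrite mulr_natr -[ell]expn1 -yE addrC subrK.
apply: pidD; last by apply: pidM => //; exact: (ell_in' Re Rw hw).
by have /pidP[r Rr ->] := p1; rewrite -(prednK n0) exprS -mulrA; apply: pidMr; apply: RM => //; exact: RX.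
Qed.

End Torsion.

(** * Endomorphisms of the quotient *)

Section Isogeny.
Variables (K : fieldExtType rat) (k : closedFieldType) (A A' : abvar k).
Variables (O : set K) (io : K -> qend A) (en : K -> A -> A).
Hypotheses (hO : is_order O) (hio : has_CM_by O io) (hen : cm_act O io en).
Hypothesis dv : forall N, (0 < N)%N -> forall y : A, exists x, x *+ N = y.
Variables (P : A) (I : A -> A').
Hypothesis hI : isogeny_with_kernel I (cyclic_gen P).

Lemma quot_hom (B : abvar k) (ph : A -> B) : hom ph -> ph P = 0 ->
  exists ps : A' -> B, hom ps /\ forall a, ps (I a) = ph a.
Proof.
move=> hph hP; have [/homP hIh sI kI oI rI] := hI; have [ID _] := hIh.
have [sec hsec] := choice sI; pose ps y := ph (sec y).
have psI a : ps (I a) = ph a.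
  apply/eqP; rewrite -subr_eq0 -(homB _ _ hph); apply/eqP.
  have : I (sec (I a) - a) = 0 by rewrite (homB _ _ hIh) hsec subrr.
  by move=> /kI[m ->]; rewrite (homMz _ _ hph) hP mul0rz.
exists ps; split=> //; apply/homP; split=> [x y|V oV].
  have [a <-] := sI x; have [b <-] := sI y; rewrite -ID !psI; by case: hph.
have [_ mph] := (homP ph).2 hph; have [o1 r1] := mph V oV.
have e : I @^-1` (ps @^-1` V) = ph @^-1` V by apply/funext => a; rewrite /preimage /= psI.
have o2 : opn (ab_sp A') (ps @^-1` V) by apply/oI; rewrite e.
split=> // g rg; apply/(rI _ _ o2); rewrite e.
have -> : (g \o ps) \o I = g \o ph by apply/funext => a /=; rewrite psI.
exact: r1.
Qed.

Lemma io_en x a : O x -> (io x).1 a = en x a *+ (io x).2.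
Proof. by move=> Ox; have := en_io hen Ox a; rewrite /= mulr1n. Qed.

Lemma io_pos x : (0 < (io x).2)%N.
Proof. by have [[io_end _ _ _ _] _ _] := hio; case: (io_end x). Qed.

Lemma end_orderP x : O x -> end_order io I x <-> cyclic_gen P (en x P).
Proof.
move=> Ox; have [/homP hIh sI kI oI rI] := hI; have hx := en_hom hen Ox.
have hIx : hom (I \o en x) by exact: hom_comp hx hIh.
split=> [[g /homP hg gE]|h].
  apply/kI; have := hom_tf dv (io_pos x) (hom_comp hIh hg) hIx; move=> /(_ _ P) /= <-.
    by rewrite (kI P).2 ?(hom0 hg) //; exists 1; rewrite mulr1z.
  by move=> a /=; rewrite gE io_en // (homMn _ _ hIh).
have [|ps [hps psE]] := quot_hom hIx; first by apply/kI.
exists ps; first exact/homP.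
by move=> a; rewrite psE /= io_en // (homMn _ _ hIh).
Qed.

Variable ell : nat.
Hypotheses (pell : prime ell) (Pl : P *+ ell = 0).

(* If J is the dual isogeny and g the endomorphism x of A', then ell x = J g I, whose image on
   A[ell] lies in the kernel of I since I J = ell. *)
Lemma end_order_dual x : end_order io I x -> O (x *+ ell) /\
  forall a, a *+ ell = 0 -> cyclic_gen P (en (x *+ ell) a).
Proof.
move=> [g /homP hg gE]; have [/homP hIh sI kI oI rI] := hI.
have [|J [hJ JE]] := @quot_hom A (fun a => a *+ ell) (hom_muln_id A ell) => //.
have IJ y : I (J y) = y *+ ell.
  by have [a <-] := sI y; rewrite JE (homMn _ _ hIh).
have [al Oal alE] := en_surj hen (hom_comp (hom_comp hIh hg) hJ).
have [d [d0 Od]] := ord_scale hO x; set y := x *+ d in Od.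
have l0 := prime_gt0 pell.
have [[io_end _ _ ioM _] _ _] := hio.
have hx : hom (io x).1 by apply/homP; case: (io_end x).
have yE a : en y a *+ (io x).2 = (io x).1 a *+ d.
  have Odn := ord_nat hO d.
  have m0 : (0 < (io y).2 * (io d%:R).2)%N by rewrite muln_gt0 !io_pos.
  have h1 := hom_muln (io x).2 (en_hom hen Od); have h2 := hom_muln d hx.
  apply: (hom_tf dv m0 h1 h2) => b; have := ioM x d%:R b; rewrite mulr_natr -/y /=.
  rewrite (io_en _ Od) (io_en _ Odn) (en_nat hO hen) !(homMn _ _ hx) => e'.
  move: e'; rewrite -!mulrnA => e' /=.
  by rewrite mulnCA e' [((io d%:R).2 * _)%N]mulnC.
have e1 : al *+ d = y *+ ell.
  apply: (en_inj hen); [exact: ordMn | exact: ordMn |].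
  apply: (hom_tf dv (io_pos x)); [exact: (en_hom hen (ordMn hO d Oal)) | exact: (en_hom hen (ordMn hO ell Od)) |].
  move=> a; rewrite (en_Mn hO hen d a Oal) (en_Mn hO hen ell a Od) alE /= [_ *+ d *+ _]mulrnAC -(homMn _ _ hJ) gE JE.
  by rewrite [en y a *+ _ *+ _]mulrnAC yE mulrnAC.
have alx : al = x *+ ell.
  have dn : (d%:R : K) != 0 by rewrite -(qa_nat K) qa_eq0 pnatr_eq0 -lt0n.
  by apply: (mulIf dn); rewrite !mulr_natr e1 /y mulrnAC.
rewrite -alx; split=> // a al0; apply/kI.
by rewrite alE /= IJ -(homMn _ _ hg) -(homMn _ _ hIh) al0 (hom0 hIh) (hom0 hg).
Qed.

End Isogeny.

(** The Weil pairing read through [lam] as a total function of two points. Its values are prescribed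
    on A[N] only, which is why every clause carries torsion hypotheses. *)
Lemma pairing_ex (k : closedFieldType) p (hp : p \in [pchar k]) (A B : abvar k)
  (Pc : cocycle k (A * B)) (lam : A -> B) (hB : is_dual Pc) (hlam : principal_polarization Pc lam) N :
  (forall y : A, exists x, x *+ N = y) -> coprime N p -> exists e : A -> A -> k,
  [/\ forall a a' b, a *+ N = 0 -> a' *+ N = 0 -> b *+ N = 0 -> e (a + a') b = e a b * e a' b,
      forall a b b', a *+ N = 0 -> b *+ N = 0 -> b' *+ N = 0 -> e a (b + b') = e a b * e a b',
      forall a, a *+ N = 0 -> e a a = 1, forall a b, a *+ N = 0 -> b *+ N = 0 -> e a b != 0 &
      [/\ forall a, a *+ N = 0 -> (forall b, b *+ N = 0 -> e a b = 1) -> a = 0,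
          forall a b z, a *+ N = 0 -> b *+ N = 0 -> weil Pc N a (lam b) z <-> z = e a b &
          forall al a b, hom al -> adj lam hB al al -> a *+ N = 0 -> b *+ N = 0 -> e (al a) b = e a (al b)]].
Proof.
move=> dv cN.
have lb b : b *+ N = 0 -> lam b *+ N = 0.
  by move=> bN; rewrite -(homMn _ _ (lam_hom hlam)) bN (hom0 (lam_hom hlam)).
have /choice[e0 he0] : forall ab : A * A, exists w, ab.1 *+ N = 0 -> ab.2 *+ N = 0 ->
    weil Pc N ab.1 (lam ab.2) w.
  move=> [a b] /=; case: (pselect (a *+ N = 0 /\ b *+ N = 0)) => [[aN bN]|n].
    by have [w hw] := weil_ex hB hlam aN (lb _ bN); exists w.
  by exists 0 => aN bN; case: n.
pose e a b := e0 (a, b); have he a b : a *+ N = 0 -> b *+ N = 0 -> weil Pc N a (lam b) (e a b).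
  exact: (he0 (a, b)).
have eP a b z : a *+ N = 0 -> b *+ N = 0 -> weil Pc N a (lam b) z <-> z = e a b.
  by move=> aN bN; split=> [h|->]; [exact: weil_uniq h (he a b aN bN) | exact: he].
have tD (a b : A) : a *+ N = 0 -> b *+ N = 0 -> (a + b) *+ N = 0.
  by move=> aN bN; rewrite mulrnDl aN bN addr0.
exists e; split=> [a a' b aN aN' bN|a b b' aN bN bN'|a aN|a b aN bN|]; last split=> //.
- by symmetry; apply/(eP _ _ _ (tD _ _ aN aN') bN); exact: (weil_addl hB (he _ _ aN bN) (he _ _ aN' bN)).
- symmetry; apply/(eP _ _ _ aN (tD _ _ bN bN')); have [lD _] := lam_hom hlam; rewrite lD.
  exact: (weil_addr hB hlam (he _ _ aN bN) (he _ _ aN bN')).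
- by symmetry; apply/(eP _ _ _ aN aN); exact: (weil_alt hB hlam aN (dv a)).
- exact: (weil_neq0 hB (he _ _ aN bN)).
- move=> a aN h; apply: (weil_nondeg hp dv hB hlam cN aN) => b bN.
  have hab := he _ _ bN aN; have hba := he _ _ aN bN.
  by have := weil_anti hB hlam dv hab hba; rewrite (h b bN) mulr1 => e1; rewrite e1 in hab.
move=> al a b hal had aN bN; apply/(eP _ _ _ aN).
  by rewrite -(homMn _ _ hal) bN (hom0 hal).
have aN' : al a *+ N = 0 by rewrite -(homMn _ _ hal) aN (hom0 hal).
exact: (weil_adj hlam hal had aN (he _ _ aN' bN)).
Qed.

(** * Self-pairings and the l-isogeny *)

Section Main.
Variables (K : fieldExtType rat) (K0 : {subfield K}) (k : closedFieldType) (A : abvar k).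
Variables (O : set K) (io : K -> qend A) (en : K -> A -> A).
Hypotheses (hO : is_order O) (hio : has_CM_by O io) (hen : cm_act O io en).
Hypothesis dv : forall N, (0 < N)%N -> forall y : A, exists x, x *+ N = y.
Variables (ell : nat) (pell : prime ell).
Hypothesis S4 : forall t x, O x -> (forall a, a *+ (ell ^ t) = 0 -> en x a = 0) ->
  exists2 y, O y & x = y *+ (ell ^ t).
Hypothesis TB : forall g : {ffun 'I_5 -> 'I_ell} -> A, injective g ->
  (forall c, g c *+ ell = 0) -> False.
Local Notation R := (int_ring K0).
Variables (eta eta' w w' : K) (fd : nat).
Hypotheses (Re : R eta) (Re' : R eta') (Rw : R w) (Rw' : R w')
  (hw : eta * eta' * w = ell%:R) (hw' : eta * eta' = ell%:R * w')
  (pr : is_prime_ideal R (pid K0 eta)) (pr' : is_prime_ideal R (pid K0 eta'))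
  (neq : pid K0 eta <> pid K0 eta') (idx : index_is R (pid K0 eta) ell)
  (idx' : index_is R (pid K0 eta') ell)
  (hfd : forall x, R x -> O (x *+ fd)) (cfd : coprime fd ell)
  (ne' : ~ pid K0 eta eta') (nw : ~ pid K0 eta w).
Variables (p : nat) (hp : p \in [pchar k]) (cp : forall t, coprime (ell ^ t) p).
Variables (B : abvar k) (Pc : cocycle k (A * B)) (lam : A -> B).
Hypotheses (hB : is_dual Pc) (hlam : principal_polarization Pc lam).
Hypothesis real : forall x, O x -> x \in K0 -> adj lam hB (en x) (en x).
Variables (F : A -> A) (f : K) (Of : O f) (enf : forall a, en f a = F a).
Variables (r n : nat) (n0 : (0 < n)%N) (P : A) (P0 : P <> 0).
Local Notation tors s := (torsion O io (pid K0 (eta ^+ s))).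
Hypotheses (hP : tors 1 P) (hn : tors n `<=` rational_pts F r).
Variables (kk : nat) (kk0 : (0 < kk)%N).
Local Notation tt := (tate Pc F lam r (ell ^ n)).
Hypothesis hkk : max_selfpairing ell tt (tors n) kk.
Variable g : A.
Hypotheses (hg : tors n g) (hgP : [set x *+ (ell ^ n.-1) | x in cyclic_gen g] = cyclic_gen P).

Lemma en_Mz x m a : O x -> en (x *~ m) a = en x a *~ m.
Proof.
move=> Ox; case: m => m; rewrite ?NegzE ?mulrNz -!pmulrn ?(en_N hO hen) ?(en_Mn hO hen) //.
exact: ordMn.
Qed.

Lemma en_Mzr x m a : O x -> en x (a *~ m) = en x a *~ m.
Proof. by move=> Ox; rewrite (homMz _ _ (en_hom hen Ox)). Qed.

Lemma cyc_P : cyclic_gen P = cyclic_gen (g *+ (ell ^ n.-1)).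
Proof.
have sw (a : A) d (m : int) : a *~ m *+ d = a *+ d *~ m.
  by case: m => m; rewrite ?NegzE ?mulrNz -!pmulrn ?mulNrn mulrnAC.
rewrite -hgP; apply/seteqP; split=> x; first by move=> [_ [m ->] <-]; exists m; rewrite sw.
by move=> [m ->]; exists (g *~ m); [exists m | rewrite sw].
Qed.

(* If pi - 1 = ell^n nu on A[l^n], the Tate pairing is e(nu x, y).  Let j be maximal such that nu
   is an integer c on A[l^j] and write nu - c = ell^j mu; then T(x, x) has order ell^(n - j)
   exactly when mu does not preserve the line spanned by ell^(n-1) x. *)
Lemma nondegenerate_iff : exists ep mu, [/\ O ep, O mu,
  forall s a, (s <= n)%N -> (tors s a <-> comp ell (en ep) s a),
  forall x y, comp ell (en ep) 1 x -> x <> 0 -> comp ell (en ep) 1 y -> ~ cyclic_gen x y ->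
    forall z, comp ell (en ep) 1 z -> exists i j, z = x *~ i + y *~ j &
  [/\ exists2 x, comp ell (en ep) 1 x & ~ cyclic_gen x (en mu x),
      tate_nondegenerate ell tt (cyclic_gen g) kk <-> ~ cyclic_gen P (en mu P) &
      forall a, a *+ ell = 0 -> en ep (en ep a) = en ep a]].
Proof.
have [ep [Oep epK cP idem [y0 y0n cy0]]] := eps_ex hO hio hen dv pell S4 Re Re' Rw Rw' hw hw' pr pr' neq idx idx' hfd cfd n0.
have l0 := prime_gt0 pell; have lt0 t : (0 < ell ^ t)%N by rewrite expn_gt0 l0.
have [e [eDl eDr eaa enz [end_ ewl eadj0]]] := pairing_ex hp hB hlam (dv (lt0 n)) (cp n).
have dv1 := dv (lt0 n.-1); have O1 := ord1_ hO; have O1e : O (1 - ep) by exact: ordB.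
have epD := fun x y => en_D hen x y Oep; have eqD := fun x y => en_D hen x y O1e.
have eadj x a b : O x -> x \in K0 -> a *+ ell ^ n = 0 -> b *+ ell ^ n = 0 -> e (en x a) b = e a (en x b).
  by move=> Ox xK; apply: eadj0; [exact: (en_hom hen Ox) | exact: real].
have epadj a b : a *+ ell ^ n = 0 -> b *+ ell ^ n = 0 -> e (en ep a) b = e a (en ep b) by exact: eadj.
have K1e : 1 - ep \in K0 by rewrite rpredB ?rpred1.
have eqadj a b : a *+ ell ^ n = 0 -> b *+ ell ^ n = 0 -> e (en (1 - ep) a) b = e a (en (1 - ep) b) by exact: eadj.
have enq a : en (1 - ep) a = a - en ep a by rewrite (en_B hO hen) // (en_1 hen).
have idq a : a *+ ell ^ n = 0 -> en (1 - ep) (en (1 - ep) a) = en (1 - ep) a.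
  move=> an; rewrite [LHS]enq [in X in _ - X]enq epD -[en ep (- _)]/(en ep (- _)).
  by rewrite (homN _ (en_hom hen Oep)) idem // subrr subr0.
have [y1 [cy1 ny1]] := not_cyclic n0 dv1 eDl eDr eaa enz end_ eqD idq eqadj cy0 y0n.
have eq0 y : comp ell (en (1 - ep)) 1 y -> en ep y = 0.
  by move=> [_]; rewrite enq => /eqP; rewrite -subr_eq0 addrAC subrr sub0r oppr_eq0 => /eqP.
(* A third independent vector at l, together with y0 and y1 from the complementary summand, would
   make five independent vectors in A[ell]. *)
have two x y : comp ell (en ep) 1 x -> x <> 0 -> comp ell (en ep) 1 y -> ~ cyclic_gen x y ->
    forall z, comp ell (en ep) 1 z -> exists i j, z = x *~ i + y *~ j.
  move=> [x1 x2] x0 [yy1 yy2] nxy z [z1 z2]; apply: contrapT => nz.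
  have [u1 u2] := cy0; have [v1 v2] := cy1.
  have [G [Gi G0]] := five_indep pell epD x1 yy1 z1 u1 v1 x2 yy2 z2 (eq0 _ cy0) (eq0 _ cy1) x0 nxy nz y0n ny1.
  exact: TB Gi G0.
have tor s x : (s <= n)%N -> comp ell (en ep) s x -> x *+ ell ^ n = 0 by exact: comp_tor.
have ratE x : comp ell (en ep) n x -> iter r F x = x.
  by move=> /(cP n x (leqnn n)).2 /hn.
pose pi := f ^+ r; have Opi : O pi by exact: ordX.
have piE a : en pi a = iter r F a.
  rewrite /pi; elim: (r) => [|s IH]; first by rewrite expr0 (en_1 hen).
  by rewrite exprS (en_mul hen) ?IH ?enf //; exact: ordX.
have Opi1 : O (pi - 1) by exact: ordB.
have cepn a : a *+ ell ^ n = 0 -> comp ell (en ep) n (en ep a).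
  by move=> an; split; [rewrite -(en_Mnr hen) // an (en_0 hen) | exact: idem].
(* ep projects A[ell^n] onto A[l^n], where pi is the identity, so (pi - 1) ep is divisible by ell^n;
   on A[l^n] itself the factor ep acts as 1. *)
have [nu Onu nuE] : exists2 y, O y & (pi - 1) * ep = y *+ (ell ^ n).
  apply: S4; first exact: ordM.
  move=> a an; rewrite (en_mul hen) // (en_B hO hen) // (en_1 hen) piE ratE ?subrr //; exact: cepn.
have tv x y z : comp ell (en ep) n x -> comp ell (en ep) n y -> tt x y z <-> z = e (en nu x) y.
  move=> cx cy; have ty := tor n _ (leqnn n) cy; have [tx xE] := cx; have [_ yE] := cy.
  have D a : a *+ ell ^ n = x -> [/\ (iter r F a - a) *+ ell ^ n = 0 &
      e (iter r F a - a) y = e (en nu x) y].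
    move=> ax; have dE : iter r F a - a = en (pi - 1) a by rewrite (en_B hO hen) // (en_1 hen) piE.
    have t1 : en (pi - 1) a *+ ell ^ n = 0.
      by rewrite -(en_Mnr hen) // ax (en_B hO hen) // (en_1 hen) piE ratE ?subrr.
    rewrite dE; split=> //; rewrite -{1}yE -epadj // -(en_mul hen) // mulrC nuE.
    by rewrite (en_Mn hO hen) // -(en_Mnr hen) // ax.
  split=> [[a [ax]]|->].
    by have [t1 <-] := D a ax; move/(ewl _ _ _ t1 ty).
  have [a ax] := dv (lt0 n) x; have [t1 <-] := D a ax; exists a; split=> //.
  exact/(ewl _ _ _ t1 ty).
pose Pj j := exists c : int, forall a, comp ell (en ep) j a -> en nu a = a *~ c.
have [j [[c hc] jn jmax]] : exists j, [/\ Pj j, (j <= n)%N & forall i, Pj i -> (i <= n)%N -> (i <= j)%N].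
  have exP : exists j, `[<Pj j>] && (j <= n)%N.
    exists 0%N; rewrite leq0n andbT; apply/asboolP; exists 0 => a [a1 _].
    by rewrite expn0 mulr1n in a1; rewrite a1 (en_0 hen) // mul0rz.
  case: (ex_maxnP exP (m := n)) => [i /andP[]//|j /andP[/asboolP h1 h2] h3].
  by exists j; split=> // i hi hin; apply: h3; rewrite hin andbT; apply/asboolP.
have Oc : O (1 *~ c) by exact: ordMz.
have encE a : en (1 *~ c) a = a *~ c by rewrite en_Mz // (en_1 hen).
have Onc : O (nu - 1 *~ c) by exact: ordB.
have [mu Omu muE] : exists2 y, O y & (nu - 1 *~ c) * ep = y *+ (ell ^ j).
  apply: S4; first exact: ordM.
  move=> a aj; rewrite (en_mul hen) // (en_B hO hen) // encE hc ?subrr //.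
  have an : a *+ ell ^ n = 0 by rewrite -(subnKC jn) expnD mulrnA aj mul0rn.
  by split; [rewrite -(en_Mnr hen) // aj (en_0 hen) | exact: idem].
have nuX x : comp ell (en ep) n x -> en nu x = en mu x *+ ell ^ j + x *~ c.
  move=> [tx xE]; have := congr1 (fun t => en t x) muE.
  rewrite (en_mul hen) // xE (en_B hO hen) // encE (en_Mn hO hen) // => <-.
  by rewrite subrK.
have tmu x : x *+ ell ^ n = 0 -> en mu x *+ ell ^ n = 0.
  by move=> tx; rewrite -(en_Mnr hen) // tx (en_0 hen).
have tvE x : comp ell (en ep) n x -> e (en nu x) x = e (en mu x) x ^+ (ell ^ j).
  move=> cx; have tx := tor n _ (leqnn n) cx; have tm := tmu _ tx.
  rewrite nuX // eDl ?(eMnl eDl enz) //; last exact: torMz.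
    by rewrite (e1Mzl eDl enz _ tx tx (eaa _ tx)) mulr1.
  exact: torMn.
have lift1 x : comp ell (en ep) 1 x -> exists x', comp ell (en ep) n x' /\ x' *+ ell ^ n.-1 = x.
  exact: lift.
have comp1 x : comp ell (en ep) n x -> comp ell (en ep) 1 (x *+ ell ^ n.-1).
  move=> [h1 h2]; split; first by rewrite expn1 -mulrnA mulnC -expnS prednK.
  by rewrite (en_Mnr hen) // h2.
have mul1 x : comp ell (en ep) 1 x -> comp ell (en ep) 1 (en mu x).
  by move=> [h1 h2]; split; [rewrite -(en_Mnr hen) // h1 (en_0 hen) | rewrite (en_comm hen) // h2].
(* For j = n, nu would be a scalar on A[l^n] and every self-pairing would be 1, against kk > 0. *)
have jlt : (j < n)%N.
  rewrite ltn_neqAle jn andbT; apply/eqP => jE; have [[Q [z [Qt tz [z1 z2]]]] _] := hkk.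
  have cQ := (cP n Q (leqnn n)).1 Qt; apply: (z2 kk0).
  have tQ := tor n _ (leqnn n) cQ; have -> : z = 1; last by rewrite expr1n.
  rewrite ((tv Q Q z cQ cQ).1 tz) tvE // jE -(eMnl eDl enz) ?tmu //; exact: (e0l eDl enz).
have ord_up x : comp ell (en ep) n x -> e (en nu x) x ^+ (ell ^ (n - j)) = 1.
  move=> cx; have tx := tor n _ (leqnn n) cx.
  by rewrite tvE // -exprM -expnD subnKC // -(eMnl eDl enz) ?tmu //; exact: (e0l eDl enz).
have ord_lt x : comp ell (en ep) n x -> x *+ ell ^ n.-1 <> 0 ->
    (e (en nu x) x ^+ (ell ^ (n - j).-1) = 1 <-> cyclic_gen (x *+ ell ^ n.-1) (en mu (x *+ ell ^ n.-1))).
  move=> cx x0; have tx := tor n _ (leqnn n) cx; have tm := tmu _ tx.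
  have -> : e (en nu x) x ^+ (ell ^ (n - j).-1) = e (en mu (x *+ ell ^ n.-1)) x.
    rewrite tvE // -exprM -expnD (en_Mnr hen) // (eMnl eDl enz) //; congr (_ ^+ (_ ^ _)); lia.
  split=> [h|[m ->]].
    by apply: (perp n0 dv1 eDl eDr eaa enz end_ epD idem epadj two cx x0 _ h); apply: mul1; exact: comp1.
  have tx1 : x *+ ell ^ n.-1 *+ ell ^ n = 0 by exact: torMn.
  by apply: (e1Mzl eDl enz _ tx1 tx); rewrite (eMnl eDl enz) // eaa // expr1n.
(* If every vector of A[l] were an eigenvector, mu would be a scalar m there, by comparison of P, y
   and P + y. Then nu would be the integer c + ell^j m on A[l^(j+1)], against the maximality of
   j. *)
have [x1 cx1 nx1] : exists2 x, comp ell (en ep) 1 x & ~ cyclic_gen x (en mu x).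
  apply: contrapT => nx; have eig x : comp ell (en ep) 1 x -> cyclic_gen x (en mu x).
    by move=> cx; apply: contrapT => h; apply: nx; exists x.
  have cP1 : comp ell (en ep) 1 P by apply/(cP 1%N P n0).
  have [y [cy ny]] := not_cyclic n0 dv1 eDl eDr eaa enz end_ epD idem epadj cP1 P0.
  have [i hi] := eig _ cP1; have [i' hi'] := eig _ cy.
  have cPy : comp ell (en ep) 1 (P + y) by exact: compD.
  have [m hm] := eig _ cPy; have [Pl _] := cP1; have [yl _] := cy; rewrite expn1 in Pl yl.
  rewrite (en_D hen) // hi hi' mulrzDl in hm.
  have e1 : y *~ (i' - m) = P *~ (m - i).
    have yi' : y *~ i' = P *~ m + y *~ m - P *~ i by rewrite -hm addrAC subrr add0r.
    by rewrite !mulrzBr yi' addrAC addrK.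
  have dm : (ell %| i' - m)%Z.
    apply/negP => nd; apply: ny; have [d <-] := zinv pell yl (introN idP nd).
    by rewrite e1; exists ((m - i) * d); rewrite mulrzA.
  have kz (a : A) t : a *+ ell = 0 -> (ell %| t)%Z -> a *~ t = 0.
    by move=> al /dvdzP[b ->]; rewrite mulrC mulrzA -pmulrn al mul0rz.
  have yi : y *~ i' = y *~ m by apply/eqP; rewrite -subr_eq0 -mulrzBr; apply/eqP; exact: kz.
  have Pi : P *~ i = P *~ m.
    by apply/eqP; rewrite eq_sym -subr_eq0 -mulrzBr -e1; apply/eqP; exact: kz.
  have := jmax j.+1; rewrite ltnn => /(_ _ jlt) h; suff : Pj j.+1 by move/h.
  exists (c + (ell ^ j)%N%:Z * m) => a [aj aE].
  have an : comp ell (en ep) n a.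
    by split=> //; rewrite -(subnKC jlt) expnD mulrnA aj mul0rn.
  have ca : comp ell (en ep) 1 (a *+ ell ^ j).
    by split; [rewrite -mulrnA -expnSr | rewrite (en_Mnr hen) // aE].
  have [s [t est]] := two _ _ cP1 P0 cy ny _ ca.
  have muA : en mu (a *+ ell ^ j) = a *+ ell ^ j *~ m.
    rewrite est (en_D hen) // !en_Mzr // hi hi' yi Pi mulrzDl -!mulrzA.
    by rewrite ![m * _]mulrC.
  rewrite nuX // -(en_Mnr hen) // muA mulrzDr addrC; congr (_ + _).
  by rewrite mulrzA pmulrn.
have kkE : kk = (n - j)%N.
  have [[Q [z [Qt tz [z1 z2]]]] hmax] := hkk; apply/eqP; rewrite eqn_leq; apply/andP; split.
    rewrite leqNgt; apply/negP => hlt; apply: (z2 kk0).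
    have cQ := (cP n Q (leqnn n)).1 Qt; rewrite ((tv Q Q z cQ cQ).1 tz).
    have -> : kk.-1 = ((n - j) + (kk.-1 - (n - j)))%N by rewrite subnKC // -ltnS prednK.
    by rewrite expnD exprM ord_up // expr1n.
  have [x [cx ex]] := lift1 _ cx1.
  apply: (hmax _ x (e (en nu x) x)); [exact/(cP n x (leqnn n)) | exact/(tv x x _ cx cx) | split; first exact: ord_up].
  have x10 : x *+ ell ^ n.-1 <> 0.
    by rewrite ex => x10; apply: nx1; rewrite x10 (en_0 hen) //; exists 0; rewrite mulr0z.
  by move=> _ /(ord_lt x cx x10); rewrite ex.
exists ep, mu; split=> //; split=> //; first by exists x1.
  have cg := (cP n g (leqnn n)).1 hg; have tg := tor n _ (leqnn n) cg.
  have tng : en nu g *+ ell ^ n = 0 by rewrite -(en_Mnr hen) // tg (en_0 hen).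
  set g1 := g *+ ell ^ n.-1.
  have g10 : g1 <> 0.
    move=> g10; have : cyclic_gen P P by exists 1; rewrite mulr1z.
    by rewrite cyc_P -/g1 g10 => -[m]; rewrite mul0rz.
  have cyE : cyclic_gen P (en mu P) <-> cyclic_gen g1 (en mu g1).
    have gP : cyclic_gen P = cyclic_gen g1 := cyc_P.
    have aux (a b : A) : cyclic_gen a = cyclic_gen b -> cyclic_gen b (en mu b) -> cyclic_gen a (en mu a).
      move=> ab hb; have [i ei] : cyclic_gen b a by rewrite -ab; exists 1; rewrite mulr1z.
      rewrite ab ei en_Mzr //; have [m ->] := hb; exists (m * i); by rewrite mulrzA.
    by split; apply: aux.
  rewrite cyE -(ord_lt g cg g10) -kkE; set z0 := e (en nu g) g.
  have z0k : z0 ^+ (ell ^ kk) = 1 by rewrite kkE; exact: ord_up.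
  split=> [nd z01|nz z zk].
    have [[Q [z [Qt tz [z1 z2]]]] _] := hkk; apply: (z2 kk0).
    have [a [b [[i ->] [i' ->]]]] := nd z z1.
    have ci t : comp ell (en ep) n (g *~ t) by exact: compMz.
    move=> /(tv _ _ _ (ci i) (ci i')) ->.
    have ti t : (g *~ t) *+ ell ^ n = 0 by exact: torMz.
    rewrite en_Mzr // -(eMnl eDl enz) //; last exact: torMz.
    have sw (a' : A) d (m : int) : a' *~ m *+ d = a' *+ d *~ m.
      by case: m => m; rewrite ?NegzE ?mulrNz -!pmulrn ?mulNrn mulrnAC.
    have tn1 : en nu g *+ ell ^ kk.-1 *+ ell ^ n = 0 by exact: torMn.
    rewrite sw; apply: (e1Mzl eDl enz) => //; apply: (e1Mz eDr enz) => //.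
    by rewrite (eMnl eDl enz).
  (* z0 has exact order ell^kk, so every root of unity concerned is a power z0^t, and this is the
     pairing of [g *+ t] with g. *)
  have [m pm md] := prim_order_exists (lt0 kk) z0k.
  have /(dvdn_pfactor _ _ pell)[i ik mE] := md.
  have ikk : i = kk.
    apply/eqP; rewrite eqn_leq ik leqNgt; apply/negP => hlt; apply: nz.
    have -> : (ell ^ kk.-1 = m * ell ^ (kk.-1 - i))%N by rewrite mE -expnD subnKC // -ltnS prednK.
    by rewrite exprM (prim_expr_order pm) expr1n.
  have [t ->] := prim_rootP pm (eq_ind_r (fun s => z ^+ s = 1) zk (etrans mE (congr1 _ ikk))).
  exists (g *+ t), g; split; [by exists (t : int) | by exists 1; rewrite mulr1z |].
  apply/(tv _ _ _ _ cg); first exact: compMn.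
  by rewrite (en_Mnr hen) // (eMnl eDl enz).
move=> a al; apply: idem; by rewrite -(prednK n0) expnS mulrnA al mul0rn.
Qed.

Variables (A' : abvar k) (I : A -> A') (hI : isogeny_with_kernel I (cyclic_gen P)).
Local Notation O' := (end_order io I).
Local Notation l := (pid K0 eta).
Local Notation nondeg := (tate_nondegenerate ell tt (cyclic_gen g) kk).

Lemma sub_local (O1 O2 : set K) : O1 `<=` O2 -> local_sub R l O1 O2.
Proof. by move=> h t ht; exists t => // i hi; have [h1 h2] := ht i hi; split=> //; exact: h. Qed.

Lemma cycD (x y z : A) : cyclic_gen x y -> cyclic_gen x z -> cyclic_gen x (y + z).
Proof. by move=> [i ->] [j ->]; exists (i + j); rewrite mulrzDr. Qed.

Lemma cycM (x y : A) m : cyclic_gen x y -> cyclic_gen x (y *~ m).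
Proof. by move=> [i ->]; exists (i * m); rewrite mulrzA. Qed.

(** Everything rests on the commutation with mu. Suppose mu preserves the line of P. If some be in O
    moved the line, P and be P would span A[l] with the same eigenvalue and mu would be scalar on
    A[l]; so O preserves the line. If mu moves the line, ell x for x in End(A') maps A[ell] into the
    line, commutes with mu, and therefore vanishes on A[ell]. *)
Lemma descending_iff : (local_proper R l O' O <-> nondeg) /\
  (~ nondeg -> order_iso O O' \/ local_proper R l O O').
Proof.
have [ep [mu [Oep Omu cP two [[x1 cx1 nx1] ndE idem1]]]] := nondegenerate_iff; rewrite ndE.
have l0 := prime_gt0 pell; have [_ n1 _] := pr; have O1 := ord1_ hO.
have tE := torsionE hio hen dv; have cP1 := (cP 1%N P n0).1 hP.
have [Pl PE] := cP1; rewrite expn1 in Pl.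
have inO' x : O x -> (O' x <-> cyclic_gen P (en x P)) by move=> Ox; exact: (end_orderP hio hen dv hI Ox).
have kill1 be z : O be -> l be -> comp ell (en ep) 1 z -> en be z = 0.
  by move=> Ob lb cz; apply: ((tE _ _).1 ((cP 1%N z n0).2 cz)); rewrite ?expr1.
have inv := inv_mod pell Re' Rw hw pr idx.
have Ofd r0 : R r0 -> O (r0 *+ fd) by exact: hfd.
(* R acts on A[l] through its residue field F_ell, hence by integers. *)
have scal b : R b -> O b -> cyclic_gen P (en b P).
  move=> Rb Ob; case: (pselect (l b)) => lb; first by exists 0; rewrite kill1 // mulr0z.
  have [i hi] := inv b Rb lb; have Obi : O (b *+ i) by exact: ordMn.
  have := kill1 _ _ (ordB hO O1 Obi) hi cP1; rewrite (en_B hO hen) // (en_1 hen) (en_Mn hO hen) //.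
  move/eqP; rewrite subr_eq0 => /eqP Pi.
  have bl : en b P *+ ell = 0 by rewrite -(en_Mnr hen) // Pl (en_0 hen).
  have [|d <-] := zinv (m := i : int) pell bl; last by rewrite -pmulrn -Pi; exists d.
  by apply/negP => /dvdzP[m hm]; apply: P0; rewrite Pi pmulrn hm mulrC mulrzA -pmulrn bl mul0rz.
have dual x : O' x -> O (x *+ ell) /\ forall a, a *+ ell = 0 -> cyclic_gen P (en (x *+ ell) a).
  exact: (end_order_dual hO hio hen dv hI pell Pl).
(* The image of ell x lies in the line of P, where ep is the identity, while ep kills the image of
   c. *)
have kill' x c : O' x -> c *+ ell = 0 -> en ep c = 0 -> en (x *+ ell) c = 0.
  move=> /dual[Oa ha] cl ec; have [m hm] := ha c cl.
  have : en ep (en (x *+ ell) c) = 0 by rewrite (en_comm hen) // ec (en_0 hen).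
  by rewrite hm en_Mzr // PE.
have dec a : a *+ ell = 0 -> exists b c, [/\ a = b + c, comp ell (en ep) 1 b, c *+ ell = 0 & en ep c = 0].
  move=> al; exists (en ep a), (a - en ep a).
  have el : en ep a *+ ell = 0 by rewrite -(en_Mnr hen) // al (en_0 hen).
  split; [by rewrite addrC subrK | by split; [rewrite expn1 | exact: idem1] | by rewrite mulrnBl al el subrr |].
  by rewrite (homB _ _ (en_hom hen Oep)) idem1 // subrr.
have nfd : ~ l fd%:R by apply: (nl_nat pell Re' Rw hw pr).
have cancel x y : x *+ ell = y *+ ell -> x = y :> K.
  have ln : (ell%:R : K) != 0 by rewrite -(qa_nat K) qa_eq0 pnatr_eq0 -lt0n.
  by rewrite -(mulr_natr x) -(mulr_natr y) => /(mulIf ln).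
have dfd d : R d -> ~ l d -> [/\ R (d *+ fd), O (d *+ fd) & ~ l (d *+ fd)].
  move=> Rd nd; split; [exact: RMn | exact: Ofd |].
  by rewrite -mulr_natr; apply: (nlM pr) => //; exact: Rnat.
case: (pselect (cyclic_gen P (en mu P))) => hmu.
  have OO' : O `<=` O'.
    move=> be Ob; apply/(inO' _ Ob); apply: contrapT => nz; apply: nx1.
    have cz : comp ell (en ep) 1 (en be P).
      by split; [rewrite expn1 -(en_Mnr hen) // Pl (en_0 hen) | rewrite (en_comm hen) // PE].
    have [i [j ->]] := two _ _ cP1 P0 cz nz _ cx1; have [c hc] := hmu.
    exists c; rewrite (en_D hen) // !en_Mzr // (en_comm hen P Omu Ob) hc en_Mzr // mulrzDl -!mulrzA.
    by rewrite ![c * _]mulrC.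
  split; first by split=> [[_ []]|/(_ hmu)//]; exact: sub_local.
  move=> _; case: (pselect (local_sub R l O' O)) => ls; last by right; split=> //; exact: sub_local.
  (* The local inclusion gives d outside l with d fd x in O. For an inverse i of d fd modulo l, 1 -
     d fd i kills A[l] while ell x kills the complementary summand, so their product kills A[ell]
     and is divisible by ell in O; x is the sum of the two parts. *)
  left; have O'O : O' `<=` O.
    move=> x O'x; have O2s y : exists m, (0 < m)%N /\ O (y *+ m) by exact: ord_scale.
    have [d [Rd nd [s [hs ds]]]] := local_sub_mem pell Re Re' Rw hw pr ne' nw O2s ls O'x.
    have [Rd' Od' nd'] := dfd d Rd nd.
    have Ody : O ((d *+ fd) * x).
      rewrite mulrnAl ds -sumrMnl big_seq; apply: (big_ind O) => [||u us]; [exact: ord0_ | exact: ordD |].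
      by have [h1 h2] := hs u us; rewrite -mulrnAl; apply: (ordM hO) => //; exact: Ofd.
    have [i hi] := inv _ Rd' nd'; have [Oa ha] := dual x O'x.
    have Ob : O (1 - d *+ fd *+ i) by apply: (ordB hO) => //; exact: ordMn.
    have [y Oy yE] : exists2 y, O y & (1 - d *+ fd *+ i) * (x *+ ell) = y *+ (ell ^ 1).
      apply: S4; first exact: ordM.
      move=> a; rewrite expn1 => /dec[b [c [-> cb cl ec]]].
      have z1 := kill1 _ _ Ob hi cb; have z2 := kill' _ _ O'x cl ec.
      by rewrite (en_mul hen) // (en_D hen _ _ Oa) z2 addr0 (en_comm hen _ Ob Oa) z1 (en_0 hen).
    have -> : x = (d *+ fd) * x *+ i + y; last by apply: ordD => //; exact: ordMn.
    rewrite expn1 mulrnAr in yE.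
    by rewrite -(cancel _ _ yE) mulrBl mul1r [d *+ fd *+ i * x]mulrnAl addrC subrK.
  exists id; split=> //; apply/seteqP; split=> [_ [x Ox <-]|x Ox]; first exact: OO'.
  by exists x => //; exact: O'O.
(* If ell x were nonzero at a point b of A[l], its value there would generate the line of P, and mu
   would map the line into the image of ell x, that is, into the line itself. *)
have O'O : O' `<=` O.
  move=> x O'x; have [Oa ha] := dual x O'x.
  have [y Oy yE] : exists2 y, O y & x *+ ell = y *+ (ell ^ 1).
    apply: S4 => // a; rewrite expn1 => /dec[b [c [-> [bl bE] cl ec]]]; rewrite expn1 in bl.
    rewrite (en_D hen _ _ Oa) (kill' _ _ O'x cl ec) addr0; have [m hm] := ha b bl.
    apply: contrapT => nb; apply: hmu.
    have ml : en mu P *+ ell = 0 by rewrite -(en_Mnr hen) // Pl (en_0 hen).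
    have [|d <-] := zinv (m := m) pell ml.
      apply/negP => /dvdzP[t ht]; apply: nb; rewrite hm ht mulrC mulrzA -pmulrn Pl mul0rz //.
    apply: cycM; rewrite -en_Mzr // -hm (en_comm hen) //; apply: ha.
    by rewrite -(en_Mnr hen) // bl (en_0 hen).
  by rewrite expn1 in yE; rewrite (cancel _ _ yE).
split; last by [].
split=> // _; split; first exact: sub_local.
(* If mu were locally in O', a multiple d fd mu with d outside l would be a sum of products of
   elements preserving the line of P. As d fd acts on A[l] by an invertible integer, mu would
   preserve the line as well. *)
move=> ls; apply: hmu.
have O2s y : exists m, (0 < m)%N /\ O' (y *+ m).
  have [d [d0 Od]] := ord_scale hO y; exists (d * ell)%N; rewrite muln_gt0 d0 l0; split=> //.
  rewrite mulrnA; apply/inO'; first exact: ordMn.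
  by rewrite (en_Mn hO hen) // -(en_Mnr hen) // Pl (en_0 hen) //; exists 0; rewrite mulr0z.
have [d [Rd nd [s [hs ds]]]] := local_sub_mem pell Re Re' Rw hw pr ne' nw O2s ls Omu.
have [Rd' Od' nd'] := dfd d Rd nd.
have [Oy cy] : O ((d *+ fd) * mu) /\ cyclic_gen P (en ((d *+ fd) * mu) P).
  rewrite mulrnAl ds -sumrMnl big_seq.
  apply: (big_ind (fun y => O y /\ cyclic_gen P (en y P))) => [|y z [h1 h2] [h3 h4]|u us].
  - by split; [exact: ord0_ | rewrite (en_z0 hO hen); exists 0; rewrite mulr0z].
  - by split; [exact: ordD | rewrite (en_add hen) //; exact: cycD].
  have [h1 h2] := hs u us; have Ou := O'O _ h2; have Ou1 := Ofd _ h1.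
  rewrite -mulrnAl; split; first exact: ordM.
  have [m hm] := (inO' _ Ou).1 h2; rewrite (en_mul hen) // hm en_Mzr //; apply: cycM.
  by apply: scal => //; exact: RMn.
have [i hi] := inv _ Rd' nd'.
have cmu : comp ell (en ep) 1 (en mu P).
  by split; [rewrite expn1 -(en_Mnr hen) // Pl (en_0 hen) | rewrite (en_comm hen) // PE].
have Odi : O (d *+ fd *+ i) by exact: ordMn.
have := kill1 _ _ (ordB hO O1 Odi) hi cmu; rewrite (en_B hO hen) // (en_1 hen) (en_Mn hO hen) //.
by move/eqP; rewrite subr_eq0 -(en_mul hen) // => /eqP ->; exact: (cycM i cy).
Qed.

End Main.

Lemma ideal_mulC (K : fieldType) (I J : set K) : ideal_mul I J = ideal_mul J I.
Proof.
have h (I' J' : set K) : ideal_mul I' J' `<=` ideal_mul J' I'.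
  move=> _ [s [hs ->]]; exists [seq (u.2, u.1) | u <- s]; split.
    by move=> _ /mapP[u us ->] /=; have [] := hs u us.
  by rewrite big_map; apply: eq_bigr => u _; rewrite mulrC.
by apply/seteqP; split; exact: h.
Qed.

Theorem theorem37
  (K : fieldExtType rat) (K0 : {subfield K})
  (hCM : quartic_cm K0) (hprim : primitive_cm K)
  (hcl : class_number_is (int_ring K0) 1)
  (ell : nat) (hell : prime ell) (l1 l2 l : set K)
  (hl1 : is_prime_ideal (int_ring K0) l1)
  (hl2 : is_prime_ideal (int_ring K0) l2)
  (hl12 : l1 <> l2)
  (hN1 : index_is (int_ring K0) l1 ell)
  (hN2 : index_is (int_ring K0) l2 ell)
  (hg1 : exists eta, totally_positive eta /\ l1 = scale_set eta (int_ring K0))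
  (hg2 : exists eta, totally_positive eta /\ l2 = scale_set eta (int_ring K0))
  (hsplit : scale_set ell%:R (int_ring K0) = ideal_mul l1 l2)
  (hl : l = l1 \/ l = l2)
  (* k is an algebraic closure of F_q *)
  (k : closedFieldType) (p e q : nat)
  (hp : p \in [pchar k])
  (halg : forall x : k, exists m, (0 < m)%N /\ x ^+ (p ^ m) = x)
  (he : (0 < e)%N) (hq : q = (p ^ e)%N) (hpell : p <> ell)
  (A : abvar k) (hdim : dimension_is (ab_sp A) 2)
  (F : A -> A) (hF : abvar_frobenius q F)
  (hord : ordinary_surface A p)
  (B : abvar k) (Pc : cocycle k (A * B)) (hB : is_dual Pc)
  (lam : A -> B) (hlam : principal_polarization Pc lam)
  (hlamF : polarization_over Pc q F lam)
  (O : set K) (hO : is_order O) (hRM : loc_max_RM K0 ell O)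
  (io : K -> qend A) (hio : has_CM_by O io)
  (P : A) (hP0 : P <> 0) (hP : torsion O io l P)
  (r : nat)
  (hr : (0 < r)%N /\ torsion O io l `<=` rational_pts F r)
  (hrmin : forall r', (0 < r')%N ->
     torsion O io l `<=` rational_pts F r' -> (r <= r')%N)
  (n : nat)
  (hn : torsion O io (ideal_exp (int_ring K0) l n) `<=` rational_pts F r)
  (hnmax : forall m,
     torsion O io (ideal_exp (int_ring K0) l m) `<=` rational_pts F r ->
     (m <= n)%N)
  (kk : nat)
  (hkk : max_selfpairing ell (tate Pc F lam r (ell ^ n))
     (torsion O io (ideal_exp (int_ring K0) l n)) kk)
  (hkk0 : (0 < kk)%N)
  (G : set A) (hG : exists g, G = cyclic_gen g)
  (hGn : G `<=` torsion O io (ideal_exp (int_ring K0) l n))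
  (hGP : [set x *+ (ell ^ n.-1) | x in G] = cyclic_gen P)
  (A' : abvar k) (I : A -> A') (hI : isogeny_with_kernel I (cyclic_gen P)) :
  let O' := end_order io I in
  let horizontal := order_iso O O' in
  let descending := local_proper (int_ring K0) l O' O in
  let ascending := local_proper (int_ring K0) l O O' in
  let nondegenerate :=
    tate_nondegenerate ell (tate Pc F lam r (ell ^ n)) G kk in
  (descending <-> nondegenerate) /\
  (~ nondegenerate -> horizontal \/ ascending).
Proof.
move=> O' horizontal descending ascending nondegenerate.
rewrite /horizontal /descending /ascending /nondegenerate /O' {O' horizontal descending ascending nondegenerate}.
have [l' [[pr pr' neq] [idx idx' [eta le] [eta' le'] sp]]] : exists l', [/\ is_prime_ideal (int_ring K0) l,
    is_prime_ideal (int_ring K0) l' & l <> l'] /\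
  [/\ index_is (int_ring K0) l ell, index_is (int_ring K0) l' ell,
    exists eta, l = pid K0 eta, exists eta, l' = pid K0 eta &
    scale_set ell%:R (int_ring K0) = ideal_mul l l'].
  have [eta1 [_ e1]] := hg1; have [eta2 [_ e2]] := hg2.
  case: hl => ->; [exists l2 | exists l1]; split; split=> //; try by [exists eta1 | exists eta2].
  - by move=> e0; apply: hl12.
  - by rewrite ideal_mulC.
subst l l'; move: sp; rewrite pid_mul => sp.
have self a : pid K0 a a by exists 1; [exact: R1 | exact: mulr1].
have Re : int_ring K0 eta by have [[sub _ _ _] _ _] := pr; exact: sub.
have Re' : int_ring K0 eta' by have [[sub _ _ _] _ _] := pr'; exact: sub.
have [w' Rw' hw'] : exists2 w', int_ring K0 w' & eta * eta' = ell%:R * w'.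
  have := self (eta * eta'); by rewrite -sp => -[w' h1 h2]; exists w'.
have [w Rw hw] : exists2 w, int_ring K0 w & eta * eta' * w = ell%:R.
  have := self ell%:R; by rewrite /pid sp => -[w h1 h2]; exists w.
have [_ n1 _] := pr.
have ne' : ~ pid K0 eta eta'.
  have [a [b [pa /pidP[b' Rb ->] ab]]] := comax hell Re Re' Rw hw pr pr' neq idx idx'.
  by move=> h; apply: n1; rewrite -ab; apply: pidD => //; rewrite mulrC; exact: pidM.
have ln : (ell%:R : K) != 0 by rewrite -(qa_nat K) qa_eq0 pnatr_eq0 -lt0n prime_gt0.
(* ell and eta eta' generate the same ideal, so w and w' are inverse units. *)
have nw : ~ pid K0 eta w.
  move=> h; apply: n1; have <- : w' * w = 1.
    by apply: (mulfI ln); rewrite mulr1 mulrA -hw' hw.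
  exact: pidM.
have [fd [ifd cfd]] := hRM.
have hfd x : int_ring K0 x -> O (x *+ fd).
  move=> Rx; have [] : (O `&` [set` K0]) (x *+ fd) => //.
  apply: (lagrange _ ifd Rx) => y z [y1 y2] [z1 z2]; split; [exact: (ordB hO) | exact: rpredB].
have dv := divisible hp halg he hq hF hB hlam hlamF hord.
have [en hen] := cm_act_ex hO hio dv.
have [V [hV adjV VF]] := adj_frob halg hq hF hB hlam hlamF.
have [f Of enf] := en_surj hen (homF hF); have [v Ov env] := en_surj hen hV.
have fv : v * f = q%:R.
  apply: (en_inj hen); [exact: (ordM hO) | exact: (ord_nat hO) |].
  by move=> a; rewrite (en_mul hen) // enf env VF (en_nat hO hen).
have adjF : adj lam hB F (en v) by have -> : en v = V by apply/funext.
have [real [h [h0 hpos hpol hM [hv hint]]]] :=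
  cm_real hCM hprim hp he hq hF dv hlam hO hen Of Ov enf fv adjF hell hpell.
have TB (g : {ffun 'I_5 -> 'I_ell} -> A) : injective g -> (forall c, g c *+ ell = 0) -> False.
  exact: (torsion_bound hp halg he hq hdim hF dv hO hen Of Ov enf fv h0 hpos hpol hM hv hint (prime_gt1 hell)).
have cp := copl hp hell hpell.
have S4 t x := divide_kernel hO hen hp he hq hF dv Of Ov enf fv (N := (ell ^ t)%N) (x := x)
  (ltac:(by rewrite expn_gt0 prime_gt0)) (cp t).
have [g0 eG] := hG; subst G.
rewrite pid_exp in hn hkk hGn.
(* By the choice of r the points of A[l] are rational, so the maximality of n gives n >= 1. *)
have n0 : (0 < n)%N by apply: hnmax; rewrite pid_exp expr1; case: hr.
have hg : torsion O io (pid K0 (eta ^+ n)) g0 by apply: hGn; exists 1; rewrite mulr1z.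
rewrite -[X in torsion O io (pid K0 X)]expr1 in hP.
exact: (descending_iff hO hio hen dv hell S4 TB Re Re' Rw Rw' hw hw' pr pr' neq idx idx' hfd cfd ne' nw
  hp cp hlam real Of enf n0 hP0 hP hn hkk0 hkk hg hGP hI).
Qed.
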